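(* Let $K$ be a polygon satisfying the mesh assumptions with parameter $\rho$, with triangulation $\mathcal T_K$, let $k\ge1$, let $V_k^{\mathrm c}(K)$ be the enhanced conforming virtual element space, and let $\widetilde I_k^K:V_k^{\mathrm c}(K)\to\widetilde V_k(\mathcal T_K)$ be the interpolation operator, all as defined in the context. Then there is a constant $C>0$, depending only on $k$, $\rho$ and the regularity constants of $\mathcal T_K$ (not on $h_K$), such that for all $v_h\in V_k^{\mathrm c}(K)$ $$|\widetilde I_k^Kv_h|_{m,K}\le C|v_h|_{m,K},\qquad m=0,1.$$
   Context: Notation: $(\cdot,\cdot)_S$, $\|\cdot\|_S$ are the $L^2(S)$ inner product and norm; $|\cdot|_{1,S}$ is the $H^1(S)$ seminorm and $|\cdot|_{0,S}=\|\cdot\|_S$. $\mathbb P_m(S)$ is the space of polynomials of degree $\le m$ on $S$ ($\{0\}$ if $m<0$); $\overline{\mathbb P}_m(S)$ is the subspace of homogeneous polynomials of degree $m$ in $\bm x-\bm x_S$ ($\{0\}$ if $m<0$), with $\bm x_S$ the barycenter of $S$. $\mathbb M_m(S)=\{((\bm x-\bm x_S)/h_S)^{\bm\beta}:|\bm\beta|\le m\}$ is the scaled monomial basis of $\mathbb P_m(S)$ ($h_S$ the diameter; empty if $m<0$). Mesh assumptions: $K\subset\mathbb R^2$ is a polygon of diameter $h_K$, star-shaped with respect to a disc of radius $\ge\rho h_K$, all of whose edges have length $\ge\rho h_K$ ($\rho>0$ fixed). $\mathcal T_K$ is a conforming shape-regular triangulation of $K$ whose triangles have diameters comparable to $h_K$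 and such that the edges of $K$ are not subdivided. $\mathcal V(K),\mathcal E(K)$ are the vertices and edges of $K$; $\mathcal V^{\mathrm{int}}(\mathcal T_K)$, $\mathcal E^{\mathrm{int}}(\mathcal T_K)$ are the vertices and edges of $\mathcal T_K$ in the interior of $K$; $\mathcal E^\partial(\mathcal T_K)=\mathcal E(K)$ are the boundary edges. Projections: $Q_k^K$ is the $L^2(K)$ projection onto $\mathbb P_k(K)$. For $v\in H^1(K)$, $\Pi_k^Kv\in\mathbb P_k(K)$ is defined by $(\nabla\Pi_k^Kv,\nabla q)_K=(\nabla v,\nabla q)_K$ for all $q\in\mathbb P_k(K)$ and $\int_{\partial K}\Pi_k^Kv\,\mathrm ds=\int_{\partial K}v\,\mathrm ds$. Virtual element space: with $\mathbb B_k(\partial K)=\{v\in C^0(\partial K):v|_e\in\mathbb P_k(e)\ \forall e\in\mathcal E(K)\}$, $$V_k^{\mathrm c}(K)=\{v\in H^1(K):\Delta v\in\mathbb P_k(K),\ v|_{\partial K}\in\mathbb B_k(\partial K),\ (v,q)_K=(\Pi_k^Kv,q)_K\ \forall q\in\overline{\mathbb P}_k(K)\oplus\overline{\mathbb P}_{k-1}(K)\}.$$ Macro finite element space: for a triangle $T$ with cubic bubble $b_T$ (product of the three barycentric coordinates), $\widetilde V_k(T)=\mathbb P_k(T)\oplus b_T\overline{\mathbb P}_{k-2}(T)\oplus b_T\overline{\mathbb P}_{k-1}(T)\oplus b_T\overline{\mathbb P}_k(T)$, with unisolvent degrees of freedom: values at the vertices of $T$, moments $\frac1{|e|}(v,q)_e$,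 $q\in\mathbb M_{k-2}(e)$, on the edges $e$ of $T$, and moments $\frac1{|T|}(v,q)_T$, $q\in\mathbb M_k(T)$. $\widetilde V_k(\mathcal T_K)=\{v\in C^0(K):v|_T\in\widetilde V_k(T)\ \forall T\in\mathcal T_K\}$. Interpolation: for $v_h\in V_k^{\mathrm c}(K)$, $\widetilde I_k^Kv_h\in\widetilde V_k(\mathcal T_K)$ is determined by - $\widetilde I_k^Kv_h(\delta)=v_h(\delta)$, $\delta\in\mathcal V(K)$; - $\widetilde I_k^Kv_h(\delta)=\Pi_k^Kv_h(\delta)$, $\delta\in\mathcal V^{\mathrm{int}}(\mathcal T_K)$; - $(\widetilde I_k^Kv_h-v_h,q)_e=0$, $q\in\mathbb M_{k-2}(e)$, $e\in\mathcal E^\partial(\mathcal T_K)$; - $(\widetilde I_k^Kv_h-\Pi_k^Kv_h,q)_e=0$, $q\in\mathbb M_{k-2}(e)$, $e\in\mathcal E^{\mathrm{int}}(\mathcal T_K)$; - $(\widetilde I_k^Kv_h-Q_k^Kv_h,q)_T=0$, $q\in\mathbb M_k(T)$, $T\in\mathcal T_K$. *)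

(* Defs.v *)
From HB Require Import structures.
From mathcomp Require Import all_boot all_order all_algebra polyXY.
From mathcomp Require Import all_classical all_reals all_analysis.

Set Implicit Arguments.
Unset Strict Implicit.
Unset Printing Implicit Defensive.

Import Order.TTheory GRing.Theory Num.Theory.
Import numFieldNormedType.Exports.

Local Open Scope classical_set_scope.
Local Open Scope ring_scope.

(** The library norm of [R * R] is the max norm (it is used only
    through the topology it induces); lengths are Euclidean. *)

Definition eucl_norm {R : realType} (x : R * R) : R := Num.sqrt (x.1 ^+ 2 + x.2 ^+ 2).

Definition eucl_dist {R : realType} (x y : R * R) : R := eucl_norm (x - y).

Definition disc {R : realType} (c : R * R) (r : R) : set (R * R) :=
  [set x | eucl_dist x c < r].

Definition diam {R : realType} (S : set (R * R)) : R :=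
  sup [set d | exists x y, [/\ S x, S y & d = eucl_dist x y]].

Definition segpath {R : realType} (a b : R * R) (t : R) : R * R :=
  a + t *: (b - a).

Definition segment {R : realType} (a b : R * R) : set (R * R) :=
  segpath a b @` `[0, 1].

Definition osegment {R : realType} (a b : R * R) : set (R * R) :=
  segpath a b @` `]0, 1[.

(** [z i] and [z (ordS i)] are consecutive vertices of the closed polyline [z]. *)
Definition edge {R : realType} (n : nat) (z : 'I_n -> R * R) (i : 'I_n) :
  set (R * R) := segment (z i) (z (ordS i)).

Definition polyline {R : realType} (n : nat) (z : 'I_n -> R * R) : set (R * R) :=
  \bigcup_(i in [set: 'I_n]) edge z i.

(** [K] is the open polygon with vertices [z]: the bounded open set whose boundary
    is the simple closed polygonal curve through [z].  Flat angles are allowed. *)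
Definition polygon {R : realType} (n : nat) (z : 'I_n -> R * R)
    (K : set (R * R)) : Prop :=
  [/\ (3 <= n)%N,
      injective z,
      forall i j : 'I_n, i != j ->
        edge z i `&` edge z j =
          if j == ordS i then [set z j]
          else if i == ordS j then [set z i] else set0 &
      [/\ K !=set0, open K, bounded_set K & closure K `\` K = polyline z]].

Definition star_shaped_wrt {R : realType} (K B : set (R * R)) : Prop :=
  B `<=` K /\ forall x y, B x -> K y -> segment x y `<=` K.

Definition regular_polygon {R : realType} (rho : R) (n : nat)
    (z : 'I_n -> R * R) (K : set (R * R)) : Prop :=
  [/\ polygon z K,
      exists c r, rho * diam K <= r /\ star_shaped_wrt K (disc c r) &
      forall i, rho * diam K <= eucl_dist (z i) (z (ordS i))].

(** Twice the signed area of the triangle [a b c]. *)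
Definition cross {R : realType} (a b c : R * R) : R :=
  (b.1 - a.1) * (c.2 - a.2) - (b.2 - a.2) * (c.1 - a.1).

Definition bary_coord {R : realType} (t : 'I_3 -> R * R) (i : 'I_3) (x : R * R) : R :=
  cross x (t (ordS i)) (t (ordS (ordS i)))
    / cross (t i) (t (ordS i)) (t (ordS (ordS i))).

Definition bubble {R : realType} (t : 'I_3 -> R * R) (x : R * R) : R :=
  \prod_(i < 3) bary_coord t i x.

Definition triangle {R : realType} (t : 'I_3 -> R * R) : set (R * R) :=
  [set x | exists l : 'I_3 -> R,
    [/\ forall i, 0 <= l i, \sum_(i < 3) l i = 1 & x = \sum_(i < 3) l i *: t i]].

Definition noncollinear {R : realType} (t : 'I_3 -> R * R) : Prop :=
  cross (t ord0) (t (ordS ord0)) (t (ordS (ordS ord0))) != 0.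

(** Conforming triangulation of [closure K] by the triangles [T j], in which every
    edge of [K] is an edge of a triangle. *)
Definition triangulation {R : realType} (n : nat) (z : 'I_n -> R * R)
    (K : set (R * R)) (N : nat) (T : 'I_N -> 'I_3 -> R * R) : Prop :=
  [/\ forall j, noncollinear (T j),
      \bigcup_(j in [set: 'I_N]) triangle (T j) = closure K,
      forall i j, i != j ->
        [\/ triangle (T i) `&` triangle (T j) = set0,
            exists a b, T i a = T j b /\
              triangle (T i) `&` triangle (T j) = [set T i a] |
            exists a b, edge (T i) a = edge (T j) b /\
              triangle (T i) `&` triangle (T j) = edge (T i) a] &
      forall i, exists j a, edge (T j) a = edge z i].

(** Every triangle contains a disc of radius at least [sigma] times its diameter,
    and its diameter is at least [tau * diam K] (it is at most [diam K]). *)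
Definition regular_triangulation {R : realType} (sigma tau : R)
    (K : set (R * R)) (N : nat) (T : 'I_N -> 'I_3 -> R * R) : Prop :=
  forall j,
    (exists c r, sigma * diam (triangle (T j)) <= r /\
       disc c r `<=` triangle (T j)) /\
    tau * diam K <= diam (triangle (T j)).

(** [R * R] with the sigma-algebra on which [lebesgue_measure] is declared; it has
    the same measurable sets as the default one, with another display. *)
Definition plane (R : realType) : measurableType _ :=
  (measurableTypeR R * measurableTypeR R)%type.

Definition area {R : realType} : {measure set (plane R) -> \bar R} :=
  (@lebesgue_measure R \x @lebesgue_measure R)%E.

Definition inner {R : realType} (S : set (R * R)) (f g : R * R -> R) : R :=
  \int[area]_(x in S) (f x * g x).

Definition barycenter {R : realType} (S : set (R * R)) : R * R :=
  ((\int[area]_(x in S) (x : R * R).1) / fine (area S),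
   (\int[area]_(x in S) (x : R * R).2) / fine (area S)).

(** Integral over the segment [a b] of a function of the parameter of [segpath]. *)
Definition line_int {R : realType} (a b : R * R) (f : R -> R) : R :=
  eucl_dist a b * \int[@lebesgue_measure R]_(t in `[0, 1]) f t.

Definition polyline_int {R : realType} (n : nat) (z : 'I_n -> R * R)
    (f : R * R -> R) : R :=
  \sum_(i < n) line_int (z i) (z (ordS i)) (fun t => f (segpath (z i) (z (ordS i)) t)).

Definition polyline_L2sq {R : realType} (n : nat) (z : 'I_n -> R * R)
    (f : R * R -> R) : \bar R :=
  (\sum_(i < n) ((eucl_dist (z i) (z (ordS i)))%:E *
    \int[@lebesgue_measure R]_(t in `[0%R, 1%R])
      ((f (segpath (z i) (z (ordS i)) t)) ^+ 2)%:E))%E.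

Definition polyline_measurable {R : realType} (n : nat) (z : 'I_n -> R * R)
    (f : R * R -> R) : Prop :=
  forall i : 'I_n, measurable_fun (`[0%R, 1%R] : set (measurableTypeR R))
    (fun t => f (segpath (z i) (z (ordS i)) t)).

Definition L2norm {R : realType} (S : set (R * R)) (f : R * R -> R) : \bar R :=
  sqrte (\int[area]_(x in S) ((f x) ^+ 2)%:E)%E.

Definition L2fun {R : realType} (S : set (R * R)) (f : R * R -> R) : Prop :=
  measurable_fun (S : set (plane R)) f /\ (L2norm S f < +oo)%E.

Definition pd1 {R : realType} (f : R * R -> R) : R * R -> R := 'D_((1, 0) : R * R) f.

Definition pd2 {R : realType} (f : R * R -> R) : R * R -> R := 'D_((0, 1) : R * R) f.

Definition grad {R : realType} (f : R * R -> R) (x : R * R) : R * R :=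
  (pd1 f x, pd2 f x).

Fixpoint Cn {R : realType} (n : nat) (f : R * R -> R) : Prop :=
  continuous f /\
  if n is m.+1 then
    [/\ forall x, derivable f x ((1, 0) : R * R) /\ derivable f x ((0, 1) : R * R),
        Cn m (pd1 f) & Cn m (pd2 f)]
  else True.

Definition smooth {R : realType} (f : R * R -> R) : Prop := forall n, Cn n f.

Definition test_fun {R : realType} (K : set (R * R)) (phi : R * R -> R) : Prop :=
  smooth phi /\
  exists A, [/\ compact A, A `<=` K & forall x, ~ A x -> phi x = 0].

Definition weak_grad {R : realType} (K : set (R * R)) (v : R * R -> R)
    (G : R * R -> R * R) : Prop :=
  [/\ L2fun K v,
      L2fun K (fun x => (G x).1),
      L2fun K (fun x => (G x).2) &
      forall phi, test_fun K phi ->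
        inner K v (pd1 phi) = - inner K (fun x => (G x).1) phi /\
        inner K v (pd2 phi) = - inner K (fun x => (G x).2) phi].

Definition H1 {R : realType} (K : set (R * R)) (v : R * R -> R) : Prop :=
  exists G, weak_grad K v G.

(** Weak gradients are unique up to null sets, so the infimum is over a single value;
    it is [+oo] when [v] is not in [H1 K]. *)
Definition H1semi {R : realType} (K : set (R * R)) (v : R * R -> R) : \bar R :=
  ereal_inf [set L2norm K (fun x => eucl_norm (G x)) | G in [set G | weak_grad K v G]].

Definition inner_vec {R : realType} (S : set (R * R)) (F G : R * R -> R * R) : R :=
  \int[area]_(x in S) ((F x).1 * (G x).1 + (F x).2 * (G x).2).

(** [Delta v = p] in the sense of distributions on [K]. *)
Definition weak_laplacian {R : realType} (K : set (R * R)) (v p : R * R -> R) : Prop :=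
  forall phi, test_fun K phi ->
    inner K v (fun x => pd1 (pd1 phi) x + pd2 (pd2 phi) x) = inner K p phi.

(** [g] is the trace of [v] on the boundary [polyline z] of [K]: the restriction to the
    boundary, extended by continuity from smooth functions on the closure of [K]. *)
Definition trace {R : realType} (n : nat) (z : 'I_n -> R * R) (K : set (R * R))
    (v g : R * R -> R) : Prop :=
  polyline_measurable z g /\
  exists (G : R * R -> R * R) (phi : nat -> R * R -> R),
    [/\ weak_grad K v G,
        forall i, smooth (phi i),
        L2norm K (fun x => phi i x - v x) @[i --> \oo] --> 0%E,
        L2norm K (fun x => eucl_norm (grad (phi i) x - G x)) @[i --> \oo] --> 0%E &
        polyline_L2sq z (fun x => phi i x - g x) @[i --> \oo] --> 0%E].

(** Degrees are integers, so that the spaces of negative degree are [{0}]. *)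
Definition polyfun {R : realType} (m : int) (f : R * R -> R) : Prop :=
  exists p : {poly {poly R}},
    (forall i j, p`_i`_j != 0 -> (i + j)%N%:Z <= m) /\
    forall x, f x = p.[x.1, x.2].

(** Homogeneous polynomials of degree [m] in [x - c]. *)
Definition hpolyfun {R : realType} (c : R * R) (m : int) (f : R * R -> R) : Prop :=
  exists p : {poly {poly R}},
    (forall i j, p`_i`_j != 0 -> (i + j)%N%:Z = m) /\
    forall x, f x = p.[x.1 - c.1, x.2 - c.2].

Definition scaled_monomial {R : realType} (S : set (R * R)) (i j : nat)
    (x : R * R) : R :=
  ((x.1 - (barycenter S).1) / diam S) ^+ i * ((x.2 - (barycenter S).2) / diam S) ^+ j.

(** On the segment [a b], with midpoint [m] and arclength [s],
    [(s - s_m) / eucl_dist a b] is [t - 2^-1] at [segpath a b t]. *)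
Definition edge_monomial {R : realType} (i : nat) (t : R) : R := (t - 2^-1) ^+ i.

(** Moment of a function on the plane against the [i]-th scaled monomial of the
    segment [a b]. *)
Definition edge_moment {R : realType} (a b : R * R) (i : nat) (f : R * R -> R) : R :=
  line_int a b (fun t => f (segpath a b t) * edge_monomial i t).

Definition L2proj {R : realType} (K : set (R * R)) (k : nat) (v q : R * R -> R) : Prop :=
  polyfun k q /\ forall r, polyfun k r -> inner K q r = inner K v r.

Definition H1proj {R : realType} (n : nat) (z : 'I_n -> R * R) (K : set (R * R))
    (k : nat) (v p : R * R -> R) : Prop :=
  polyfun k p /\
  exists G g,
    [/\ weak_grad K v G,
        trace z K v g,
        forall q, polyfun k q ->
          inner_vec K (grad p) (grad q) = inner_vec K G (grad q) &
        polyline_int z p = polyline_int z g].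

Definition bdry_space {R : realType} (n : nat) (z : 'I_n -> R * R) (k : nat)
    (g : R * R -> R) : Prop :=
  {within polyline z, continuous g} /\
  forall i, exists p : {poly R}, (size p <= k.+1)%N /\
    forall t, 0 <= t <= 1 -> g (segpath (z i) (z (ordS i)) t) = p.[t].

Definition vem_space {R : realType} (n : nat) (z : 'I_n -> R * R) (K : set (R * R))
    (k : nat) (v : R * R -> R) : Prop :=
  [/\ H1 K v,
      exists p, polyfun k p /\ weak_laplacian K v p,
      exists g, trace z K v g /\ bdry_space z k g &
      exists p, H1proj z K k v p /\
        forall q1 q2, hpolyfun (barycenter K) k q1 -> hpolyfun (barycenter K) (k%:Z - 1) q2 ->
          inner K v (fun x => q1 x + q2 x) = inner K p (fun x => q1 x + q2 x)].

Definition local_space {R : realType} (t : 'I_3 -> R * R) (k : nat)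
    (w : R * R -> R) : Prop :=
  exists p q0 q1 q2,
    [/\ polyfun k p,
        hpolyfun (barycenter (triangle t)) (k%:Z - 2) q0,
        hpolyfun (barycenter (triangle t)) (k%:Z - 1) q1,
        hpolyfun (barycenter (triangle t)) k q2 &
        forall x, triangle t x ->
          w x = p x + bubble t x * q0 x + bubble t x * q1 x + bubble t x * q2 x].

Definition macro_space {R : realType} (K : set (R * R)) (N : nat)
    (T : 'I_N -> 'I_3 -> R * R) (k : nat) (w : R * R -> R) : Prop :=
  {within closure K, continuous w} /\ forall j, local_space (T j) k w.

(** [w] is the interpolant of [v]; [g], [p] and [q] are the boundary values and the
    two projections of [v].  The interior vertices of the mesh are those in the open
    set [K], its interior edges those whose relative interior is in [K]. *)
Definition interpolant {R : realType} (n : nat) (z : 'I_n -> R * R) (K : set (R * R))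
    (N : nat) (T : 'I_N -> 'I_3 -> R * R) (k : nat) (v w : R * R -> R) : Prop :=
  macro_space K T k w /\
  exists g p q,
    [/\ trace z K v g /\ bdry_space z k g, H1proj z K k v p, L2proj K k v q &
    [/\ forall i, w (z i) = g (z i),
        forall j a, K (T j a) -> w (T j a) = p (T j a),
        forall i l, (l + 2 <= k)%N ->
          edge_moment (z i) (z (ordS i)) l (fun x => w x - g x) = 0,
        forall j a l, osegment (T j a) (T j (ordS a)) `<=` K -> (l + 2 <= k)%N ->
          edge_moment (T j a) (T j (ordS a)) l (fun x => w x - p x) = 0 &
        forall j l m, (l + m <= k)%N ->
          inner (triangle (T j)) (fun x => w x - q x)
            (scaled_monomial (triangle (T j)) l m) = 0]].

(* Main.v *)
(** Everything reduces to sup bounds. On each triangle the interpolant lies in a fixed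
    finite-dimensional space, and its degrees of freedom are values and moments of the boundary
    values [g] of [v] and of its two projections [p], [q], so that unisolvence on the reference
    triangle bounds it by sup bounds of [g], [p] and the norm of [q]. With [c0 = 0] and [M = |v| / h] for [m = 0], and with [c0] the mean
    of [v] and [M] the norm of a weak gradient for [m = 1], one shows that [g - c0] on the
    boundary, [p - c0] on [K] and [|q - c0| / h] are all at most a constant times [M].

    On a boundary edge [g] is a polynomial. It is recovered from the Green formula on the
    adjacent triangle, with test functions whose gradient vanishes on the two other edges. For
    [m = 0] the remaining term contains the Laplacian [f] of [v], a polynomial whose moments
    against squared bubbles are moments of [v]. For [m = 1] it contains the weak gradient,
    and [|v - c0| <= C h |grad v|] by a Poincare inequality on the star-shaped [K]. The gradient
    of [p] is bounded by testing with [p] itself, integrating by parts when [m = 0], and the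
    constant in [p] by comparing means on the boundary, where the mean over an edge does not
    depend on the choice of the trace. Finally the piecewise gradient of the interpolant is a
    weak gradient, by the fundamental theorem of calculus on lines. The norm of an arbitrary weak
    gradient of [v] bounds the right-hand side, so that no uniqueness of weak gradients is used. *)

Require Import Defs.
From HB Require Import structures.
From mathcomp Require Import all_boot all_order all_algebra polyXY ring lra.
From mathcomp Require Import all_classical all_reals all_analysis measurable_realfun.

Set Implicit Arguments.
Unset Strict Implicit.
Unset Printing Implicit Defensive.

Import Order.TTheory GRing.Theory Num.Theory.
Import numFieldNormedType.Exports.

Local Open Scope classical_set_scope.
Local Open Scope ring_scope.

(** * Affine changes of variables in the plane *)

(** For [m = 0] only the norm of [v] is available, while the trace and the projection involve
    derivatives. Each weak gradient is therefore paired with a polynomial field and moved onto it;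
    the price is a power of [1 / h] from inverse estimates. Sup norms are compared with [|v| / h]
    because a constant function has norm of order [h] on [K].

    All polynomial estimates rest on one algebraic fact: a linear form that vanishes on the common
    kernel of finitely many others is a combination of them. Used on one fixed reference triangle it
    yields constants that depend on [k] alone. The geometry enters only through affine maps,
    controlled by the lower bound [kap] on the area of a triangle of size [h], through [rho], and
    through the perimeter bound [CL], which comes from counting triangles by area.

    A trace comes with its own approximating functions and its own weak gradient, and the data of
    the interpolant contain two traces of the same [v]. Identities are hence proved for smooth
    functions and passed to the limit, and two weak gradients are compared only through their
    moments. *)

Lemma measurable_affine {R : realType} (a b : R) :
  measurable_fun setT (fun s : measurableTypeR R => (a + b * s : measurableTypeR R)).
Proof.
apply: (@continuous_measurable_fun R (fun s => a + b * s)) => s.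
by apply: cvgD; [exact: cvg_cst|apply: cvgM; [exact: cvg_cst|exact: cvg_id]].
Qed.

(** Both sides are measures in [A], so by uniqueness of the Lebesgue measure they need only be
    compared on the intervals []x, y]]. For [b < 0] the preimage is half-open on the other side but
    has the same length. *)
Lemma lebesgue_affine_set {R : realType} (a b : R) (A : set (measurableTypeR R)) :
  b != 0 -> measurable A ->
  lebesgue_measure A =
  (`|b|%:E * lebesgue_measure ((fun s : measurableTypeR R => (a + b * s)%R : measurableTypeR R) @^-1` A))%E.
Proof.
move=> b0 mA.
pose phi := fun s : measurableTypeR R => (a + b * s : measurableTypeR R).
have mphi : measurable_fun setT phi by exact: measurable_affine.
pose m : {measure set (measurableTypeR R) -> \bar R} :=
  mscale (NngNum (normr_ge0 b)) (pushforward lebesgue_measure phi).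
rewrite (@lebesgue_measure_unique _ (m mphi)) // => _ [[x y] _ <-] /=.
rewrite /mscale /= /pushforward.
have [b_gt0|b_le0] := ltP 0 b.
  have -> : phi @^-1` `]x, y] = `](x - a) / b, (y - a) / b]%classic.
    apply/seteqP; split => s /=; rewrite !in_itv /= /phi ltr_pdivrMr // ler_pdivlMr //;
      move=> /andP[? ?]; apply/andP; split; lra.
  rewrite !lebesgue_measure_itv /= !lte_fin ltr_pM2r ?invr_gt0 // ltrD2r.
  case: ifP => _; last by rewrite mule0.
  rewrite -!EFinB -EFinM gtr0_norm //; congr (_%:E); field; lra.
have b_lt0 : b < 0 by lra.
have -> : phi @^-1` `]x, y] = `[(y - a) / b, (x - a) / b[%classic.
  apply/seteqP; split => s /=; rewrite !in_itv /= /phi ltr_ndivlMr // ler_ndivrMr //;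
    move=> /andP[? ?]; apply/andP; split; lra.
rewrite !lebesgue_measure_itv /= !lte_fin ltr_nM2r ?invr_lt0 // ltrD2r.
case: ifP => _; last by rewrite mule0.
rewrite -!EFinB -EFinM ltr0_norm //; congr (_%:E); field; lra.
Qed.

Lemma ge0_integral_affine {R : realType} (a b : R) (f : R -> \bar R) :
  b != 0 -> measurable_fun (setT : set (measurableTypeR R)) f -> (forall x, 0 <= f x)%E ->
  (\int[@lebesgue_measure R]_x f x =
   `|b|%:E * \int[@lebesgue_measure R]_x f (a + b * x)%R)%E.
Proof.
move=> b0 mf f0.
pose phi := fun s : measurableTypeR R => (a + b * s : measurableTypeR R).
have mphi : measurable_fun setT phi by exact: measurable_affine.
pose m : {measure set (measurableTypeR R) -> \bar R} :=
  mscale (NngNum (normr_ge0 b)) (pushforward lebesgue_measure phi).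
rewrite (@eq_measure_integral _ _ _ _ (m mphi)); last first.
  by move=> A mA _; exact: lebesgue_affine_set.
rewrite ge0_integral_mscale //= (@ge0_integral_pushforward _ _ _ _ _ phi) //.
Qed.

(** The affine map that sends the reference vertices (0,0), (1,0), (0,1) to [a], [b], [c]. Its
    Jacobian determinant is [cross a b c]. *)
Definition amap {R : realType} (a b c : R * R) (x : R * R) : R * R :=
  (a.1 + x.1 * (b.1 - a.1) + x.2 * (c.1 - a.1), a.2 + x.1 * (b.2 - a.2) + x.2 * (c.2 - a.2)).

Lemma measurable_fst_plane {R : realType} :
  measurable_fun setT (fun x : plane R => x.1 : R).
Proof. exact: measurable_fst. Qed.

Lemma measurable_snd_plane {R : realType} :
  measurable_fun setT (fun x : plane R => x.2 : R).
Proof. exact: measurable_snd. Qed.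

Lemma measurable_amap {R : realType} (a b c : R * R) :
  measurable_fun setT (amap a b c : plane R -> plane R).
Proof.
apply/measurable_fun_pairP; split; rewrite /comp /amap /=.
  apply: measurable_funD; first apply: measurable_funD => //.
    apply: measurable_funM => //; exact: measurable_fst_plane.
  apply: measurable_funM => //; exact: measurable_snd_plane.
apply: measurable_funD; first apply: measurable_funD => //.
  apply: measurable_funM => //; exact: measurable_fst_plane.
apply: measurable_funM => //; exact: measurable_snd_plane.
Qed.

Lemma ge0_area_tonelli1 {R : realType} (f : plane R -> \bar R) :
  measurable_fun setT f -> (forall x, 0 <= f x)%E ->
  (\int[area]_x f x = \int[@lebesgue_measure R]_x \int[@lebesgue_measure R]_y f (x, y))%E.
Proof. by move=> mf f0; rewrite /area fubini_tonelli1. Qed.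

Lemma ge0_area_tonelli2 {R : realType} (f : plane R -> \bar R) :
  measurable_fun setT f -> (forall x, 0 <= f x)%E ->
  (\int[area]_x f x = \int[@lebesgue_measure R]_y \int[@lebesgue_measure R]_x f (x, y))%E.
Proof. by move=> mf f0; rewrite /area fubini_tonelli2. Qed.

Lemma ge0_area_swap {R : realType} (f : plane R -> \bar R) :
  measurable_fun setT f -> (forall x, 0 <= f x)%E ->
  (\int[area]_x f x = \int[area]_x f (x.2, x.1))%E.
Proof.
move=> mf f0.
rewrite ge0_area_tonelli1 // [RHS]ge0_area_tonelli2 //=.
by apply: measurableT_comp => //; exact: measurable_swap.
Qed.

(** A non-zero pivot allows two one-dimensional substitutions with Tonelli between them. [H] is the
    intermediate integrand: its first variable is already the first coordinate of the image, its
    second is still the reference one. The two factors, the inverse of [p] and [D / p], account for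
    the determinant. *)
Lemma ge0_integral_amap_pivot {R : realType} (a b c : R * R) (f : plane R -> \bar R) :
  b.1 - a.1 != 0 -> cross a b c != 0 -> measurable_fun setT f -> (forall x, 0 <= f x)%E ->
  (\int[area]_x f x = `|cross a b c|%:E * \int[area]_x f (amap a b c x))%E.
Proof.
move=> p0 D0 mf f0.
set p := b.1 - a.1 in p0; pose q := c.1 - a.1; pose r := b.2 - a.2; pose u := c.2 - a.2.
pose D := cross a b c.
have mfa : measurable_fun setT (fun x : plane R => f (amap a b c x)).
  by apply: measurableT_comp => //; exact: measurable_amap.
rewrite [in RHS]ge0_area_tonelli2 //.
pose H := fun z : plane R => f (z.1, a.2 + (z.1 - a.1) * r / p + D / p * z.2).
have mH : measurable_fun setT H.
  apply: (@measurableT_comp _ _ _ _ _ _ f) => //.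
  apply/measurable_fun_pairP; split => /=; first exact: measurable_fst_plane.
  apply: measurable_funD; last first.
    apply: measurable_funM => //; exact: measurable_snd_plane.
  apply: measurable_funD => //; apply: measurable_funM => //; apply: measurable_funM => //.
  apply: measurable_funB => //; exact: measurable_fst_plane.
have H0 x : (0 <= H x)%E by exact: f0.
have E1 t : (\int[@lebesgue_measure R]_s f (amap a b c (s, t)) =
   `|p^-1|%:E * \int[@lebesgue_measure R]_s H (s, t))%E.
  rewrite (@ge0_integral_affine _ (- (a.1 + t * q) / p) p^-1) ?invr_eq0 //; last first.
    exact: (measurable_fun_pair1 t mfa).
  congr (_ * _)%E; apply: eq_integral => s _; rewrite /H /amap /=; congr (f (_, _)).
    by rewrite -/p -/q; field.
  by rewrite -/p -/q -/r -/u /D /cross -/p -/q -/r -/u; field.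
under [in RHS]eq_integral do rewrite E1.
rewrite ge0_integralZl_EFin //; last 2 first.
- by move=> t _; exact: integral_ge0.
- exact: measurable_fun_fubini_tonelli_G.
rewrite -ge0_area_tonelli2 // !ge0_area_tonelli1 //.
have E2 s : (\int[@lebesgue_measure R]_y f (s, y) =
   `|D / p|%:E * \int[@lebesgue_measure R]_t H (s, t))%E.
  rewrite (@ge0_integral_affine _ (a.2 + (s - a.1) * r / p) (D / p)) //.
    by rewrite mulf_neq0 // invr_eq0.
  exact: (measurable_fun_pair2 s mf).
under eq_integral do rewrite E2.
rewrite ge0_integralZl_EFin //; last 2 first.
- by move=> t _; exact: integral_ge0.
- exact: measurable_fun_fubini_tonelli_F.
by rewrite muleA -EFinM normrM.
Qed.

(** If the pivot vanishes, [c.1 - a.1] cannot vanish too. Exchanging [b] and [c] makes it the pivot,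
    flips the sign of the determinant and swaps the reference coordinates. *)
Lemma ge0_integral_amap {R : realType} (a b c : R * R) (f : plane R -> \bar R) :
  cross a b c != 0 -> measurable_fun setT f -> (forall x, 0 <= f x)%E ->
  (\int[area]_x f x = `|cross a b c|%:E * \int[area]_x f (amap a b c x))%E.
Proof.
move=> D0 mf f0.
have [p0|p0] := eqVneq (b.1 - a.1) 0; last exact: ge0_integral_amap_pivot.
have q0 : c.1 - a.1 != 0.
  by apply: contraNneq D0 => q0; rewrite /cross p0 q0 mul0r mulr0 subrr.
have cE : cross a b c = - cross a c b by rewrite /cross; ring.
rewrite (@ge0_integral_amap_pivot _ a c b) //; last by move: D0; rewrite cE oppr_eq0.
rewrite cE normrN; congr (_ * _)%E.
rewrite ge0_area_swap //; last first.
  by apply: measurableT_comp => //; exact: measurable_amap.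
by apply: eq_integral => x _; rewrite /amap /=; congr (f (_, _)); ring.
Qed.

Lemma integrable_amap {R : realType} (a b c : R * R) (f : R * R -> R) :
  cross a b c != 0 -> area.-integrable (setT : set (plane R)) (EFin \o f) ->
  area.-integrable (setT : set (plane R)) (EFin \o (f \o amap a b c)).
Proof.
move=> D0 /integrableP[mf fi]; apply/integrableP; split.
  apply/measurable_EFinP; apply: measurableT_comp; last exact: measurable_amap.
  exact/measurable_EFinP.
rewrite (@ge0_integral_amap _ a b c) // in fi; last exact: measurableT_comp.
rewrite -(@lte_pmul2l _ `|cross a b c|%:E) ?lte_fin ?normr_gt0 //.
by rewrite gt0_muley ?lte_fin ?normr_gt0.
Qed.

Lemma Rintegral_amap {R : realType} (a b c : R * R) (f : R * R -> R) :
  cross a b c != 0 -> area.-integrable (setT : set (plane R)) (EFin \o f) ->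
  \int[area]_(x in setT : set (plane R)) f x =
  `|cross a b c| * \int[area]_(x in setT : set (plane R)) f (amap a b c x).
Proof.
move=> D0 fi.
have fai := integrable_amap D0 fi.
have mf : measurable_fun setT (EFin \o f : plane R -> _) by case/integrableP: fi.
have D00 : (0 <= `|cross a b c|%:E)%E by rewrite lee_fin.
rewrite -RintegralZl // /Rintegral; congr fine.
rewrite integralE [in RHS]integralE.
have mfa : measurable_fun setT (EFin \o (f \o amap a b c) : plane R -> _).
  by case/integrableP: fai.
rewrite (@ge0_integral_amap _ a b c) // ?[X in (_ - X)%E](@ge0_integral_amap _ a b c) //; last 2 first.
- exact: measurable_funeneg.
- exact: measurable_funepos.
congr (_ - _)%E.
  rewrite -ge0_integralZl_EFin //; last first.
    apply: measurableT_comp; last exact: measurable_amap.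
    exact: measurable_funepos.
  apply: eq_integral => x _.
  by rewrite !funeposE /= EFinM maxe_pMr // mule0.
rewrite -ge0_integralZl_EFin //; last first.
  apply: measurableT_comp; last exact: measurable_amap.
  exact: measurable_funeneg.
apply: eq_integral => x _.
by rewrite !funenegE /= -mulrN EFinM maxe_pMr // mule0.
Qed.

(** The plane carries the product sigma-algebra. An open set is the countable union of the boxes
    with rational centre and half-side [n.+1%:R^-1] that it contains, and each box is a measurable
    rectangle. *)
Lemma open_measurable_plane {R : realType} (U : set (R * R)) :
  open U -> measurable (U : set (plane R)).
Proof.
move=> oU.
pose box (q r : rat) (n : nat) : set (plane R) :=
  ball (ratr q : R) n.+1%:R^-1 `*` ball (ratr r : R) n.+1%:R^-1.
have mbox q r n : measurable (box q r n) by apply: measurableX; exact: measurable_ball.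
have -> : U = \bigcup_q \bigcup_r \bigcup_n (if `[< box q r n `<=` U >] then box q r n else set0).
  apply/seteqP; split => [x Ux|x [q _ [r _ [n _]]]]; last first.
    by case: asboolP => // + ?; exact.
  have /nbhs_ballP[e e0 xeU] : nbhs x U by exact: open_nbhs_nbhs.
  have [n ne] : exists n : nat, n.+1%:R^-1 < e / 2.
    have e20 : 0 < e / 2 by rewrite divr_gt0.
    have := near_infty_natSinv_lt (PosNum e20) => -[m _ /(_ m)]; rewrite /= leqnn => /(_ isT) H.
    by exists m.
  have d0 : 0 < n.+1%:R^-1 :> R by rewrite invr_gt0.
  have [q xq] : exists q : rat, ball x.1 (n.+1%:R^-1) (ratr q : R).
    have [y [yB [q _ yE]]] := dense_rat (ex_intro _ x.1 (ballxx x.1 d0)) (ball_open x.1 n.+1%:R^-1).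
    by exists q; rewrite yE.
  have [r xr] : exists r : rat, ball x.2 (n.+1%:R^-1) (ratr r : R).
    have [y [yB [r _ yE]]] := dense_rat (ex_intro _ x.2 (ballxx x.2 d0)) (ball_open x.2 n.+1%:R^-1).
    by exists r; rewrite yE.
  exists q => //; exists r => //; exists n => //.
  case: asboolP => [_|]; first by split; exact: ball_sym.
  case; move=> y [/= y1 y2]; apply: xeU; split => /=.
    have := ball_triangle xq y1; apply: le_ball; rewrite (splitr e); apply: lerD; exact: ltW.
  have := ball_triangle xr y2; apply: le_ball; rewrite (splitr e); apply: lerD; exact: ltW.
apply: bigcupT_measurable_rat => q; apply: bigcupT_measurable_rat => r.
apply: bigcupT_measurable => n; case: ifP => _; [exact: mbox|exact: measurable0].
Qed.

Lemma continuous_measurable_plane {R : realType} (f : R * R -> R) :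
  continuous f -> measurable_fun (setT : set (plane R)) f.
Proof.
move=> cf; apply: (measurability _ (RGenOpens.measurableE R)) => _ [_ [a [b ->]] <-].
rewrite setTI; apply: open_measurable_plane.
apply: open_comp; [by move=> x _; exact: cf|exact: interval_open].
Qed.

(** * Square-integrable functions: inner product, norm, Cauchy-Schwarz *)

Section square_integrable.
Context {d : measure_display} {X : measurableType d} {R : realType}.
Implicit Types (mu : {measure set X -> \bar R}) (S : set X) (f g u : X -> R).

(** The real integral takes the value 0 where the extended one is infinite, so bilinearity is only
    available for functions in [sqint]. *)
Definition ip mu S f g : R := \int[mu]_(x in S) (f x * g x).

Definition sqint mu S f : Prop :=
  measurable_fun S f /\ (\int[mu]_(x in S) ((f x) ^+ 2)%:E < +oo)%E.

Definition nrm mu S f : R := Num.sqrt (ip mu S f f).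

Lemma sqint_integrable_sqr mu S f : measurable S -> sqint mu S f ->
  mu.-integrable S (EFin \o (fun x => f x ^+ 2)).
Proof.
move=> mS [mf fi]; apply/integrableP; split.
  by apply/measurable_EFinP; exact: measurable_funX.
by under eq_integral => x _ do rewrite /= ger0_norm ?sqr_ge0 //.
Qed.

Lemma sqint_integrableM mu S f g : measurable S -> sqint mu S f -> sqint mu S g ->
  mu.-integrable S (EFin \o (fun x => f x * g x)).
Proof.
move=> mS fi gi.
have := integrableD mS (sqint_integrable_sqr mS fi) (sqint_integrable_sqr mS gi).
apply: le_integrable => //.
  by apply/measurable_EFinP; apply: measurable_funM; [case: fi|case: gi].
move=> x Sx /=; rewrite lee_fin [leRHS]ger0_norm ?addr_ge0 ?sqr_ge0 // ler_norml.
by apply/andP; split; nra.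
Qed.

Lemma ip_def mu S f g : measurable S -> sqint mu S f -> sqint mu S g ->
  (\int[mu]_(x in S) (f x * g x)%:E)%E = (ip mu S f g)%:E.
Proof.
move=> mS fi gi; rewrite /ip /Rintegral fineK //.
apply: integrable_fin_num => //; exact: sqint_integrableM.
Qed.

Lemma nrm_ge0 mu S f : 0 <= nrm mu S f.
Proof. exact: sqrtr_ge0. Qed.

Lemma ip_ge0 mu S f : 0 <= ip mu S f f.
Proof. by apply: Rintegral_ge0 => x _; rewrite -expr2 sqr_ge0. Qed.

Lemma nrm_sqr mu S f : nrm mu S f ^+ 2 = ip mu S f f.
Proof. by rewrite sqr_sqrtr // ip_ge0. Qed.

Lemma ipC mu S f g : ip mu S f g = ip mu S g f.
Proof. by apply: eq_Rintegral => x _; rewrite mulrC. Qed.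

Lemma sqintD mu S f g : measurable S -> sqint mu S f -> sqint mu S g ->
  sqint mu S (fun x => f x + g x).
Proof.
move=> mS fi gi; split; first by apply: measurable_funD; [case: fi|case: gi].
have : mu.-integrable S (EFin \o (fun x => 2 * (f x ^+ 2 + g x ^+ 2))).
  apply: (@eq_integrable _ _ _ _ _ mS (fun x => (2%:E * ((f x ^+ 2)%R%:E + (g x ^+ 2)%R%:E))%E)).
    by move=> x _.
  by apply: integrableZl => //; apply: integrableD => //; exact: sqint_integrable_sqr.
move=> /integrableP[_ ]; apply: le_lt_trans; apply: ge0_le_integral => //.
- by move=> x _; rewrite lee_fin sqr_ge0.
- apply/measurable_EFinP; apply: measurable_funX.
  by apply: measurable_funD; [case: fi|case: gi].
- apply/measurable_EFinP; apply: measurableT_comp => //; apply: measurable_funM => //.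
  by apply: measurable_funD; apply: measurable_funX; [case: fi|case: gi].
move=> x Sx /=; rewrite lee_fin ger0_norm; last by rewrite mulr_ge0 // addr_ge0 ?sqr_ge0.
by have := sqr_ge0 (f x - g x); nra.
Qed.

Lemma sqintZ mu S (k : R) f : measurable S -> sqint mu S f ->
  sqint mu S (fun x => k * f x).
Proof.
move=> mS fi; split; first by apply: measurable_funM => //; case: fi.
have /integrableP[_] := integrableZl mS (k ^+ 2) (sqint_integrable_sqr mS fi).
apply: le_lt_trans; apply: ge0_le_integral => //.
- by move=> x _; rewrite lee_fin sqr_ge0.
- apply/measurable_EFinP; apply: measurable_funX.
  by apply: measurable_funM => //; case: fi.
- apply: measurableT_comp => //; apply: emeasurable_funM => //.
  by apply/measurable_EFinP; apply: measurable_funX; case: fi.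
move=> x Sx; rewrite [leRHS](_ : _ = ((k * f x) ^+ 2)%:E) //.
by rewrite /= -exprMn ger0_norm ?sqr_ge0.
Qed.

Lemma sqintB mu S f g : measurable S -> sqint mu S f -> sqint mu S g ->
  sqint mu S (fun x => f x - g x).
Proof.
move=> mS fi gi; have := sqintD mS fi (sqintZ (-1) mS gi).
by congr (sqint _ _ _); apply/funext => x; rewrite mulN1r.
Qed.

Lemma sqintS mu S S' f : measurable S -> measurable S' -> S' `<=` S -> sqint mu S f ->
  sqint mu S' f.
Proof.
move=> mS mS' SS [mf fi]; split; first exact: measurable_funS mf.
apply: le_lt_trans fi; apply: ge0_subset_integral => //.
  by apply/measurable_EFinP; exact: measurable_funX.
by move=> x _; rewrite lee_fin sqr_ge0.
Qed.

Lemma sqint_bounded mu S f (M : R) : measurable S -> (mu S < +oo)%E ->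
  measurable_fun S f -> (forall x, S x -> `|f x| <= M) -> sqint mu S f.
Proof.
move=> mS Sfin mf fM; split => //.
apply: (@le_lt_trans _ _ (\int[mu]_(x in S) (M ^+ 2)%:E)%E).
  apply: ge0_le_integral => //.
  - by move=> x _; rewrite lee_fin sqr_ge0.
  - by apply/measurable_EFinP; exact: measurable_funX.
  move=> x Sx; rewrite lee_fin -[f x ^+ 2]ger0_norm ?sqr_ge0 // normrX.
  by rewrite ler_pXn2r ?nnegrE ?fM // (le_trans _ (fM _ Sx)).
by rewrite integral_cst // lte_mul_pinfty // lee_fin sqr_ge0.
Qed.

Lemma ipDl mu S f g u : measurable S -> sqint mu S f -> sqint mu S g -> sqint mu S u ->
  ip mu S (fun x => f x + g x) u = ip mu S f u + ip mu S g u.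
Proof.
move=> mS fi gi ui; rewrite /ip.
under eq_Rintegral => x _ do rewrite mulrDl.
by rewrite RintegralD //; exact: sqint_integrableM.
Qed.

Lemma ipZl mu S (k : R) f u : measurable S -> sqint mu S f -> sqint mu S u ->
  ip mu S (fun x => k * f x) u = k * ip mu S f u.
Proof.
move=> mS fi ui; rewrite /ip.
under eq_Rintegral => x _ do rewrite -mulrA.
by rewrite RintegralZl //; exact: sqint_integrableM.
Qed.

Lemma ipBl mu S f g u : measurable S -> sqint mu S f -> sqint mu S g -> sqint mu S u ->
  ip mu S (fun x => f x - g x) u = ip mu S f u - ip mu S g u.
Proof.
move=> mS fi gi ui; rewrite /ip.
under eq_Rintegral => x _ do rewrite mulrBl.
by rewrite RintegralB //; exact: sqint_integrableM.
Qed.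

Lemma ipDr mu S f g u : measurable S -> sqint mu S f -> sqint mu S g -> sqint mu S u ->
  ip mu S u (fun x => f x + g x) = ip mu S u f + ip mu S u g.
Proof. by move=> *; rewrite ipC ipDl // !(ipC mu S _ u). Qed.

Lemma ipBr mu S f g u : measurable S -> sqint mu S f -> sqint mu S g -> sqint mu S u ->
  ip mu S u (fun x => f x - g x) = ip mu S u f - ip mu S u g.
Proof. by move=> *; rewrite ipC ipBl // !(ipC mu S _ u). Qed.

Lemma cauchy_schwarz mu S f g : measurable S -> sqint mu S f -> sqint mu S g ->
  `|ip mu S f g| <= nrm mu S f * nrm mu S g.
Proof.
move=> mS fi gi.
have key (t : R) : 0 <= t ^+ 2 * ip mu S f f + 2 * t * ip mu S f g + ip mu S g g.
  have := ip_ge0 mu S (fun x => t * f x + g x).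
  rewrite ipDl ?ipDr ?ipZl //; try by [apply: sqintD => //; apply: sqintZ|apply: sqintZ].
  rewrite !(ipC mu S _ (fun x => t * f x)) !ipZl //; try by apply: sqintZ.
  move/le_trans; apply.
  by rewrite le_eqVlt; apply/orP; left; apply/eqP; ring.
rewrite -ler_sqr ?nnegrE ?mulr_ge0 ?nrm_ge0 // exprMn !nrm_sqr real_normK ?num_real //.
move: (ip_ge0 mu S f) (ip_ge0 mu S g) key.
move: (ip mu S f f) (ip mu S f g) (ip mu S g g) => A B C A0 C0 key.
(* For [A = 0] the non-negative polynomial of [key] is affine in [t]; unless [B = 0], the [t] chosen
   below gives it the value -1. For [A > 0] it is evaluated at its minimiser [- B / A]. *)
have [A00|Ap] := eqVneq A 0.
  have [->|B0] := eqVneq B 0; first by rewrite expr0n /= mulr_ge0.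
  have := key (- (C + 1) / (2 * B)); rewrite A00 mulr0 add0r.
  have -> : 2 * (- (C + 1) / (2 * B)) * B + C = -1 by field.
  lra.
have := key (- B / A).
have -> : (- B / A) ^+ 2 * A + 2 * (- B / A) * B + C = (A * C - B ^+ 2) / A by field.
by rewrite pmulr_lge0 ?invr_gt0 ?lt_neqAle ?A0 ?(eq_sym 0) ?Ap // subr_ge0.
Qed.

Lemma nrmD mu S f g : measurable S -> sqint mu S f -> sqint mu S g ->
  nrm mu S (fun x => f x + g x) <= nrm mu S f + nrm mu S g.
Proof.
move=> mS fi gi.
rewrite -ler_sqr ?nnegrE ?addr_ge0 ?nrm_ge0 // nrm_sqr ipDl ?ipDr //; try exact: sqintD.
rewrite (ipC mu S g f) sqrrD !nrm_sqr.
have := cauchy_schwarz mS fi gi; rewrite ler_norml => /andP[_]; lra.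
Qed.

Lemma nrmZ mu S (k : R) f : measurable S -> sqint mu S f ->
  nrm mu S (fun x => k * f x) = `|k| * nrm mu S f.
Proof.
move=> mS fi; rewrite {1}/nrm ipZl ?(ipC _ _ f) ?ipZl //; try exact: sqintZ.
by rewrite mulrA -expr2 sqrtrM ?sqr_ge0 // sqrtr_sqr.
Qed.

Lemma nrmB mu S f g : measurable S -> sqint mu S f -> sqint mu S g ->
  nrm mu S (fun x => f x - g x) <= nrm mu S f + nrm mu S g.
Proof.
move=> mS fi gi; have := nrmD mS fi (sqintZ (-1) mS gi).
rewrite nrmZ // normrN normr1 mul1r.
by under [X in nrm _ _ X]eq_fun do rewrite mulN1r.
Qed.

Lemma nrmS mu S S' f : measurable S -> measurable S' -> S' `<=` S -> sqint mu S f ->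
  nrm mu S' f <= nrm mu S f.
Proof.
move=> mS mS' SS fi; have fi' := sqintS mS mS' SS fi.
rewrite /nrm ler_wsqrtr // -lee_fin -!ip_def //.
apply: ge0_subset_integral => //.
  by apply/measurable_EFinP; apply: measurable_funM; case: fi.
by move=> x _; rewrite -expr2 lee_fin sqr_ge0.
Qed.

Lemma nrm_bounded mu S f (M : R) : measurable S -> (mu S < +oo)%E ->
  measurable_fun S f -> 0 <= M -> (forall x, S x -> `|f x| <= M) ->
  nrm mu S f <= M * Num.sqrt (fine (mu S)).
Proof.
move=> mS Sfin mf M0 fM.
have fi := sqint_bounded mS Sfin mf fM.
rewrite -ler_sqr ?nnegrE ?mulr_ge0 ?nrm_ge0 ?sqrtr_ge0 // nrm_sqr exprMn sqr_sqrtr ?fine_ge0 //.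
rewrite -lee_fin -ip_def // EFinM fineK ?ge0_fin_numE // -integral_cst //.
apply: ge0_le_integral => //.
- by move=> x _; rewrite -expr2 lee_fin sqr_ge0.
- by apply/measurable_EFinP; apply: measurable_funM; case: fi.
move=> x Sx; rewrite -expr2 lee_fin -[f x ^+ 2]ger0_norm ?sqr_ge0 // normrX.
by rewrite ler_pXn2r ?nnegrE ?fM // (le_trans _ (fM _ Sx)).
Qed.

Lemma eq_nrm mu S f g : {in S, f =1 g} -> nrm mu S f = nrm mu S g.
Proof. by move=> fg; congr Num.sqrt; apply: eq_Rintegral => x xS; rewrite fg. Qed.

Lemma eq_ip mu S f f' g g' : {in S, f =1 f'} -> {in S, g =1 g'} ->
  ip mu S f g = ip mu S f' g'.
Proof. by move=> ff gg; apply: eq_Rintegral => x xS; rewrite ff // gg. Qed.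

Lemma eq_sqint mu S f g : {in S, f =1 g} -> sqint mu S f -> sqint mu S g.
Proof.
move=> fg [mf fi]; split; first exact: eq_measurable_fun mf.
by under eq_integral => x xS do rewrite -fg //.
Qed.

Lemma ip_cvgl mu S (f_ : nat -> X -> R) f g : measurable S ->
  (forall i, sqint mu S (f_ i)) -> sqint mu S f -> sqint mu S g ->
  nrm mu S (fun x => f_ i x - f x) @[i --> \oo] --> (0 : R) ->
  ip mu S (f_ i) g @[i --> \oo] --> ip mu S f g.
Proof.
move=> mS fi_ fi gi cf.
apply/subr_cvg0; apply/norm_cvg0P.
apply: (@squeeze_cvgr _ _ _ _ (fun=> 0) (fun i => nrm mu S (fun x => f_ i x - f x) * nrm mu S g)).
- apply: nearW => i; rewrite normr_ge0 /= -ipBl //.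
  by apply: cauchy_schwarz => //; exact: sqintB.
- exact: cvg_cst.
- by rewrite -(mul0r (nrm mu S g)); apply: cvgM => //; exact: cvg_cst.
Qed.

End square_integrable.

(** * Smooth functions and cutoffs *)

(** Reduces a directional derivative to a derivative in one real variable, where the chain rule and
    the mean value theorem are available. *)
Lemma is_derive_lineP {R : numFieldType} {V W : normedModType R} (f : V -> W) x v df :
  is_derive (0 : R) 1 (fun h : R => f (h *: v + x)) df <-> is_derive x v f df.
Proof.
have E : 'D_1 (fun h : R => f (h *: v + x)) 0 = 'D_v f x.
  rewrite /derive; set g1 := fun h => h^-1 *: _; set g2 := fun h => h^-1 *: _.
  suff -> : g1 = g2 by [].
  by rewrite funeqE /g1 /g2 => h /=; rewrite addr0 scale0r add0r [_%:A]mulr1.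
split=> -[D <-]; apply: DeriveDef.
- exact: (derivable1P f x v).2.
- exact/esym.
- exact: (derivable1P f x v).1.
- exact: E.
Qed.

Lemma continuous_fst_plane {R : realType} : continuous (fun x : R * R => x.1).
Proof. by move=> x; exact: cvg_fst. Qed.

Lemma continuous_snd_plane {R : realType} : continuous (fun x : R * R => x.2).
Proof. by move=> x; exact: cvg_snd. Qed.

Lemma CnS {R : realType} n (f : R * R -> R) : Cn n.+1 f -> Cn n f.
Proof.
elim: n f => [|n IH] f [cf [df c1 c2]]; split; [exact: cf|by []|exact: cf|].
by split; [exact: df|apply: IH; exact: c1|apply: IH; exact: c2].
Qed.

Lemma smooth_continuous {R : realType} (f : R * R -> R) : smooth f -> continuous f.
Proof. by move=> /(_ 0%N)[]. Qed.

Lemma smooth_pd1 {R : realType} (f : R * R -> R) : smooth f -> smooth (pd1 f).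
Proof. by move=> sf n; have [_ []] := sf n.+1. Qed.

Lemma smooth_pd2 {R : realType} (f : R * R -> R) : smooth f -> smooth (pd2 f).
Proof. by move=> sf n; have [_ []] := sf n.+1. Qed.

Lemma smooth_derivable1 {R : realType} (f : R * R -> R) x : smooth f ->
  derivable f x ((1, 0) : R * R).
Proof. by move=> /(_ 1%N)[_ [/(_ x)[]]]. Qed.

Lemma smooth_derivable2 {R : realType} (f : R * R -> R) x : smooth f ->
  derivable f x ((0, 1) : R * R).
Proof. by move=> /(_ 1%N)[_ [/(_ x)[]]]. Qed.

Lemma smooth_cst {R : realType} (c : R) : smooth (fun _ : R * R => c).
Proof.
move=> n; elim: n c => [|n IH] c; split; [by move=> x; exact: cvg_cst|by []|by move=> x; exact: cvg_cst|].
split.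
- by move=> x; split; exact: derivable_cst.
- have -> : pd1 (fun _ : R * R => c) = fun=> 0 by apply/funext => x; rewrite /pd1 derive_cst.
  exact: IH.
- have -> : pd2 (fun _ : R * R => c) = fun=> 0 by apply/funext => x; rewrite /pd2 derive_cst.
  exact: IH.
Qed.

Lemma pd1D {R : realType} (f g : R * R -> R) : smooth f -> smooth g ->
  pd1 (fun x => f x + g x) = fun x => pd1 f x + pd1 g x.
Proof.
by move=> sf sg; apply/funext => x; rewrite /pd1 deriveD //; exact: smooth_derivable1.
Qed.

Lemma pd2D {R : realType} (f g : R * R -> R) : smooth f -> smooth g ->
  pd2 (fun x => f x + g x) = fun x => pd2 f x + pd2 g x.
Proof.
by move=> sf sg; apply/funext => x; rewrite /pd2 deriveD //; exact: smooth_derivable2.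
Qed.

Lemma pdM {R : realType} (v : R * R) (f g : R * R -> R) :
  (forall x, derivable f x v) -> (forall x, derivable g x v) ->
  'D_v (fun x => f x * g x) = fun x => f x * 'D_v g x + g x * 'D_v f x.
Proof. by move=> df dg; apply/funext => x; rewrite deriveM. Qed.

Lemma pd1M {R : realType} (f g : R * R -> R) : smooth f -> smooth g ->
  pd1 (fun x => f x * g x) = fun x => f x * pd1 g x + g x * pd1 f x.
Proof. by move=> sf sg; apply: pdM => x; exact: smooth_derivable1. Qed.

Lemma pd2M {R : realType} (f g : R * R -> R) : smooth f -> smooth g ->
  pd2 (fun x => f x * g x) = fun x => f x * pd2 g x + g x * pd2 f x.
Proof. by move=> sf sg; apply: pdM => x; exact: smooth_derivable2. Qed.

Lemma CnD {R : realType} n (f g : R * R -> R) : Cn n f -> Cn n g ->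
  Cn n (fun x => f x + g x).
Proof.
elim: n f g => [|n IH] f g [cf Hf] [cg Hg];
  (split; first by move=> x; apply: cvgD; [exact: cf|exact: cg]); first by [].
case: Hf Hg => [df f1 f2] [dg g1 g2]; split.
- move=> x; have [dx1 dx2] := df x; have [dy1 dy2] := dg x.
  split; apply: derivableD; [exact dx1|exact dy1|exact dx2|exact dy2].
- have -> : pd1 (fun x => f x + g x) = fun x => pd1 f x + pd1 g x.
    apply/funext => x; rewrite /pd1 deriveD //; [by case: (df x)|by case: (dg x)].
  by apply: IH; [exact: f1|exact: g1].
- have -> : pd2 (fun x => f x + g x) = fun x => pd2 f x + pd2 g x.
    apply/funext => x; rewrite /pd2 deriveD //; [by case: (df x)|by case: (dg x)].
  by apply: IH; [exact: f2|exact: g2].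
Qed.

Lemma smoothD {R : realType} (f g : R * R -> R) : smooth f -> smooth g ->
  smooth (fun x => f x + g x).
Proof. by move=> sf sg n; exact: CnD. Qed.

Lemma CnM {R : realType} n (f g : R * R -> R) : Cn n f -> Cn n g ->
  Cn n (fun x => f x * g x).
Proof.
elim: n f g => [|n IH] f g Hf' Hg'; have [cf Hf] := Hf'; have [cg Hg] := Hg'.
  by split; [move=> x; apply: cvgM; [exact: cf|exact: cg]|].
have [df f1 f2] := Hf; have [dg g1 g2] := Hg.
have Hf0 := CnS Hf'; have Hg0 := CnS Hg'; clear Hf' Hg' Hf Hg.
have df1 x := (df x).1; have df2 x := (df x).2; have dg1 x := (dg x).1; have dg2 x := (dg x).2.
split; first by move=> x; apply: cvgM; [exact: cf|exact: cg].
split; first by move=> x; split; apply: derivableM.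
- rewrite [pd1 _](pdM df1 dg1); apply: CnD; apply: IH;
    [exact Hf0|exact g1|exact Hg0|exact f1].
- rewrite [pd2 _](pdM df2 dg2); apply: CnD; apply: IH;
    [exact Hf0|exact g2|exact Hg0|exact f2].
Qed.

Lemma smoothM {R : realType} (f g : R * R -> R) : smooth f -> smooth g ->
  smooth (fun x => f x * g x).
Proof. by move=> sf sg n; exact: CnM. Qed.

Lemma smoothZ {R : realType} (k : R) (f : R * R -> R) : smooth f ->
  smooth (fun x => k * f x).
Proof. by move=> sf; apply: smoothM; [exact: smooth_cst|exact: sf]. Qed.

Lemma smoothN {R : realType} (f : R * R -> R) : smooth f -> smooth (fun x => - f x).
Proof.
move=> /(smoothZ (-1)).
by have -> : (fun x => - f x) = (fun x => -1 * f x) by apply/funext => x; rewrite mulN1r.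
Qed.

Lemma smoothB {R : realType} (f g : R * R -> R) : smooth f -> smooth g ->
  smooth (fun x => f x - g x).
Proof. by move=> sf sg; apply: smoothD; [exact: sf|exact: smoothN]. Qed.

Lemma is_derive_affine {R : realType} (h : R -> R) (dh al be ga : R) (x v : R * R) :
  is_derive (ga + al * x.1 + be * x.2) 1 h dh ->
  is_derive x v (fun y => h (ga + al * y.1 + be * y.2)) ((al * v.1 + be * v.2) * dh).
Proof.
move=> hd; apply/is_derive_lineP.
pose u t : R := t * (al * v.1 + be * v.2) + (ga + al * x.1 + be * x.2).
have -> : (fun t : R => h (ga + al * (t *: v + x).1 + be * (t *: v + x).2)) = h \o u.
  by apply/funext => t /=; congr h; rewrite /u /GRing.scale /=; ring.
have du : is_derive (0 : R) 1 u (al * v.1 + be * v.2).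
  have D1 := is_deriveM (is_derive_id (0 : R) (1 : R)) (is_derive_cst (al * v.1 + be * v.2) (0 : R) (1 : R)).
  have D2 := is_deriveD D1 (is_derive_cst (ga + al * x.1 + be * x.2) (0 : R) (1 : R)).
  by apply: (is_derive_eq D2); rewrite scaler0 add0r addr0 [LHS]mulr1.
have u0 : u 0 = ga + al * x.1 + be * x.2 by rewrite /u mul0r add0r.
have hd' : is_derive (u 0) 1 h dh by rewrite u0.
by apply: (is_derive_eq (@is_derive1_comp _ h u 0 dh _ hd' du)); rewrite mulrC.
Qed.

Lemma pd_affine {R : realType} (h h' : R -> R) (al be ga : R) :
  (forall s : R, is_derive s 1 h (h' s)) ->
  (pd1 (fun x => h (ga + al * x.1 + be * x.2)) = fun x => al * h' (ga + al * x.1 + be * x.2)) /\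
  (pd2 (fun x => h (ga + al * x.1 + be * x.2)) = fun x => be * h' (ga + al * x.1 + be * x.2)).
Proof.
move=> hd; split; apply/funext => x.
  have [_ ] := @is_derive_affine R h _ al be ga x (1, 0) (hd _).
  by rewrite /pd1 => -> /=; rewrite mulr1 mulr0 addr0.
have [_ ] := @is_derive_affine R h _ al be ga x (0, 1) (hd _).
by rewrite /pd2 => -> /=; rewrite mulr1 mulr0 add0r.
Qed.

Lemma continuous_affine {R : realType} (al be ga : R) :
  continuous (fun x : R * R => ga + al * x.1 + be * x.2).
Proof.
move=> x; apply: cvgD; first (apply: cvgD; first exact: cvg_cst).
  by apply: cvgM; [exact: cvg_cst|exact: cvg_fst].
by apply: cvgM; [exact: cvg_cst|exact: cvg_snd].
Qed.

Lemma smooth_affine {R : realType} (al be ga : R) :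
  smooth (fun x : R * R => ga + al * x.1 + be * x.2).
Proof.
case=> [|n]; (split; first exact: continuous_affine); first by [].
have D (s : R) : is_derive s 1 id ((fun=> 1) s : R) by exact: is_derive_id.
have [E1 E2] := pd_affine al be ga D.
split.
- by move=> x; split;
    [have [] := @is_derive_affine R id _ al be ga x (1, 0) (D _) |
     have [] := @is_derive_affine R id _ al be ga x (0, 1) (D _)].
- by rewrite E1; exact: smooth_cst.
- by rewrite E2; exact: smooth_cst.
Qed.

(** [P ((s - 1)^-1) * exp (- (s - 1)^-1)] for [s > 1], extended by 0: a family of smooth functions that is closed under
    differentiation, which only changes [P]. *)
Definition eb {R : realType} (P : {poly R}) (s : R) : R :=
  if 1 < s then P.[(s - 1)^-1] * expR (- (s - 1)^-1) else 0.

(** Each monomial satisfies $r^i \le i!\, e^r$ by the exponential series, which gives the constant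
    term by term. *)
Lemma poly_exp_bound {R : realType} (P : {poly R}) :
  exists2 C : R, 0 <= C & forall r, 0 <= r -> `|P.[r]| * expR (- r) <= C.
Proof.
exists (\sum_(i < size P) `|P`_i| * i`!%:R); first by apply: sumr_ge0 => i _; rewrite mulr_ge0.
move=> r r0; rewrite horner_coef.
apply: (@le_trans _ _ (\sum_(i < size P) `|P`_i| * r ^+ i * expR (- r))).
  rewrite -mulr_suml ler_wpM2r ?expR_ge0 //.
  by apply: le_trans (ler_norm_sum _ _ _) _; apply: ler_sum => i _; rewrite normrM normrX (ger0_norm r0).
apply: ler_sum => i _; rewrite -mulrA ler_wpM2l //.
rewrite expRN ler_pdivrMr ?expR_gt0 //.
have f0 : (0 : R) < i`!%:R by rewrite ltr0n fact_gt0.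
rewrite -ler_pdivrMl // mulrC.
case: (nat_of_ord i) => [|m]; first by rewrite expr0 fact0 divr1 (le_trans _ (expR_ge1Dx r)) // lerDl.
by apply: le_trans (expR_ge1Dxn m r0); rewrite lerDr.
Qed.

Lemma eb_bounded {R : realType} (P : {poly R}) :
  exists2 C : R, 0 <= C & forall s, `|eb P s| <= C.
Proof.
have [C C0 HC] := poly_exp_bound P; exists C => // s; rewrite /eb.
case: ifPn => s1; last by rewrite normr0.
rewrite normrM [X in _ * X]ger0_norm ?expR_ge0 //; apply: HC.
by rewrite invr_ge0 subr_ge0 ltW.
Qed.

(** The uniform bound for [P * 'X^2] is divided by the two extra powers of $(s-1)^{-1}$. Quadratic
    decay at [s = 1] is what makes the derivative there exist and vanish. *)
Lemma eb_quad {R : realType} (P : {poly R}) :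
  exists2 C : R, 0 <= C & forall s, `|eb P s| <= C * (s - 1) ^+ 2.
Proof.
have [C C0 HC] := eb_bounded (P * 'X^2); exists C => // s.
have := HC s; rewrite /eb; case: ifPn => s1; last by rewrite normr0 mulr_ge0 ?sqr_ge0.
have s10 : 0 < s - 1 by rewrite subr_gt0.
rewrite hornerM hornerXn mulrAC normrM normrX (gtr0_norm (_ : 0 < (s - 1)^-1)) ?invr_gt0 //.
by rewrite exprVn ler_pdivrMr ?exprn_gt0.
Qed.

(** With $r = (s-1)^{-1}$ one has $r' = -r^2$, so $P(r) e^{-r}$ has derivative $r^2 (P - P')(r)
    e^{-r}$. At the junction [s = 1] the difference quotient is at most a constant times the
    increment, by [eb_quad]. *)
Lemma eb_is_derive {R : realType} (P : {poly R}) (s : R) :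
  is_derive s 1 (eb P) (eb ('X^2 * (P - P^`())) s).
Proof.
have [s1|s1|<-] := ltgtP 1 s.
- have s10 : s - 1 != 0 by rewrite subr_eq0 gt_eqF.
  apply: (@near_eq_is_derive R R R (fun s : R => P.[(s - 1)^-1] * expR (- (s - 1)^-1))).
    near=> t; rewrite /eb ifT //; near: t; exact: lt_nbhsr.
  have D0 : is_derive s 1 (fun s => s - 1) 1.
    by rewrite -[X in is_derive _ _ _ X]subr0; apply: is_deriveB.
  have D1 : is_derive s 1 (fun s => (s - 1)^-1) (- (s - 1) ^- 2).
    have [d e] := D0; apply: DeriveDef; first exact: derivableV.
    by rewrite deriveV // e [LHS]mulr1.
  have D2 : is_derive s 1 (fun s => P.[(s - 1)^-1]) (P^`().[(s - 1)^-1] * (- (s - 1) ^- 2)).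
    exact: (@is_derive1_comp _ (horner P) (fun s => (s - 1)^-1)).
  have D3 : is_derive s 1 (fun s => expR (- (s - 1)^-1)) (expR (- (s - 1)^-1) * - (- (s - 1) ^- 2)).
    exact: (@is_derive1_comp _ expR (fun s => - (s - 1)^-1)).
  apply: (@is_derive_eq _ _ _ _ _ _ _ _ (is_deriveM D2 D3)).
  rewrite /eb s1 !hornerE /GRing.scale /= exprVn; ring.
- apply: (@near_eq_is_derive R R R (fun=> 0)).
    near=> t; rewrite /eb ifF //; apply/negbTE; rewrite -leNgt ltW //; near: t.
    exact: lt_nbhsl.
  have -> : eb ('X^2 * (P - P^`())) s = 0 by rewrite /eb ltNge ltW.
  exact: is_derive_cst.
have -> : eb ('X^2 * (P - P^`())) 1 = 0 by rewrite /eb ltxx.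
have [C C0 HC] := eb_quad P.
have lim : h^-1 *: ((eb P \o shift 1) (h *: 1) - eb P 1) @[h --> (0:R)^'] --> (0 : R).
  apply/norm_cvg0P; apply: (@squeeze_cvgr _ _ _ _ (fun=> 0) (fun h => C * `|h|)).
  - apply: nearW => h; rewrite normr_ge0 /= {2}/eb ltxx subr0 [h *: 1]mulr1 normrM normfV.
    have := HC (h + 1); rewrite addrK.
    have [->|h0] := eqVneq h 0; first by rewrite normr0 invr0 mul0r mulr0.
    by rewrite ler_pdivrMl ?normr_gt0 // -real_normK ?num_real // => H; apply: le_trans H _; suff -> : `|h| * (C * `|h|) = C * `|h| ^+ 2 by []; ring.
  - exact: cvg_cst.
  - have N : `|h| @[h --> (0:R)^'] --> (0:R).
      by rewrite -[X in _ --> X](@normr0 _ R); apply: cvg_norm; exact: cvg_within.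
    by rewrite -[X in _ --> X](mulr0 C); apply: cvgM N; exact: cvg_cst.
by apply: DeriveDef; [apply/cvg_ex; exists 0|exact: cvg_lim lim].
Unshelve. all: by end_near. Qed.

Lemma continuous_eb {R : realType} (P : {poly R}) : continuous (eb P).
Proof.
move=> s; apply: differentiable_continuous; apply/derivable1_diffP.
by have [] := eb_is_derive P s.
Qed.

Lemma smooth_eb {R : realType} (P : {poly R}) (al be ga : R) :
  smooth (fun x => eb P (ga + al * x.1 + be * x.2)).
Proof.
move=> n; elim: n P => [|n IH] P;
  (split; first by move=> x; apply: (@continuous_comp _ _ _ (fun x : R * R => ga + al * x.1 + be * x.2) (eb P)); [exact: continuous_affine|exact: continuous_eb]);
  first by [].
have [E1 E2] := pd_affine al be ga (eb_is_derive P).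
split.
- by move=> x; split;
    [have [] := @is_derive_affine R _ _ al be ga x (1, 0) (eb_is_derive P _) |
     have [] := @is_derive_affine R _ _ al be ga x (0, 1) (eb_is_derive P _)].
- by rewrite E1; apply: CnM; [exact: smooth_cst|exact: IH].
- by rewrite E2; apply: CnM; [exact: smooth_cst|exact: IH].
Qed.

Lemma is_derive_slice1 {R : realType} (f : R * R -> R) (s c : R) : smooth f ->
  is_derive s 1 (fun s : R => f (s, c)) (pd1 f (s, c)).
Proof.
move=> sf; apply/is_derive_lineP.
have /is_derive_lineP := derivableP (@smooth_derivable1 _ f (s, c) sf).
congr (is_derive _ _ _ _); apply/funext => h; congr f.
by rewrite [LHS](_ : _ = (h * 1 + s, h * 0 + c)) // mulr0 add0r.
Qed.

Lemma is_derive_slice2 {R : realType} (f : R * R -> R) (s c : R) : smooth f ->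
  is_derive s 1 (fun s : R => f (c, s)) (pd2 f (c, s)).
Proof.
move=> sf; apply/is_derive_lineP.
have /is_derive_lineP := derivableP (@smooth_derivable2 _ f (c, s) sf).
congr (is_derive _ _ _ _); apply/funext => h; congr f.
by rewrite [LHS](_ : _ = (h * 0 + c, h * 1 + s)) // mulr0 add0r.
Qed.

Lemma is_derive1_continuous {R : realType} (f df : R -> R) :
  (forall x : R, is_derive x 1 f (df x)) -> continuous f.
Proof.
move=> fd x; apply: differentiable_continuous; apply/derivable1_diffP.
by have [] := fd x.
Qed.

Lemma MVT_near {R : realType} (f df : R -> R) (x t : R) :
  (forall x : R, is_derive x 1 f (df x)) ->
  exists2 y, `|y - x| <= `|t| & f (x + t) - f x = t * df y.
Proof.
move=> fd; have cf := is_derive1_continuous fd.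
have [t0|t0] := leP 0 t.
  have [||y] := @MVT_segment R f df x (x + t).
  - by rewrite lerDl.
  - exact: continuous_subspaceT.
  rewrite in_itv /= => /andP[y1 y2] E; exists y; last by rewrite E; ring.
  by rewrite !ger0_norm; lra.
have [||y] := @MVT_segment R f df (x + t) x.
- by rewrite gerDl ltW.
- exact: continuous_subspaceT.
rewrite in_itv /= => /andP[y1 y2] E; exists y; last by rewrite -opprB E; ring.
rewrite ler0_norm ?(ltr0_norm t0); lra.
Qed.

(** [smooth] only speaks of iterated partial derivatives along the axes. The increment in direction
    [v] is split into a vertical and a horizontal step, the mean value theorem is applied to each,
    and continuity of the partial derivatives gives the limit. *)
Lemma is_derive_smooth {R : realType} (f : R * R -> R) (x v : R * R) : smooth f ->
  is_derive x v f (v.1 * pd1 f x + v.2 * pd2 f x).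
Proof.
move=> sf; case: x => x1 x2; set x := (x1, x2); set D := (X in is_derive _ _ _ X).
suff lim : h^-1 *: ((f \o shift x) (h *: v) - f x) @[h --> (0:R)^'] --> (D : R).
  by apply: DeriveDef; [apply/cvg_ex; exists D|exact: cvg_lim lim].
apply/cvgrPdist_le => e e0.
pose M := `|v.1| + `|v.2| + 1.
have M0 : 0 < M by rewrite ltr_pwDr // addr_ge0.
have eM : 0 < e / M by rewrite divr_gt0.
have c1 := smooth_continuous (smooth_pd1 sf); have c2 := smooth_continuous (smooth_pd2 sf).
have /cvgrPdist_le /(_ _ eM) /nbhs_ballP[d1 d10 H1] := c1 x.
have /cvgrPdist_le /(_ _ eM) /nbhs_ballP[d2 d20 H2] := c2 x.
pose d := Num.min d1 d2.
have d0 : 0 < d by rewrite lt_min d10 d20.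
near=> h.
have h0 : h != 0 by near: h; exact: nbhs_dnbhs_neq.
have hd : `|h| * M < d.
  rewrite -ltr_pdivlMr //; near: h; apply: nbhs_dnbhs; apply/nbhs_ballP; exists (d / M).
    by rewrite /= divr_gt0.
  by move=> y; rewrite /ball /= sub0r normrN.
have [y1 y1b E1] := MVT_near x1 (h * v.1) (fun s => is_derive_slice1 s (x2 + h * v.2) sf).
have [y2 y2b E2] := MVT_near x2 (h * v.2) (fun s => is_derive_slice2 s x1 sf).
have hM1 : `|h * v.1| < d.
  by apply: le_lt_trans hd; rewrite normrM ler_wpM2l // /M -addrA lerDl addr_ge0.
have hM2 : `|h * v.2| < d.
  by apply: le_lt_trans hd; rewrite normrM ler_wpM2l // /M -addrA addrCA lerDl addr_ge0.
have B1 : `|pd1 f x - pd1 f (y1, x2 + h * v.2)| <= e / M.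
  apply: H1; split; rewrite /ball /=.
    by rewrite distrC; apply: le_lt_trans y1b _; apply: lt_le_trans hM1 _; rewrite ge_min lexx.
  by rewrite opprD addNKr normrN; apply: lt_le_trans hM2 _; rewrite ge_min lexx.
have B2 : `|pd2 f x - pd2 f (x1, y2)| <= e / M.
  apply: H2; split; rewrite /ball /=.
    by rewrite subrr normr0.
  by rewrite distrC; apply: le_lt_trans y2b _; apply: lt_le_trans hM2 _; rewrite ge_min lexx orbT.
have -> : h^-1 *: ((f \o shift x) (h *: v) - f x) =
   v.1 * pd1 f (y1, x2 + h * v.2) + v.2 * pd2 f (x1, y2).
  have -> : (f \o shift x) (h *: v) = f (x1 + h * v.1, x2 + h * v.2).
    by congr f; rewrite /shift /x /= [h *: v](surjective_pairing _) /=; congr (_, _); rewrite addrC.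
  have -> : f (x1 + h * v.1, x2 + h * v.2) - f x =
     (f (x1 + h * v.1, x2 + h * v.2) - f (x1, x2 + h * v.2)) + (f (x1, x2 + h * v.2) - f x) by ring.
  rewrite E1 E2 [LHS](_ : _ = h^-1 * (h * v.1 * pd1 f (y1, x2 + h * v.2) + h * v.2 * pd2 f (x1, y2))) //.
  by field.
have -> : D - (v.1 * pd1 f (y1, x2 + h * v.2) + v.2 * pd2 f (x1, y2)) =
  v.1 * (pd1 f x - pd1 f (y1, x2 + h * v.2)) + v.2 * (pd2 f x - pd2 f (x1, y2)).
  by rewrite /D; ring.
apply: le_trans (ler_normD _ _) _; rewrite !normrM.
apply: (@le_trans _ _ (`|v.1| * (e / M) + `|v.2| * (e / M))).
  by apply: lerD; apply: ler_wpM2l.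
rewrite -mulrDl mulrCA ger_pMr // ler_pdivrMr // mul1r /M; lra.
Unshelve. all: by end_near. Qed.

(** * Green's formula on a triangle *)

Lemma continuous_pair {R : realType} {T : topologicalType} (f g : T -> R) :
  continuous f -> continuous g -> continuous (fun x => (f x, g x)).
Proof. by move=> cf cg x; exact: (cvg_pair (cf x) (cg x)). Qed.

Definition box {R : realType} (B : R) : set (R * R) := `[-B, B] `*` `[-B, B].

Lemma bounded_in_box {R : realType} (S : set (R * R)) : bounded_set S ->
  exists2 B : R, 0 < B & S `<=` box B.
Proof.
move=> [M [_ HM]]; exists (`|M| + 1); first by rewrite ltr_wpDl.
move=> x Sx; have : `|x| <= `|M| + 1 by apply: HM => //; rewrite ltr_pwDr // ler_norm.
by rewrite prod_normE ge_max !ler_norml => /andP[H1 H2]; split; rewrite /= in_itv.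
Qed.

Lemma compact_box {R : realType} (B : R) : compact (box B).
Proof. by apply: compact_setX; exact: segment_compact. Qed.

Lemma continuous_bounded_box {R : realType} (f : R * R -> R) (B : R) : continuous f ->
  exists2 M : R, 0 <= M & forall x, box B x -> `|f x| <= M.
Proof.
move=> cf; have : compact (f @` box B).
  by apply: continuous_compact; [exact: continuous_subspaceT|exact: compact_box].
move=> /compact_bounded[M [_ HM]]; exists (`|M| + 1); first by rewrite addr_ge0.
move=> x Bx; apply: HM; first by rewrite ltr_pwDr // ler_norm.
by exists x.
Qed.

Lemma measurable_box {R : realType} (B : R) : measurable (box B : set (plane R)).
Proof. by apply: measurableX; exact: measurable_itv. Qed.

Lemma area_box_fin {R : realType} (B : R) : (area (box B : set (plane R)) < +oo)%E.
Proof.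
rewrite [area _](_ : _ = (@lebesgue_measure R \x @lebesgue_measure R)%E (box B)) // /box.
have E : (@lebesgue_measure R `[(- B)%R, B] < +oo)%E.
  by rewrite lebesgue_measure_itv /=; case: ifP => _; rewrite ?ltry // -EFinB ltry.
rewrite product_measure1E; try exact: measurable_itv.
by apply: lte_mul_pinfty => //; rewrite ge0_fin_numE.
Qed.

Lemma bounded_area_fin {R : realType} (S : set (R * R)) :
  measurable (S : set (plane R)) -> bounded_set S -> (area (S : set (plane R)) < +oo)%E.
Proof.
move=> mS /bounded_in_box[B B0 SB]; apply: le_lt_trans (area_box_fin B).
by apply: le_measure; rewrite ?inE //; exact: measurable_box.
Qed.

Lemma continuous_bounded_on {R : realType} (S : set (R * R)) (f : R * R -> R) :
  bounded_set S -> continuous f -> exists2 M : R, 0 <= M & forall x, S x -> `|f x| <= M.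
Proof.
move=> /bounded_in_box[B B0 SB] cf; have [M M0 HM] := continuous_bounded_box B cf.
by exists M => // x Sx; apply: HM; exact: SB.
Qed.

Lemma sqint_continuous {R : realType} (S : set (R * R)) (f : R * R -> R) :
  measurable (S : set (plane R)) -> bounded_set S -> continuous f -> sqint area (S : set (plane R)) f.
Proof.
move=> mS bS cf; have [M M0 HM] := continuous_bounded_on bS cf.
apply: (sqint_bounded mS (bounded_area_fin mS bS) _ HM).
by apply: measurable_funTS; exact: continuous_measurable_plane.
Qed.

Lemma integrable_bounded_on {R : realType} (S : set (R * R)) (f : R * R -> R) (M : R) :
  measurable (S : set (plane R)) -> bounded_set S -> measurable_fun (S : set (plane R)) f ->
  (forall x, S x -> `|f x| <= M) -> area.-integrable (S : set (plane R)) (EFin \o f).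
Proof.
move=> mS bS mf HM; apply: measurable_bounded_integrable => //.
  exact: bounded_area_fin.
by exists M; split; [exact: num_real|move=> y My x Sx; apply: le_trans (HM _ Sx) _; exact: ltW].
Qed.

Lemma integrable_continuous {R : realType} (S : set (R * R)) (f : R * R -> R) :
  measurable (S : set (plane R)) -> bounded_set S -> continuous f ->
  area.-integrable (S : set (plane R)) (EFin \o f).
Proof.
move=> mS bS cf; have [M M0 HM] := continuous_bounded_on bS cf.
apply: (integrable_bounded_on mS bS _ HM).
by apply: measurable_funTS; exact: continuous_measurable_plane.
Qed.

Lemma FTC_segment {R : realType} (f F : R -> R) (a b : R) : a <= b ->
  (forall x : R, is_derive x 1 F (f x)) -> continuous f ->
  (\int[@lebesgue_measure R]_(x in `[a, b]) (f x)%:E = (F b - F a)%:E)%E.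
Proof.
rewrite le_eqVlt => /orP[/eqP <-|ab] FD cf.
  by rewrite set_itv1 integral_set1 subrr.
have cF := is_derive1_continuous FD.
rewrite (@continuous_FTC2 _ f F a b) //.
- exact: continuous_subspaceT.
- split.
  + by move=> x _; have [] := FD x.
  + by apply: cvg_at_right_filter; exact: cF.
  + by apply: cvg_at_left_filter; exact: cF.
- by move=> x _; rewrite derive1E; have [_ ->] := FD x.
Qed.

Definition rtri {R : realType} : set (R * R) :=
  [set x | [/\ 0 < x.1, 0 < x.2 & x.1 + x.2 < 1]].

Lemma open_rtri {R : realType} : open (@rtri R).
Proof.
have -> : @rtri R = [set x | 0 < x.1] `&` [set x | 0 < x.2] `&` [set x | x.1 + x.2 < 1].
  by apply/seteqP; split => x; [case => ? ? ?; split => //; split|case => -[? ?] ?; split].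
apply: openI; first apply: openI.
- by apply: (@open_comp _ _ (fun x : R * R => x.1) [set y | 0 < y]) => [x _|]; [exact: cvg_fst|exact: open_gt].
- by apply: (@open_comp _ _ (fun x : R * R => x.2) [set y | 0 < y]) => [x _|]; [exact: cvg_snd|exact: open_gt].
apply: (@open_comp _ _ (fun x : R * R => x.1 + x.2) [set y | y < 1]) => [x _|]; last exact: open_lt.
by apply: cvgD; [exact: cvg_fst|exact: cvg_snd].
Qed.

Lemma measurable_rtri {R : realType} : measurable (@rtri R : set (plane R)).
Proof. exact: open_measurable_plane open_rtri. Qed.

Lemma rtri_box {R : realType} : @rtri R `<=` box 1.
Proof. by move=> x [x1 x2 x3]; split; rewrite /= in_itv /=; apply/andP; split; lra. Qed.

Lemma box_bounded {R : realType} (B : R) : bounded_set (box B).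
Proof.
exists B; split; first exact: num_real.
move=> y By x [/=]; rewrite !in_itv /= => H1 H2.
by rewrite prod_normE ge_max !ler_norml; apply/andP; split; lra.
Qed.

Lemma bounded_subset {R : realType} (A B : set (R * R)) : A `<=` B -> bounded_set B -> bounded_set A.
Proof. by move=> AB [M [Mr HM]]; exists M; split => // y My x Ax; apply: HM => //; exact: AB. Qed.

Lemma bounded_rtri {R : realType} : bounded_set (@rtri R).
Proof. exact: bounded_subset rtri_box (box_bounded 1). Qed.

Lemma integral_rtri_slices {R : realType} (f : R * R -> R) : continuous f ->
  (\int[area]_(x in (@rtri R : set (plane R))) (f x)%:E =
   \int[@lebesgue_measure R]_(t in `]0%R, 1%R[) \int[@lebesgue_measure R]_(s in `[0%R, (1 - t)%R]) (f (s, t))%:E)%E.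
Proof.
move=> cf.
have fi := integrable_continuous measurable_rtri bounded_rtri cf.
rewrite integral_mkcond.
have fi' : area.-integrable (setT : set (plane R)) ((EFin \o f) \_ rtri).
  by apply/(integrable_mkcond _ _).1 => //; exact: measurable_rtri.
rewrite -(integral21_prod_meas1 fi') [RHS]integral_mkcond.
apply: eq_integral => t _; rewrite /fubini_G patchE.
case: ifPn => [|tn].
  rewrite inE /= in_itv /= => /andP[t0 t1].
  have mft : measurable_fun (`]0%R, (1 - t)%R[ : set (measurableTypeR R)) (fun s => (f (s, t))%:E).
    apply/measurable_EFinP; apply: measurable_funTS; apply: continuous_measurable_fun.
    by move=> s; apply: (@continuous_comp _ _ _ (fun s : R => (s, t)) f); [apply: continuous_pair => ?; [exact: cvg_id|exact: cvg_cst]|exact: cf].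
  have -> := @integral_itv_bndoo R 0 (1 - t) _ true false mft.
  rewrite [RHS]integral_mkcond; apply: eq_integral => s _; rewrite !patchE.
  congr (if _ then _ else _); apply/idP/idP; rewrite !inE /= in_itv /=.
    by case => /= s0 _ st; apply/andP; split; lra.
  by move=> /andP[s0 st]; split => /=; lra.
rewrite integral0_eq // => s _; rewrite patchE ifN //.
apply: contra tn; rewrite !inE /= in_itv /= => -[/= s0 t0 st]; apply/andP; split; lra.
Qed.

(** On the horizontal slice at height [t] the fundamental theorem of calculus leaves the value on
    the hypotenuse minus the value on the vertical leg. *)
Lemma divergence_rtri1 {R : realType} (f F : R * R -> R) : continuous f -> continuous F ->
  (forall s t : R, is_derive s 1 (fun s : R => F (s, t)) (f (s, t))) ->
  \int[area]_(x in (@rtri R : set (plane R))) f x =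
  \int[@lebesgue_measure R]_(t in `[0%R, 1%R]) (F (1 - t, t) - F (0, t)).
Proof.
move=> cf cF FD; rewrite /Rintegral integral_rtri_slices //; congr fine.
have cF1 : continuous (fun t : R => F (1 - t, t)).
  move=> t; apply: (@continuous_comp _ _ _ (fun t : R => (1 - t, t)) F); last exact: cF.
  by apply: continuous_pair => ?; [apply: cvgB; [exact: cvg_cst|exact: cvg_id]|exact: cvg_id].
have cF0 : continuous (fun t : R => F (0, t)).
  move=> t; apply: (@continuous_comp _ _ _ (fun t : R => (0, t)) F); last exact: cF.
  by apply: continuous_pair => ?; [exact: cvg_cst|exact: cvg_id].
have mt : measurable_fun (`]0%R, 1%R[ : set (measurableTypeR R)) (fun t => (F (1 - t, t) - F (0, t))%:E).
  apply/measurable_EFinP; apply: measurable_funTS; apply: continuous_measurable_fun.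
  by move=> t; apply: cvgB; [exact: cF1|exact: cF0].
have -> := @integral_itv_bndoo R 0 1 _ true false mt.
apply: eq_integral => t; rewrite inE /= in_itv /= => /andP[t0 t1].
rewrite (@FTC_segment _ _ (fun s => F (s, t))) //; first by rewrite subr_ge0 ltW.
move=> s; apply: (@continuous_comp _ _ _ (fun s : R => (s, t)) f); last exact: cf.
by apply: continuous_pair => ?; [exact: cvg_id|exact: cvg_cst].
Qed.

Lemma ge0_rtri_swap {R : realType} (f : R * R -> R) : continuous f ->
  \int[area]_(x in (@rtri R : set (plane R))) f x =
  \int[area]_(x in (@rtri R : set (plane R))) f (x.2, x.1).
Proof.
move=> cf.
pose a : R * R := (0, 0); pose b : R * R := (0, 1); pose c : R * R := (1, 0).
have D : cross a b c = -1 by rewrite /cross /=; ring.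
have fi := integrable_continuous measurable_rtri bounded_rtri cf.
rewrite Rintegral_mkcond [RHS]Rintegral_mkcond (@Rintegral_amap _ a b c).
- rewrite D normrN normr1 mul1r; apply: eq_Rintegral => x _.
  rewrite !patchE; have -> : amap a b c x = (x.2, x.1) by rewrite /amap /=; congr (_, _); ring.
  congr (if _ then _ else _); apply/idP/idP; rewrite !inE /= => -[/= ? ? ?]; split => //=; lra.
- by rewrite D oppr_eq0 oner_eq0.
rewrite -restrict_EFin; apply/(integrable_mkcond _ _).1 => //; exact: measurable_rtri.
Qed.

Lemma divergence_rtri2 {R : realType} (f F : R * R -> R) : continuous f -> continuous F ->
  (forall s t : R, is_derive t 1 (fun t : R => F (s, t)) (f (s, t))) ->
  \int[area]_(x in (@rtri R : set (plane R))) f x =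
  \int[@lebesgue_measure R]_(s in `[0%R, 1%R]) (F (s, 1 - s) - F (s, 0)).
Proof.
move=> cf cF FD; rewrite ge0_rtri_swap //.
have sw (g : R * R -> R) : continuous g -> continuous (fun x : R * R => g (x.2, x.1)).
  move=> cg x; apply: (@continuous_comp _ _ _ (fun x : R * R => (x.2, x.1)) g); last exact: cg.
  by apply: continuous_pair => ?; [exact: cvg_snd|exact: cvg_fst].
exact: (@divergence_rtri1 _ (fun x => f (x.2, x.1)) (fun x => F (x.2, x.1)) (sw _ cf) (sw _ cF) (fun s t => FD t s)).
Qed.

Definition otri {R : realType} (a b c : R * R) : set (R * R) := amap a b c @` rtri.

(** Barycentric coordinates with respect to [b] and [c], as quotients of signed areas. Together they
    invert [amap a b c]. *)
Definition lam2 {R : realType} (a b c x : R * R) : R := cross a x c / cross a b c.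
Definition lam3 {R : realType} (a b c x : R * R) : R := cross a b x / cross a b c.

Lemma lam2_amap {R : realType} (a b c x : R * R) : cross a b c != 0 ->
  lam2 a b c (amap a b c x) = x.1.
Proof. by rewrite /lam2 /cross /amap /= => D; field; exact: D. Qed.

Lemma lam3_amap {R : realType} (a b c x : R * R) : cross a b c != 0 ->
  lam3 a b c (amap a b c x) = x.2.
Proof. by rewrite /lam3 /cross /amap /= => D; field; exact: D. Qed.

Lemma amap_lam {R : realType} (a b c x : R * R) : cross a b c != 0 ->
  amap a b c (lam2 a b c x, lam3 a b c x) = x.
Proof.
case: x => x1 x2; rewrite /lam2 /lam3 /cross /amap /= => D.
by congr (_, _); field; exact: D.
Qed.

Lemma otriE {R : realType} (a b c x : R * R) : cross a b c != 0 ->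
  otri a b c x <-> rtri (lam2 a b c x, lam3 a b c x).
Proof.
move=> D; split; first by move=> [y yr <-]; rewrite lam2_amap // lam3_amap // -surjective_pairing.
by move=> xr; exists (lam2 a b c x, lam3 a b c x) => //; rewrite amap_lam.
Qed.

Lemma otri_amap {R : realType} (a b c x : R * R) : cross a b c != 0 ->
  otri a b c (amap a b c x) <-> rtri x.
Proof. by move=> D; rewrite otriE // lam2_amap // lam3_amap // -surjective_pairing. Qed.

Lemma lam2E {R : realType} (a b c x : R * R) :
  lam2 a b c x = (a.2 * (c.1 - a.1) - a.1 * (c.2 - a.2)) / cross a b c
    + (c.2 - a.2) / cross a b c * x.1 + - (c.1 - a.1) / cross a b c * x.2.
Proof. by rewrite /lam2 {1}/cross; ring. Qed.

Lemma lam3E {R : realType} (a b c x : R * R) :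
  lam3 a b c x = (a.1 * (b.2 - a.2) - a.2 * (b.1 - a.1)) / cross a b c
    + - (b.2 - a.2) / cross a b c * x.1 + (b.1 - a.1) / cross a b c * x.2.
Proof. by rewrite /lam3 {1}/cross; ring. Qed.

Lemma smooth_lam2 {R : realType} (a b c : R * R) : smooth (lam2 a b c).
Proof. rewrite (funext (@lam2E R a b c)); exact: smooth_affine. Qed.

Lemma smooth_lam3 {R : realType} (a b c : R * R) : smooth (lam3 a b c).
Proof. rewrite (funext (@lam3E R a b c)); exact: smooth_affine. Qed.

Lemma continuous_amap {R : realType} (a b c : R * R) : continuous (amap a b c).
Proof.
apply: continuous_pair => x.
  apply: cvgD; first (apply: cvgD; first exact: cvg_cst).
    by apply: cvgM; [exact: cvg_fst|exact: cvg_cst].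
  by apply: cvgM; [exact: cvg_snd|exact: cvg_cst].
apply: cvgD; first (apply: cvgD; first exact: cvg_cst).
  by apply: cvgM; [exact: cvg_fst|exact: cvg_cst].
by apply: cvgM; [exact: cvg_snd|exact: cvg_cst].
Qed.

Lemma open_otri {R : realType} (a b c : R * R) : cross a b c != 0 -> open (otri a b c).
Proof.
move=> D.
have -> : otri a b c = (fun x => (lam2 a b c x, lam3 a b c x)) @^-1` rtri.
  by apply/seteqP; split => x /(otriE x D).
apply: open_comp; last exact: open_rtri.
by move=> x _; apply: continuous_pair; apply: smooth_continuous; [exact: smooth_lam2|exact: smooth_lam3].
Qed.

Lemma measurable_otri {R : realType} (a b c : R * R) : cross a b c != 0 ->
  measurable (otri a b c : set (plane R)).
Proof. by move=> D; apply: open_measurable_plane; exact: open_otri. Qed.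

Lemma bounded_otri {R : realType} (a b c : R * R) : bounded_set (otri a b c).
Proof.
have c1 : continuous (fun x : R * R => (amap a b c x).1).
  by move=> x; apply: (@continuous_comp _ _ _ (amap a b c) (fun x => x.1)); [exact: continuous_amap|exact: cvg_fst].
have c2 : continuous (fun x : R * R => (amap a b c x).2).
  by move=> x; apply: (@continuous_comp _ _ _ (amap a b c) (fun x => x.2)); [exact: continuous_amap|exact: cvg_snd].
have [M1 M10 H1] := continuous_bounded_on bounded_rtri c1.
have [M2 M20 H2] := continuous_bounded_on bounded_rtri c2.
apply: bounded_subset (box_bounded (M1 + M2)) => _ [x xr <-].
have := H1 _ xr; have := H2 _ xr; move: (amap a b c x) => y.
rewrite !ler_norml => /andP[? ?] /andP[? ?].
by split; rewrite /= in_itv /=; apply/andP; split; lra.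
Qed.

Lemma Rintegral_otri {R : realType} (a b c : R * R) (f : R * R -> R) : cross a b c != 0 ->
  area.-integrable (otri a b c : set (plane R)) (EFin \o f) ->
  \int[area]_(x in (otri a b c : set (plane R))) f x =
  `|cross a b c| * \int[area]_(x in (@rtri R : set (plane R))) f (amap a b c x).
Proof.
move=> D fi.
rewrite Rintegral_mkcond [in RHS]Rintegral_mkcond (@Rintegral_amap _ a b c) //; last first.
  rewrite -restrict_EFin; apply/(integrable_mkcond _ _).1 => //; exact: measurable_otri.
congr (_ * _); apply: eq_Rintegral => x _; rewrite !patchE.
by congr (if _ then _ else _); apply/idP/idP; rewrite !inE => /(otri_amap _ D).
Qed.

Lemma is_derive_amap1 {R : realType} (a b c : R * R) (F : R * R -> R) (s t : R) : smooth F ->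
  is_derive s 1 (fun s : R => F (amap a b c (s, t)))
    ((b.1 - a.1) * pd1 F (amap a b c (s, t)) + (b.2 - a.2) * pd2 F (amap a b c (s, t))).
Proof.
move=> sF; apply/is_derive_lineP.
have /is_derive_lineP := is_derive_smooth (amap a b c (s, t)) (b.1 - a.1, b.2 - a.2) sF.
congr (is_derive _ _ _ _); apply/funext => h; congr F.
rewrite [LHS](_ : _ = (h * (b.1 - a.1) + (amap a b c (s, t)).1, h * (b.2 - a.2) + (amap a b c (s, t)).2)) //.
rewrite [h%:A](_ : _ = h); last exact: mulr1.
by rewrite /amap /=; congr (_, _); ring.
Qed.

Lemma is_derive_amap2 {R : realType} (a b c : R * R) (F : R * R -> R) (s t : R) : smooth F ->
  is_derive t 1 (fun t : R => F (amap a b c (s, t)))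
    ((c.1 - a.1) * pd1 F (amap a b c (s, t)) + (c.2 - a.2) * pd2 F (amap a b c (s, t))).
Proof.
move=> sF; apply/is_derive_lineP.
have /is_derive_lineP := is_derive_smooth (amap a b c (s, t)) (c.1 - a.1, c.2 - a.2) sF.
congr (is_derive _ _ _ _); apply/funext => h; congr F.
rewrite [LHS](_ : _ = (h * (c.1 - a.1) + (amap a b c (s, t)).1, h * (c.2 - a.2) + (amap a b c (s, t)).2)) //.
rewrite [h%:A](_ : _ = h); last exact: mulr1.
by rewrite /amap /=; congr (_, _); ring.
Qed.

(** The field [Xs * (b - a) + Xt * (c - a)] has no flux through the edges [a c] and [b c]. *)
Lemma green_triangle {R : realType} (a b c : R * R) (Xs Xt u : R * R -> R) :
  cross a b c != 0 -> smooth Xs -> smooth Xt -> smooth u ->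
  (forall t : R, Xs (amap a b c (0, t)) = 0) ->
  (forall t : R, Xs (amap a b c (1 - t, t)) + Xt (amap a b c (1 - t, t)) = 0) ->
  let X1 x := Xs x * (b.1 - a.1) + Xt x * (c.1 - a.1) in
  let X2 x := Xs x * (b.2 - a.2) + Xt x * (c.2 - a.2) in
  \int[area]_(x in (otri a b c : set (plane R)))
     (X1 x * pd1 u x + X2 x * pd2 u x + u x * (pd1 X1 x + pd2 X2 x)) =
  - (`|cross a b c| * \int[@lebesgue_measure R]_(s in `[0%R, 1%R])
       (Xt (amap a b c (s, 0)) * u (amap a b c (s, 0)))).
Proof.
move=> D sXs sXt su H1 H2 X1 X2.
pose F x := Xs x * u x; pose H x := Xt x * u x.
have sF : smooth F by exact: smoothM.
have sH : smooth H by exact: smoothM.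
pose f x := (b.1 - a.1) * pd1 F x + (b.2 - a.2) * pd2 F x.
pose h x := (c.1 - a.1) * pd1 H x + (c.2 - a.2) * pd2 H x.
have sf : smooth f.
  by apply: smoothD; apply: smoothZ; [exact: smooth_pd1|exact: smooth_pd2].
have sh : smooth h.
  by apply: smoothD; apply: smoothZ; [exact: smooth_pd1|exact: smooth_pd2].
have E x : X1 x * pd1 u x + X2 x * pd2 u x + u x * (pd1 X1 x + pd2 X2 x) = f x + h x.
  have sc k : smooth (fun _ : R * R => k) := smooth_cst k.
  have pd1c (k : R) : pd1 (fun _ : R * R => k) = fun=> 0 by apply/funext => y; rewrite /pd1 derive_cst.
  have pd2c (k : R) : pd2 (fun _ : R * R => k) = fun=> 0 by apply/funext => y; rewrite /pd2 derive_cst.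
  rewrite /X1 /X2 pd1D ?pd2D; try by [apply: smoothM].
  rewrite !pd1M // !pd2M // !pd1c !pd2c /f /h /F /H !pd1M // !pd2M //; ring.
under eq_Rintegral => x _ do rewrite E.
have mt := measurable_otri D; have bt := bounded_otri a b c.
have fi := integrable_continuous mt bt (smooth_continuous sf).
have hi := integrable_continuous mt bt (smooth_continuous sh).
rewrite RintegralD // !Rintegral_otri // -mulrDr -mulrN; congr (_ * _).
have ca (g : R * R -> R) : smooth g -> continuous (fun x => g (amap a b c x)).
  move=> sg x; apply: (@continuous_comp _ _ _ (amap a b c) g); first exact: continuous_amap.
  exact: smooth_continuous.
have I1 := @divergence_rtri1 _ _ (fun x => F (amap a b c x)) (ca _ sf) (ca _ sF) (fun s t => is_derive_amap1 a b c s t sF).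
have I2 := @divergence_rtri2 _ _ (fun x => H (amap a b c x)) (ca _ sh) (ca _ sH) (fun s t => is_derive_amap2 a b c s t sH).
rewrite I1 I2.
have cont2 (p q : R -> R) : continuous p -> continuous q -> continuous (fun t : R => H (amap a b c (p t, q t))).
  move=> cp cq t; apply: (@continuous_comp _ _ _ (fun t => (p t, q t)) (fun x => H (amap a b c x))); last exact: ca.
  exact: continuous_pair.
have cid : continuous (fun t : R => t) by move=> t; exact: cvg_id.
have c1m : continuous (fun t : R => 1 - t) by move=> t; apply: cvgB; [exact: cvg_cst|exact: cvg_id].
have c0 : continuous (fun t : R => (0 : R)) by move=> t; exact: cvg_cst.
have ic (g : R -> R) : continuous g -> (@lebesgue_measure R).-integrable `[0%R, 1%R] (EFin \o g).
  move=> cg; apply: continuous_compact_integrable; first exact: segment_compact.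
  exact: continuous_subspaceT.
(* [H1] removes the contribution of the edge [a c]. On [b c], [H2] makes the horizontal contribution
   the negative of the vertical one, so that after the reparametrization [t -> 1 - t] only the edge
   [a b] survives. *)
have -> : \int[@lebesgue_measure R]_(t in `[0%R, 1%R]) (F (amap a b c (1 - t, t)) - F (amap a b c (0, t))) =
    - \int[@lebesgue_measure R]_(t in `[0%R, 1%R]) H (amap a b c (1 - t, t)).
  rewrite -mulN1r -RintegralZl //; last exact/ic/cont2.
  apply: eq_Rintegral => t _; rewrite /F /H H1 mul0r subr0.
  by rewrite (_ : Xs _ = - Xt (amap a b c (1 - t, t))); [ring|rewrite -[LHS]subr0 -(H2 t); ring].
rewrite RintegralB //; [|exact/ic/cont2|exact/ic/cont2].
have -> : \int[@lebesgue_measure R]_(t in `[0%R, 1%R]) H (amap a b c (t, 1 - t)) =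
   \int[@lebesgue_measure R]_(t in `[0%R, 1%R]) H (amap a b c (1 - t, t)).
  rewrite (@Rintegration_by_substitution_onem R (fun t => H (amap a b c (t, 1 - t))) 1).
  - rewrite /unstable.onem subrr; apply: eq_Rintegral => t _; congr (H (amap a b c (_, _))); ring.
  - by rewrite ler01 lexx.
  - by apply: continuous_subspaceT; exact: cont2.
by rewrite addKr.
Qed.

(** * Moments of weak gradients on a triangle *)

Lemma hausdorff_plane {R : realType} : hausdorff_space (R * R)%type.
Proof. exact: norm_hausdorff. Qed.

Lemma test_fun_pd {R : realType} (K : set (R * R)) (phi : R * R -> R) :
  test_fun K phi -> test_fun K (pd1 phi) /\ test_fun K (pd2 phi).
Proof.
move=> [sphi [A [cA AK A0]]].
have clA : closed A by apply: compact_closed cA; exact: hausdorff_plane.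
have near0 x : ~ A x -> \forall y \near x, cst 0 y = phi y.
  move=> nA; have : nbhs x (~` A) by apply: open_nbhs_nbhs; split => //; exact: closed_openC.
  by apply: filterS => y nAy; rewrite A0.
split; split; [exact: smooth_pd1| |exact: smooth_pd2|]; exists A; split => // x nA.
  by rewrite /pd1 -(near_eq_derive _ (near0 x nA)) derive_cst.
by rewrite /pd2 -(near_eq_derive _ (near0 x nA)) derive_cst.
Qed.

Definition lam1 {R : realType} (a b c x : R * R) : R := 1 - lam2 a b c x - lam3 a b c x.

Lemma lam1E {R : realType} (a b c x : R * R) : exists ga al be : R, forall x,
  lam1 a b c x = ga + al * x.1 + be * x.2.
Proof.
exists (1 - (a.2 * (c.1 - a.1) - a.1 * (c.2 - a.2)) / cross a b c
         - (a.1 * (b.2 - a.2) - a.2 * (b.1 - a.1)) / cross a b c).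
exists (- ((c.2 - a.2) / cross a b c) - - (b.2 - a.2) / cross a b c).
exists (- (- (c.1 - a.1) / cross a b c) - (b.1 - a.1) / cross a b c).
by move=> y; rewrite /lam1 lam2E lam3E; ring.
Qed.

Definition affine {R : realType} (l : R * R -> R) : Prop :=
  exists ga al be : R, l = fun x => ga + al * x.1 + be * x.2.

Lemma affine_lam1 {R : realType} (a b c : R * R) : affine (lam1 a b c).
Proof.
have [ga [al [be E]]] := lam1E a b c (0, 0).
by exists ga, al, be; apply/funext => x; exact: E.
Qed.

Lemma affine_lam2 {R : realType} (a b c : R * R) : affine (lam2 a b c).
Proof. by eexists; eexists; eexists; apply/funext => x; exact: lam2E. Qed.

Lemma affine_lam3 {R : realType} (a b c : R * R) : affine (lam3 a b c).
Proof. by eexists; eexists; eexists; apply/funext => x; exact: lam3E. Qed.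

Lemma affine_smooth {R : realType} (l : R * R -> R) : affine l -> smooth l.
Proof. by move=> [ga [al [be ->]]]; exact: smooth_affine. Qed.

Lemma smooth_eb_affine {R : realType} (P : {poly R}) (k : R) (l : R * R -> R) : affine l ->
  smooth (fun x => eb P (k * l x)).
Proof.
move=> [ga [al [be ->]]].
have -> : (fun x => eb P (k * (ga + al * x.1 + be * x.2))) =
          (fun x : R * R => eb P (k * ga + k * al * x.1 + k * be * x.2)).
  by apply/funext => x; congr (eb P _); ring.
exact: smooth_eb.
Qed.

Lemma eb_cvg {R : realType} (P : {poly R}) (s : R) : 0 < s ->
  eb P (n.+1%:R * s) @[n --> \oo] --> P.[0].
Proof.
move=> s0.
have ru : (n.+1%:R * s - 1)^-1 @[n --> \oo] --> (0 : R).
  have -> : (fun n : nat => (n.+1%:R * s - 1)^-1) = (fun n : nat => n.+1%:R^-1 * (s - n.+1%:R^-1)^-1).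
    apply/funext => n; have n0 : n.+1%:R != 0 :> R by rewrite pnatr_eq0.
    by rewrite -invfM mulrBr mulfV.
  rewrite -(mul0r (s - 0)^-1); apply: cvgM; first exact: cvg_harmonic.
  apply: cvgV; first by rewrite subr0 gt_eqF.
  by apply: cvgB; [exact: cvg_cst|exact: cvg_harmonic].
have : P.[(n.+1%:R * s - 1)^-1] * expR (- (n.+1%:R * s - 1)^-1) @[n --> \oo] --> P.[0] * expR (- 0).
  apply: cvgM; first by apply: (@cvg_comp _ _ _ _ (horner P) _ _ _ ru); exact: continuous_horner.
  apply: (@cvg_comp _ _ _ (fun n : nat => - (n.+1%:R * s - 1)^-1) expR \oo (nbhs (- 0))).
    by apply: cvgN.
  exact: continuous_expR.
rewrite oppr0 expR0 mulr1; apply: cvg_trans; apply: near_eq_cvg.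
have [m ms] : exists m : nat, m.+1%:R^-1 < s.
  have := near_infty_natSinv_lt (PosNum s0) => -[m _ /(_ m)]; rewrite /= leqnn => /(_ isT) H.
  by exists m.
exists m => // n /= mn; rewrite /eb ifT // -ltr_pdivrMl ?ltr0n // mulr1.
by apply: le_lt_trans ms; rewrite lef_pV2 ?posrE ?ltr0n // ler_nat.
Qed.

Lemma eb_le {R : realType} (P : {poly R}) (s : R) : s <= 1 -> eb P s = 0.
Proof. by rewrite /eb => s1; rewrite ltNge s1. Qed.

Lemma eb_affine_le {R : realType} (P : {poly R}) n (s : R) : s <= 0 -> eb P (n.+1%:R * s) = 0.
Proof.
move=> s0; apply: eb_le; apply: le_trans (_ : 0 <= 1) => //.
by rewrite mulr_ge0_le0.
Qed.

(** [mcut n s] vanishes for [s < n.+1%:R^-1] and converges to [s]. With [r = (n.+1%:R * s - 1)^-1], its derivative is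
    [dmcut n s = (1 + (1 + r^-1) * r ^+ 2) * exp (- r)], which is bounded uniformly in [n]. *)
Definition mcut {R : realType} (n : nat) (s : R) : R := s * eb 1 (n.+1%:R * s).
Definition dmcut {R : realType} (n : nat) (s : R) : R := eb (1 + 'X + 'X^2) (n.+1%:R * s).

Lemma mcut_is_derive {R : realType} n (s : R) : is_derive s 1 (mcut n) (dmcut n s).
Proof.
have D0 : is_derive s 1 (fun s : R => n.+1%:R * s) n.+1%:R.
  have := is_deriveM (is_derive_cst (n.+1%:R : R) s 1) (is_derive_id s (1 : R)).
  by rewrite scaler0 addr0 [cst _ _ *: _]mulr1.
have D1 := @is_derive1_comp R (eb 1) (fun s => n.+1%:R * s) s _ _ (eb_is_derive 1 _) D0.
apply: (is_derive_eq (is_deriveM (is_derive_id s (1 : R)) D1)).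
rewrite /dmcut /GRing.scale /= derivC subr0 mulr1 mulr1.
set t := n.+1%:R * s; rewrite /eb; case: ifPn => t1; last by rewrite !mul0r mulr0 addr0.
have t10 : t - 1 != 0 by rewrite subr_eq0 gt_eqF.
rewrite !hornerE; set r := (t - 1)^-1; set e := expR _.
have tr : t * r = 1 + r by rewrite /r; field.
transitivity (t * r * r * e + e); first by rewrite /t /=; ring.
rewrite tr; ring.
Qed.

Lemma mcut_cvg {R : realType} (s : R) : 0 < s -> mcut n s @[n --> \oo] --> s.
Proof.
move=> s0; rewrite -[X in _ --> X]mulr1; apply: cvgM; first exact: cvg_cst.
by have := @eb_cvg R 1 s s0; rewrite hornerC.
Qed.

Lemma dmcut_cvg {R : realType} (s : R) : 0 < s -> dmcut n s @[n --> \oo] --> (1 : R).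
Proof. by move=> s0; have := @eb_cvg R (1 + 'X + 'X^2) s s0; rewrite !hornerE expr0n /= !addr0. Qed.

Lemma eb1_bound {R : realType} (s : R) : 0 <= eb 1 s <= 1.
Proof.
rewrite /eb; case: ifPn => s1; last by rewrite lexx ler01.
by rewrite hornerC mul1r expR_ge0 /= -[X in _ <= X]expR0 ler_expR oppr_le0 invr_ge0 subr_ge0 ltW.
Qed.

Lemma closed_ge_smooth {R : realType} (l : R * R -> R) (d : R) : smooth l -> closed [set x | d <= l x].
Proof.
move=> sl; apply: (@closed_comp _ _ l [set y | d <= y]); last exact: closed_ge.
by move=> x _; exact: smooth_continuous.
Qed.

Lemma otri_lam {R : realType} (a b c x : R * R) : cross a b c != 0 ->
  otri a b c x <-> [/\ 0 < lam1 a b c x, 0 < lam2 a b c x & 0 < lam3 a b c x].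
Proof.
by move=> D; rewrite otriE // /rtri /= /lam1; split => -[? ? ?]; split => //; lra.
Qed.

Lemma test_fun_otri {R : realType} (K : set (R * R)) (a b c : R * R) (d : R) (phi : R * R -> R) :
  cross a b c != 0 -> otri a b c `<=` K -> 0 < d -> smooth phi ->
  (forall x, lam1 a b c x < d \/ lam2 a b c x < d \/ lam3 a b c x < d -> phi x = 0) ->
  test_fun K phi.
Proof.
move=> D TK d0 sphi phi0; split => //.
pose A := [set x | d <= lam1 a b c x] `&` [set x | d <= lam2 a b c x] `&` [set x | d <= lam3 a b c x].
have AT : A `<=` otri a b c.
  by move=> x [[/= x1 x2] x3]; apply/otri_lam => //; split; apply: lt_le_trans d0 _.
exists A; split.
- have [B B0 TB] := bounded_in_box (bounded_otri a b c).
  apply: (@subclosed_compact _ A (box B)); [|exact: compact_box|by move=> x /AT /TB].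
  apply: closedI; first apply: closedI; apply: closed_ge_smooth; apply: affine_smooth.
  + exact: affine_lam1.
  + exact: affine_lam2.
  + exact: affine_lam3.
- by move=> x /AT /TK.
move=> x nA; apply: phi0.
have [l1|l1] := ltP (lam1 a b c x) d; first by left.
have [l2|l2] := ltP (lam2 a b c x) d; first by right; left.
have [l3|l3] := ltP (lam3 a b c x) d; first by right; right.
by exfalso; apply: nA.
Qed.

Lemma eb_small {R : realType} (P : {poly R}) n (s : R) : s < n.+1%:R^-1 -> eb P (n.+1%:R * s) = 0.
Proof.
move=> sn; apply: eb_le; apply: ltW.
by rewrite -ltr_pdivlMl ?ltr0n // mulr1.
Qed.

(** A cutoff with values in [0,1] that tends to the indicator of the triangle. Its derivatives are
    unbounded in [n]; they only meet [v] itself and drop out when two weak gradients of the same [v]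
    are compared. *)
Definition cut {R : realType} (a b c : R * R) (n : nat) (x : R * R) : R :=
  eb 1 (n.+1%:R * lam1 a b c x) * eb 1 (n.+1%:R * lam2 a b c x) * eb 1 (n.+1%:R * lam3 a b c x).

Lemma smooth_cut {R : realType} (a b c : R * R) n : smooth (cut a b c n).
Proof.
apply: smoothM; first apply: smoothM; apply: smooth_eb_affine.
- exact: affine_lam1.
- exact: affine_lam2.
- exact: affine_lam3.
Qed.

Lemma cut_bound {R : realType} (a b c : R * R) n x : `|cut a b c n x| <= 1.
Proof.
have B s := andP (@eb1_bound R s).
rewrite /cut; have [p0 p1] := B (n.+1%:R * lam1 a b c x); have [q0 q1] := B (n.+1%:R * lam2 a b c x).
have [r0 r1] := B (n.+1%:R * lam3 a b c x).
by rewrite ger0_norm ?mulr_ge0 // !mulr_ile1 ?mulr_ge0.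
Qed.

Lemma cut_cvg {R : realType} (a b c x : R * R) : cross a b c != 0 ->
  cut a b c n x @[n --> \oo] --> (\1_(otri a b c) x : R).
Proof.
move=> D; rewrite indicE; case: (pselect (otri a b c x)) => [Tx|nTx].
  rewrite mem_set //=; have /(otri_lam _ D)[x1 x2 x3] := Tx.
  have -> : (true%:R : R) = 1 * 1 * 1 by rewrite !mulr1.
  have H s : 0 < s -> eb 1 (n.+1%:R * s) @[n --> \oo] --> (1 : R).
    by move=> s0; have := @eb_cvg R 1 s s0; rewrite hornerC.
  by apply: cvgM; first apply: cvgM; exact: H.
rewrite memNset //= (_ : (fun n => cut a b c n x) = fun=> 0); first exact: cvg_cst.
apply/funext => n; rewrite /cut.
have [l1|l1] := leP (lam1 a b c x) 0; first by rewrite eb_affine_le // !mul0r.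
have [l2|l2] := leP (lam2 a b c x) 0; first by rewrite [X in _ * X * _]eb_affine_le // mulr0 mul0r.
have [l3|l3] := leP (lam3 a b c x) 0; first by rewrite [X in _ * X]eb_affine_le // mulr0.
by exfalso; apply: nTx; apply/otri_lam.
Qed.

Lemma ip_cvg_dominated {d} {X : measurableType d} {R : realType} (mu : {measure set X -> \bar R})
    (S : set X) (g : X -> R) (h_ : nat -> X -> R) (h : X -> R) (M : R) :
  measurable S -> (mu S < +oo)%E -> sqint mu S g ->
  (forall n, measurable_fun S (h_ n)) -> (forall n x, S x -> `|h_ n x| <= M) ->
  (forall x, S x -> h_ n x @[n --> \oo] --> h x) ->
  ip mu S g (h_ n) @[n --> \oo] --> ip mu S g h.
Proof.
move=> mS Sfin gi mh hM hc.
have mg : measurable_fun S g by case: gi.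
have mh' : measurable_fun S h by exact: (measurable_fun_cvg mh).
have sq1 : sqint mu S (fun=> `|M|).
  by apply: (@sqint_bounded _ _ _ _ _ _ `|M|) => // x _; rewrite normr_id.
have sqg : sqint mu S (fun x => `|g x|).
  split; first exact: measurableT_comp.
  by case: gi => _; under eq_integral do rewrite -real_normK ?num_real //.
have [] := @dominated_convergence _ _ _ mu S mS (fun n x => (g x * h_ n x)%:E)
   (fun x => (g x * h x)%:E) (fun x => (`|M| * `|g x|)%:E).
- by move=> n; apply/measurable_EFinP; exact: measurable_funM.
- by apply/measurable_EFinP; exact: measurable_funM.
- apply: aeW => x Sx; apply: cvg_EFin; first exact: nearW.
  by apply: cvgM; [exact: cvg_cst|exact: hc].
- exact: sqint_integrableM.
- apply: aeW => x n Sx; rewrite lee_fin normrM mulrC ler_wpM2r // (le_trans (hM n x Sx)) //.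
  exact: ler_norm.
move=> ghi _ cI; apply: fine_cvg; rewrite fineK //.
exact: integrable_fin_num ghi.
Qed.

Lemma Rintegral_setIindic {d} {X : measurableType d} {R : realType} (mu : {measure set X -> \bar R})
    (S T : set X) (g h : X -> R) : T `<=` S ->
  ip mu S g (fun x => h x * \1_T x) = ip mu T g h.
Proof.
move=> TS; rewrite /ip Rintegral_mkcond [RHS]Rintegral_mkcond; apply: eq_Rintegral => x _.
rewrite !patchE indicE; case: (pselect (T x)) => Tx.
  by rewrite [x \in T]mem_set // mem_set ?mulr1 //; exact: TS.
by rewrite [x \in T]memNset // !mulr0; case: ifP.
Qed.

Lemma L2fun_sqint {R : realType} (K : set (R * R)) (f : R * R -> R) :
  L2fun K f -> sqint area (K : set (plane R)) f.
Proof.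
move=> [mf]; rewrite /L2norm => lt; split => //.
have : (0 <= \int[area]_(x in (K : set (plane R))) ((f x) ^+ 2)%:E)%E.
  by apply: integral_ge0 => x _; rewrite lee_fin sqr_ge0.
by move: lt; case: (\int[area]_(x in _) _)%E => [r| |] //=; rewrite ?ltry.
Qed.

Lemma cut_limit {R : realType} (K : set (R * R)) (a b c : R * R) (g psi : R * R -> R) :
  open K -> bounded_set K -> cross a b c != 0 -> otri a b c `<=` K ->
  sqint area (K : set (plane R)) g -> continuous psi ->
  ip area (K : set (plane R)) g (fun x => psi x * cut a b c n x) @[n --> \oo] -->
  ip area (otri a b c : set (plane R)) g psi.
Proof.
move=> oK bK D TK gi cpsi.
have mK := open_measurable_plane oK.
rewrite -(@Rintegral_setIindic _ (plane R) R area _ _ _ _ TK).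
have [M M0 HM] := continuous_bounded_on bK cpsi.
apply: (@ip_cvg_dominated _ _ _ _ _ _ _ _ M) => //.
- exact: bounded_area_fin.
- move=> n; apply: measurable_funTS; apply: continuous_measurable_plane => x.
  by apply: cvgM; [exact: cpsi|exact/smooth_continuous/smooth_cut].
- move=> n x Kx; rewrite normrM -[leRHS]mulr1; apply: ler_pM => //; first exact: HM.
  exact: cut_bound.
- by move=> x Kx; apply: cvgM; [exact: cvg_cst|exact: cut_cvg].
Qed.

Lemma test_fun_cut {R : realType} (K : set (R * R)) (a b c : R * R) (psi : R * R -> R) n :
  cross a b c != 0 -> otri a b c `<=` K -> smooth psi ->
  test_fun K (fun x => psi x * cut a b c n x).
Proof.
move=> D TK spsi.
apply: (@test_fun_otri R K a b c n.+1%:R^-1) => //.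
  by apply: smoothM => //; exact: smooth_cut.
move=> x; rewrite /cut => -[|[|]] /(@eb_small R 1) ->; rewrite ?mul0r ?mulr0 ?mul0r ?mulr0 //.
Qed.

(** Equality of moments on triangles replaces the almost everywhere uniqueness of weak gradients. *)
Lemma weak_grad_moment {R : realType} (K : set (R * R)) (v : R * R -> R) (G G' : R * R -> R * R)
    (a b c : R * R) (psi : R * R -> R) :
  open K -> bounded_set K -> weak_grad K v G -> weak_grad K v G' ->
  cross a b c != 0 -> otri a b c `<=` K -> smooth psi ->
  ip area (otri a b c : set (plane R)) (fun x => (G x).1) psi =
    ip area (otri a b c : set (plane R)) (fun x => (G' x).1) psi /\
  ip area (otri a b c : set (plane R)) (fun x => (G x).2) psi =
    ip area (otri a b c : set (plane R)) (fun x => (G' x).2) psi.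
Proof.
move=> oK bK [_ /L2fun_sqint G1 /L2fun_sqint G2 HG] [_ /L2fun_sqint G1' /L2fun_sqint G2' HG'] D TK spsi.
have cpsi := smooth_continuous spsi.
have E n := HG _ (test_fun_cut n D TK spsi).
have E' n := HG' _ (test_fun_cut n D TK spsi).
split.
  have L := cut_limit oK bK D TK G1 cpsi; have L' := cut_limit oK bK D TK G1' cpsi.
  apply: cvg_unique L _; first exact: norm_hausdorff.
  apply: cvg_trans L'; apply: near_eq_cvg; apply: nearW => n.
  by have [E1 _] := E n; have [E1' _] := E' n; apply: oppr_inj; rewrite -[LHS]E1' -[RHS]E1.
have L := cut_limit oK bK D TK G2 cpsi; have L' := cut_limit oK bK D TK G2' cpsi.
apply: cvg_unique L _; first exact: norm_hausdorff.
apply: cvg_trans L'; apply: near_eq_cvg; apply: nearW => n.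
by have [_ E1] := E n; have [_ E1'] := E' n; apply: oppr_inj; rewrite -[LHS]E1' -[RHS]E1.
Qed.

Lemma smooth_mcut {R : realType} n (l : R * R -> R) : affine l -> smooth (fun x => mcut n (l x)).
Proof.
by move=> la; apply: smoothM; [exact: affine_smooth|exact: smooth_eb_affine].
Qed.

Lemma pd_mcut {R : realType} n (l : R * R -> R) : affine l ->
  (pd1 (fun x => mcut n (l x)) = fun x => pd1 l x * dmcut n (l x)) /\
  (pd2 (fun x => mcut n (l x)) = fun x => pd2 l x * dmcut n (l x)).
Proof.
move=> [ga [al [be ->]]].
have [E1 E2] := pd_affine al be ga (@mcut_is_derive R n).
have [F1 F2] := pd_affine al be ga (fun s : R => is_derive_id s (1 : R)).
by rewrite E1 E2 F1 F2; split; apply/funext => x; rewrite mulr1.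
Qed.

Lemma mcut_bound {R : realType} n (s : R) : `|mcut n s| <= `|s|.
Proof.
rewrite /mcut normrM -[leRHS]mulr1 ler_wpM2l //.
by have /andP[p0 p1] := eb1_bound (n.+1%:R * s); rewrite ger0_norm.
Qed.

Lemma mcut_small {R : realType} n (s : R) : s < n.+1%:R^-1 -> mcut n s = 0.
Proof. by move=> /(@eb_small R 1); rewrite /mcut => ->; rewrite mulr0. Qed.

Lemma mcut_le0 {R : realType} n (s : R) : s <= 0 -> mcut n s = 0 /\ dmcut n s = 0.
Proof. by move=> s0; rewrite /mcut /dmcut !eb_affine_le // mulr0. Qed.

(** * The weak Laplacian tested with bubble functions *)

Section bubble_cut.
Context {R : realType} (a b c : R * R) (r : R * R -> R).
Context (D : cross a b c != 0) (sr : smooth r).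
Let l1 := lam1 a b c.
Let l2 := lam2 a b c.
Let l3 := lam3 a b c.

(** Each barycentric factor is truncated by [mcut] instead of multiplying the whole bubble by a
    cutoff. The linear vanishing of the coordinate at its edge compensates the steep cutoff, which
    keeps the first derivatives bounded. *)
Definition bub_cut n (x : R * R) : R :=
  mcut n (lam1 a b c x) * mcut n (lam2 a b c x) * mcut n (lam3 a b c x) * r x.

Definition bub (x : R * R) : R := lam1 a b c x * lam2 a b c x * lam3 a b c x * r x.

Let s1 n : smooth (fun x => mcut n (l1 x)). Proof. exact/smooth_mcut/affine_lam1. Qed.
Let s2 n : smooth (fun x => mcut n (l2 x)). Proof. exact/smooth_mcut/affine_lam2. Qed.
Let s3 n : smooth (fun x => mcut n (l3 x)). Proof. exact/smooth_mcut/affine_lam3. Qed.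

Lemma smooth_bub_cut n : smooth (bub_cut n).
Proof. by do 3! (apply: smoothM => //). Qed.

Lemma pd_bub_cut n :
  (pd1 (bub_cut n) = fun x =>
     mcut n (l1 x) * mcut n (l2 x) * mcut n (l3 x) * pd1 r x
     + r x * (mcut n (l1 x) * mcut n (l2 x) * (pd1 l3 x * dmcut n (l3 x))
              + mcut n (l3 x) * (mcut n (l1 x) * (pd1 l2 x * dmcut n (l2 x))
                                 + mcut n (l2 x) * (pd1 l1 x * dmcut n (l1 x))))) /\
  (pd2 (bub_cut n) = fun x =>
     mcut n (l1 x) * mcut n (l2 x) * mcut n (l3 x) * pd2 r x
     + r x * (mcut n (l1 x) * mcut n (l2 x) * (pd2 l3 x * dmcut n (l3 x))
              + mcut n (l3 x) * (mcut n (l1 x) * (pd2 l2 x * dmcut n (l2 x))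
                                 + mcut n (l2 x) * (pd2 l1 x * dmcut n (l1 x))))).
Proof.
have s12 := smoothM (s1 n) (s2 n); have s123 := smoothM s12 (s3 n).
have [A1 A2] := pd_mcut n (affine_lam1 a b c).
have [B1 B2] := pd_mcut n (affine_lam2 a b c).
have [C1 C2] := pd_mcut n (affine_lam3 a b c).
split.
  by rewrite (pd1M s123 sr) (pd1M s12 (s3 n)) (pd1M (s1 n) (s2 n)) A1 B1 C1.
by rewrite (pd2M s123 sr) (pd2M s12 (s3 n)) (pd2M (s1 n) (s2 n)) A2 B2 C2.
Qed.

Lemma pd_bub :
  (pd1 bub = fun x =>
     l1 x * l2 x * l3 x * pd1 r x
     + r x * (l1 x * l2 x * pd1 l3 x + l3 x * (l1 x * pd1 l2 x + l2 x * pd1 l1 x))) /\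
  (pd2 bub = fun x =>
     l1 x * l2 x * l3 x * pd2 r x
     + r x * (l1 x * l2 x * pd2 l3 x + l3 x * (l1 x * pd2 l2 x + l2 x * pd2 l1 x))).
Proof.
have t1 := affine_smooth (affine_lam1 a b c); have t2 := smooth_lam2 a b c; have t3 := smooth_lam3 a b c.
have s12 := smoothM t1 t2; have s123 := smoothM s12 t3.
split.
  by rewrite (pd1M s123 sr) (pd1M s12 t3) (pd1M t1 t2).
by rewrite (pd2M s123 sr) (pd2M s12 t3) (pd2M t1 t2).
Qed.

Lemma test_fun_bub_cut (K : set (R * R)) n : otri a b c `<=` K -> test_fun K (bub_cut n).
Proof.
move=> TK; apply: (@test_fun_otri R K a b c n.+1%:R^-1) => //; first exact: smooth_bub_cut.
move=> x; rewrite /bub_cut => -[|[|]] /mcut_small ->; rewrite ?mul0r ?mulr0 ?mul0r ?mulr0 ?mul0r //.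
Qed.

Lemma bub_cut_cvg x : bub_cut n x @[n --> \oo] --> bub x * \1_(otri a b c) x /\
  pd1 (bub_cut n) x @[n --> \oo] --> pd1 bub x * \1_(otri a b c) x /\
  pd2 (bub_cut n) x @[n --> \oo] --> pd2 bub x * \1_(otri a b c) x.
Proof.
rewrite indicE; case: (pselect (otri a b c x)) => [Tx|nTx].
  rewrite mem_set //= !mulr1; have /(otri_lam _ D)[x1 x2 x3] := Tx.
  have m1 := mcut_cvg x1; have m2 := mcut_cvg x2; have m3 := mcut_cvg x3.
  have d1 := dmcut_cvg x1; have d2 := dmcut_cvg x2; have d3 := dmcut_cvg x3.
  have cc (k : R) : (fun n : nat => k) @ \oo --> k by exact: cvg_cst.
  split; first exact: cvgM (cvgM (cvgM m1 m2) m3) (cc (r x)).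
  have [E1 E2] := pd_bub; rewrite E1 E2.
  have L (k1 k2 k3 k4 : R) :
    mcut n (l1 x) * mcut n (l2 x) * mcut n (l3 x) * k4
     + r x * (mcut n (l1 x) * mcut n (l2 x) * (k3 * dmcut n (l3 x))
              + mcut n (l3 x) * (mcut n (l1 x) * (k2 * dmcut n (l2 x))
                                 + mcut n (l2 x) * (k1 * dmcut n (l1 x)))) @[n --> \oo] -->
    l1 x * l2 x * l3 x * k4
     + r x * (l1 x * l2 x * (k3 * 1) + l3 x * (l1 x * (k2 * 1) + l2 x * (k1 * 1))).
    apply: cvgD; first exact: cvgM (cvgM (cvgM m1 m2) m3) (cc k4).
    apply: cvgM; first exact: cc.
    apply: cvgD; first exact: cvgM (cvgM m1 m2) (cvgM (cc k3) d3).
    apply: cvgM; first exact: m3.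
    exact: cvgD (cvgM m1 (cvgM (cc k2) d2)) (cvgM m2 (cvgM (cc k1) d1)).
  split.
    have := L (pd1 l1 x) (pd1 l2 x) (pd1 l3 x) (pd1 r x); rewrite !mulr1.
    by under eq_fun do rewrite -(congr1 (@^~ x) (pd_bub_cut _).1).
  have := L (pd2 l1 x) (pd2 l2 x) (pd2 l3 x) (pd2 r x); rewrite !mulr1.
  by under eq_fun do rewrite -(congr1 (@^~ x) (pd_bub_cut _).2).
rewrite memNset //= !mulr0.
(* Outside the open triangle some barycentric coordinate is non-positive, and there both [mcut] and
   its derivative vanish. Every term of the product rule contains one of the two. *)
have Z n : [\/ mcut n (l1 x) = 0 /\ dmcut n (l1 x) = 0,
     mcut n (l2 x) = 0 /\ dmcut n (l2 x) = 0 | mcut n (l3 x) = 0 /\ dmcut n (l3 x) = 0].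
  have [q1|q1] := leP (l1 x) 0; first by apply: Or31; exact: mcut_le0.
  have [q2|q2] := leP (l2 x) 0; first by apply: Or32; exact: mcut_le0.
  have [q3|q3] := leP (l3 x) 0; first by apply: Or33; exact: mcut_le0.
  by exfalso; apply: nTx; apply/otri_lam.
have -> : (fun n => bub_cut n x) = fun=> 0.
  by apply/funext => n; rewrite /bub_cut -/(l1 x) -/(l2 x) -/(l3 x); case: (Z n) => -[-> _]; ring.
have -> : (fun n => pd1 (bub_cut n) x) = fun=> 0.
  by apply/funext => n; rewrite (pd_bub_cut n).1; case: (Z n) => -[-> ->]; ring.
have -> : (fun n => pd2 (bub_cut n) x) = fun=> 0.
  by apply/funext => n; rewrite (pd_bub_cut n).2; case: (Z n) => -[-> ->]; ring.
by split; [|split]; exact: cvg_cst.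
Qed.

Lemma bub_cut_bound (K : set (R * R)) : bounded_set K -> exists M : R, forall n x, K x ->
  [/\ `|bub_cut n x| <= M, `|pd1 (bub_cut n) x| <= M & `|pd2 (bub_cut n) x| <= M].
Proof.
move=> bK.
have t1 := affine_smooth (affine_lam1 a b c); have t2 := smooth_lam2 a b c; have t3 := smooth_lam3 a b c.
have cb (f : R * R -> R) : smooth f -> exists M : R, 0 <= M /\ forall x, K x -> `|f x| <= M.
  by move=> /smooth_continuous /(continuous_bounded_on bK)[M M0 HM]; exists M.
have [m1 [m10 M1]] := cb _ t1; have [m2 [m20 M2]] := cb _ t2; have [m3 [m30 M3]] := cb _ t3.
have [r0 [r00 R0]] := cb _ sr.
have [C C0 HC] := @eb_bounded R (1 + 'X + 'X^2).
have nM (u w U W : R) : `|u| <= U -> `|w| <= W -> `|u * w| <= U * W.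
  by move=> uU wW; rewrite normrM; apply: ler_pM.
have nD (u w U W : R) : `|u| <= U -> `|w| <= W -> `|u + w| <= U + W.
  by move=> uU wW; apply: le_trans (ler_normD _ _) _; apply: lerD.
have B1 n x : K x -> `|mcut n (l1 x)| <= m1 by move=> Kx; apply: le_trans (mcut_bound _ _) (M1 _ Kx).
have B2 n x : K x -> `|mcut n (l2 x)| <= m2 by move=> Kx; apply: le_trans (mcut_bound _ _) (M2 _ Kx).
have B3 n x : K x -> `|mcut n (l3 x)| <= m3 by move=> Kx; apply: le_trans (mcut_bound _ _) (M3 _ Kx).
have P (p : (R * R -> R) -> R * R -> R) : (forall f, smooth f -> smooth (p f)) ->
  exists M : R, forall n x, K x -> `|mcut n (l1 x) * mcut n (l2 x) * mcut n (l3 x) * p r x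
     + r x * (mcut n (l1 x) * mcut n (l2 x) * (p l3 x * dmcut n (l3 x))
              + mcut n (l3 x) * (mcut n (l1 x) * (p l2 x * dmcut n (l2 x))
                                 + mcut n (l2 x) * (p l1 x * dmcut n (l1 x))))| <= M.
  move=> sp; have [p1 [p10 P1]] := cb _ (sp _ t1); have [p2 [p20 P2]] := cb _ (sp _ t2).
  have [p3 [p30 P3]] := cb _ (sp _ t3); have [p4 [p40 P4]] := cb _ (sp _ sr).
  exists (m1 * m2 * m3 * p4 + r0 * (m1 * m2 * (p3 * C) + m3 * (m1 * (p2 * C) + m2 * (p1 * C)))).
  move=> n x Kx.
  have := B1 n x Kx; have := B2 n x Kx; have := B3 n x Kx => b3 b2 b1.
  apply: (nD); first by apply: (nM); [apply: (nM); [exact: (nM)|]|exact: P4].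
  apply: (nM); first exact: R0.
  apply: (nD); first by apply: (nM); [exact: (nM)|apply: (nM); [exact: P3|exact: HC]].
  apply: (nM) => //.
  by apply: (nD); apply: (nM) => //; apply: (nM); [exact: P2|exact: HC|exact: P1|exact: HC].
have [A HA] := P pd1 (@smooth_pd1 R); have [B HB] := P pd2 (@smooth_pd2 R).
exists (m1 * m2 * m3 * r0 + `|A| + `|B|) => n x Kx; split.
- apply: (@le_trans _ _ (m1 * m2 * m3 * r0)); last by rewrite -addrA lerDl addr_ge0.
  apply: (nM); last exact: R0.
  apply: (nM); last exact: B3.
  by apply: (nM); [exact: B1|exact: B2].
- rewrite (pd_bub_cut n).1; apply: le_trans (HA n x Kx) _; apply: le_trans (ler_norm _) _.
  by rewrite -addrA addrCA lerDl addr_ge0 // !mulr_ge0.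
rewrite (pd_bub_cut n).2; apply: le_trans (HB n x Kx) _; apply: le_trans (ler_norm _) _.
by rewrite lerDr addr_ge0 // !mulr_ge0.
Qed.

(** The test functions [bub_cut n] and their first derivatives converge boundedly to those of [bub]. Second derivatives of
    [bub_cut n] need not, but they only enter through the weak gradient. *)
Lemma bubble_laplacian (K : set (R * R)) (v f : R * R -> R) (G : R * R -> R * R) :
  open K -> bounded_set K -> otri a b c `<=` K -> weak_grad K v G -> weak_laplacian K v f ->
  continuous f ->
  ip area (otri a b c : set (plane R)) (fun x => (G x).1) (pd1 bub)
  + ip area (otri a b c : set (plane R)) (fun x => (G x).2) (pd2 bub) =
  - ip area (otri a b c : set (plane R)) f bub.
Proof.
move=> oK bK TK wG lap cf.
have [/L2fun_sqint vi /L2fun_sqint G1 /L2fun_sqint G2 HG] := wG.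
have mK := open_measurable_plane oK.
have fi := sqint_continuous mK bK cf.
have [M HM] := bub_cut_bound bK.
have ms (h : R * R -> R) : smooth h -> measurable_fun (K : set (plane R)) h.
  by move=> sh; apply: measurable_funTS; apply: continuous_measurable_plane; exact: smooth_continuous.
have si (h : R * R -> R) : smooth h -> sqint area (K : set (plane R)) h.
  by move=> sh; apply: sqint_continuous => //; exact: smooth_continuous.
have L1 : ip area (K : set (plane R)) (fun x => (G x).1) (pd1 (bub_cut n)) @[n --> \oo] -->
    ip area (otri a b c : set (plane R)) (fun x => (G x).1) (pd1 bub).
  rewrite -(@Rintegral_setIindic _ (plane R) R area _ _ _ _ TK).
  apply: (@ip_cvg_dominated _ _ _ _ _ _ _ _ M) => //; first exact: bounded_area_fin.
  - by move=> n; apply: ms; apply: smooth_pd1; exact: smooth_bub_cut.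
  - by move=> n x Kx; have [] := HM n x Kx.
  - by move=> x _; exact: (bub_cut_cvg x).2.1.
have L2 : ip area (K : set (plane R)) (fun x => (G x).2) (pd2 (bub_cut n)) @[n --> \oo] -->
    ip area (otri a b c : set (plane R)) (fun x => (G x).2) (pd2 bub).
  rewrite -(@Rintegral_setIindic _ (plane R) R area _ _ _ _ TK).
  apply: (@ip_cvg_dominated _ _ _ _ _ _ _ _ M) => //; first exact: bounded_area_fin.
  - by move=> n; apply: ms; apply: smooth_pd2; exact: smooth_bub_cut.
  - by move=> n x Kx; have [] := HM n x Kx.
  - by move=> x _; exact: (bub_cut_cvg x).2.2.
have L0 : ip area (K : set (plane R)) f (bub_cut n) @[n --> \oo] -->
    ip area (otri a b c : set (plane R)) f bub.
  rewrite -(@Rintegral_setIindic _ (plane R) R area _ _ _ _ TK).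
  apply: (@ip_cvg_dominated _ _ _ _ _ _ _ _ M) => //; first exact: bounded_area_fin.
  - by move=> n; apply: ms; exact: smooth_bub_cut.
  - by move=> n x Kx; have [] := HM n x Kx.
  - by move=> x _; exact: (bub_cut_cvg x).1.
have E n : ip area (K : set (plane R)) (fun x => (G x).1) (pd1 (bub_cut n))
  + ip area (K : set (plane R)) (fun x => (G x).2) (pd2 (bub_cut n))
  = - ip area (K : set (plane R)) f (bub_cut n).
  (* The weak gradient is tested with the partial derivatives of the truncated bubble, which are
     again test functions. The two identities add up to the Laplacian of the test function paired
     with [v]. *)
  have tb := test_fun_bub_cut n TK; have sb := smooth_bub_cut n.
  have [tb1 tb2] := test_fun_pd tb.
  have [H1 _] := HG _ tb1; have [_ H2] := HG _ tb2.
  pose S : set (plane R) := K.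
  have lapE : ip area S v (fun x => pd1 (pd1 (bub_cut n)) x + pd2 (pd2 (bub_cut n)) x) =
     ip area S f (bub_cut n) := lap _ tb.
  have H1' : ip area S v (pd1 (pd1 (bub_cut n))) = - ip area S (fun x => (G x).1) (pd1 (bub_cut n)) := H1.
  have H2' : ip area S v (pd2 (pd2 (bub_cut n))) = - ip area S (fun x => (G x).2) (pd2 (bub_cut n)) := H2.
  rewrite -/S -lapE ipDr //; last 2 first.
  - by apply: si; apply: smooth_pd1; exact: smooth_pd1.
  - by apply: si; apply: smooth_pd2; exact: smooth_pd2.
  have alg (p q A B : R) : p = - A -> q = - B -> A + B = - (p + q) by move=> -> ->; ring.
  exact: alg H1' H2'.
have L12 : ip area (K : set (plane R)) (fun x => (G x).1) (pd1 (bub_cut n))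
  + ip area (K : set (plane R)) (fun x => (G x).2) (pd2 (bub_cut n)) @[n --> \oo] -->
  ip area (otri a b c : set (plane R)) (fun x => (G x).1) (pd1 bub)
  + ip area (otri a b c : set (plane R)) (fun x => (G x).2) (pd2 bub).
  exact: cvgD L1 L2.
apply: cvg_unique L12 _; first exact: norm_hausdorff.
apply: cvg_trans (cvgN L0); apply: near_eq_cvg; apply: nearW => n.
by rewrite E.
Qed.

End bubble_cut.

(** * Traces *)

Lemma L2norm_nrm {R : realType} (S : set (R * R)) (f : R * R -> R) :
  measurable (S : set (plane R)) -> sqint area (S : set (plane R)) f ->
  L2norm S f = (nrm area (S : set (plane R)) f)%:E.
Proof.
move=> mS fi; rewrite /L2norm.
under eq_integral do rewrite expr2.
by rewrite ip_def.
Qed.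

Lemma nrm_cvg0 {R : realType} (S : set (R * R)) (f_ : nat -> R * R -> R) :
  measurable (S : set (plane R)) -> (forall n, sqint area (S : set (plane R)) (f_ n)) ->
  L2norm S (f_ i) @[i --> \oo] --> 0%E ->
  nrm area (S : set (plane R)) (f_ i) @[i --> \oo] --> (0 : R).
Proof.
move=> mS fi; under eq_fun do rewrite L2norm_nrm //.
exact: fine_cvg.
Qed.

Definition unit_itv {R : realType} : set (measurableTypeR R) := `[0%R, 1%R].

Lemma measurable_unit {R : realType} : measurable (@unit_itv R).
Proof. exact: measurable_itv. Qed.

Lemma unit_fin {R : realType} : (@lebesgue_measure R unit_itv < +oo)%E.
Proof. by rewrite /unit_itv lebesgue_measure_itv /= lte_fin ltr01 ltry. Qed.

Lemma unit_measure {R : realType} : (@lebesgue_measure R unit_itv = 1)%E.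
Proof. by rewrite /unit_itv lebesgue_measure_itv /= lte_fin ltr01 -EFinB subr0. Qed.

Lemma Rintegral_unit_cst {R : realType} (k : R) : \int[@lebesgue_measure R]_(t in unit_itv) k = k.
Proof.
rewrite Rintegral_cst; last exact: measurable_unit.
by rewrite [fine _](congr1 fine unit_measure) mulr1.
Qed.

Lemma continuous_segpath {R : realType} (a b : R * R) : continuous (segpath a b).
Proof.
have E : segpath a b = fun t => (a.1 + t * (b.1 - a.1), a.2 + t * (b.2 - a.2)) by [].
rewrite E; apply: continuous_pair => t.
  by apply: cvgD; [exact: cvg_cst|apply: cvgM; [exact: cvg_id|exact: cvg_cst]].
by apply: cvgD; [exact: cvg_cst|apply: cvgM; [exact: cvg_id|exact: cvg_cst]].
Qed.

Lemma segpath_amap {R : realType} (a b c : R * R) (s : R) : amap a b c (s, 0) = segpath a b s.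
Proof.
rewrite [RHS](_ : _ = (a.1 + s * (b.1 - a.1), a.2 + s * (b.2 - a.2))) //.
by rewrite /amap /= !mul0r !addr0.
Qed.

Lemma sqint_unit_continuous {R : realType} (f : R -> R) : continuous f ->
  sqint (@lebesgue_measure R) unit_itv f.
Proof.
move=> cf.
have : compact (f @` `[0%R, 1%R]).
  by apply: continuous_compact; [exact: continuous_subspaceT|exact: segment_compact].
move=> /compact_bounded[M [_ HM]].
apply: (@sqint_bounded _ _ _ _ _ _ (`|M| + 1) measurable_unit unit_fin).
  by apply: measurable_funTS; exact: continuous_measurable_fun.
move=> x xI; apply: HM; first by rewrite ltr_pwDr // ler_norm.
by exists x.
Qed.

(** The interior half of [trace] in real-valued norms; [approx_edge] is the boundary half, edge by
    edge. Both keep the approximating sequence explicit, so that Green's formula can be passed to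
    the limit along it. *)
Definition h1approx {R : realType} (K : set (R * R)) (v : R * R -> R) (G : R * R -> R * R)
    (phi : nat -> R * R -> R) : Prop :=
  [/\ weak_grad K v G, forall i, smooth (phi i),
   nrm area (K : set (plane R)) (fun x => phi i x - v x) @[i --> \oo] --> (0 : R),
   nrm area (K : set (plane R)) (fun x => pd1 (phi i) x - (G x).1) @[i --> \oo] --> (0 : R) &
   nrm area (K : set (plane R)) (fun x => pd2 (phi i) x - (G x).2) @[i --> \oo] --> (0 : R)].

Definition approx_edge {R : realType} (phi : nat -> R * R -> R) (g : R * R -> R) (a b : R * R) : Prop :=
  sqint (@lebesgue_measure R) unit_itv (g \o segpath a b) /\
  nrm (@lebesgue_measure R) unit_itv (fun t => phi i (segpath a b t) - g (segpath a b t)) @[i --> \oo] --> (0 : R).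

Lemma eucl_norm_sqr {R : realType} (x : R * R) : eucl_norm x ^+ 2 = x.1 ^+ 2 + x.2 ^+ 2.
Proof. by rewrite sqr_sqrtr // addr_ge0 ?sqr_ge0. Qed.

Lemma eucl_norm_ge0 {R : realType} (x : R * R) : 0 <= eucl_norm x.
Proof. exact: sqrtr_ge0. Qed.

Lemma sqint_eucl {R : realType} (S : set (R * R)) (f g : R * R -> R) :
  measurable (S : set (plane R)) ->
  sqint area (S : set (plane R)) f -> sqint area (S : set (plane R)) g ->
  sqint area (S : set (plane R)) (fun x => eucl_norm (f x, g x)) /\
  ip area (S : set (plane R)) (fun x => eucl_norm (f x, g x)) (fun x => eucl_norm (f x, g x)) =
  ip area (S : set (plane R)) f f + ip area (S : set (plane R)) g g.
Proof.
move=> mS fi gi.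
have mf : measurable_fun (S : set (plane R)) f by case: fi.
have mg : measurable_fun (S : set (plane R)) g by case: gi.
have me : measurable_fun (S : set (plane R)) (fun x => eucl_norm (f x, g x)).
  apply: (@measurableT_comp _ _ _ _ _ _ (@Num.sqrt R)); last first.
    by apply: measurable_funD; exact: measurable_funX.
  by apply: continuous_measurable_fun; exact: sqrt_continuous.
have E : ip area (S : set (plane R)) (fun x => eucl_norm (f x, g x)) (fun x => eucl_norm (f x, g x)) =
  ip area (S : set (plane R)) f f + ip area (S : set (plane R)) g g.
  rewrite /ip -RintegralD //; [|exact: sqint_integrableM|exact: sqint_integrableM].
  by apply: eq_Rintegral => x _; rewrite -!expr2 eucl_norm_sqr.
split=> //; split => //.
under eq_integral do rewrite eucl_norm_sqr /= !expr2 EFinD.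
rewrite ge0_integralD //.
- by rewrite !ip_def // -EFinD ltry.
- by move=> x _; rewrite -expr2 lee_fin sqr_ge0.
- by apply/measurable_EFinP; exact: measurable_funM.
- by move=> x _; rewrite -expr2 lee_fin sqr_ge0.
- by apply/measurable_EFinP; exact: measurable_funM.
Qed.

Lemma nrm_eucl_le {R : realType} (S : set (R * R)) (f g : R * R -> R) :
  measurable (S : set (plane R)) ->
  sqint area (S : set (plane R)) f -> sqint area (S : set (plane R)) g ->
  nrm area (S : set (plane R)) f <= nrm area (S : set (plane R)) (fun x => eucl_norm (f x, g x)) /\
  nrm area (S : set (plane R)) g <= nrm area (S : set (plane R)) (fun x => eucl_norm (f x, g x)).
Proof.
move=> mS fi gi; have [_ E] := sqint_eucl mS fi gi.
rewrite /nrm E; split; rewrite ler_wsqrtr //; first by rewrite lerDl ip_ge0.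
by rewrite lerDr ip_ge0.
Qed.

(** The boundary norm in [trace] is a sum of non-negative terms weighted by edge lengths. As these
    are positive, each term is controlled by the sum. *)
Lemma trace_approx {R : realType} (n : nat) (z : 'I_n -> R * R) (K : set (R * R)) (v g : R * R -> R) :
  open K -> bounded_set K -> (forall i, 0 < eucl_dist (z i) (z (ordS i))) ->
  trace z K v g ->
  exists G phi, h1approx K v G phi /\ forall i, approx_edge phi g (z i) (z (ordS i)).
Proof.
move=> oK bK zd [mg [G [phi [wG sphi c0 c1 c2]]]].
have mK := open_measurable_plane oK.
have [/L2fun_sqint vi /L2fun_sqint G1 /L2fun_sqint G2 _] := wG.
have si (h : R * R -> R) : smooth h -> sqint area (K : set (plane R)) h.
  by move=> sh; apply: sqint_continuous => //; exact: smooth_continuous.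
exists G, phi; split.
  have D1 i : sqint area (K : set (plane R)) (fun x => pd1 (phi i) x - (G x).1).
    by apply: sqintB => //; apply: si; exact: smooth_pd1.
  have D2 i : sqint area (K : set (plane R)) (fun x => pd2 (phi i) x - (G x).2).
    by apply: sqintB => //; apply: si; exact: smooth_pd2.
  have c1' := nrm_cvg0 mK (fun i => (sqint_eucl mK (D1 i) (D2 i)).1) c1.
  split => //.
  - by apply: nrm_cvg0 => // i; apply: sqintB => //; exact: si.
  - apply: (@squeeze_cvgr _ _ _ _ (fun=> 0) _ _ _ _ _ c1'); last exact: cvg_cst.
    by apply: nearW => i; rewrite nrm_ge0 /=; have [] := nrm_eucl_le mK (D1 i) (D2 i).
  - apply: (@squeeze_cvgr _ _ _ _ (fun=> 0) _ _ _ _ _ c1'); last exact: cvg_cst.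
    by apply: nearW => i; rewrite nrm_ge0 /=; have [] := nrm_eucl_le mK (D1 i) (D2 i).
move=> j; set d := eucl_dist (z j) (z (ordS j)).
pose h i t := phi i (segpath (z j) (z (ordS j)) t) - g (segpath (z j) (z (ordS j)) t).
pose I i := (\int[@lebesgue_measure R]_(t in unit_itv) ((h i t) ^+ 2)%:E)%E.
have cphi i : continuous (fun t => phi i (segpath (z j) (z (ordS j)) t)).
  move=> t; apply: (@continuous_comp _ _ _ (segpath (z j) (z (ordS j))) (phi i)).
    exact: continuous_segpath.
  exact: smooth_continuous.
have mgj : measurable_fun (@unit_itv R) (fun t => g (segpath (z j) (z (ordS j)) t)) := mg j.
have mh i : measurable_fun (@unit_itv R) (h i).
  apply: measurable_funB => //; apply: measurable_funTS; exact: continuous_measurable_fun.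
have leI i : (I i <= d^-1%:E * polyline_L2sq z (fun x => (phi i x - g x)%R))%E.
  rewrite /polyline_L2sq (bigD1 j) //=.
  have -> : (\int[lebesgue_measure]_(t in `[0%R, 1%R])
     ((phi i (segpath (z j) (z (ordS j)) t) - g (segpath (z j) (z (ordS j)) t)) ^+ 2)%:E)%E = I i by [].
  have I0 : (0 <= I i)%E by apply: integral_ge0 => t _; rewrite lee_fin sqr_ge0.
  rewrite ge0_muleDr; last 2 first.
  - by rewrite mule_ge0 // lee_fin ltW.
  - apply: sume_ge0 => l _; rewrite mule_ge0 //; first by rewrite lee_fin ltW.
    by apply: integral_ge0 => t _; rewrite lee_fin sqr_ge0.
  have -> : (d^-1%:E * ((eucl_dist (z j) (z (ordS j)))%:E * I i) = I i)%E.
    by rewrite muleA -EFinM mulVf ?mul1e //; apply: lt0r_neq0; exact: zd.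
  rewrite leeDl // mule_ge0 //.
    by rewrite lee_fin invr_ge0; exact: ltW (zd j).
  apply: sume_ge0 => l _; rewrite mule_ge0 //; first by rewrite lee_fin ltW.
  by apply: integral_ge0 => t _; rewrite lee_fin sqr_ge0.
have cI : I i @[i --> \oo] --> 0%E.
  apply: (@squeeze_cvge _ _ _ _ (fun=> 0%E) _ (fun i => d^-1%:E * polyline_L2sq z (fun x => (phi i x - g x)%R))%E).
  - by apply: nearW => i; rewrite leI andbT; apply: integral_ge0 => t _; rewrite lee_fin sqr_ge0.
  - exact: cvg_cst.
  - by rewrite -(mule0 d^-1%:E); apply: cvgeZl.
(* Convergence to 0 makes some [I m] finite. On the edge [g] is then the difference of the
   continuous [phi m] and a square-integrable function, hence square-integrable itself. *)
have [m Im] : exists m, (I m < +oo)%E.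
  have := cI; move=> /fine_cvgP[[m _ /(_ m)]]; rewrite /= leqnn => /(_ isT) fm _.
  by exists m; rewrite ltey_eq fm.
have hi_m : sqint (@lebesgue_measure R) unit_itv (h m) by split.
have gi : sqint (@lebesgue_measure R) unit_itv (g \o segpath (z j) (z (ordS j))).
  apply: (@eq_sqint _ (measurableTypeR R) R (@lebesgue_measure R) unit_itv (fun t => phi m (segpath (z j) (z (ordS j)) t) - h m t)).
    by move=> t _; rewrite /h /= subKr.
  by apply: sqintB => //; [exact: measurable_unit|exact: sqint_unit_continuous].
split=> //.
have hi i : sqint (@lebesgue_measure R) unit_itv (h i).
  by apply: sqintB => //; [exact: measurable_unit|exact: sqint_unit_continuous].
have E i : I i = (ip (@lebesgue_measure R) unit_itv (h i) (h i))%:E.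
  by rewrite -ip_def //; exact: measurable_unit.
have cI' : ip (@lebesgue_measure R) unit_itv (h i) (h i) @[i --> \oo] --> (0 : R).
  by move: cI; under eq_fun do rewrite E; exact: fine_cvg.
rewrite /nrm -[X in _ --> X]sqrtr0.
by apply: (@cvg_comp _ _ _ _ (@Num.sqrt R) _ _ _ cI'); exact: sqrt_continuous.
Qed.

(** Green's formula holds for every smooth [phi i]. Its interior terms pair [phi i] and its gradient
    with fixed smooth functions and its edge term pairs [phi i] with [Xt], so that each term
    converges by Cauchy-Schwarz. *)
Lemma green_trace {R : realType} (K : set (R * R)) (v g : R * R -> R) G phi (a b c : R * R)
    (Xs Xt : R * R -> R) :
  open K -> bounded_set K -> h1approx K v G phi -> approx_edge phi g a b ->
  cross a b c != 0 -> otri a b c `<=` K -> smooth Xs -> smooth Xt ->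
  (forall t : R, Xs (amap a b c (0, t)) = 0) ->
  (forall t : R, Xs (amap a b c (1 - t, t)) + Xt (amap a b c (1 - t, t)) = 0) ->
  let X1 x := Xs x * (b.1 - a.1) + Xt x * (c.1 - a.1) in
  let X2 x := Xs x * (b.2 - a.2) + Xt x * (c.2 - a.2) in
  let T : set (plane R) := otri a b c in
  ip area T (fun x => (G x).1) X1 + ip area T (fun x => (G x).2) X2
   + ip area T v (fun x => pd1 X1 x + pd2 X2 x) =
  - (`|cross a b c| * \int[@lebesgue_measure R]_(s in unit_itv)
       (g (segpath a b s) * Xt (segpath a b s))).
Proof.
move=> oK bK [wG sphi c0 c1 c2] [gi cg] D TK sXs sXt H1 H2 X1 X2 T.
have mK := open_measurable_plane oK; have mT := measurable_otri D.
have [/L2fun_sqint vi /L2fun_sqint G1 /L2fun_sqint G2 _] := wG.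
have sX1 : smooth X1 by apply: smoothD; apply: smoothM => //; exact: smooth_cst.
have sX2 : smooth X2 by apply: smoothD; apply: smoothM => //; exact: smooth_cst.
have siK (h : R * R -> R) : smooth h -> sqint area (K : set (plane R)) h.
  by move=> sh; apply: sqint_continuous => //; exact: smooth_continuous.
have siT (h : R * R -> R) : smooth h -> sqint area T h.
  by move=> sh; apply: sqint_continuous => //; [exact: bounded_otri|exact: smooth_continuous].
have toT (f : R * R -> R) : sqint area (K : set (plane R)) f -> sqint area T f by exact: sqintS.
have lim (f_ : nat -> R * R -> R) (f h : R * R -> R) :
    (forall i, sqint area (K : set (plane R)) (f_ i)) -> sqint area (K : set (plane R)) f -> smooth h ->
    nrm area (K : set (plane R)) (fun x => f_ i x - f x) @[i --> \oo] --> (0 : R) ->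
    ip area T (f_ i) h @[i --> \oo] --> ip area T f h.
  move=> fi_ fi sh cf; apply: ip_cvgl => //; [by move=> i; exact: toT|exact: toT|exact: siT|].
  apply: (@squeeze_cvgr _ _ _ _ (fun=> 0) _ _ _ _ _ cf); last exact: cvg_cst.
  apply: nearW => i; rewrite nrm_ge0 /=; apply: (nrmS mK mT TK); exact: sqintB.
have L1 := lim _ _ _ (fun i => siK _ (smooth_pd1 (sphi i))) G1 sX1 c1.
have L2 := lim _ _ _ (fun i => siK _ (smooth_pd2 (sphi i))) G2 sX2 c2.
have sdiv : smooth (fun x => pd1 X1 x + pd2 X2 x).
  by apply: smoothD; [exact: smooth_pd1|exact: smooth_pd2].
have L0 := lim _ _ _ (fun i => siK _ (sphi i)) vi sdiv c0.
pose Xe t := Xt (segpath a b t).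
have cXe : continuous Xe.
  move=> t; apply: (@continuous_comp _ _ _ (segpath a b) Xt); first exact: continuous_segpath.
  exact: smooth_continuous.
have cphi i : continuous (fun t => phi i (segpath a b t)).
  move=> t; apply: (@continuous_comp _ _ _ (segpath a b) (phi i)); first exact: continuous_segpath.
  exact: smooth_continuous.
have Le : ip (@lebesgue_measure R) unit_itv (fun t => phi i (segpath a b t)) Xe @[i --> \oo] -->
          ip (@lebesgue_measure R) unit_itv (g \o segpath a b) Xe.
  apply: ip_cvgl => //; [exact: measurable_unit| |exact: sqint_unit_continuous].
  by move=> i; exact: sqint_unit_continuous.
have E i : ip area T (pd1 (phi i)) X1 + ip area T (pd2 (phi i)) X2
   + ip area T (phi i) (fun x => pd1 X1 x + pd2 X2 x) =
  - (`|cross a b c| * ip (@lebesgue_measure R) unit_itv (fun t => phi i (segpath a b t)) Xe).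
  have := green_triangle D sXs sXt (sphi i) H1 H2; rewrite -/X1 -/X2.
  under [in X in _ = - (_ * X) -> _]eq_Rintegral do rewrite !segpath_amap mulrC.
  rewrite -[X in _ = - (_ * X) -> _]/(ip (@lebesgue_measure R) unit_itv (fun t => phi i (segpath a b t)) Xe) => <-.
  have i1 := sqint_integrableM mT (siT _ (smooth_pd1 (sphi i))) (siT _ sX1).
  have i2 := sqint_integrableM mT (siT _ (smooth_pd2 (sphi i))) (siT _ sX2).
  have i3 := sqint_integrableM mT (siT _ (sphi i)) (siT _ sdiv).
  rewrite /ip -RintegralD // -RintegralD //; last exact: integrableD i1 i2.
  by apply: eq_Rintegral => x _; ring.
have R1 : - (`|cross a b c| * ip (@lebesgue_measure R) unit_itv (fun t => phi i (segpath a b t)) Xe) @[i --> \oo] -->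
   - (`|cross a b c| * ip (@lebesgue_measure R) unit_itv (g \o segpath a b) Xe).
  by apply: cvgN; apply: cvgM => //; exact: cvg_cst.
have R2 : ip area T (pd1 (phi i)) X1 + ip area T (pd2 (phi i)) X2
   + ip area T (phi i) (fun x => pd1 X1 x + pd2 X2 x) @[i --> \oo] -->
   ip area T (fun x => (G x).1) X1 + ip area T (fun x => (G x).2) X2
   + ip area T v (fun x => pd1 X1 x + pd2 X2 x).
  by apply: cvgD => //; exact: cvgD.
apply: cvg_unique R2 _; first exact: norm_hausdorff.
apply: cvg_trans R1; apply: near_eq_cvg; apply: nearW => i.
by rewrite E.
Qed.

(** * Integration along lines *)

(** Induction over the intervals cut out by a finite set of breakpoints. *)
Lemma gap_ind {R : realType} (P : seq R) (Q : R -> R -> Prop) :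
  (forall a b, a < b -> (forall p, p \in P -> ~~ (a < p < b)) -> Q a b) ->
  (forall a p b, a < p -> p < b -> p \in P -> Q a p -> Q p b -> Q a b) ->
  forall a b, a < b -> Q a b.
Proof.
move=> Q0 Qs.
have H m : forall a b : R, (count (fun p => (a < p < b)%R) P <= m)%N -> a < b -> Q a b.
  elim: m => [|m IH] a b.
    rewrite leqn0 => /eqP c0 ab; apply: Q0 => // p pP; apply/negP => apb.
    have : has (fun p => (a < p < b)%R) P by apply/hasP; exists p.
    by rewrite has_count c0.
  move=> cm ab; have [/hasP[p pP apb]|/hasPn nP] := boolP (has (fun p => (a < p < b)%R) P); last first.
    exact: Q0.
  have /andP[ap pb] := apb.
  have lt (f : pred R) : subpred f (fun p => (a < p < b)%R) -> ~~ f p -> (count f P <= m)%N.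
    move=> sub fp; rewrite -ltnS; apply: leq_trans cm.
    have -> : count (fun p => (a < p < b)%R) P =
      (count f P + count (fun q => (a < q < b)%R && ~~ f q) P)%N.
      rewrite -count_predUI [X in (_ + X)%N](_ : _ = 0%N); last first.
        by apply/eqP; rewrite -leqn0 leqNgt -has_count; apply/hasPn => q _ /=; case: (f q); rewrite ?andbF.
      rewrite addn0; apply: eq_count => q /=; case: (boolP (f q)) => [/sub ->|] //=.
      by rewrite andbT.
    rewrite -addn1 leq_add2l -has_count; apply/hasP; exists p => //.
    by rewrite apb.
  apply: (Qs a p b) => //; apply: IH => //; apply: lt; rewrite ?ltxx ?andbF //.
    by move=> q /andP[-> qp] /=; exact: lt_trans pb.
  by move=> q /andP[pq ->]; rewrite andbT; exact: lt_trans pq.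
by move=> a b; exact: H.
Qed.

(** Inside the interval [U] is both open and closed, and an interval is connected. *)
Lemma interval_sub_or_disjoint {R : realType} (U : set R) (a b : R) : open U ->
  (forall x, a < x < b -> closure U x -> U x) ->
  `]a, b[ `<=` U \/ (forall x, a < x < b -> ~ U x).
Proof.
move=> oU cU; case: (pselect (exists x, a < x < b /\ U x)) => [[x [abx Ux]]|nE]; last first.
  by right => x abx Ux; apply: nE; exists x.
left; have : connected (`]a, b[%classic : set R) by apply/connected_intervalP; exact: interval_is_interval.
move=> /(_ (`]a, b[%classic `&` U)) E.
suff <- : `]a, b[%classic `&` U = `]a, b[%classic by move=> y [].
apply: E.
- by exists x; split => //; rewrite /= in_itv.
- by exists U.
- exists (closure U); first exact: closed_closure.
  apply/seteqP; split => y [yab Uy]; split => //; first exact: subset_closure.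
  by apply: cU => //; move: yab; rewrite /= in_itv.
Qed.

Lemma closure_itv {R : realType} (a b x : R) : a < b -> a <= x <= b ->
  closure `]a, b[%classic x.
Proof.
move=> ab /andP[ax xb] B /nbhs_ballP[e /= e0 eB].
(* A point of the closed interval is moved towards the midpoint by the fraction [t < 1]. It lands in
   the open interval, and the distance covered is below [e]. *)
pose m := (a + b) / 2; pose t := e / (e + (b - a)).
have d0 : 0 < e + (b - a) by lra.
have t0 : 0 < t by rewrite divr_gt0.
have t1 : t < 1 by rewrite ltr_pdivrMr // mul1r; lra.
have te : t * (b - a) < e by rewrite /t mulrAC ltr_pdivrMr // ltr_pM2l //; lra.
exists (x + t * (m - x)); split.
  have m1 : m = (a + b) / 2 by [].
  by rewrite /= in_itv /=; apply/andP; split; nra.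
apply: eB; rewrite /ball /= opprD addNKr normrN normrM (gtr0_norm t0).
apply: le_lt_trans te; rewrite (ler_wpM2l (ltW t0)) // /m ler_norml; apply/andP; split; lra.
Qed.

Lemma Rintegral_split {R : realType} (h : R -> R) (a p b : R) : a <= p -> p <= b ->
  (@lebesgue_measure R).-integrable `]a, b] (EFin \o h) ->
  \int[@lebesgue_measure R]_(x in `]a, b]) h x =
  \int[@lebesgue_measure R]_(x in `]a, p]) h x + \int[@lebesgue_measure R]_(x in `]p, b]) h x.
Proof.
move=> ap pb hi; apply/eqP; rewrite addrC -subr_eq; apply/eqP; exact: Rintegral_itvB.
Qed.

Lemma Rintegral_gap {R : realType} (h h' H' : R -> R) (a b : R) : a <= b ->
  (forall x : R, is_derive x 1 H' (h' x)) -> continuous h' ->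
  measurable_fun (setT : set (measurableTypeR R)) h ->
  (forall x, a < x < b -> h x = h' x) ->
  \int[@lebesgue_measure R]_(x in `]a, b]) h x = H' b - H' a.
Proof.
move=> ab HD ch mh hh.
have mh' : measurable_fun (setT : set (measurableTypeR R)) h' by exact: continuous_measurable_fun.
rewrite /Rintegral (@eq_integral_itv_bounded R a b h' h false false).
- have -> := @integral_itv_bndoo R a b (fun z => (h' z)%:E) false false.
    have <- := @integral_itv_bndoo R a b (fun z => (h' z)%:E) true false.
      by rewrite (FTC_segment ab HD ch).
    by apply/measurable_EFinP; exact: measurable_funTS.
  by apply/measurable_EFinP; exact: measurable_funTS.
- exact: measurable_funTS.
- exact: measurable_funTS.
by move=> x; rewrite in_itv /=; exact: hh.
Qed.

Lemma integrable_bounded_itv {R : realType} (h : R -> R) (M a b : R) :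
  measurable_fun (setT : set (measurableTypeR R)) h -> (forall x, `|h x| <= M) ->
  (@lebesgue_measure R).-integrable `]a, b] (EFin \o h).
Proof.
move=> mh hM; apply: measurable_bounded_integrable.
- exact: measurable_itv.
- have E : (@lebesgue_measure R `]a, b] < +oo)%E.
    by rewrite lebesgue_measure_itv /=; case: ifP => _; rewrite ?ltry // -EFinB ltry.
  exact: E.
- exact: measurable_funTS.
exists M; split; first exact: num_real.
by move=> y My x _; apply: le_trans (hM x) (ltW My).
Qed.

(** Each gap between breakpoints has its own antiderivative [H'], tied to [H] only at the ends of
    the gap. The contributions therefore telescope in the values of [H]. *)
Lemma piecewise_FTC {R : realType} (H h : R -> R) (P : seq R) (M a b : R) : a < b ->
  measurable_fun (setT : set (measurableTypeR R)) h -> (forall x, `|h x| <= M) ->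
  (forall a b, a < b -> (forall p, p \in P -> ~~ (a < p < b)) ->
    exists H' h' : R -> R, [/\ forall x : R, is_derive x 1 H' (h' x), continuous h',
      H a = H' a, H b = H' b & forall x, a < x < b -> h x = h' x]) ->
  \int[@lebesgue_measure R]_(x in `]a, b]) h x = H b - H a.
Proof.
move=> ab mh hM gap; elim/(@gap_ind R P): a b / ab => [a b ab /(gap _ _ ab)|a p b ap pb pP Q1 Q2].
  move=> [H' [h' [HD ch -> -> hh]]].
  by apply: Rintegral_gap => //; exact: ltW.
rewrite (@Rintegral_split R h a p b (ltW ap) (ltW pb)); last exact: integrable_bounded_itv hM.
by rewrite Q1 Q2; ring.
Qed.

(** Between breakpoints [U] contains a gap or misses it, and a contained gap contributes a
    difference of values of [H] at its ends. A breakpoint is the end of at most two gaps, hence the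
    factor 2. *)
Lemma boundary_bound1 {R : realType} (U : set R) (H h : R -> R) (P : seq R) (M a b : R) : a < b ->
  open U -> (forall x, closure U x -> U x \/ x \in P) ->
  (forall x : R, is_derive x 1 H (h x)) -> continuous h -> (forall x, U x -> `|h x| <= M) ->
  ~ closure U a -> ~ closure U b ->
  `|\int[@lebesgue_measure R]_(x in `]a, b]) (h x * \1_U x)| <= 2 * \sum_(p <- P) `|H p|.
Proof.
move=> ab oU UP HD ch hM na nb.
(* The bound that survives the induction counts the ends [a], [b] once and the inner breakpoints
   twice. [Ht] vanishes off the closure of [U], so that the outermost ends disappear at the
   conclusion. *)
pose Ht (x : R) : R := if `[< closure U x >] then `|H x| else 0.
have Ht0 x : 0 <= Ht x by rewrite /Ht; case: ifP.
have mh : measurable_fun (setT : set (measurableTypeR R)) (fun x => h x * \1_U x).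
  apply: measurable_funM; first exact: continuous_measurable_fun.
  by apply: measurable_indic; exact: open_measurable.
have bh x : `|h x * \1_U x| <= `|M|.
  rewrite indicE; case: (pselect (U x)) => Ux.
    by rewrite mem_set // mulr1; apply: le_trans (hM _ Ux) (ler_norm _).
  by rewrite memNset // mulr0 normr0.
suff : `|\int[@lebesgue_measure R]_(x in `]a, b]) (h x * \1_U x)| <=
   Ht a + Ht b + 2 * \sum_(p <- P | a < p < b) Ht p.
  move/le_trans; apply; rewrite {1 2}/Ht !asboolF // !add0r ler_pM2l //.
  rewrite big_mkcond; apply: ler_sum => p _; rewrite /Ht.
  by case: ifP => // _; case: ifP.
clear na nb; elim/(@gap_ind R P): a b / ab => [a b ab nP|a p b ap pb pP Q1 Q2].
  have sum0 : 0 <= 2 * \sum_(p <- P | a < p < b) Ht p by rewrite mulr_ge0 // sumr_ge0.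
  have gp x : a < x < b -> closure U x -> U x by move=> abx /UP[//|/nP]; rewrite abx.
  have [sub|dis] := interval_sub_or_disjoint oU gp.
  - have Uab : closure U a /\ closure U b.
      have cl := closure_subset sub.
      by split; apply: cl; apply: closure_itv => //; rewrite lexx ltW.
    rewrite (@Rintegral_gap R _ h H) //; last first.
    + by move=> x abx; rewrite indicE mem_set ?mulr1 //; apply: sub; rewrite /= in_itv.
    + exact: ltW.
    rewrite /Ht !asboolT; [|exact: Uab.2|exact: Uab.1].
    by apply: le_trans (ler_normB _ _) _; lra.
  rewrite (@Rintegral_gap R _ (fun=> 0) (fun=> 0)) //.
  - by rewrite subrr normr0 !addr_ge0.
  - exact: ltW.
  - by move=> x; exact: cvg_cst.
  - by move=> x abx; rewrite indicE memNset ?mulr0 //; exact: dis.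
rewrite (@Rintegral_split R _ a p b (ltW ap) (ltW pb)); last exact: integrable_bounded_itv bh.
apply: le_trans (ler_normD _ _) _; apply: le_trans (lerD Q1 Q2) _.
(* [Ht p] occurs as an end of both halves. The sum over the whole interval contains [p] at least
   once, and it carries the factor 2. *)
suff : \sum_(q <- P | a < q < p) Ht q + \sum_(q <- P | p < q < b) Ht q + Ht p <= \sum_(q <- P | a < q < b) Ht q by lra.
have -> : \sum_(q <- P | a < q < b) Ht q = \sum_(q <- P | a < q < p) Ht q + \sum_(q <- P | p < q < b) Ht q
   + \sum_(q <- P | q == p) Ht q.
  rewrite [LHS]big_mkcond [X in _ = X + _ + _]big_mkcond [X in _ = _ + X + _]big_mkcond [X in _ = _ + X]big_mkcond.
  rewrite -big_split -big_split /=; apply: eq_bigr => q _.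
  have [qp|qp|qp] := ltgtP q p.
  - by rewrite (lt_trans qp pb) ?andbT ?andbF /= !addr0.
  - by rewrite (lt_trans ap qp) ?andbT ?andbF /= !addr0 add0r.
  - by rewrite qp ap pb ?ltxx ?andbT ?andbF /= !add0r.
rewrite lerD2l (eq_bigr (fun=> Ht p)); last by move=> q /eqP ->.
rewrite big_const_seq iter_addr addr0.
have c1 : (0 < count (fun q => q == p) P)%N by rewrite -has_count; apply/hasP; exists p.
by rewrite -(prednK c1) mulrS lerDl mulrn_wge0.
Qed.

Section slice_green.
Context {R : realType} (n : nat) (a b : 'I_n -> R * R) (K : set (R * R)) (f F : R * R -> R).
Local Notation mu := (@lebesgue_measure R).

(** [tt i y] is the parameter at which the line through the edge [i] reaches height [y]. For a
    horizontal edge it is a division by zero, which [on] rules out, so that [cc] vanishes there. *)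
Let dy i : R := (b i).2 - (a i).2.
Let tt i (y : R) : R := (y - (a i).2) / dy i.
Let on i (y : R) : bool := (dy i != 0) && (0 <= tt i y <= 1).
Let cc i (y : R) : R := if on i y then `|F (segpath (a i) (b i) (tt i y))| else 0.

Let ccE i (y : R) : dy i != 0 -> forall t, y = (a i).2 + dy i * t -> cc i y = (`|F (segpath (a i) (b i) t)|) * \1_unit_itv t.
Proof.
move=> d0 t yE; have tE : tt i y = t by rewrite /tt yE; field.
rewrite /cc /on d0 tE /= indicE /unit_itv; case: ifPn => t01.
  by rewrite mem_set ?mulr1 // /= in_itv.
by rewrite memNset ?mulr0 // /= in_itv /=; apply/negP.
Qed.

Context (cF : continuous F).

Let cFs i : continuous (fun t => `|F (segpath (a i) (b i) t)|).
Proof.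
move=> t; apply: cvg_norm; apply: (@continuous_comp _ _ _ (segpath (a i) (b i)) F); last exact: cF.
exact: continuous_segpath.
Qed.

Let mind : measurable_fun (setT : set (measurableTypeR R)) (\1_(@unit_itv R) : R -> R).
Proof. by apply: measurable_indic; exact: measurable_unit. Qed.

Let mcc i : measurable_fun (setT : set (measurableTypeR R)) (cc i).
Proof.
have [d0|d0] := eqVneq (dy i) 0.
  have -> : cc i = fun=> 0 by apply/funext => y; rewrite /cc /on d0 eqxx.
  exact: measurable_cst.
have -> : cc i = (fun t => (`|F (segpath (a i) (b i) t)|) * \1_unit_itv t) \o (fun y : R => - (a i).2 / dy i + (dy i)^-1 * y).
  by apply/funext => y /=; apply: ccE => //; field.
apply: (@measurableT_comp _ _ _ (measurableTypeR R) (measurableTypeR R) _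
  (fun t : measurableTypeR R => (`|F (segpath (a i) (b i) t)|) * \1_unit_itv t)).
  by apply: measurable_funM => //; apply: continuous_measurable_fun; exact: cFs.
exact: measurable_affine.
Qed.

Let cc0 i y : 0 <= cc i y.
Proof. by rewrite /cc; case: ifP. Qed.

Let int_cc i : (\int[mu]_y (cc i y)%:E =
  (`|dy i| * \int[mu]_(t in unit_itv) `|F (segpath (a i) (b i) t)|)%:E)%E.
Proof.
have [d0|d0] := eqVneq (dy i) 0.
  rewrite d0 normr0 mul0r; apply: integral0_eq => y _.
  by rewrite /cc /on d0 eqxx.
rewrite (@ge0_integral_affine R (a i).2 (dy i)) //.
- rewrite EFinM; congr (_ * _)%E.
  rewrite /Rintegral fineK; last first.
    apply: integrable_fin_num => //; first exact: measurable_unit.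
    apply: continuous_compact_integrable; first exact: segment_compact.
    exact: continuous_subspaceT.
  rewrite [RHS]integral_mkcond; apply: eq_integral => t _.
  rewrite (ccE d0 (erefl _)) patchE indicE; case: ifPn => _; by rewrite ?mulr1 ?mulr0.
- by apply/measurable_EFinP; exact: mcc.
- by move=> y; rewrite lee_fin.
Qed.

Context (mK : measurable (K : set (plane R))) (bK : bounded_set K) (cf : continuous f).
Context (FD : forall s t : R, is_derive s 1 (fun s : R => F (s, t)) (f (s, t))).
Context (oK : forall y : R, open [set x | K (x, y)]).
Context (clK : forall x y : R, closure [set x | K (x, y)] x ->
  K (x, y) \/ exists i, segment (a i) (b i) (x, y)).

(** A horizontal edge meets only the line at the height of its first endpoint. Off these finitely
    many heights every line meets every edge at most once, in a point of [pts]. *)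
Let bad : seq R := [seq (a i).2 | i <- enum 'I_n].
Let pts (y : R) : seq R := [seq (segpath (a i) (b i) (tt i y)).1 | i <- enum 'I_n & on i y].

Let pts_sum y : \sum_(p <- pts y) `|F (p, y)| = \sum_(i < n) cc i y.
Proof.
rewrite /pts big_map big_filter big_enum_cond /= big_mkcond /=; apply: eq_bigr => i _.
rewrite /cc; case: ifPn => // /andP[d0 _]; congr (`|F _|).
rewrite [RHS](surjective_pairing _); congr (_, _).
rewrite [RHS](_ : _ = (a i).2 + tt i y * dy i) // /tt; field.
by [].
Qed.

Let slice_bound y : y \notin bad -> exists2 r : R, `|r| <= 2 * \sum_(i < n) cc i y &
  (\int[mu]_x ((f \_ K) (x, y))%:E = r%:E)%E.
Proof.
move=> yb; rewrite -pts_sum.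
have [B B0 KB] := bounded_in_box bK.
have [M M0 HM] := continuous_bounded_on bK cf.
pose U := [set x | K (x, y)].
pose r := \int[mu]_(x in `](- B - 1), (B + 1)]) (f (x, y) * \1_U x).
exists r.
  have cl x : closure U x -> - B <= x <= B.
    have : closure U `<=` `[- B, B]%classic.
      have -> : `[- B, B]%classic = closure `[- B, B]%classic.
        by apply/closure_id; exact: itv_closed.
      by apply: closure_subset => s /KB[/=].
    by move=> sub /sub; rewrite /= in_itv.
  apply: (@boundary_bound1 R U (fun x => F (x, y)) (fun x => f (x, y)) _ M) => //.
  - lra.
  - exact: oK.
  - move=> x /clK[?|[i [t t01 xyE]]]; [by left|right].
    move: t01; rewrite /= in_itv /= => t01.
    have y2 : y = (a i).2 + t * dy i by have := congr1 snd xyE.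
    have x2 : x = (segpath (a i) (b i) t).1 by have := congr1 fst xyE.
    have d0 : dy i != 0.
      apply: contraNneq yb => d0; apply/mapP; exists i; first by rewrite mem_enum.
      by rewrite y2 d0 mulr0 addr0.
    have tE : tt i y = t by rewrite /tt y2; field.
    apply/mapP; exists i; last by rewrite tE.
    by rewrite mem_filter mem_enum andbT /on d0 tE.
  - move=> x; apply: (@continuous_comp _ _ _ (fun s : R => (s, y)) f); last exact: cf.
    by apply: continuous_pair => ?; [exact: cvg_id|exact: cvg_cst].
  - by move=> x Ux; exact: HM.
  - by move=> /cl /andP[]; lra.
  - by move=> /cl /andP[]; lra.
have mh : measurable_fun (setT : set (measurableTypeR R)) (fun x => f (x, y) * \1_U x).
  apply: measurable_funM.
    apply: continuous_measurable_fun => x.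
    apply: (@continuous_comp _ _ _ (fun s : R => (s, y)) f); last exact: cf.
    by apply: continuous_pair => ?; [exact: cvg_id|exact: cvg_cst].
  by apply: measurable_indic; apply: open_measurable; exact: oK.
have bh x : `|f (x, y) * \1_U x| <= M.
  rewrite indicE; case: (pselect (U x)) => Ux; first by rewrite mem_set // mulr1; exact: HM.
  by rewrite memNset // mulr0 normr0.
rewrite /r /Rintegral fineK; last first.
  apply: integrable_fin_num => //; exact: integrable_bounded_itv bh.
rewrite [RHS]integral_mkcond; apply: eq_integral => x _; rewrite !patchE indicE.
case: (pselect (K (x, y))) => Kx; last first.
  rewrite memNset // [x \in U]memNset // mulr0; by case: ifP.
rewrite mem_set // [x \in U]mem_set // mulr1 ifT //.
rewrite inE /= in_itv /=; have [/=] := KB _ Kx; rewrite !in_itv /= => /andP[? ?] _.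
by apply/andP; split; lra.
Qed.

(** On each horizontal line the integral of [f] over a component of the slice of [K] is a difference of two boundary values
    of [F]; no outward normal is needed. *)
Lemma slice_green :
  `|\int[area]_(x in (K : set (plane R))) f x| <=
  2 * \sum_(i < n) `|(b i).2 - (a i).2| * \int[mu]_(t in unit_itv) `|F (segpath (a i) (b i) t)|.
Proof.
have fi := integrable_continuous mK bK cf.
have fi' : area.-integrable (setT : set (plane R)) (EFin \o (f \_ K)).
  by rewrite -restrict_EFin; apply/(integrable_mkcond _ _).1.
have sumE : (\int[mu]_y (2 * \sum_(i < n) cc i y)%:E =
  (2 * \sum_(i < n) `|dy i| * \int[mu]_(t in unit_itv) `|F (segpath (a i) (b i) t)|)%:E)%E.
  under eq_integral do rewrite EFinM -sumEFin.
  rewrite ge0_integralZl_EFin //; last 2 first.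
  - by move=> y _; apply: sume_ge0 => i _; rewrite lee_fin.
  - by apply: emeasurable_sum => i; apply/measurable_EFinP; exact: mcc.
  rewrite ge0_integral_sum //; last 2 first.
  - by move=> i; apply/measurable_EFinP; exact: mcc.
  - by move=> i y _; rewrite lee_fin.
  by rewrite EFinM -sumEFin; congr (_ * _)%E; apply: eq_bigr => i _; exact: int_cc.
rewrite -lee_fin -sumE EFin_normr_Rintegral //.
have -> : (\int[area]_(x in (K : set (plane R))) (f x)%:E = \int[area]_x ((f \_ K) x)%:E)%E.
  by rewrite integral_mkcond restrict_EFin.
have mG := measurable_fubini_G fi'.
rewrite -(integral21_prod_meas1 fi').
apply: le_trans (le_abse_integral _ measurableT mG) _.
apply: ae_ge0_le_integral => //.
- exact: measurableT_comp.
- by move=> y _; rewrite lee_fin mulr_ge0 // sumr_ge0.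
- apply/measurable_EFinP; apply: measurable_funM => //; apply: measurable_sum => i; exact: mcc.
exists [set` bad]; split.
- apply: countable_measurable; first exact: measurable_set1.
  exact/finite_set_countable/finite_seq.
- exact/countable_lebesgue_measure0/finite_set_countable/finite_seq.
move=> y /=; apply: contra_notP => /negP yb _.
by have [r rb rE] := slice_bound yb; rewrite /fubini_G rE lee_fin.
Qed.

End slice_green.

Definition swap {R : realType} (x : R * R) : R * R := (x.2, x.1).

Lemma continuous_swap {R : realType} : continuous (@swap R).
Proof. by apply: continuous_pair => x; [exact: cvg_snd|exact: cvg_fst]. Qed.

Lemma Rintegral_swap {R : realType} (K : set (R * R)) (f : R * R -> R) :
  measurable (K : set (plane R)) -> bounded_set K -> continuous f ->
  \int[area]_(x in (K : set (plane R))) f x =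
  \int[area]_(x in (swap @^-1` K : set (plane R))) f (swap x).
Proof.
move=> mK bK cf.
pose a : R * R := (0, 0); pose b : R * R := (0, 1); pose c : R * R := (1, 0).
have D : cross a b c = -1 by rewrite /cross /=; ring.
have fi := integrable_continuous mK bK cf.
rewrite Rintegral_mkcond [RHS]Rintegral_mkcond (@Rintegral_amap _ a b c).
- rewrite D normrN normr1 mul1r; apply: eq_Rintegral => x _.
  rewrite !patchE; have -> : amap a b c x = swap x by rewrite /amap /swap /=; congr (_, _); ring.
  by congr (if _ then _ else _); apply/idP/idP; rewrite !inE.
- by rewrite D oppr_eq0 oner_eq0.
by rewrite -restrict_EFin; apply/(integrable_mkcond _ _).1.
Qed.

(** The second estimate is the first one for the configuration with exchanged coordinates. *)
Lemma boundary_green {R : realType} (n : nat) (a b : 'I_n -> R * R) (K : set (R * R)) (F : R * R -> R) :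
  open K -> bounded_set K -> (forall x, closure K x -> K x \/ exists i, segment (a i) (b i) x) ->
  smooth F ->
  `|\int[area]_(x in (K : set (plane R))) pd1 F x| <=
    2 * \sum_(i < n) `|(b i).2 - (a i).2| * \int[@lebesgue_measure R]_(t in unit_itv) `|F (segpath (a i) (b i) t)| /\
  `|\int[area]_(x in (K : set (plane R))) pd2 F x| <=
    2 * \sum_(i < n) `|(b i).1 - (a i).1| * \int[@lebesgue_measure R]_(t in unit_itv) `|F (segpath (a i) (b i) t)|.
Proof.
move=> oK bK clK sF.
have mK := open_measurable_plane oK.
have cF := smooth_continuous sF.
have cF1 := smooth_continuous (smooth_pd1 sF); have cF2 := smooth_continuous (smooth_pd2 sF).
split.
  apply: slice_green => //.
  - by move=> s t; exact: is_derive_slice1.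
  - move=> y; apply: (@open_comp _ _ (fun x : R => (x, y)) K) => // x _.
    by apply: continuous_pair => ?; [exact: cvg_id|exact: cvg_cst].
  - move=> x y H; apply: clK => B nB.
    have : nbhs x [set s | B (s, y)].
      apply: (_ : continuous (fun s : R => (s, y))); last exact: nB.
      by apply: continuous_pair => ?; [exact: cvg_id|exact: cvg_cst].
    by move=> /H[s [/= Ks Bs]]; exists (s, y).
rewrite Rintegral_swap //.
pose a' i := swap (a i); pose b' i := swap (b i).
have segE i t : swap (segpath (a' i) (b' i) t) = segpath (a i) (b i) t by [].
have -> : \sum_(i < n) `|(b i).1 - (a i).1| * \int[@lebesgue_measure R]_(t in unit_itv) `|F (segpath (a i) (b i) t)|
 = \sum_(i < n) `|(b' i).2 - (a' i).2| * \int[@lebesgue_measure R]_(t in unit_itv) `|(F \o swap) (segpath (a' i) (b' i) t)| by [].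
apply: (@slice_green R n a' b' (swap @^-1` K) (pd2 F \o swap) (F \o swap)).
- by move=> x; apply: continuous_comp; [exact: continuous_swap|exact: cF].
- by apply: open_measurable_plane; apply: open_comp => // x _; exact: continuous_swap.
- have [B B0 KB] := bounded_in_box bK.
  by apply: bounded_subset (box_bounded B) => x /KB[].
- by move=> x; apply: continuous_comp; [exact: continuous_swap|exact: cF2].
- by move=> s t; exact: is_derive_slice2.
- move=> y; apply: (@open_comp _ _ (fun x : R => (y, x)) K) => // x _.
  by apply: continuous_pair => ?; [exact: cvg_cst|exact: cvg_id].
- move=> x y H.
  have /clK[|[i [t t01 E]]] : closure K (y, x).
    move=> B nB.
    have : nbhs x [set s | B (y, s)].
      apply: (_ : continuous (fun s : R => (y, s))); last exact: nB.
      by apply: continuous_pair => ?; [exact: cvg_cst|exact: cvg_id].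
    by move=> /H[s [/= Ks Bs]]; exists (y, s).
  + by left.
  + by right; exists i, t => //; rewrite -[LHS]/(swap (segpath (a i) (b i) t)) E.
Qed.

Lemma L1_le_nrm_unit {R : realType} (h : R -> R) : sqint (@lebesgue_measure R) unit_itv h ->
  \int[@lebesgue_measure R]_(t in unit_itv) `|h t| <= nrm (@lebesgue_measure R) unit_itv h.
Proof.
move=> hi.
have si1 : sqint (@lebesgue_measure R) unit_itv (fun=> 1) by apply: sqint_unit_continuous => t; exact: cvg_cst.
have sih : sqint (@lebesgue_measure R) unit_itv (fun t => `|h t|).
  split; first by apply: measurableT_comp => //; case: hi.
  by case: hi => _; under eq_integral do rewrite -real_normK ?num_real //.
have := cauchy_schwarz measurable_unit sih si1.
have n1 : nrm (@lebesgue_measure R) unit_itv (fun=> 1) = 1.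
  by rewrite /nrm /ip Rintegral_unit_cst mulr1 sqrtr1.
have -> : ip (@lebesgue_measure R) unit_itv (fun t => `|h t|) (fun=> 1) = \int[@lebesgue_measure R]_(t in unit_itv) `|h t|.
  by apply: eq_Rintegral => t _; rewrite mulr1.
have -> : nrm (@lebesgue_measure R) unit_itv (fun t => `|h t|) = nrm (@lebesgue_measure R) unit_itv h.
  by congr Num.sqrt; apply: eq_Rintegral => t _; rewrite -normrM ger0_norm // -expr2 sqr_ge0.
by rewrite n1 mulr1; apply: le_trans; exact: ler_norm.
Qed.

Lemma coord_le_eucl {R : realType} (a b : R * R) :
  `|b.1 - a.1| <= eucl_dist a b /\ `|b.2 - a.2| <= eucl_dist a b.
Proof.
by split; rewrite distrC -sqrtr_sqr ler_wsqrtr //= ?lerDl ?lerDr sqr_ge0.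
Qed.

(** Applied to [phi i * q1] and [phi i * q2], with [phi i] split on the boundary as
    [(phi i - g) + g]: the first part tends to 0 in norm and the second is at most [Mg]. Each of the
    two components of the field contributes a factor 2. *)
Lemma boundary_green_trace {R : realType} (n : nat) (a b : 'I_n -> R * R) (K : set (R * R))
    (v g : R * R -> R) G phi (q1 q2 : R * R -> R) (Mg Mq : R) :
  open K -> bounded_set K -> (forall x, closure K x -> K x \/ exists i, segment (a i) (b i) x) ->
  h1approx K v G phi -> (forall i, approx_edge phi g (a i) (b i)) ->
  smooth q1 -> smooth q2 ->
  0 <= Mg -> (forall i t, 0 <= t <= 1 -> `|g (segpath (a i) (b i) t)| <= Mg) ->
  0 <= Mq -> (forall i t, 0 <= t <= 1 -> `|q1 (segpath (a i) (b i) t)| <= Mq) ->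
  (forall i t, 0 <= t <= 1 -> `|q2 (segpath (a i) (b i) t)| <= Mq) ->
  `|ip area (K : set (plane R)) (fun x => (G x).1) q1 + ip area (K : set (plane R)) (fun x => (G x).2) q2
    + ip area (K : set (plane R)) v (fun x => pd1 q1 x + pd2 q2 x)| <=
  4 * (\sum_(i < n) eucl_dist (a i) (b i)) * Mg * Mq.
Proof.
move=> oK bK clK [wG sphi c0 c1 c2] ce sq1 sq2 Mg0 HMg Mq0 HM1 HM2.
pose S : set (plane R) := K; rewrite -/S.
have mK := open_measurable_plane oK.
have [/L2fun_sqint vi /L2fun_sqint G1 /L2fun_sqint G2 _] := wG.
have si (h : R * R -> R) : smooth h -> sqint area S h.
  by move=> sh; apply: sqint_continuous => //; exact: smooth_continuous.
pose N i j := nrm (@lebesgue_measure R) unit_itv (fun t => phi i (segpath (a j) (b j) t) - g (segpath (a j) (b j) t)).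
have cphi i j : continuous (fun t => phi i (segpath (a j) (b j) t)).
  move=> t; apply: (@continuous_comp _ _ _ (segpath (a j) (b j)) (phi i)); first exact: continuous_segpath.
  exact: smooth_continuous.
have edge_int i j (q : R * R -> R) : smooth q -> (forall t, 0 <= t <= 1 -> `|q (segpath (a j) (b j) t)| <= Mq) ->
  \int[@lebesgue_measure R]_(t in unit_itv) `|phi i (segpath (a j) (b j) t) * q (segpath (a j) (b j) t)| <=
   (N i j + Mg) * Mq.
  move=> sq Hq.
  have [gi _] := ce j.
  have hi : sqint (@lebesgue_measure R) unit_itv (fun t => phi i (segpath (a j) (b j) t) - g (segpath (a j) (b j) t)).
    by apply: sqintB => //; [exact: measurable_unit|exact: sqint_unit_continuous].
  have si1 : sqint (@lebesgue_measure R) unit_itv (fun=> 1) by apply: sqint_unit_continuous => t; exact: cvg_cst.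
  have iabs : (@lebesgue_measure R).-integrable unit_itv
     (EFin \o (fun t => `|phi i (segpath (a j) (b j) t) - g (segpath (a j) (b j) t)|)).
    have := sqint_integrableM measurable_unit hi si1.
    move/(integrable_norm); apply: eq_integrable => // [|t _ /=]; last by rewrite mulr1.
    exact: measurable_unit.
  have icst (k : R) : (@lebesgue_measure R).-integrable unit_itv (EFin \o (fun=> k)).
    apply: continuous_compact_integrable; first exact: segment_compact.
    by apply: continuous_subspaceT => t; exact: cvg_cst.
  have isum : (@lebesgue_measure R).-integrable unit_itv
     (EFin \o (fun t => `|phi i (segpath (a j) (b j) t) - g (segpath (a j) (b j) t)| + Mg)).
    have := integrableD measurable_unit iabs (icst Mg).
    by apply: eq_integrable => //; exact: measurable_unit.
  apply: (@le_trans _ _ (\int[@lebesgue_measure R]_(t in unit_itv)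
     (Mq * (`|phi i (segpath (a j) (b j) t) - g (segpath (a j) (b j) t)| + Mg)))).
    apply: le_Rintegral.
    - exact: measurable_unit.
    - apply: continuous_compact_integrable; first exact: segment_compact.
      apply: continuous_subspaceT => t; apply: cvg_norm; apply: cvgM; first exact: cphi.
      apply: (@continuous_comp _ _ _ (segpath (a j) (b j)) q); first exact: continuous_segpath.
      exact: smooth_continuous.
    - apply: (@eq_integrable _ _ _ _ _ measurable_unit
        (fun t => (Mq%:E * (EFin (`|phi i (segpath (a j) (b j) t) - g (segpath (a j) (b j) t)|)%R + EFin Mg))%E)).
        by move=> t _.
      apply: integrableZl; first exact: measurable_unit.
      by apply: integrableD; [exact: measurable_unit|exact: iabs|exact: icst].
    - move=> t; rewrite /unit_itv /= in_itv /= => t01.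
      rewrite normrM mulrC; apply: ler_pM => //; first exact: Hq.
      have -> : phi i (segpath (a j) (b j) t) = (phi i (segpath (a j) (b j) t) - g (segpath (a j) (b j) t)) + g (segpath (a j) (b j) t) by ring.
      by apply: le_trans (ler_normD _ _) _; rewrite subrK lerD2l HMg.
  have mU := @measurable_unit R.
  rewrite RintegralZl //.
  rewrite RintegralD //.
  rewrite Rintegral_unit_cst mulrC ler_wpM2r // lerD2r.
  exact: L1_le_nrm_unit hi.
have B i : `|ip area S (pd1 (phi i)) q1 + ip area S (pd2 (phi i)) q2
    + ip area S (phi i) (fun x => pd1 q1 x + pd2 q2 x)| <=
    4 * \sum_(j < n) eucl_dist (a j) (b j) * ((N i j + Mg) * Mq).
  have [H1 _] := boundary_green oK bK clK (smoothM (sphi i) sq1).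
  have [_ H2] := boundary_green oK bK clK (smoothM (sphi i) sq2).
  have -> : ip area S (pd1 (phi i)) q1 + ip area S (pd2 (phi i)) q2
    + ip area S (phi i) (fun x => pd1 q1 x + pd2 q2 x) =
    \int[area]_(x in S) pd1 (fun x => phi i x * q1 x) x + \int[area]_(x in S) pd2 (fun x => phi i x * q2 x) x.
    have sp := sphi i; have s1 := smooth_pd1 sp; have s2 := smooth_pd2 sp.
    have t1 := smooth_pd1 sq1.
    have iM (f1 f2 : R * R -> R) : smooth f1 -> smooth f2 ->
        (@area R).-integrable S (EFin \o (fun x => f1 x * f2 x)).
      by move=> h1 h2; apply: sqint_integrableM; [exact mK|exact: si|exact: si].
    rewrite (ipDr mK (si _ t1) (si _ (smooth_pd2 sq2)) (si _ sp)) (pd1M sp sq1) (pd2M sp sq2) /ip.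
    rewrite (RintegralD mK (iM _ _ sp t1) (iM _ _ sq1 s1)).
    rewrite (RintegralD mK (iM _ _ sp (smooth_pd2 sq2)) (iM _ _ sq2 s2)).
    have E (f1 f2 : R * R -> R) : \int[area]_(x in S) (f1 x * f2 x) = \int[area]_(x in S) (f2 x * f1 x).
      by apply: eq_Rintegral => x _; rewrite mulrC.
    rewrite (E q1) (E q2) addrACA.
    by congr (_ + _); rewrite addrC.
  apply: le_trans (ler_normD _ _) _.
  have -> : (4 : R) = 2 + 2 by ring.
  rewrite mulrDl; apply: lerD.
    apply: le_trans H1 _; rewrite ler_pM2l //; apply: ler_sum => j _.
    apply: ler_pM => //; first by apply: Rintegral_ge0.
      by have [] := coord_le_eucl (a j) (b j).
    by apply: edge_int => //; exact: HM1.
  apply: le_trans H2 _; rewrite ler_pM2l //; apply: ler_sum => j _.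
  apply: ler_pM => //; first by apply: Rintegral_ge0.
    by have [] := coord_le_eucl (a j) (b j).
  by apply: edge_int => //; exact: HM2.
have L : `|ip area S (pd1 (phi i)) q1 + ip area S (pd2 (phi i)) q2
    + ip area S (phi i) (fun x => pd1 q1 x + pd2 q2 x)| @[i --> \oo] -->
   `|ip area S (fun x => (G x).1) q1 + ip area S (fun x => (G x).2) q2
    + ip area S v (fun x => pd1 q1 x + pd2 q2 x)|.
  apply: cvg_norm; apply: cvgD; first apply: cvgD.
  - by apply: ip_cvgl => //; [move=> i; apply: si; exact: smooth_pd1|exact: si].
  - by apply: ip_cvgl => //; [move=> i; apply: si; exact: smooth_pd2|exact: si].
  - apply: ip_cvgl => //; [by move=> i; exact: si|].
    by apply: si; apply: smoothD; [exact: smooth_pd1|exact: smooth_pd2].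
have L' : 4 * \sum_(j < n) eucl_dist (a j) (b j) * ((N i j + Mg) * Mq) @[i --> \oo] -->
   4 * \sum_(j < n) eucl_dist (a j) (b j) * ((0 + Mg) * Mq).
  apply: cvgM; first exact: cvg_cst.
  apply: cvg_big => [|j _]; first exact: add_continuous.
  apply: cvgM; first exact: cvg_cst.
  apply: cvgM; last exact: cvg_cst.
  by apply: cvgD; [exact: (ce j).2|exact: cvg_cst].
have -> : 4 * (\sum_(i < n) eucl_dist (a i) (b i)) * Mg * Mq =
  4 * \sum_(j < n) eucl_dist (a j) (b j) * ((0 + Mg) * Mq) by rewrite -mulr_suml add0r; ring.
apply: (ler_cvg_to L L'); exact: nearW.
Qed.

(** * The Poincare inequality on star-shaped sets *)

Lemma ge0_integral_exchange {d1 d2} {T1 : measurableType d1} {T2 : measurableType d2} {R : realType}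
    (m1 : {sigma_finite_measure set T1 -> \bar R}) (m2 : {sigma_finite_measure set T2 -> \bar R})
    (A : set T1) (B : set T2) (f : T1 * T2 -> \bar R) :
  measurable A -> measurable B -> measurable_fun setT f -> (forall x, 0 <= f x)%E ->
  (\int[m1]_(x in A) \int[m2]_(y in B) f (x, y) = \int[m2]_(y in B) \int[m1]_(x in A) f (x, y))%E.
Proof.
move=> mA mB mf f0; pose g := f \_ (A `*` B).
have mg : measurable_fun setT g.
  by apply/(measurable_restrictT _ _).1; [exact: measurableX|exact: measurable_funTS].
have g0 x : (0 <= g x)%E by rewrite /g patchE; case: ifP.
rewrite integral_mkcond [RHS]integral_mkcond.
transitivity (\int[m1]_x \int[m2]_y g (x, y))%E.
  apply: eq_integral => x _; rewrite patchE; case: ifPn => xA.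
    rewrite integral_mkcond; apply: eq_integral => y _; rewrite /g !patchE.
    by congr (if _ then _ else _); apply/idP/idP; rewrite !inE /= ; [split => //; exact: set_mem|case].
  rewrite -[LHS](integral0 m2 setT); apply: eq_integral => y _; rewrite /g patchE ifN //.
  by apply: contra xA; rewrite !inE => -[].
rewrite fubini_tonelli //; apply: eq_integral => y _; rewrite patchE; case: ifPn => yB.
  rewrite [RHS]integral_mkcond; apply: eq_integral => x _; rewrite /g !patchE.
  by congr (if _ then _ else _); apply/idP/idP; rewrite !inE /= ; [case|split => //; exact: set_mem].
rewrite -[RHS](integral0 m1 setT); apply: eq_integral => x _; rewrite /g patchE ifN //.
by apply: contra yB; rewrite !inE => -[].
Qed.

Definition mean {d} {X : measurableType d} {R : realType} (mu : {measure set X -> \bar R}) (S : set X)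
    (f : X -> R) : R := ip mu S f (fun=> 1) / ip mu S (fun=> 1) (fun=> 1).

Lemma measurable_integral_on {d1 d2} {T1 : measurableType d1} {T2 : measurableType d2} {R : realType}
    (m2 : {sigma_finite_measure set T2 -> \bar R}) (B : set T2) (f : T1 * T2 -> \bar R) :
  measurable B -> measurable_fun setT f -> (forall x, 0 <= f x)%E ->
  measurable_fun setT (fun x => \int[m2]_(y in B) f (x, y))%E.
Proof.
move=> mB mf f0; pose g := f \_ (setT `*` B).
have mg : measurable_fun setT g.
  by apply/(measurable_restrictT _ _).1; [exact: measurableX|exact: measurable_funTS].
have g0 x : (0 <= g x)%E by rewrite /g patchE; case: ifP.
have := @measurable_fun_fubini_tonelli_F _ _ _ _ _ m2 g mg g0.
rewrite /fubini_F (_ : (fun x => \int[m2]_y g (x, y))%E = (fun x => \int[m2]_(y in B) f (x, y))%E) //.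
apply/funext => x; rewrite [RHS]integral_mkcond; apply: eq_integral => y _; rewrite /g !patchE.
by rewrite in_setX in_setT.
Qed.

(** The squared distance from [f] to the constant [k] is a quadratic polynomial in [k] whose minimum
    is at the mean. This allows the mean to be replaced by any convenient constant, such as a point
    value or the mean of an approximation. *)
Lemma mean_min {d} {X : measurableType d} {R : realType} (mu : {measure set X -> \bar R}) (S : set X)
    (f : X -> R) (c : R) :
  measurable S -> sqint mu S f -> sqint mu S (fun=> 1) -> ip mu S (fun=> 1) (fun=> 1) != 0 ->
  ip mu S (fun x => f x - mean mu S f) (fun x => f x - mean mu S f) <= ip mu S (fun x => f x - c) (fun x => f x - c).
Proof.
move=> mS fi oi o0; set m := mean mu S f.
have ci k : sqint mu S (fun=> k).
  have := sqintZ k mS oi; rewrite (_ : (fun x => k * 1) = fun=> k) //.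
  by apply/funext => x; rewrite mulr1.
have E k : ip mu S (fun x => f x - k) (fun x => f x - k) =
   ip mu S f f - 2 * k * ip mu S f (fun=> 1) + k ^+ 2 * ip mu S (fun=> 1) (fun=> 1).
  have K1 u : sqint mu S u -> ip mu S u (fun=> k) = k * ip mu S u (fun=> 1).
    move=> ui; rewrite ipC -(ipC _ _ (fun=> 1) u) -(ipZl k mS oi ui).
    by congr ip; apply/funext => x; rewrite mulr1.
  rewrite ipBl // ?ipBr //; last exact: sqintB.
  rewrite K1 // (ipC _ _ (fun=> k) f) K1 // K1 // (ipC _ _ (fun=> k) (fun=> 1)) K1 //; ring.
rewrite !E -subr_ge0.
have -> : ip mu S f (fun=> 1) = m * ip mu S (fun=> 1) (fun=> 1) by rewrite /m /mean divfK.
have -> : forall a b : R, a - 2 * c * (m * b) + c ^+ 2 * b - (a - 2 * m * (m * b) + m ^+ 2 * b) = (c - m) ^+ 2 * b.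
  by move=> a b; ring.
by rewrite mulr_ge0 // ?sqr_ge0 // ip_ge0.
Qed.

Lemma unit_integrable {R : realType} (f : R -> R) : continuous f ->
  (@lebesgue_measure R).-integrable unit_itv (EFin \o f).
Proof.
move=> cf; apply: continuous_compact_integrable; first exact: segment_compact.
exact: continuous_subspaceT.
Qed.

Lemma measurable_integral_on2 {d1 d2} {T1 : measurableType d1} {T2 : measurableType d2} {R : realType}
    (m1 : {sigma_finite_measure set T1 -> \bar R}) (A : set T1) (f : T1 * T2 -> \bar R) :
  measurable A -> measurable_fun setT f -> (forall x, 0 <= f x)%E ->
  measurable_fun setT (fun y => \int[m1]_(x in A) f (x, y))%E.
Proof.
move=> mA mf f0.
have mf' : measurable_fun setT (fun p : T2 * T1 => f (p.2, p.1)).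
  by apply: (measurableT_comp mf); exact: measurable_swap.
exact: (measurable_integral_on m1 mA mf').
Qed.

Definition grad2 {R : realType} (u : R * R -> R) (x : R * R) : R := pd1 u x * pd1 u x + pd2 u x * pd2 u x.

Lemma smooth_grad2 {R : realType} (u : R * R -> R) : smooth u -> smooth (grad2 u).
Proof.
move=> su; have s1 := smooth_pd1 su; have s2 := smooth_pd2 su.
by apply: smoothD; exact: smoothM.
Qed.

Lemma grad2_ge0 {R : realType} (u : R * R -> R) x : 0 <= grad2 u x.
Proof. by rewrite addr_ge0 // -expr2 sqr_ge0. Qed.

(** The fundamental theorem of calculus along the segment, then Cauchy-Schwarz twice: for the
    integral in [t], and for the product of [x - y] with the gradient. *)
Lemma sqr_diff_le_path {R : realType} (u : R * R -> R) (x y : R * R) (h : R) : smooth u ->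
  eucl_dist x y <= h ->
  (u x - u y) ^+ 2 <= h ^+ 2 * \int[@lebesgue_measure R]_(t in unit_itv) grad2 u (segpath y x t).
Proof.
move=> su xyh.
pose f t := (x.1 - y.1) * pd1 u (segpath y x t) + (x.2 - y.2) * pd2 u (segpath y x t).
have c1 : continuous (fun t => pd1 u (segpath y x t)).
  move=> t; apply: (@continuous_comp _ _ _ (segpath y x) (pd1 u)); first exact: continuous_segpath.
  by apply: smooth_continuous; exact: smooth_pd1.
have c2 : continuous (fun t => pd2 u (segpath y x t)).
  move=> t; apply: (@continuous_comp _ _ _ (segpath y x) (pd2 u)); first exact: continuous_segpath.
  by apply: smooth_continuous; exact: smooth_pd2.
have cg : continuous (fun t => grad2 u (segpath y x t)).
  move=> t; apply: (@continuous_comp _ _ _ (segpath y x) (grad2 u)); first exact: continuous_segpath.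
  by apply: smooth_continuous; exact: smooth_grad2.
have cf : continuous f.
  by move=> t; apply: cvgD; apply: cvgM; [exact: cvg_cst|exact: c1|exact: cvg_cst|exact: c2].
have D t : is_derive (t : R) 1 (fun t => u (segpath y x t)) (f t).
  apply/is_derive_lineP.
  have -> : (fun s : R => u (segpath y x (s *: (1 : R) + t))) = (fun s : R => u (s *: (x - y) + segpath y x t)).
    apply/funext => s; congr u; rewrite /segpath [s%:A]mulr1.
    by rewrite scalerDl addrCA.
  by apply/is_derive_lineP; apply: is_derive_eq (is_derive_smooth _ _ su) _.
have I0 : \int[@lebesgue_measure R]_(t in unit_itv) f t = u x - u y.
  rewrite /Rintegral (@FTC_segment R f _ 0 1 ler01 D cf) /=; congr (u _ - u _).
    by rewrite /segpath scale1r addrC subrK.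
  by rewrite /segpath scale0r addr0.
have sf := sqint_unit_continuous cf.
have L := L1_le_nrm_unit sf.
have A : `|u x - u y| <= nrm (@lebesgue_measure R) unit_itv f.
  rewrite -I0; apply: le_trans L; apply: le_normr_Rintegral; first exact: measurable_unit.
  exact: unit_integrable.
rewrite -real_normK ?num_real // (@le_trans _ _ (nrm (@lebesgue_measure R) unit_itv f ^+ 2)) //.
  by rewrite ler_sqr ?nnegrE ?nrm_ge0.
rewrite nrm_sqr -RintegralZl //; last 2 first.
- exact: measurable_unit.
- exact: unit_integrable cg.
apply: le_Rintegral.
- exact: measurable_unit.
- by apply: sqint_integrableM; first exact: measurable_unit.
- apply: unit_integrable => t; apply: cvgM; first exact: cvg_cst.
  by apply: cvgD; apply: cvgM; [exact: c1|exact: c1|exact: c2|exact: c2].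
move=> t _; rewrite -expr2 /f.
set a := pd1 _ _; set b := pd2 _ _.
apply: (@le_trans _ _ (((x.1 - y.1) ^+ 2 + (x.2 - y.2) ^+ 2) * (a ^+ 2 + b ^+ 2))).
  have := sqr_ge0 ((x.1 - y.1) * b - (x.2 - y.2) * a); rewrite -subr_ge0 -[in X in _ -> X]subr_ge0; nra.
apply: ler_wpM2r; first by rewrite addr_ge0 // sqr_ge0.
rewrite -[leLHS](@sqr_sqrtr _ _) ?addr_ge0 ?sqr_ge0 //.
have h0 : 0 <= h by apply: le_trans xyh; exact: eucl_norm_ge0.
by rewrite ler_sqr ?nnegrE ?sqrtr_ge0.
Qed.

Lemma area_sigma_finite {R : realType} : sigma_finite setT (@area R).
Proof.
exists (fun n => box n%:R).
  apply/seteqP; split => // x _.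
  exists (Num.truncn (Num.max `|x.1| `|x.2|)).+1 => //.
  have : Num.max `|x.1| `|x.2| < (Num.truncn (Num.max `|x.1| `|x.2|)).+1%:R by rewrite truncnS_gt.
  rewrite gt_max => /andP[/ltW a /ltW b].
  by split; rewrite /= in_itv /= -ler_norml.
by move=> n; split; [exact: measurable_box|exact: area_box_fin].
Qed.

(** [area] with the sigma-finite structure that Tonelli's theorem requires. *)
Definition sfarea {R : realType} : set (plane R) -> \bar R := @area R.
HB.instance Definition _ {R : realType} := Measure.copy (@sfarea R) (@area R).
HB.instance Definition _ {R : realType} :=
  Measure_isSigmaFinite.Build _ _ _ (@sfarea R) area_sigma_finite.

Lemma segpathE {R : realType} (a b : R * R) (t : R) :
  segpath a b t = (a.1 + t * (b.1 - a.1), a.2 + t * (b.2 - a.2)).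
Proof. by []. Qed.

Lemma half_le1 {R : realType} : 2^-1 <= 1 :> R.
Proof. lra. Qed.

Lemma half_ge0 {R : realType} : 0 <= 2^-1 :> R.
Proof. lra. Qed.

Section poincare.
Context {R : realType} (K Q : set (R * R)) (u : R * R -> R) (h : R).
Context (oK : open K) (mQ : measurable (Q : set (plane R))).
Context (QK : Q `<=` K) (su : smooth u).
Context (KQh : forall x y, K x -> Q y -> eucl_dist x y <= h).
Context (star : forall x y, K x -> Q y -> segment y x `<=` K).

Let E := grad2 u.
Let D : plane R -> R := E \_ K.
Let mK : measurable (K : set (plane R)) := open_measurable_plane oK.

Let E0 x : 0 <= E x.
Proof. exact: grad2_ge0. Qed.

Let D0 x : (0 <= (D x)%:E)%E.
Proof. by rewrite lee_fin /D patchE; case: ifP => // _; exact: E0. Qed.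

Let cE : continuous E := smooth_continuous (smooth_grad2 su).

Let mD : measurable_fun setT (fun x => (D x)%:E).
Proof.
apply/measurable_EFinP; apply: (@measurable_restrictT _ _ (plane R) R K E mK).1.
by apply: (measurable_funS measurableT) => //; exact: continuous_measurable_plane.
Qed.

Let Phi (p : (plane R * plane R) * measurableTypeR R) : \bar R := (D (segpath p.1.2 p.1.1 p.2))%:E.

Let mPhi : measurable_fun setT Phi.
Proof.
apply: (@measurableT_comp _ _ _ _ _ _ (fun x => (D x)%:E)) => [|]; first exact: mD.
have m1 : measurable_fun setT (fun p : (plane R * plane R) * measurableTypeR R => p.1.1).
  by apply: measurableT_comp => //; exact: measurable_fst.
have m2 : measurable_fun setT (fun p : (plane R * plane R) * measurableTypeR R => p.1.2).
  by apply: measurableT_comp => //; exact: measurable_fst.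
have m3 : measurable_fun setT (fun p : (plane R * plane R) * measurableTypeR R => p.2).
  exact: measurable_snd.
apply/measurable_fun_pairP; split => /=.
  apply: measurable_funD.
    by apply: measurableT_comp m2; exact: measurable_fst_plane.
  apply: measurable_funM => //; apply: measurable_funB.
    by apply: measurableT_comp m1; exact: measurable_fst_plane.
  by apply: measurableT_comp m2; exact: measurable_fst_plane.
apply: measurable_funD.
  by apply: measurableT_comp m2; exact: measurable_snd_plane.
apply: measurable_funM => //; apply: measurable_funB.
  by apply: measurableT_comp m1; exact: measurable_snd_plane.
by apply: measurableT_comp m2; exact: measurable_snd_plane.
Qed.

Let I : \bar R := (\int[area]_(x in (K : set (plane R))) (E x)%:E)%E.

Let IE : I = (\int[area]_x (D x)%:E)%E.
Proof. by rewrite /I integral_mkcond restrict_EFin. Qed.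

(** The map [x -> a + t x] has Jacobian [t ^+ 2 >= 1/4], which is the source of the factor 4. [D] is
    extended by zero, so the change of variables can be made on the whole plane. *)
Let scaled (a : R * R) (t : R) : 2^-1 <= t ->
  (\int[area]_x (D ((a.1 + t * x.1, a.2 + t * x.2) : R * R))%:E <= 4%:E * I)%E.
Proof.
move=> t2; have t0 : 0 < t by apply: lt_le_trans t2; rewrite invr_gt0.
pose b : R * R := (a.1 + t, a.2); pose c : R * R := (a.1, a.2 + t).
have cr : cross a b c = t ^+ 2 by rewrite /cross /=; ring.
have c0 : cross a b c != 0 by rewrite cr expf_neq0 // gt_eqF.
rewrite IE (@ge0_integral_amap _ a b c _ c0 mD D0) cr muleA -EFinM.
under [X in (_ <= _ * X)%E]eq_integral => x _.
  rewrite (_ : amap a b c x = ((a.1 + t * x.1, a.2 + t * x.2) : R * R)); last first.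
    by rewrite /amap /=; congr (_, _); ring.
  over.
rewrite -[leLHS]mul1e lee_pmul //; first exact: integral_ge0.
rewrite lee_fin ger0_norm ?sqr_ge0 //; nra.
Qed.

Let boundx (y : plane R) (t : R) : 2^-1 <= t -> (\int[area]_(x in (K : set (plane R))) Phi ((x, y), t) <= 4%:E * I)%E.
Proof.
move=> t2; apply: (@le_trans _ _ (\int[area]_x Phi ((x, y), t))%E).
  apply: ge0_subset_integral => //.
    exact: measurable_fun_pair1 y (measurable_fun_pair1 t mPhi).
  by move=> ? _; exact: D0.
apply: le_trans (scaled ((1 - t) * y.1, (1 - t) * y.2) t2).
rewrite le_eqVlt; apply/orP; left; apply/eqP; apply: eq_integral => x _.
by rewrite /Phi segpathE /=; congr (D (_, _))%:E; ring.
Qed.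

Let boundy (x : plane R) (t : R) : t <= 2^-1 -> (\int[area]_(y in (Q : set (plane R))) Phi ((x, y), t) <= 4%:E * I)%E.
Proof.
move=> t2; apply: (@le_trans _ _ (\int[area]_y Phi ((x, y), t))%E).
  apply: ge0_subset_integral => //.
    exact: measurable_fun_pair2 x (measurable_fun_pair1 t mPhi).
  by move=> ? _; exact: D0.
have t2' : 2^-1 <= 1 - t by lra.
apply: le_trans (scaled (t * x.1, t * x.2) t2').
rewrite le_eqVlt; apply/orP; left; apply/eqP; apply: eq_integral => y _.
by rewrite /Phi segpathE /=; congr (D (_, _))%:E; ring.
Qed.

Let Ha : set (measurableTypeR R) := `[0, 2^-1]%classic.
Let Hb : set (measurableTypeR R) := `]2^-1, 1]%classic.
Let mHa : measurable Ha. Proof. exact: measurable_itv. Qed.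
Let mHb : measurable Hb. Proof. exact: measurable_itv. Qed.
Let A p := (\int[@lebesgue_measure R]_(t in Ha) Phi (p, t))%E.
Let B p := (\int[@lebesgue_measure R]_(t in Hb) Phi (p, t))%E.

Let Phi0 p : (0 <= Phi p)%E. Proof. exact: D0. Qed.
Let mA : measurable_fun setT A. Proof. exact: measurable_integral_on. Qed.
Let mB : measurable_fun setT B. Proof. exact: measurable_integral_on. Qed.
Let A0 p : (0 <= A p)%E. Proof. exact: integral_ge0. Qed.
Let B0 p : (0 <= B p)%E. Proof. exact: integral_ge0. Qed.
Let I0 : (0 <= I)%E. Proof. by apply: integral_ge0 => x _; rewrite lee_fin. Qed.

Let half (S : set (measurableTypeR R)) : measurable S -> S `<=` unit_itv ->
  (\int[@lebesgue_measure R]_(t in S) (4%:E * I) <= 4%:E * I)%E.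
Proof.
move=> mS SU; apply: (@le_trans _ _ (\int[@lebesgue_measure R]_(t in unit_itv) (4%:E * I))%E).
  apply: ge0_subset_integral => //; first exact: measurable_unit.
  by move=> t _; rewrite mule_ge0.
rewrite integral_cst; last exact: measurable_unit.
have E1 : (@lebesgue_measure R unit_itv = 1)%E by exact: unit_measure.
by rewrite -[X in (_ <= X)%E]mule1 lee_wpmul2l ?mule_ge0 // -E1.
Qed.

Let AQ x : (\int[area]_(y in (Q : set (plane R))) A (x, y) <= 4%:E * I)%E.
Proof.
have mx : measurable_fun setT (fun p : plane R * measurableTypeR R => Phi ((x, p.1), p.2)).
  apply: (@measurableT_comp _ _ _ _ _ _ Phi) => //; apply: measurable_fun_pair; last exact: measurable_snd.
  by apply: measurable_fun_pair; [exact: measurable_cst|exact: measurable_fst].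
have -> : (\int[area]_(y in (Q : set (plane R))) A (x, y) =
    \int[@lebesgue_measure R]_(t in Ha) \int[area]_(y in (Q : set (plane R))) Phi ((x, y), t))%E.
  exact: (ge0_integral_exchange sfarea (@lebesgue_measure R) mQ mHa mx).
apply: le_trans (half mHa _); last first.
  by move=> t; rewrite /Ha /unit_itv /= !in_itv /= => /andP[-> t2]; rewrite (le_trans t2) // half_le1.
apply: ge0_le_integral => //.
- by move=> t _; exact: integral_ge0.
- apply: measurable_funTS.
  exact: (measurable_integral_on2 sfarea mQ mx).
- by move=> t; rewrite /Ha /= in_itv /= => /andP[_ t2]; exact: boundy.
Qed.

Let BK y : (\int[area]_(x in (K : set (plane R))) B (x, y) <= 4%:E * I)%E.
Proof.
have mx : measurable_fun setT (fun p : plane R * measurableTypeR R => Phi ((p.1, y), p.2)).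
  apply: (@measurableT_comp _ _ _ _ _ _ Phi) => //; apply: measurable_fun_pair; last exact: measurable_snd.
  by apply: measurable_fun_pair; [exact: measurable_fst|exact: measurable_cst].
have -> : (\int[area]_(x in (K : set (plane R))) B (x, y) =
    \int[@lebesgue_measure R]_(t in Hb) \int[area]_(x in (K : set (plane R))) Phi ((x, y), t))%E.
  exact: (ge0_integral_exchange sfarea (@lebesgue_measure R) mK mHb mx).
apply: le_trans (half mHb _); last first.
  by move=> t; rewrite /Hb /unit_itv /= !in_itv /= => /andP[t2 ->]; rewrite andbT (le_trans _ (ltW t2)) // half_ge0.
apply: ge0_le_integral => //.
- by move=> t _; exact: integral_ge0.
- apply: measurable_funTS.
  exact: (measurable_integral_on2 sfarea mK mx).
- by move=> t; rewrite /Hb /= in_itv /= => /andP[t2 _]; apply: boundx; exact: ltW.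
Qed.

Let path_bound x y : K x -> Q y ->
  (((u x - u y) ^+ 2)%:E <= (h ^+ 2)%:E * (A (x, y) + B (x, y)))%E.
Proof.
move=> Kx Qy.
have := sqr_diff_le_path su (KQh Kx Qy); rewrite -lee_fin => /le_trans; apply.
rewrite EFinM lee_wpmul2l ?lee_fin ?sqr_ge0 //.
have ci : (@lebesgue_measure R).-integrable unit_itv (EFin \o (fun t => grad2 u (segpath y x t))).
  apply: unit_integrable => t.
  by apply: (@continuous_comp _ _ _ (segpath y x) (grad2 u)); [exact: continuous_segpath|exact: cE].
rewrite fineK; last by apply: integrable_fin_num => //; exact: measurable_unit.
have -> : unit_itv = Ha `|` Hb.
  apply/seteqP; split => t; rewrite /unit_itv /Ha /Hb /= !in_itv /=.
    by move=> /andP[t0 t1]; case: (leP t 2^-1) => t2; [left; rewrite t0 |right; rewrite t1].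
  case=> /andP[t0 t1]; first by rewrite t0 (le_trans t1) // half_le1.
  by rewrite t1 (le_trans _ (ltW t0)) // half_ge0.
rewrite -ge0_integral_setU //; last 2 first.
- by apply: measurable_funTS; exact: measurable_fun_pair2.
- apply/disj_setPS => t [] /=; rewrite /Ha /Hb /= !in_itv /= => /andP[_ t1] /andP[t2 _].
  by have := lt_le_trans t2 t1; rewrite ltxx.
rewrite le_eqVlt; apply/orP; left; apply/eqP; apply: eq_integral => t.
rewrite inE => tH; congr EFin; rewrite /D patchE ifT // inE.
apply: (star Kx Qy); exists t => //=.
move: tH; rewrite /Ha /Hb /= !in_itv /= => -[]/andP[t0 t1]; first by rewrite t0 (le_trans t1) // half_le1.
by rewrite t1 (le_trans _ (ltW t0)) // half_ge0.
Qed.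

Let V := ip area (K : set (plane R)) (fun x => u x - mean area (K : set (plane R)) u) (fun x => u x - mean area (K : set (plane R)) u).

Context (bK : bounded_set K) (K0 : ip area (K : set (plane R)) (fun=> 1) (fun=> 1) != 0).

(** The mean of [u] is replaced by the value [u y]. The half [B] of the path can already be
    estimated by integration over [x]; the half [A] has to wait for the average over [y]. *)
Let Vy y : Q y -> (V%:E <= (h ^+ 2)%:E * (\int[area]_(x in (K : set (plane R))) A (x, y) + 4%:E * I))%E.
Proof.
move=> Qy; have cu := smooth_continuous su.
have si f : continuous f -> sqint area (K : set (plane R)) f by move=> cf; exact: sqint_continuous.
have c1 : continuous ((fun=> 1) : R * R -> R) by move=> ?; exact: cvg_cst.
have cuy : continuous (fun x => u x - u y) by move=> x; apply: cvgB; [exact: cu|exact: cvg_cst].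
have V1 : V <= ip area (K : set (plane R)) (fun x => u x - u y) (fun x => u x - u y).
  by apply: mean_min; [exact: mK|exact: si|exact: si c1|exact: K0].
apply: (@le_trans _ _ (\int[area]_(x in (K : set (plane R))) ((u x - u y) ^+ 2)%:E)%E).
  rewrite -[leRHS]fineK; first by rewrite lee_fin.
  have := sqint_integrableM mK (si _ cuy) (si _ cuy).
  by move/(integrable_fin_num mK).
apply: (@le_trans _ _ (\int[area]_(x in (K : set (plane R))) ((h ^+ 2)%:E * (A (x, y) + B (x, y))))%E).
  apply: ge0_le_integral => //.
  - by move=> x _; rewrite lee_fin sqr_ge0.
  - apply/measurable_EFinP; apply: (measurable_funS measurableT) => //.
    by apply: measurable_funX; exact: continuous_measurable_plane.
  - apply: measurable_funTS; apply: measurable_funeM; apply: emeasurable_funD.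
      exact: measurable_fun_pair1 y mA.
    exact: measurable_fun_pair1 y mB.
  - by move=> x Kx; exact: path_bound.
have mAy : measurable_fun (K : set (plane R)) (fun x => A (x, y)).
  by apply: measurable_funTS; exact: measurable_fun_pair1 y mA.
have mBy : measurable_fun (K : set (plane R)) (fun x => B (x, y)).
  by apply: measurable_funTS; exact: measurable_fun_pair1 y mB.
rewrite ge0_integralZl ?lee_fin ?sqr_ge0 //; last 2 first.
- exact: emeasurable_funD.
- by move=> x _; rewrite adde_ge0.
rewrite ge0_integralD // lee_wpmul2l ?lee_fin ?sqr_ge0 // leeD2l //.
Qed.

(** Along the segment from [y] to [x], the half [t <= 2^-1] is integrated over [y] and the half [t >= 2^-1] over [x], so that
    the change of variables has a Jacobian bounded below. *)
Lemma poincare_square :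
  fine (area (Q : set (plane R))) * V <=
  4 * h ^+ 2 * (fine (area (K : set (plane R))) + fine (area (Q : set (plane R)))) *
  \int[area]_(x in (K : set (plane R))) grad2 u x.
Proof.
have fK : (area (K : set (plane R)) < +oo)%E by exact: bounded_area_fin.
have aK : (fine (area (K : set (plane R))))%:E = area (K : set (plane R)).
  by rewrite fineK // ge0_fin_numE.
have aQ : (fine (area (Q : set (plane R))))%:E = area (Q : set (plane R)).
  rewrite fineK // ge0_fin_numE //; apply: le_lt_trans fK.
  by apply: le_measure => //; rewrite inE.
have IE' : I = (\int[area]_(x in (K : set (plane R))) grad2 u x)%:E.
  rewrite /Rintegral fineK //; apply: integrable_fin_num => //.
  exact: integrable_continuous.
move: aK aQ; move: (fine (area K)) (fine (area Q)) => kK kQ aK aQ.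
rewrite -lee_fin; apply: (@le_trans _ _ (V%:E * area (Q : set (plane R)))%E).
  by rewrite -aQ -EFinM mulrC.
have H : (\int[area]_(y in (Q : set (plane R))) V%:E <= \int[area]_(y in (Q : set (plane R)))
   ((h ^+ 2)%:E * (\int[area]_(x in (K : set (plane R))) A (x, y) + 4%:E * I)))%E.
  apply: ge0_le_integral => //.
  - by move=> y _; rewrite lee_fin ip_ge0.
  - apply: measurable_funeM; apply: emeasurable_funD => //.
    apply: measurable_funTS.
  exact: (measurable_integral_on2 sfarea mK mA).
rewrite integral_cst // in H; apply: le_trans H _.
have mKA : measurable_fun (Q : set (plane R)) (fun y => (\int[area]_(x in (K : set (plane R))) A (x, y))%E).
  apply: measurable_funTS.
  exact: (measurable_integral_on2 sfarea mK mA).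
rewrite ge0_integralZl ?lee_fin ?sqr_ge0 //; last 2 first.
- by apply: emeasurable_funD.
- by move=> y _; rewrite adde_ge0 ?mule_ge0 //; exact: integral_ge0.
rewrite ge0_integralD //; last 2 first.
- by move=> y _; exact: integral_ge0.
- by move=> y _; rewrite mule_ge0.
rewrite integral_cst //.
(* On the half [A] the path is close to [y], so the bound [AQ] needs the integration over [y] to be
   the inner one. *)
have <- : (\int[area]_(x in (K : set (plane R))) \int[area]_(y in (Q : set (plane R))) A (x, y) =
  \int[area]_(y in (Q : set (plane R))) \int[area]_(x in (K : set (plane R))) A (x, y))%E.
  exact: (ge0_integral_exchange sfarea sfarea mK mQ mA).
have L1 : (\int[area]_(x in (K : set (plane R))) \int[area]_(y in (Q : set (plane R))) A (x, y) <= 4%:E * I * area (K : set (plane R)))%E.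
  rewrite -(integral_cst area mK (4%:E * I)%E); apply: (ge0_le_integral area mK).
  - by move=> x _; exact: integral_ge0.
  - by apply: measurable_funTS; exact: (measurable_integral_on sfarea mQ mA).
  - exact: measurable_cst.
  - by move=> x _; exact: AQ.
apply: (@le_trans _ _ ((h ^+ 2)%:E * (4%:E * I * area (K : set (plane R)) + 4%:E * I * area (Q : set (plane R))))%E).
  by rewrite lee_wpmul2l ?lee_fin ?sqr_ge0 // leeD2r.
by rewrite IE' -aK -aQ -!(EFinM, EFinD) lee_fin le_eqVlt; apply/orP; left; apply/eqP; ring.
Qed.

End poincare.

(** Squares stand in for discs because their area is that of a product of intervals. *)
Definition square {R : realType} (c : R * R) (s : R) : set (R * R) :=
  `[c.1 - s, c.1 + s] `*` `[c.2 - s, c.2 + s].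

Lemma measurable_square {R : realType} (c : R * R) (s : R) : measurable (square c s : set (plane R)).
Proof. by apply: measurableX; exact: measurable_itv. Qed.

Lemma area_square {R : realType} (c : R * R) (s : R) : 0 < s ->
  area (square c s : set (plane R)) = (4 * s ^+ 2)%:E.
Proof.
move=> s0.
rewrite [area _](_ : _ = (@lebesgue_measure R \x @lebesgue_measure R)%E (square c s)) // /square.
rewrite product_measure1E; [|exact: measurable_itv|exact: measurable_itv].
have L (a : R) : (@lebesgue_measure R `[(a - s)%R, (a + s)%R] = (2 * s)%:E)%E.
  by rewrite lebesgue_measure_itv /= lte_fin ifT; [rewrite -EFinB; congr EFin; ring|lra].
transitivity ((2 * s)%:E * (2 * s)%:E)%E; first by congr (_ * _)%E; exact: L.
by rewrite -EFinM; congr EFin; ring.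
Qed.

Lemma coord_le {R : realType} (x y : R * R) (s : R) : eucl_dist x y <= s ->
  y.1 - s <= x.1 <= y.1 + s /\ y.2 - s <= x.2 <= y.2 + s.
Proof.
move=> xy; have [a b] := coord_le_eucl y x.
have E : eucl_dist y x = eucl_dist x y.
  by rewrite /eucl_dist /eucl_norm /=; congr Num.sqrt; ring.
rewrite E in a b.
move: (le_trans a xy) (le_trans b xy); rewrite !ler_norml; lra.
Qed.

Lemma square_disc {R : realType} (c : R * R) (r : R) : 0 < r -> square c (r / 2) `<=` disc c r.
Proof.
move=> r0 x [/=]; rewrite !in_itv /= => x1 x2.
rewrite /disc /= /eucl_dist /eucl_norm -[ltRHS]gtr0_norm // -sqrtr_sqr ltr_sqrt ?exprn_gt0 //=.
nra.
Qed.

Lemma ip1 {d} {X : measurableType d} {R : realType} (mu : {measure set X -> \bar R}) (S : set X) :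
  measurable S -> ip mu S (fun=> 1) (fun=> 1) = fine (mu S).
Proof. by move=> mS; rewrite /ip Rintegral_cst // mulr1 mul1r. Qed.

Lemma triangle_step {R : realType} (r A0 A d q g d1 g0 : R) : 0 <= r -> 0 <= q ->
  A0 <= A + d -> r * A <= q * g -> g <= d1 + g0 -> r * A0 <= r * d + q * (d1 + g0).
Proof.
move=> r0 q0 H1 H2 H3; have := ler_wpM2l r0 H1; have := ler_wpM2l q0 H3; lra.
Qed.

Lemma sqr_add_le {R : realType} (a b n1 n2 g1 g2 g0 : R) : 0 <= a -> 0 <= b ->
  0 <= n1 -> 0 <= n2 -> 0 <= g0 -> a <= n1 + g1 -> b <= n2 + g2 -> g1 <= g0 -> g2 <= g0 ->
  g0 ^+ 2 = g1 ^+ 2 + g2 ^+ 2 -> a ^+ 2 + b ^+ 2 <= (n1 + n2 + g0) ^+ 2.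
Proof.
move=> a0 b0 n10 n20 g00 H1 H2 G1 G2 E.
have A : a ^+ 2 <= (n1 + g1) ^+ 2 by rewrite ler_sqr // nnegrE (le_trans a0).
have B : b ^+ 2 <= (n2 + g2) ^+ 2 by rewrite ler_sqr // nnegrE (le_trans b0).
have C1 := ler_wpM2l n10 G1; have C2 := ler_wpM2l n20 G2.
have C3 : 0 <= n1 * n2 by exact: mulr_ge0.
have C4 : 0 <= n1 * g0 by exact: mulr_ge0.
have C5 : 0 <= n2 * g0 by exact: mulr_ge0.
nra.
Qed.

Section poincare_limit.
Context {R : realType} (K : set (R * R)) (c : R * R) (r h : R).
Context (oK : open K) (bK : bounded_set K) (r0 : 0 < r) (discK : disc c r `<=` K).
Context (star : forall x y, disc c r x -> K y -> segment x y `<=` K).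
Context (Kh : forall x y, K x -> K y -> eucl_dist x y <= h).

Let S : set (plane R) := K.
Let mS : measurable S := open_measurable_plane oK.
Let fS : (area S < +oo)%E := bounded_area_fin mS bK.

Let Kc : K c.
Proof. by apply: discK; rewrite /disc /= /eucl_dist subrr /eucl_norm /= expr0n addr0 sqrtr0. Qed.

Let h_ge : r <= 2 * h.
Proof.
have Kd : K ((c.1 + r / 2, c.2) : R * R).
  apply: discK; rewrite /disc /= /eucl_dist /eucl_norm /= subrr expr0n addr0 sqrtr_sqr.
  rewrite (_ : c.1 + r / 2 - c.1 = r / 2); last by ring.
  by rewrite gtr0_norm; move: r0; lra.
have := Kh Kd Kc; rewrite /eucl_dist /eucl_norm /= subrr expr0n addr0 sqrtr_sqr.
rewrite (_ : c.1 + r / 2 - c.1 = r / 2); last by ring.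
by rewrite gtr0_norm; move: r0; lra.
Qed.

Lemma area_diam_bound : r ^+ 2 <= fine (area S) <= 4 * h ^+ 2.
Proof.
have h0 : 0 < h by move: h_ge r0; lra.
have r20 : 0 < r / 2 by rewrite divr_gt0.
have fE : (fine (area S))%:E = area S by rewrite fineK // ge0_fin_numE.
apply/andP; split; rewrite -lee_fin fE.
  apply: (@le_trans _ _ (area (square c (r / 2) : set (plane R)))).
    by rewrite area_square // lee_fin le_eqVlt; apply/orP; left; apply/eqP; field.
  apply: le_measure; rewrite ?inE //; first exact: measurable_square.
  by apply: subset_trans discK; exact: square_disc.
rewrite -(area_square c h0); apply: le_measure; rewrite ?inE //; first exact: measurable_square.
move=> x Kx; have [a b] := coord_le (Kh Kx Kc).
by split; rewrite /= in_itv.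
Qed.

(** The inequality for the smooth [phi i] is taken in its square root form, where the approximation
    errors enter additively and tend to 0. By [mean_min] the mean of [v] may be replaced by that of
    [phi i]. *)
Lemma poincare v G phi : h1approx K v G phi ->
  r ^+ 2 * nrm area S (fun x => v x - mean area S v) ^+ 2 <=
  4 * h ^+ 2 * (4 * h ^+ 2 + r ^+ 2) * nrm area S (fun x => eucl_norm (G x)) ^+ 2.
Proof.
move=> [wG sphi c0 c1 c2].
have [/L2fun_sqint vi /L2fun_sqint G1 /L2fun_sqint G2 _] := wG.
have si (f : R * R -> R) : smooth f -> sqint area S f.
  by move=> sf; apply: sqint_continuous => //; exact: smooth_continuous.
have ci (k : R) : sqint area S (fun=> k) by apply: sqint_continuous => // ?; exact: cvg_cst.
have /andP[A1 A2] := area_diam_bound.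
have K0 : ip area S (fun=> 1) (fun=> 1) != 0.
  by rewrite ip1 // gt_eqF // (lt_le_trans _ A1) // exprn_gt0.
pose Q := square c (r / 2).
have r20 : 0 < r / 2 by rewrite divr_gt0.
have aQ : fine (area (Q : set (plane R))) = r ^+ 2 by rewrite area_square //=; field.
have QD x : Q x -> disc c r x by move=> Qx; exact: (square_disc r0 Qx).
pose k := 4 * h ^+ 2 * (4 * h ^+ 2 + r ^+ 2).
have k0 : 0 <= k.
  have h2 := sqr_ge0 h; have r2 := sqr_ge0 r.
  by apply: mulr_ge0; [apply: mulr_ge0|apply: addr_ge0 => //; apply: mulr_ge0].
pose A i := nrm area S (fun x => phi i x - mean area S (phi i)).
pose gam i := nrm area S (fun x => eucl_norm (grad (phi i) x)).
have PA i : r * A i <= Num.sqrt k * gam i.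
  rewrite -ler_sqr ?nnegrE ?mulr_ge0 ?sqrtr_ge0 ?nrm_ge0 ?(ltW r0) // !exprMn (sqr_sqrtr k0).
  have := @poincare_square R K Q (phi i) h oK (measurable_square _ _) (subset_trans (@square_disc _ _ _ r0) discK)
    (sphi i) (fun x y Kx Qy => Kh Kx (discK (QD _ Qy))) (fun x y Kx Qy => star (QD _ Qy) Kx) bK K0.
  rewrite aQ /A nrm_sqr => /le_trans; apply.
  have [_ E] := sqint_eucl mS (si _ (smooth_pd1 (sphi i))) (si _ (smooth_pd2 (sphi i))).
  have -> : \int[area]_(x in S) grad2 (phi i) x = gam i ^+ 2.
    rewrite /gam nrm_sqr E /ip -RintegralD //.
    - by apply: sqint_integrableM => //; apply: si; apply: smooth_pd1.
    - by apply: sqint_integrableM => //; apply: si; apply: smooth_pd2.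
  apply: ler_wpM2r; first exact: sqr_ge0.
  apply: ler_wpM2l; last by rewrite lerD2r.
  by apply: mulr_ge0 => //; exact: sqr_ge0.
pose gam0 := nrm area S (fun x => eucl_norm (G x)).
pose A0 := nrm area S (fun x => v x - mean area S v).
pose d0 i := nrm area S (fun x => phi i x - v x).
pose d1 i := nrm area S (fun x => pd1 (phi i) x - (G x).1) + nrm area S (fun x => pd2 (phi i) x - (G x).2).
have B i : r * A0 <= r * d0 i + Num.sqrt k * (d1 i + gam0).
  have H1 : A0 <= nrm area S (fun x => v x - mean area S (phi i)).
    by apply: ler_wsqrtr; exact: (mean_min (mean area S (phi i)) mS vi (ci 1) K0).
  have H2 : nrm area S (fun x => v x - mean area S (phi i)) <= A i + d0 i.
    have := nrmB mS (sqintB mS (si _ (sphi i)) (ci (mean area S (phi i)))) (sqintB mS (si _ (sphi i)) vi).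
    by congr (_ <= _); apply: eq_nrm => x _; ring.
  have e1 := sqintB mS (si _ (smooth_pd1 (sphi i))) G1.
  have e2 := sqintB mS (si _ (smooth_pd2 (sphi i))) G2.
  have [_ E] := sqint_eucl mS (si _ (smooth_pd1 (sphi i))) (si _ (smooth_pd2 (sphi i))).
  have H3 : gam i <= d1 i + gam0.
    have [g1 g2] := nrm_eucl_le mS G1 G2.
    have gE : gam0 ^+ 2 = nrm area S (fun x => (G x).1) ^+ 2 + nrm area S (fun x => (G x).2) ^+ 2.
      by rewrite !nrm_sqr; have [_ ->] := sqint_eucl mS G1 G2.
    have t1 : nrm area S (pd1 (phi i)) <= nrm area S (fun x => pd1 (phi i) x - (G x).1) + nrm area S (fun x => (G x).1).
      have -> : nrm area S (pd1 (phi i)) = nrm area S (fun x => (pd1 (phi i) x - (G x).1) + (G x).1).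
        by apply: eq_nrm => x _; rewrite subrK.
      exact: nrmD mS e1 G1.
    have t2 : nrm area S (pd2 (phi i)) <= nrm area S (fun x => pd2 (phi i) x - (G x).2) + nrm area S (fun x => (G x).2).
      have -> : nrm area S (pd2 (phi i)) = nrm area S (fun x => (pd2 (phi i) x - (G x).2) + (G x).2).
        by apply: eq_nrm => x _; rewrite subrK.
      exact: nrmD mS e2 G2.
    rewrite -ler_sqr; [|by rewrite nnegrE nrm_ge0|by rewrite nnegrE !addr_ge0 // nrm_ge0].
    rewrite /gam nrm_sqr E -!nrm_sqr.
    exact: (sqr_add_le (nrm_ge0 _ _ _) (nrm_ge0 _ _ _) (nrm_ge0 _ _ _) (nrm_ge0 _ _ _) (nrm_ge0 _ _ _) t1 t2 g1 g2 gE).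
  exact: triangle_step (ltW r0) (sqrtr_ge0 k) (le_trans H1 H2) (PA i) H3.
have L : r * d0 i + Num.sqrt k * (d1 i + gam0) @[i --> \oo] --> r * 0 + Num.sqrt k * (0 + gam0).
  apply: cvgD; apply: cvgM; [exact: cvg_cst|exact: c0|exact: cvg_cst|].
  by apply: cvgD; [rewrite -[X in _ --> X]addr0; apply: cvgD|exact: cvg_cst].
have M : r * A0 <= Num.sqrt k * gam0.
  rewrite mulr0 !add0r in L.
  apply: (ler_cvg_to (cvg_cst (r * A0)) L); exact: nearW.
rewrite -/A0 -/gam0 -/k -(sqr_sqrtr k0) -!exprMn ler_sqr //.
  by rewrite nnegrE mulr_ge0 ?nrm_ge0 ?(ltW r0).
by rewrite nnegrE mulr_ge0 ?sqrtr_ge0 ?nrm_ge0.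
Qed.

End poincare_limit.

(** * Polynomials and finite-dimensional bounds *)

(** Equivalence of norms in finite dimension: a form that vanishes on the common kernel of others is a combination of them. *)
Lemma matrix_factor_ker {F : fieldType} (n m p : nat) (L : 'M[F]_(n, m)) (B : 'M[F]_(n, p)) :
  (forall c : 'rV[F]_n, c *m L = 0 -> c *m B = 0) -> exists D, B = L *m D.
Proof.
move=> H; exists (pinvmx L *m B).
(* The rows of [1 - L *m pinvmx L] are in the left kernel of [L], hence in that of [B]. *)
have Z : (1%:M - L *m pinvmx L) *m L = 0 by rewrite mulmxBl mul1mx mulmxKpV ?submx_refl // subrr.
have : (1%:M - L *m pinvmx L) *m B = 0.
  apply/row_matrixP => i; rewrite row_mul H ?row0 //.
  by rewrite -row_mul Z row0.
by rewrite mulmxBl mul1mx mulmxA => /eqP; rewrite subr_eq0 => /eqP.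
Qed.

Lemma finite_bound {R : realFieldType} (I J : finType) (L : I -> J -> R) (B : I -> R) :
  (forall c : I -> R, (forall j, \sum_i c i * L i j = 0) -> \sum_i c i * B i = 0) ->
  exists2 C : R, 0 <= C & forall (c : I -> R) M,
    (forall j, `|\sum_i c i * L i j| <= M) -> `|\sum_i c i * B i| <= C * M.
Proof.
move=> H.
pose ML := \matrix_(i < #|I|, j < #|J|) L (enum_val i) (enum_val j).
pose MB := \matrix_(i < #|I|, j < 1) B (enum_val i).
have sumE (f : I -> R) : \sum_i f i = \sum_(i < #|I|) f (enum_val i).
  exact: big_enum_val.
have [c|D DE] := @matrix_factor_ker _ _ _ _ ML MB.
  move=> cL; apply/rowP => j; rewrite !mxE.
  have := H (fun i => c 0 (enum_rank i)); rewrite sumE => H'.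
  rewrite -[RHS]H'; first by apply: eq_bigr => i _; rewrite !mxE enum_valK.
  move=> j'; rewrite sumE; move/rowP: cL => /(_ (enum_rank j')); rewrite !mxE => cL.
  by rewrite -[RHS]cL; apply: eq_bigr => i _; rewrite !mxE enum_valK enum_rankK.
exists (\sum_j `|D j 0|); first by apply: sumr_ge0.
move=> c M HM.
have -> : \sum_i c i * B i = \sum_(j < #|J|) (\sum_i c i * L i (enum_val j)) * D j 0.
  transitivity ((\row_i c (enum_val i) *m MB) 0 0).
    by rewrite mxE sumE; apply: eq_bigr => i _; rewrite !mxE.
  rewrite DE mulmxA mxE; apply: eq_bigr => j _; congr (_ * _).
  by rewrite mxE sumE; apply: eq_bigr => i _; rewrite !mxE.
rewrite mulr_suml; apply: le_trans (ler_norm_sum _ _ _) _; apply: ler_sum => j _.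
by rewrite normrM mulrC ler_wpM2l.
Qed.

(** Linearity is asked on continuous functions only: the forms in question are integrals, which are
    not additive on functions that fail to be integrable. *)
Definition linfun_on {R : realType} {T : topologicalType} (F : (T -> R) -> R) : Prop :=
  (forall f g : T -> R, continuous f -> continuous g -> F (fun x => f x + g x) = F f + F g) /\
  (forall (k : R) (f : T -> R), continuous f -> F (fun x => k * f x) = k * F f).

Lemma continuous_bigsum {R : realType} {T : topologicalType} (I : Type) (r : seq I) (P : pred I) (f : I -> T -> R) :
  (forall i, continuous (f i)) -> continuous (fun x => \sum_(i <- r | P i) f i x).
Proof.
move=> cf x; apply: cvg_big => [|i _]; first exact: add_continuous.
exact: cf.
Qed.

Lemma linfun_sum {R : realType} {T : topologicalType} (F : (T -> R) -> R) (I : finType) (c : I -> R) (e : I -> T -> R) :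
  linfun_on F -> (forall i, continuous (e i)) ->
  F (fun x => \sum_i c i * e i x) = \sum_i c i * F (e i).
Proof.
move=> [FD FZ] ce.
have cZ k i : continuous (fun x => k * e i x) by move=> x; apply: cvgM; [exact: cvg_cst|exact: ce].
have F0 : F (fun=> 0) = 0.
  have E := FZ 0 (fun=> 0) (@cst_continuous _ _ _); rewrite mul0r in E.
  by rewrite E mul0r.
elim: (index_enum I) => [|i r IH].
  by rewrite big_nil; under [X in F X]eq_fun do rewrite big_nil.
rewrite big_cons -IH -FZ // -FD //; last exact: continuous_bigsum.
by congr F; apply/funext => x; rewrite big_cons.
Qed.

Lemma span_bound {R : realType} {T : topologicalType} (I J : finType) (e : I -> T -> R)
    (L : J -> (T -> R) -> R) (B : (T -> R) -> R) :
  (forall i, continuous (e i)) -> (forall j, linfun_on (L j)) -> linfun_on B ->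
  (forall c, (forall j, L j (fun x => \sum_i c i * e i x) = 0) -> B (fun x => \sum_i c i * e i x) = 0) ->
  exists2 C : R, 0 <= C & forall (c : I -> R) M,
    (forall j, `|L j (fun x => \sum_i c i * e i x)| <= M) -> `|B (fun x => \sum_i c i * e i x)| <= C * M.
Proof.
move=> ce lL lB H.
have [c Hc|C C0 HC] := @finite_bound R I J (fun i j => L j (e i)) (fun i => B (e i)).
  by rewrite -linfun_sum //; apply: H => j; rewrite linfun_sum.
exists C => // c M HM; rewrite linfun_sum //; apply: HC => j.
by rewrite -linfun_sum.
Qed.

(** Each estimate is required to persist for larger constants, so that the sum of the individual
    constants serves all indices. *)
Lemma finite_uniform {R : realDomainType} (I : finType) (Q : I -> R -> Prop) :
  (forall i, exists2 C : R, 0 <= C & forall C', C <= C' -> Q i C') ->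
  exists2 C : R, 0 <= C & forall i, Q i C.
Proof.
move=> H.
have /choice[C HC] : forall i, exists C : R, 0 <= C /\ forall C', C <= C' -> Q i C'.
  by move=> i; have [C ? ?] := H i; exists C.
exists (\sum_i C i); first by apply: sumr_ge0 => i _; case: (HC i).
move=> i; apply: (HC i).2; rewrite (bigD1 i) //= lerDl sumr_ge0 // => j _.
by case: (HC j).
Qed.

(** * Polynomials in two variables *)

Definition mono {R : realType} (i j : nat) (x : R * R) : R := x.1 ^+ i * x.2 ^+ j.

(** The index type is the full square of exponents, a finite product. Indices of total degree above
    [m] carry the zero function, so their coefficients are arbitrary and have to be left out of
    coefficient bounds. *)
Definition pmono {R : realType} (m : nat) (ij : 'I_m.+1 * 'I_m.+1) : R * R -> R :=
  if (ij.1 + ij.2 <= m)%N then mono ij.1 ij.2 else fun=> 0.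

(** The same functions as [polyfun], by [polyfun_pf], but written over a fixed finite family, as the
    linear algebra bounds require. *)
Definition pf {R : realType} (m : nat) (f : R * R -> R) : Prop :=
  exists c : 'I_m.+1 * 'I_m.+1 -> R, f = fun x => \sum_ij c ij * pmono ij x.

Lemma pf_mono {R : realType} m i j : (i + j <= m)%N -> pf m (@mono R i j).
Proof.
move=> ijm.
have im : (i < m.+1)%N by rewrite ltnS (leq_trans _ ijm) // leq_addr.
have jm : (j < m.+1)%N by rewrite ltnS (leq_trans _ ijm) // leq_addl.
exists (fun p => (p == (Ordinal im, Ordinal jm))%:R); apply/funext => x.
rewrite (bigD1 (Ordinal im, Ordinal jm)) //= eqxx mul1r /pmono /= ijm big1 ?addr0 //.
by move=> p /negPf ->; rewrite mul0r.
Qed.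

Lemma pfD {R : realType} m (f g : R * R -> R) : pf m f -> pf m g -> pf m (fun x => f x + g x).
Proof.
move=> [c ->] [d ->]; exists (fun ij => c ij + d ij); apply/funext => x.
by rewrite -big_split; apply: eq_bigr => ij _; rewrite mulrDl.
Qed.

Lemma pfZ {R : realType} m (k : R) (f : R * R -> R) : pf m f -> pf m (fun x => k * f x).
Proof.
move=> [c ->]; exists (fun ij => k * c ij); apply/funext => x.
by rewrite mulr_sumr; apply: eq_bigr => ij _; rewrite mulrA.
Qed.

Lemma pf0 {R : realType} m : pf m (fun=> 0 : R).
Proof.
exists (fun=> 0); apply/funext => x; rewrite big1 // => ij _.
by rewrite mul0r.
Qed.

Lemma pf_ind {R : realType} m (Q : (R * R -> R) -> Prop) (f : R * R -> R) :
  Q (fun=> 0) -> (forall f g, Q f -> Q g -> Q (fun x => f x + g x)) ->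
  (forall k f, Q f -> Q (fun x => k * f x)) ->
  (forall i j, (i + j <= m)%N -> Q (mono i j)) -> pf m f -> Q f.
Proof.
move=> Q0 QD QZ Qm [c ->].
elim: (index_enum _) => [|ij r IH].
  by under eq_fun do rewrite big_nil.
under eq_fun do rewrite big_cons; apply: QD => //; apply: QZ.
by rewrite /pmono; case: ifP => // h; exact: Qm.
Qed.

Lemma pfW {R : realType} m m' (f : R * R -> R) : (m <= m')%N -> pf m f -> pf m' f.
Proof.
move=> mm; apply: pf_ind; [exact: pf0|exact: pfD|exact: pfZ|].
by move=> i j ij; apply: pf_mono; exact: leq_trans mm.
Qed.

Lemma pfM {R : realType} m m' (f g : R * R -> R) : pf m f -> pf m' g ->
  pf (m + m') (fun x => f x * g x).
Proof.
move=> + pg; apply: (@pf_ind _ _ (fun f => pf (m + m') (fun x => f x * g x))).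
- by under eq_fun do rewrite mul0r; exact: pf0.
- by move=> f1 f2 h1 h2; under eq_fun do rewrite mulrDl; exact: pfD.
- by move=> k f1 h1; under eq_fun do rewrite -mulrA; exact: pfZ.
move=> i j ij.
apply: (@pf_ind _ m' (fun g => pf (m + m') (fun x => mono i j x * g x)) g) pg.
- by under eq_fun do rewrite mulr0; exact: pf0.
- by move=> f1 f2 h1 h2; under eq_fun do rewrite mulrDr; exact: pfD.
- by move=> k f1 h1; under eq_fun do rewrite mulrCA; exact: pfZ.
move=> i' j' ij'.
rewrite (_ : (fun x => _) = mono (i + i') (j + j')).
  by apply: pf_mono; rewrite addnACA leq_add.
by apply/funext => x; rewrite /mono !exprD; ring.
Qed.

Lemma pf_cst {R : realType} m (k : R) : pf m (fun=> k).
Proof.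
have := pfZ k (@pf_mono R m 0 0 (leq0n m)); congr pf.
by apply/funext => x; rewrite /mono !expr0 !mulr1.
Qed.

Lemma pf_exp {R : realType} m n (f : R * R -> R) : pf m f -> pf (n * m) (fun x => f x ^+ n).
Proof.
move=> pm; elim: n => [|n IH].
  by under eq_fun do rewrite expr0; exact: pf_cst.
by rewrite mulSn; under eq_fun do rewrite exprS; exact: pfM.
Qed.

Lemma pf_affine {R : realType} (al be ga : R) : pf 1 (fun x : R * R => ga + al * x.1 + be * x.2).
Proof.
have h1 := pfZ al (@pf_mono R 1 1 0 isT); have h2 := pfZ be (@pf_mono R 1 0 1 isT).
have := pfD (pfD (pf_cst 1 ga) h1) h2; congr pf.
by apply/funext => x; rewrite /mono !expr0 !expr1 mulr1 mul1r.
Qed.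

Lemma pf_comp {R : realType} m (f l1 l2 : R * R -> R) : pf 1 l1 -> pf 1 l2 -> pf m f ->
  pf m (fun x => f (l1 x, l2 x)).
Proof.
move=> h1 h2; apply: (@pf_ind _ _ (fun f => pf m (fun x => f (l1 x, l2 x)))) => //.
- exact: pf0.
- by move=> f1 f2; exact: pfD.
- by move=> k f1; exact: pfZ.
move=> i j ij; have := pfM (pf_exp i h1) (pf_exp j h2); rewrite !muln1.
exact: pfW.
Qed.

Lemma smooth_mono {R : realType} i j : smooth (@mono R i j).
Proof.
have s1 : smooth (fun x : R * R => x.1).
  by have := @smooth_affine R 1 0 0; congr smooth; apply/funext => x; ring.
have s2 : smooth (fun x : R * R => x.2).
  by have := @smooth_affine R 0 1 0; congr smooth; apply/funext => x; ring.
have sX (f : R * R -> R) n : smooth f -> smooth (fun x => f x ^+ n).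
  move=> sf; elim: n => [|n IH]; first by under eq_fun do rewrite expr0; exact: smooth_cst.
  by under eq_fun do rewrite exprS; exact: smoothM.
by apply: smoothM; exact: sX.
Qed.

Lemma pf_smooth {R : realType} m (f : R * R -> R) : pf m f -> smooth f.
Proof.
apply: pf_ind; [exact: smooth_cst|exact: smoothD| |by move=> i j _; exact: smooth_mono].
by move=> k g; exact: smoothZ.
Qed.

Lemma pf_sum {R : realType} m (I : Type) (r : seq I) (F : I -> R * R -> R) :
  (forall i, pf m (F i)) -> pf m (fun x => \sum_(i <- r) F i x).
Proof.
move=> H; elim: r => [|i r IH]; first by under eq_fun do rewrite big_nil; exact: pf0.
by under eq_fun do rewrite big_cons; exact: pfD.
Qed.

Lemma polyfun_pf {R : realType} (m : nat) (f : R * R -> R) : polyfun m%:Z f <-> pf m f.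
Proof.
split=> [[p [pm fE]]|].
  have -> : f = fun x => \sum_(i < size p) \sum_(j < size p`_i) p`_i`_j * mono i j x.
    apply/funext => x; rewrite fE (horner_coef p) horner_sum; apply: eq_bigr => i _.
    rewrite hornerM -polyC_exp hornerC horner_coef mulr_suml; apply: eq_bigr => j _.
    by rewrite /mono; ring.
  apply: pf_sum => i; apply: pf_sum => j.
  have [->|/pm] := eqVneq p`_i`_j 0; first by under eq_fun do rewrite mul0r; exact: pf0.
  by move=> ij; apply: pfZ; exact: pf_mono.
apply: pf_ind => [|g h [p [pm pE]] [q [qm qE]]|k g [p [pm pE]]|i j ij].
- by exists 0; split => [i j|x]; [rewrite !coef0 eqxx|rewrite !horner0].
- exists (p + q); split => [i j|x]; last by rewrite pE qE !hornerD.
  by rewrite !coefD; have [->|/pm //] := eqVneq p`_i`_j 0; rewrite add0r; exact: qm.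
- exists (k%:P%:P * p); split => [i j|x]; last by rewrite pE !hornerE.
  by rewrite !coefCM mulf_eq0 negb_or => /andP[_]; exact: pm.
- exists ('X^i * ('X^j)%:P); split => [i' j'|x]; last first.
    by rewrite /mono !hornerE.
  rewrite coefMC coefXn; have [->|_] := eqVneq i' i; last by rewrite mul0r coef0 eqxx.
  by rewrite mul1r coefXn; have [->|_] := eqVneq j' j; [|rewrite eqxx].
Qed.

Lemma pd_coord {R : realType} :
  [/\ smooth (fun x : R * R => x.1), smooth (fun x : R * R => x.2) &
   [/\ pd1 (fun x : R * R => x.1) = fun=> 1, pd2 (fun x : R * R => x.1) = fun=> 0,
    pd1 (fun x : R * R => x.2) = fun=> 0 & pd2 (fun x : R * R => x.2) = fun=> 1]].
Proof.
have D (s : R) : is_derive s 1 id ((fun=> 1) s : R) by exact: is_derive_id.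
have E1 : (fun x : R * R => x.1) = fun x => id (0 + 1 * x.1 + 0 * x.2) by apply/funext => x /=; ring.
have E2 : (fun x : R * R => x.2) = fun x => id (0 + 0 * x.1 + 1 * x.2) by apply/funext => x /=; ring.
have [a1 a2] := pd_affine 1 0 0 D; have [b1 b2] := pd_affine 0 1 0 D.
split; first by rewrite E1; exact: smooth_affine.
  by rewrite E2; exact: smooth_affine.
by rewrite E1 E2 a1 a2 b1 b2; split; apply/funext => x; rewrite ?mul1r ?mul0r.
Qed.

Lemma pd_cst {R : realType} (k : R) : pd1 (fun=> k) = (fun=> 0) /\ pd2 (fun=> k) = (fun=> 0).
Proof. by split; apply/funext => x; exact: derive_cst. Qed.

Lemma pf_pd_mono {R : realType} i j : pf (i + j) (pd1 (@mono R i j)) /\ pf (i + j) (pd2 (@mono R i j)).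
Proof.
have [s1 s2 [e11 e12 e21 e22]] := @pd_coord R.
have x1 : pf 1 (fun x : R * R => x.1).
  by have := pf_affine (1 : R) 0 0; congr pf; apply/funext => x; ring.
have x2 : pf 1 (fun x : R * R => x.2).
  by have := pf_affine (0 : R) 1 0; congr pf; apply/funext => x; ring.
elim: i => [|i [IH1 IH2]]; last first.
  have -> : mono i.+1 j = (fun x : R * R => x.1 * mono i j x) by apply/funext => x; rewrite /mono exprS mulrA.
  have sm := @smooth_mono R i j.
  rewrite pd1M // pd2M // e11 e12 addSn -add1n; split; apply: pfD.
  - exact: pfM.
  - by under eq_fun do rewrite mulr1; exact: pf_mono.
  - exact: pfM.
  - by under eq_fun do rewrite mulr0; exact: pf0.
elim: j => [|j [IH1 IH2]].
  have -> : mono 0 0 = (fun=> 1 : R) by apply/funext => x; rewrite /mono !expr0 mulr1.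
  by have [-> ->] := pd_cst (1 : R); split; exact: pf0.
have -> : mono 0 j.+1 = (fun x : R * R => x.2 * mono 0 j x) by apply/funext => x; rewrite /mono exprS; ring.
have sm := @smooth_mono R 0 j.
rewrite pd1M // pd2M // e21 e22 add0n -add1n; split; apply: pfD.
- exact: pfM.
- by under eq_fun do rewrite mulr0; exact: pf0.
- exact: pfM.
- by under eq_fun do rewrite mulr1; exact: pf_mono.
Qed.

Lemma pf_pd {R : realType} m (f : R * R -> R) : pf m f -> pf m (pd1 f) /\ pf m (pd2 f).
Proof.
move=> pm; suff [_ [? ?]] : smooth f /\ (pf m (pd1 f) /\ pf m (pd2 f)) by [].
move: pm; apply: (@pf_ind _ _ (fun f => smooth f /\ (pf m (pd1 f) /\ pf m (pd2 f)))).
- by split; [exact: smooth_cst|have [-> ->] := pd_cst (0 : R); split; exact: pf0].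
- move=> g h [sg [g1 g2]] [sh [h1 h2]]; split; first exact: smoothD.
  by rewrite pd1D // pd2D //; split; exact: pfD.
- move=> k g [sg [g1 g2]]; split; first exact: smoothZ.
  have sk := @smooth_cst R k; rewrite pd1M // pd2M //; have [-> ->] := pd_cst k.
  by split; apply: pfD; do ?[exact: pfZ]; under eq_fun do rewrite mulr0; exact: pf0.
move=> i j ij; split; first exact: smooth_mono.
by have [h1 h2] := @pf_pd_mono R i j; split; exact: pfW ij _.
Qed.

Lemma pf_slice {R : realType} m (f : R * R -> R) : pf m f ->
  exists2 P : {poly R}, (size P <= m.+1)%N & forall s, f (s, 0) = P.[s].
Proof.
apply: (@pf_ind _ _ (fun f => exists2 P : {poly R}, (size P <= m.+1)%N & forall s, f (s, 0) = P.[s])) => [|g h [p pm pE] [q qm qE]|k g [p pm pE]|i j ij].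
- by exists 0; rewrite ?size_poly0 // => s; rewrite horner0.
- exists (p + q) => [|s]; last by rewrite pE qE hornerD.
  by apply: leq_trans (size_polyD _ _) _; rewrite geq_max pm.
- exists (k *: p) => [|s]; last by rewrite pE hornerZ.
  exact: leq_trans (size_scale_leq _ _) pm.
exists ((j == 0%N)%:R *: 'X^i) => [|s].
  apply: leq_trans (size_scale_leq _ _) _; by rewrite size_polyXn ltnS (leq_trans _ ij) // leq_addr.
by rewrite /mono hornerZ hornerXn expr0n /= mulrC.
Qed.

Lemma pf_segpath {R : realType} m (f : R * R -> R) (a b : R * R) : pf m f ->
  exists2 P : {poly R}, (size P <= m.+1)%N & forall s, f (segpath a b s) = P.[s].
Proof.
move=> pm; have h1 := pf_affine (b.1 - a.1) 0 a.1; have h2 := pf_affine (b.2 - a.2) 0 a.2.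
have [P Ps PE] := pf_slice (pf_comp h1 h2 pm).
exists P => // s; rewrite -PE; congr f.
rewrite [LHS](_ : _ = (a.1 + s * (b.1 - a.1), a.2 + s * (b.2 - a.2))) //=.
by congr (_, _); ring.
Qed.

Lemma poly_zero_itv {R : realType} (P : {poly R}) (a b : R) : a < b ->
  (forall s, a < s < b -> P.[s] = 0) -> P = 0.
Proof.
move=> ab H; apply/eqP; apply: contraT => P0.
pose x i : R := a + (b - a) * (i.+1%:R / (size P).+1%:R).
have xi i : (i < size P)%N -> a < x i < b.
  move=> iP; have q0 : 0 < i.+1%:R / (size P).+1%:R :> R by rewrite divr_gt0 // ltr0n.
  have q1 : i.+1%:R / (size P).+1%:R < 1 :> R by rewrite ltr_pdivrMr ?ltr0n // mul1r ltr_nat ltnS.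
  have ba : 0 < b - a by rewrite subr_gt0.
  rewrite /x; move: (i.+1%:R / _) q0 q1 => t q0 q1.
  have := mulr_gt0 ba q0; have : 0 < (b - a) * (1 - t) by rewrite mulr_gt0 // subr_gt0.
  lra.
have := @max_poly_roots _ P [seq x i | i <- iota 0 (size P)] P0.
rewrite size_map size_iota ltnn => -> //.
  apply/allP => y /mapP[i]; rewrite mem_iota => /andP[_]; rewrite add0n => iP ->.
  by apply/eqP; apply: H; exact: xi.
rewrite map_inj_uniq ?iota_uniq // => i j; rewrite /x => /addrI /mulfI.
have -> : b - a != 0 by rewrite subr_eq0 gt_eqF.
move=> /(_ isT) /mulIf; rewrite invr_neq0 ?pnatr_eq0 // => /(_ isT) /eqP.
by rewrite eqr_nat eqSS => /eqP.
Qed.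

(** Division by the second coordinate leaves a remainder in the first coordinate alone, and this
    remainder vanishes on an interval. For [m = 0] the truncated degree [m.-1] is harmless, as the
    quotient is then zero. *)
Lemma pf_shift {R : realType} m (f : R * R -> R) : pf m f -> (forall s, 0 < s < 1 -> f (s, 0) = 0) ->
  exists2 g, pf m.-1 g & forall x, f x = x.2 * g x.
Proof.
move=> pm f0.
have [g pg [P PE]] : exists2 g, pf m.-1 g & exists P : {poly R}, forall x, f x = x.2 * g x + P.[x.1].
  move: pm {f0}; apply: (@pf_ind _ _ (fun f => exists2 g, pf m.-1 g & exists P : {poly R}, forall x, f x = x.2 * g x + P.[x.1])) => [|f1 f2 [g1 p1 [q1 E1]] [g2 p2 [q2 E2]]|k f1 [g1 p1 [q1 E1]]|i j ij].
  - by exists (fun=> 0); [exact: pf0|exists 0 => x; rewrite horner0 mulr0 addr0].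
  - exists (fun x => g1 x + g2 x); first exact: pfD.
    by exists (q1 + q2) => x; rewrite E1 E2 hornerD; ring.
  - exists (fun x => k * g1 x); first exact: pfZ.
    by exists (k *: q1) => x; rewrite E1 hornerZ; ring.
  case: j ij => [|j] ij.
    exists (fun=> 0); first exact: pf0.
    by exists 'X^i => x; rewrite hornerXn /mono expr0; ring.
  exists (mono i j); last by exists 0 => x; rewrite horner0 /mono exprS; ring.
  by apply: pf_mono; rewrite addnS in ij; case: m ij.
have P0 : P = 0.
  apply: (@poly_zero_itv _ P 0 1) => // s s01.
  by have := PE (s, 0); rewrite f0 //= mul0r add0r.
by exists g => // x; rewrite PE P0 horner0 addr0.
Qed.

(** The variables are treated one at a time: for a fixed second coordinate [s] one has a polynomial
    in the first coordinate that vanishes on an interval, and its coefficients are polynomials in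
    [s] that then vanish on an interval too. *)
Lemma pf_coef_zero {R : realType} m (c : 'I_m.+1 * 'I_m.+1 -> R) (a : R) : 0 < a ->
  (forall x : R * R, 0 < x.1 < a -> 0 < x.2 < a -> \sum_ij c ij * pmono ij x = 0) ->
  forall ij : 'I_m.+1 * 'I_m.+1, (ij.1 + ij.2 <= m)%N -> c ij = 0.
Proof.
move=> a0 H [i j] /= ij.
pose q (i : 'I_m.+1) : {poly R} := \poly_(j < m.+1) (if (i + j <= m)%N then c (i, inord j) else 0).
pose p s : {poly R} := \poly_(i < m.+1) (q (inord i)).[s].
have E s t : \sum_ij c ij * pmono ij (t, s) = (p s).[t].
  rewrite /p horner_poly.
  transitivity (\sum_i \sum_j c (i, j) * pmono (i, j) (t, s)).
    by rewrite pair_bigA; apply: eq_bigr => -[].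
  apply: eq_bigr => i' _; rewrite inord_val /q horner_poly mulr_suml; apply: eq_bigr => j' _.
  rewrite inord_val /pmono /=; case: ifP => _; last by rewrite !mulr0 !mul0r.
  by rewrite /mono /=; ring.
have p0 s : 0 < s < a -> p s = 0.
  move=> sa; apply: (poly_zero_itv a0) => t ta.
  by rewrite -E H.
have q0 : q i = 0.
  apply: (poly_zero_itv a0) => s /p0 /(congr1 (fun P : {poly R} => P`_i)).
  by rewrite /p coef_poly ltn_ord coef0 inord_val.
have := congr1 (fun P : {poly R} => P`_j) q0.
by rewrite /q coef_poly ltn_ord coef0 inord_val ij.
Qed.

(** * Polynomials controlled by their moments against a positive weight *)

Lemma Rintegral_lower {d} {X : measurableType d} {R : realType} (mu : {measure set X -> \bar R})
    (S Q : set X) (f : X -> R) (e : R) :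
  measurable S -> measurable Q -> Q `<=` S -> (mu Q < +oo)%E -> mu.-integrable S (EFin \o f) ->
  (forall x, S x -> 0 <= f x) -> 0 <= e -> (forall x, Q x -> e <= f x) ->
  e * fine (mu Q) <= \int[mu]_(x in S) f x.
Proof.
move=> mS mQ QS fQ fi f0 e0 fe.
have mf : measurable_fun S (EFin \o f) by case/integrableP: fi.
have mfQ : measurable_fun Q (EFin \o f) by exact: measurable_funS mf.
rewrite -lee_fin EFinM fineK ?ge0_fin_numE // /Rintegral fineK; last exact: integrable_fin_num.
rewrite -integral_cst //; apply: (@le_trans _ _ (\int[mu]_(x in Q) (f x)%:E)%E).
  by apply: ge0_le_integral => // x Qx; rewrite lee_fin ?e0 ?fe.
by apply: ge0_subset_integral => // x Sx; rewrite lee_fin f0.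
Qed.

Lemma Rintegral_zero_plane {R : realType} (S : set (R * R)) (f : R * R -> R) :
  open S -> bounded_set S -> continuous f -> (forall x, S x -> 0 <= f x) ->
  \int[area]_(x in (S : set (plane R))) f x = 0 -> forall x, S x -> f x = 0.
Proof.
move=> oS bS cf f0 I0 x Sx; apply/eqP; apply: contraT => fx0.
have fx : 0 < f x by rewrite lt_neqAle eq_sym fx0 f0.
have mS := open_measurable_plane oS.
have : nbhs x (S `&` [set y | f x / 2 < f y]).
  apply: filterI; first exact: open_nbhs_nbhs.
  apply: open_nbhs_nbhs; split; last by rewrite /=; lra.
  by apply: (@open_comp _ _ f [set y | f x / 2 < y]) => [? _|]; [exact: cf|exact: open_gt].
move=> /nbhs_ballP[e /= e0 He].
pose Q := square x (e / 2).
have QS y : Q y -> S y /\ f x / 2 < f y.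
  move=> [/=]; rewrite !in_itv /= => y1 y2; apply: He.
  by split; rewrite /ball /= ltr_norml; lra.
have e2 : 0 < e / 2 by rewrite divr_gt0.
have aQ := area_square x e2.
have := @Rintegral_lower _ _ _ area S Q f (f x / 2) mS (measurable_square _ _).
rewrite I0 aQ => /(_ (fun y Qy => (QS y Qy).1) (ltry _) (integrable_continuous mS bS cf) f0) H.
have : f x / 2 * fine (4 * (e / 2) ^+ 2)%:E <= 0.
  by apply: H => [|y /QS[_ /ltW]] //; rewrite divr_ge0 // ltW.
by rewrite /= leNgt !mulr_gt0 // invr_gt0.
Qed.

Lemma Rintegral_zero_unit {R : realType} (f : R -> R) :
  continuous f -> (forall x, 0 <= x <= 1 -> 0 <= f x) ->
  \int[@lebesgue_measure R]_(x in unit_itv) f x = 0 -> forall x, 0 < x < 1 -> f x = 0.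
Proof.
move=> cf f0 I0 x x01; apply/eqP; apply: contraT => fx0.
have fx : 0 < f x by rewrite lt_neqAle eq_sym fx0 f0 //; lra.
have : nbhs x ([set` `]0, 1[] `&` [set y | f x / 2 < f y]).
  apply: filterI; first by apply: open_nbhs_nbhs; split => //=; rewrite in_itv.
  apply: open_nbhs_nbhs; split; last by rewrite /=; lra.
  by apply: (@open_comp _ _ f [set y | f x / 2 < y]) => [? _|]; [exact: cf|exact: open_gt].
move=> /nbhs_ballP[e /= e0 He].
pose Q : set (measurableTypeR R) := `[x - e / 2, x + e / 2]%classic.
have QS y : Q y -> 0 < y < 1 /\ f x / 2 < f y.
  rewrite /Q /= in_itv /= => y1; have [] := He y; first by rewrite /ball /= ltr_norml; lra.
  by rewrite /= in_itv.
have aQ : (@lebesgue_measure R Q = e%:E)%E.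
  by rewrite lebesgue_measure_itv /= lte_fin ifT; [rewrite -EFinB; congr EFin; field|lra].
have mU := @measurable_unit R.
have := @Rintegral_lower _ _ _ (@lebesgue_measure R) unit_itv Q f (f x / 2) mU (measurable_itv _).
have QU : Q `<=` unit_itv by move=> y /QS[? _]; rewrite /unit_itv /= in_itv /=; lra.
have f0' y : unit_itv y -> 0 <= f y by rewrite /unit_itv /= in_itv; exact: f0.
have fQ : (@lebesgue_measure R Q < +oo)%E by rewrite aQ ltry.
rewrite I0 => /(_ QU fQ (unit_integrable cf) f0') H.
have : f x / 2 * fine (@lebesgue_measure R Q) <= 0.
  by apply: H => [|y /QS[_ /ltW]] //; rewrite divr_ge0 // ltW.
by rewrite aQ /= leNgt !mulr_gt0 // invr_gt0.
Qed.

(** If all weighted moments of a combination against the [e j] vanish, so does its weighted square,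
    and the hypothesis makes its coefficients vanish; [finite_bound] turns this into an estimate.
    [P] selects the indices whose coefficients are determined. *)
Lemma gram_bound {R : realType} {T : topologicalType} (I : finType) (P : pred I) (e : I -> T -> R)
    (F : (T -> R) -> R) (om : T -> R) :
  (forall i, continuous (e i)) -> continuous om -> linfun_on F ->
  (forall c, F (fun x => (\sum_i c i * e i x) ^+ 2 * om x) = 0 -> forall i, P i -> c i = 0) ->
  exists2 C : R, 0 <= C & forall c M,
    (forall j, `|F (fun x => (\sum_i c i * e i x) * (om x * e j x))| <= M) ->
    forall i, P i -> `|c i| <= C * M.
Proof.
move=> ce com [FD FZ] H.
have lF j : linfun_on (fun f : T -> R => F (fun x => f x * (om x * e j x))).
  have cj : continuous (fun x => om x * e j x) by move=> x; apply: cvgM; [exact: com|exact: ce].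
  split=> [f g cf cg|k f cf].
    rewrite -(FD (fun x => f x * (om x * e j x)) (fun x => g x * (om x * e j x))); first by congr F; apply/funext => x; rewrite mulrDl.
      by move=> x; apply: cvgM; [exact: cf|exact: cj].
    by move=> x; apply: cvgM; [exact: cg|exact: cj].
  rewrite -(FZ k (fun x => f x * (om x * e j x))); first by congr F; apply/funext => x; rewrite -mulrA.
  by move=> x; apply: cvgM; [exact: cf|exact: cj].
have [|C C0 HC] := @finite_uniform R I (fun i C => forall c M,
    (forall j, `|F (fun x => (\sum_i c i * e i x) * (om x * e j x))| <= M) -> P i -> `|c i| <= C * M).
  move=> i0.
  (* The form to be bounded extracts the single coefficient [i0], or is zero if [i0] is not selected
     by [P]. *)
  have [c|C C0 HC] := @finite_bound R I I (fun i j => F (fun x => e i x * (om x * e j x)))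
      (fun i => if P i && (i == i0) then 1 else 0).
    move=> Hc.
    have cE j : F (fun x => (\sum_i c i * e i x) * (om x * e j x)) = 0.
      by rewrite -[RHS](Hc j) (linfun_sum _ (lF j) ce).
    have F0 : F (fun x => (\sum_i c i * e i x) ^+ 2 * om x) = 0.
      have cfj j : continuous (fun x => (\sum_i c i * e i x) * (om x * e j x)).
        move=> x; apply: cvgM; last by apply: cvgM; [exact: com|exact: ce].
        by apply: continuous_bigsum => i y; apply: cvgM; [exact: cvg_cst|exact: ce].
      have E0 : F (fun x => \sum_j c j * ((\sum_i c i * e i x) * (om x * e j x))) = 0.
        by rewrite (linfun_sum c (conj FD FZ) cfj) big1 // => j _; rewrite cE mulr0.
      rewrite -[RHS]E0; congr F; apply/funext => x.
      under [RHS]eq_bigr => j _ do rewrite mulrCA (mulrCA (c j)).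
      by rewrite -!mulr_sumr expr2; ring.
    rewrite big1 // => i _; case: ifPn; rewrite ?mulr0 // => /andP[Pi _].
    by rewrite (H c F0) ?mul0r.
  exists C => // C' CC' c M HM Pi0.
  have M0 : 0 <= M by apply: le_trans (HM i0).
  have := HC c M; rewrite (bigD1 i0) //= Pi0 eqxx /= mulr1 big1 ?addr0; last first.
    by move=> i /negPf ->; rewrite andbF mulr0.
  move=> /(_ _)/le_trans; apply; last exact: ler_wpM2r.
  by move=> j; rewrite -(linfun_sum _ (lF j) ce); exact: HM.
exists C => // c M HM i; exact: HC.
Qed.

Definition pfsum {R : realType} m (c : 'I_m.+1 * 'I_m.+1 -> R) : R * R -> R :=
  fun x => \sum_ij c ij * pmono ij x.

Lemma pf_pmono {R : realType} m (ij : 'I_m.+1 * 'I_m.+1) : pf m (@pmono R m ij).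
Proof. by rewrite /pmono; case: ifP => h; [exact: pf_mono|exact: pf0]. Qed.

Lemma pf_continuous {R : realType} m (f : R * R -> R) : pf m f -> continuous f.
Proof. by move=> pm; apply: smooth_continuous; exact: pf_smooth pm. Qed.

Lemma smooth_bigsum {R : realType} (I : Type) (r : seq I) (f : I -> R * R -> R) :
  (forall i, smooth (f i)) -> smooth (fun x => \sum_(i <- r) f i x).
Proof.
move=> sf; elim: r => [|i r IH]; first by under eq_fun do rewrite big_nil; exact: smooth_cst.
by under eq_fun do rewrite big_cons; exact: smoothD.
Qed.

Lemma pd_bigsum {R : realType} (I : Type) (r : seq I) (c : I -> R) (e : I -> R * R -> R) :
  (forall i, smooth (e i)) ->
  pd1 (fun x => \sum_(i <- r) c i * e i x) = (fun x => \sum_(i <- r) c i * pd1 (e i) x) /\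
  pd2 (fun x => \sum_(i <- r) c i * e i x) = (fun x => \sum_(i <- r) c i * pd2 (e i) x).
Proof.
move=> se; elim: r => [|i r [IH1 IH2]].
  have E (h : I -> R * R -> R) : (fun x => \sum_(i <- [::]) h i x) = fun=> 0 by apply/funext => x; rewrite big_nil.
  by rewrite !E; exact: pd_cst.
have E (h : I -> R * R -> R) : (fun x => \sum_(i <- i :: r) h i x) = fun x => h i x + \sum_(i <- r) h i x.
  by apply/funext => x; rewrite big_cons.
have sr : smooth (fun x => \sum_(i <- r) c i * e i x) by apply: smooth_bigsum => j; exact: smoothZ.
have si : smooth (fun x => c i * e i x) by exact: smoothZ.
have sc := @smooth_cst R (c i); have [c1 c2] := pd_cst (c i).
rewrite !E pd1D // pd2D // IH1 IH2 pd1M // pd2M // c1 c2.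
by split; apply/funext => x; rewrite mulr0 addr0.
Qed.

Lemma pfsum_bound {R : realType} m (B : R) : exists2 C : R, 0 <= C & forall (c : 'I_m.+1 * 'I_m.+1 -> R) M,
  0 <= M -> (forall ij : 'I_m.+1 * 'I_m.+1, (ij.1 + ij.2 <= m)%N -> `|c ij| <= M) ->
  forall x, box B x -> [/\ `|pfsum c x| <= C * M, `|pd1 (pfsum c) x| <= C * M & `|pd2 (pfsum c) x| <= C * M].
Proof.
have gen (e : 'I_m.+1 * 'I_m.+1 -> R * R -> R) : (forall ij, continuous (e ij)) ->
  (forall ij : 'I_m.+1 * 'I_m.+1, ~~ (ij.1 + ij.2 <= m)%N -> e ij = fun=> 0) ->
  exists2 C : R, 0 <= C & forall (c : 'I_m.+1 * 'I_m.+1 -> R) M, 0 <= M ->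
   (forall ij : 'I_m.+1 * 'I_m.+1, (ij.1 + ij.2 <= m)%N -> `|c ij| <= M) ->
   forall x, box B x -> `|\sum_ij c ij * e ij x| <= C * M.
  move=> ce e0.
  have [ij|C C0 HC] := @finite_uniform R ('I_m.+1 * 'I_m.+1)%type (fun ij C => forall x, box B x -> `|e ij x| <= C).
    have [C C0 HC] := continuous_bounded_box B (ce ij); exists C => // C' CC' x Bx.
    exact: le_trans (HC _ Bx) CC'.
  exists (\sum_(ij : 'I_m.+1 * 'I_m.+1) C); first by apply: sumr_ge0.
  move=> c M M0 HM x Bx; rewrite mulr_suml; apply: le_trans (ler_norm_sum _ _ _) _; apply: ler_sum => ij _.
  rewrite normrM mulrC; case: (boolP (ij.1 + ij.2 <= m)%N) => h.
    by apply: ler_pM => //; [exact: HC|exact: HM].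
  by rewrite e0 // normr0 mul0r mulr_ge0.
have p0 (ij : 'I_m.+1 * 'I_m.+1) : ~~ (ij.1 + ij.2 <= m)%N -> @pmono R m ij = fun=> 0.
  by rewrite /pmono => /negPf ->.
have [||C0 C00 H0] := gen (@pmono R m); [by move=> ij; exact: pf_continuous (pf_pmono ij)|exact: p0|].
have [||C1 C10 H1] := gen (fun ij => pd1 (@pmono R m ij)).
- by move=> ij; have [h _] := pf_pd (@pf_pmono R m ij); exact: pf_continuous h.
- by move=> ij h; rewrite p0 //; have [-> _] := pd_cst (0 : R).
have [||C2 C20 H2] := gen (fun ij => pd2 (@pmono R m ij)).
- by move=> ij; have [_ h] := pf_pd (@pf_pmono R m ij); exact: pf_continuous h.
- by move=> ij h; rewrite p0 //; have [_ ->] := pd_cst (0 : R).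
exists (C0 + C1 + C2); first by rewrite !addr_ge0.
move=> c M M0 HM x Bx.
have [|d1 d2] := @pd_bigsum R _ (index_enum _) c (@pmono R m).
  by move=> ij; exact: pf_smooth (pf_pmono ij).
have h0 := H0 c M M0 HM x Bx; have h1 := H1 c M M0 HM x Bx; have h2 := H2 c M M0 HM x Bx.
have k0 := mulr_ge0 C00 M0; have k1 := mulr_ge0 C10 M0; have k2 := mulr_ge0 C20 M0.
rewrite /pfsum d1 d2 !mulrDl; split; [apply: le_trans h0 _|apply: le_trans h1 _|apply: le_trans h2 _].
- by rewrite -addrA lerDl addr_ge0.
- by rewrite addrAC lerDr addr_ge0.
- by rewrite lerDr addr_ge0.
Qed.

Lemma linfun_area {R : realType} (S : set (R * R)) (h : R * R -> R) : open S -> bounded_set S -> continuous h ->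
  linfun_on (fun f : R * R -> R => \int[area]_(x in (S : set (plane R))) (f x * h x)).
Proof.
move=> oS bS ch; have mS := open_measurable_plane oS.
have ci (f : R * R -> R) : continuous f -> (@area R).-integrable (S : set (plane R)) (EFin \o (fun x => f x * h x)).
  by move=> cf; apply: integrable_continuous => // x; apply: cvgM; [exact: cf|exact: ch].
split=> [f g cf cg|k f cf].
  by rewrite -RintegralD; [apply: eq_Rintegral => x _; rewrite mulrDl|exact: mS|exact: ci|exact: ci].
rewrite -RintegralZl; [|exact: mS|exact: ci].
by apply: eq_Rintegral => x _; rewrite mulrA.
Qed.

Lemma linfun_unit {R : realType} (h : R -> R) : continuous h ->
  linfun_on (fun f : R -> R => \int[@lebesgue_measure R]_(t in unit_itv) (f t * h t)).
Proof.
move=> ch; have mS := @measurable_unit R.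
have ci (f : R -> R) : continuous f -> (@lebesgue_measure R).-integrable unit_itv (EFin \o (fun x => f x * h x)).
  by move=> cf; apply: unit_integrable => x; apply: cvgM; [exact: cf|exact: ch].
split=> [f g cf cg|k f cf].
  by rewrite -RintegralD; [apply: eq_Rintegral => x _; rewrite mulrDl|exact: mS|exact: ci|exact: ci].
rewrite -RintegralZl; [|exact: mS|exact: ci].
by apply: eq_Rintegral => x _; rewrite mulrA.
Qed.

(** A vanishing weighted square forces the polynomial to vanish on a small square at the origin,
    hence identically. The box on which the bound is concluded is unrelated to [S] and may be much
    larger; inverse estimates on [K] depend on this. *)
Lemma pf_moment_bound {R : realType} (S : set (R * R)) (om : R * R -> R) (a B : R) m :
  open S -> bounded_set S -> 0 < a -> (forall x, 0 < x.1 < a -> 0 < x.2 < a -> S x) ->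
  continuous om -> (forall x, S x -> 0 < om x) ->
  exists2 C : R, 0 <= C & forall f M, pf m f ->
    (forall i j, (i + j <= m)%N -> `|\int[area]_(x in (S : set (plane R))) (f x * (om x * mono i j x))| <= M) ->
    forall x, box B x -> [/\ `|f x| <= C * M, `|pd1 f x| <= C * M & `|pd2 f x| <= C * M].
Proof.
move=> oS bS a0 aS com om0; have mS := open_measurable_plane oS.
have c1 : continuous ((fun=> 1) : R * R -> R) by move=> ?; exact: cvg_cst.
have ce (ij : 'I_m.+1 * 'I_m.+1) : continuous (@pmono R m ij) by exact: pf_continuous (pf_pmono ij).
have [c Hc [i j]|C C0 HC] := @gram_bound R _ _ (fun ij : 'I_m.+1 * 'I_m.+1 => ij.1 + ij.2 <= m)%N (@pmono R m)
    (fun f => \int[area]_(x in (S : set (plane R))) (f x * 1)) om ce com (linfun_area oS bS c1).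
  apply: (pf_coef_zero a0) => x x1 x2.
  have cs : continuous (pfsum c).
    by apply: continuous_bigsum => ij y; apply: cvgM; [exact: cvg_cst|exact: ce].
  have := @Rintegral_zero_plane R S (fun x => (pfsum c x) ^+ 2 * om x) oS bS.
  move=> /(_ _ _ _ x (aS x x1 x2)) H.
  have /eqP : pfsum c x ^+ 2 * om x = 0.
    apply: H.
    - by move=> y; apply: cvgM; [apply: cvgM; exact: cs|exact: com].
    - by move=> y Sy; rewrite mulr_ge0 ?sqr_ge0 // ltW // om0.
    - by rewrite -[RHS]Hc; apply: eq_Rintegral => y _; rewrite mulr1.
  by rewrite mulf_eq0 sqrf_eq0 => /orP[/eqP //|/eqP h]; have := om0 x (aS x x1 x2); rewrite h ltxx.
have [D D0 HD] := @pfsum_bound R m B.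
exists (D * C); first exact: mulr_ge0.
move=> f M [c fE] HM x Bx.
have M0 : 0 <= M by apply: le_trans (HM 0%N 0%N isT).
rewrite -!mulrA fE -/(pfsum c); apply: HD => //; first exact: mulr_ge0.
apply: HC => ij; rewrite /pmono; case: ifP => h.
  have := HM _ _ h; rewrite fE; congr (`|_| <= _); apply: eq_Rintegral => y _.
  by rewrite mulr1.
rewrite (_ : \int[area]_(x in _) _ = 0) ?normr0 //.
rewrite /Rintegral integral0_eq // => y _.
by rewrite !(mulr0, mul0r).
Qed.

Lemma poly_moment_bound {R : realType} (k : nat) (om : R -> R) :
  continuous om -> (forall t, 0 < t < 1 -> 0 < om t) -> (forall t, 0 <= t <= 1 -> 0 <= om t) ->
  exists2 C : R, 0 <= C & forall (P : {poly R}) M, (size P <= k.+1)%N ->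
    (forall i, (i <= k)%N -> `|\int[@lebesgue_measure R]_(t in unit_itv) (P.[t] * (om t * t ^+ i))| <= M) ->
    forall t, 0 <= t <= 1 -> `|P.[t]| <= C * M.
Proof.
move=> com om0 om1.
have ce (i : 'I_k.+1) : continuous (fun t : R => t ^+ i) by move=> t; exact: exprn_continuous.
have c1 : continuous ((fun=> 1) : R -> R) by move=> ?; exact: cvg_cst.
have [c Hc i _|C C0 HC] := @gram_bound R R 'I_k.+1 xpredT (fun (i : 'I_k.+1) (t : R) => t ^+ i)
    (fun f => \int[@lebesgue_measure R]_(t in unit_itv) (f t * 1)) om ce com (linfun_unit c1).
  pose P : {poly R} := \poly_(i < k.+1) c (inord i).
  have PE t : \sum_i c i * t ^+ i = P.[t].
    by rewrite horner_poly; apply: eq_bigr => j _; rewrite inord_val.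
  have P0 : P = 0.
    apply: (@poly_zero_itv _ P 0 1 ltr01) => t t01.
    have cP : continuous (fun t => P.[t]) by exact: continuous_horner.
    have /eqP : P.[t] ^+ 2 * om t = 0.
      apply: (@Rintegral_zero_unit R (fun t => P.[t] ^+ 2 * om t)) t01.
      - by move=> y; apply: cvgM; [apply: cvgM; exact: cP|exact: com].
      - by move=> y y01; rewrite mulr_ge0 ?sqr_ge0 // om1.
      - by rewrite -[RHS]Hc; apply: eq_Rintegral => y _; rewrite PE mulr1.
    by rewrite mulf_eq0 sqrf_eq0 => /orP[/eqP //|/eqP h]; have := om0 t t01; rewrite h ltxx.
  have := congr1 (fun Q : {poly R} => Q`_i) P0.
  by rewrite coef0 coef_poly ltn_ord inord_val.
exists (\sum_(i < k.+1) C); first by apply: sumr_ge0.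
move=> P M sP HM t t01.
have PE s : P.[s] = \sum_(i < k.+1) P`_i * s ^+ i by rewrite (horner_coef_wide _ sP).
have Hc (i : 'I_k.+1) : `|P`_i| <= C * M.
  apply: (HC (fun i : 'I_k.+1 => P`_i)) => // j.
  have := HM j; rewrite -ltnS ltn_ord => /(_ isT); congr (`|_| <= _); apply: eq_Rintegral => y _.
  by rewrite PE mulr1.
rewrite PE mulr_suml; apply: le_trans (ler_norm_sum _ _ _) _; apply: ler_sum => i _.
rewrite normrM normrX; apply: le_trans (Hc i); rewrite ler_piMr //.
by rewrite exprn_ile1 // ger0_norm; lra.
Qed.

(** * Unisolvence on the reference triangle *)

Definition rbub {R : realType} (x : R * R) : R := x.1 * x.2 * (1 - x.1 - x.2).

Lemma pf_coord {R : realType} : pf 1 (fun x : R * R => x.1) /\ pf 1 (fun x : R * R => x.2).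
Proof.
by split; [have := pf_affine (1 : R) 0 0|have := pf_affine (0 : R) 1 0]; congr pf; apply/funext => x; ring.
Qed.

Lemma pf_lam1 {R : realType} : pf 1 (fun x : R * R => 1 - x.1 - x.2).
Proof. by have := pf_affine (-1 : R) (-1) 1; congr pf; apply/funext => x; ring. Qed.

Lemma pf_rbub {R : realType} : pf 3 (@rbub R).
Proof. by have [h1 h2] := @pf_coord R; apply: (pfM (pfM h1 h2)); exact: pf_lam1. Qed.

Lemma rbub_gt0 {R : realType} (x : R * R) : rtri x -> 0 < rbub x.
Proof. by move=> [x1 x2 x3]; rewrite !mulr_gt0 //; lra. Qed.

(** The end values make $P = t(t-1)Q$ with [Q] of degree at most [k - 2], so [Q] is itself a
    combination of the test monomials. Testing with [Q] gives a vanishing integral of $Q^2\,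
    t(1-t)$. *)
Lemma edge_poly_zero {R : realType} k (P : {poly R}) : (size P <= k.+1)%N -> P.[0] = 0 -> P.[1] = 0 ->
  (forall l, (l + 2 <= k)%N -> \int[@lebesgue_measure R]_(t in unit_itv) (P.[t] * (t - 2^-1) ^+ l) = 0) ->
  P = 0.
Proof.
move=> sP P0 P1 HM.
have [Q1 Q1E] : exists Q1 : {poly R}, P = Q1 * ('X - 0%:P) by apply/factor_theorem; rewrite /root P0.
have : root Q1 1.
  by move: P1; rewrite Q1E hornerM !hornerE subr0 mulr1 => /eqP.
move=> /factor_theorem[Q QE].
have PE t : P.[t] = Q.[t] * (t * (t - 1)) by rewrite Q1E QE !hornerM !hornerXsubC subr0; ring.
suff Qz : Q = 0 by rewrite Q1E QE Qz !mul0r.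
have [//|Q0] := eqVneq Q 0.
have sQ : (size Q + 2 <= k.+1)%N.
  have := sP; rewrite Q1E QE -mulrA size_mul ?mulf_neq0 ?polyXsubC_eq0 //.
  by rewrite size_mul ?polyXsubC_eq0 // !size_XsubC /= !addnS addn0.
(* The coefficients of [Q'] are those of [Q] expanded at the midpoint, where the moments are
   centred. *)
pose Q' := Q \Po ('X + 2^-1%:P).
have sQ' : size Q' = size Q by rewrite size_comp_poly2 // size_XaddC.
have QQ' t : Q.[t] = \sum_(l < size Q) Q'`_l * (t - 2^-1) ^+ l.
  by rewrite -sQ' -horner_coef horner_comp !hornerE subrK.
have cP : continuous (fun t => P.[t]) by exact: continuous_horner.
have cQ : continuous (fun t => Q.[t]) by exact: continuous_horner.
have ce (l : 'I_(size Q)) : continuous (fun t : R => (t - 2^-1) ^+ l).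
  move=> t; apply: (@continuous_comp _ _ _ (fun t : R => t - 2^-1) (fun t => t ^+ l)); last exact: exprn_continuous.
  by apply: cvgB; [exact: cvg_id|exact: cvg_cst].
have := linfun_sum (fun l : 'I_(size Q) => Q'`_l) (linfun_unit cP) ce.
rewrite [X in _ = X]big1 => [E|l _]; last first.
  rewrite (_ : Rintegral _ _ _ = 0) ?mulr0 //; rewrite -[RHS](HM l).
    by apply: eq_Rintegral => t _; rewrite mulrC.
  by have b := ltn_ord l; move: sQ; rewrite !addn2 !ltnS; exact: leq_ltn_trans.
have Z t : 0 < t < 1 -> Q.[t] ^+ 2 * (t * (1 - t)) = 0.
  apply: (@Rintegral_zero_unit R (fun t => Q.[t] ^+ 2 * (t * (1 - t)))).
  - move=> y; apply: cvgM; first by apply: cvgM; exact: cQ.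
    by apply: cvgM; [exact: cvg_id|apply: cvgB; [exact: cvg_cst|exact: cvg_id]].
  - by move=> y y01; rewrite mulr_ge0 ?sqr_ge0 // mulr_ge0; lra.
  - transitivity (- \int[@lebesgue_measure R]_(t in unit_itv) (Q.[t] * P.[t])).
      rewrite -mulN1r -RintegralZl; [|exact: measurable_unit|].
        by apply: eq_Rintegral => y _; rewrite PE; ring.
      by apply: unit_integrable => y; apply: cvgM; [exact: cQ|exact: cP].
    apply/eqP; rewrite oppr_eq0; apply/eqP; rewrite -[RHS]E.
    by apply: eq_Rintegral => y _; rewrite QQ'.
apply: (@poly_zero_itv _ Q 0 1 ltr01) => t t01.
have /eqP := Z t t01; rewrite mulf_eq0 sqrf_eq0 => /orP[/eqP //|].
by rewrite mulf_eq0 => /orP[] /eqP; lra.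
Qed.

Definition refv {R : realType} (a : 'I_3) : R * R :=
  (if val a == 1%N then 1 else 0, if val a == 2%N then 1 else 0).

Lemma ref_edges {R : realType} (Q : 'I_3 -> Prop) (f : R * R -> R) :
  (forall a, Q a -> forall s, f (segpath (refv a) (refv (ordS a)) s) = 0) -> (forall a, Q a) ->
  [/\ forall s, f (s, 0) = 0, forall s, f (0, s) = 0 & forall s, f (s, 1 - s) = 0].
Proof.
move=> H HQ; split=> s.
- have := H ord0 (HQ _) s; congr (f _ = _); rewrite segpathE /refv /=.
  by congr (_, _); ring.
- have := H (inord 2) (HQ _) (1 - s); congr (f _ = _); rewrite segpathE /refv /= inordK //=.
  by congr (_, _); ring.
- have := H (inord 1) (HQ _) (1 - s); congr (f _ = _); rewrite segpathE /refv /= inordK //=.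
  by congr (_, _); ring.
Qed.

Lemma rbub_edge {R : realType} (a : 'I_3) (s : R) : rbub (segpath (refv a) (refv (ordS a)) s) = 0.
Proof.
rewrite segpathE /rbub /refv; case: a => -[|[|[|//]]] i /=; ring.
Qed.

(** Three divisions by [pf_shift], with affine changes of variables that bring the next edge to the
    axis. The quotient need only vanish inside that edge, where the factors already divided out are
    non-zero. The degree of [g] is not tracked beyond [k]. *)
Lemma pf_divide_bubble {R : realType} k (p : R * R -> R) : pf k p ->
  (forall s, p (s, 0) = 0) -> (forall s, p (0, s) = 0) -> (forall s, p (s, 1 - s) = 0) ->
  exists2 g, pf k g & forall x, p x = rbub x * g x.
Proof.
move=> pp h1 h2 h3; have [f1 f2] := @pf_coord R; have f3 := @pf_lam1 R.
have [g1 pg1 E1] := pf_shift pp (fun s _ => h1 s).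
have [|g2 pg2 E2] := pf_shift (pf_comp f2 f1 pg1).
  move=> s /andP[s0 _] /=; have := E1 (0, s); rewrite h2 /= => /esym/eqP.
  by rewrite mulf_eq0 gt_eqF //= => /eqP.
have [|g3 pg3 E3] := pf_shift (pf_comp f3 f1 pg2).
  move=> s s01 /=; rewrite subr0.
  have E2s := E2 (1 - s, s); have := E1 (s, 1 - s); rewrite h3 /= E2s /= => /esym/eqP.
  by rewrite !mulf_eq0 => /or3P[] /eqP //; lra.
exists (fun x => g3 (x.1, 1 - x.1 - x.2)).
  apply: (pf_comp f1 f3); apply: pfW pg3.
  by rewrite (leq_trans (leq_pred _)) // (leq_trans (leq_pred _)) // leq_pred.
move=> x; rewrite E1.
have -> : g1 x = x.1 * g2 (x.2, x.1) by have := E2 (x.2, x.1); rewrite /= -surjective_pairing.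
have -> : g2 (x.2, x.1) = (1 - x.1 - x.2) * g3 (x.1, 1 - x.1 - x.2).
  by have := E3 (x.1, 1 - x.1 - x.2) => /= <-; congr (g2 (_, _)); ring.
by rewrite /rbub; ring.
Qed.

(** The vertex and edge conditions make [p] divisible by the bubble, so that [w] is the bubble times an element of [P_k],
    to which [w] is orthogonal. *)
Lemma ref_unisolvent {R : realType} k (p q : R * R -> R) : pf k p -> pf k q ->
  let w x := p x + rbub x * q x in
  (forall a, w (refv a) = 0) ->
  (forall a l, (l + 2 <= k)%N ->
    \int[@lebesgue_measure R]_(t in unit_itv) (w (segpath (refv a) (refv (ordS a)) t) * (t - 2^-1) ^+ l) = 0) ->
  (forall i j, (i + j <= k)%N -> \int[area]_(x in (rtri : set (plane R))) (w x * mono i j x) = 0) ->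
  forall x, rtri x -> w x = 0.
Proof.
move=> pp pq w wv we wi.
have b0 a : rbub (refv a) = 0 :> R.
  by have := @rbub_edge R a 0; rewrite /segpath scale0r addr0.
have pe a s : p (segpath (refv a) (refv (ordS a)) s) = 0.
  have [P sP PE] := pf_segpath (refv a) (refv (ordS a)) pp.
  rewrite PE (@edge_poly_zero R k P) ?horner0 //.
  - by rewrite -PE /segpath scale0r addr0; have := wv a; rewrite /w b0 mul0r addr0.
  - by rewrite -PE /segpath scale1r addrC subrK; have := wv (ordS a); rewrite /w b0 mul0r addr0.
  - move=> l lk; rewrite -[RHS](we a l lk); apply: eq_Rintegral => t _.
    by rewrite /w rbub_edge mul0r addr0 PE.
have [h1 h2 h3] := @ref_edges R (fun=> True) p (fun a _ s => pe a s) (fun=> I).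
have [g pg gE] := pf_divide_bubble pp h1 h2 h3.
pose u x := g x + q x.
have pu : pf k u by exact: pfD.
have wE x : w x = rbub x * u x by rewrite /w gE -mulrDr.
have cb : continuous (@rbub R) := pf_continuous pf_rbub.
have cu : continuous u := pf_continuous pu.
have cw : continuous w.
  move=> y; apply: cvgD; first exact: (pf_continuous pp).
  by apply: cvgM; [exact: cb|exact: (pf_continuous pq)].
have Z : \int[area]_(x in (rtri : set (plane R))) (rbub x * u x ^+ 2) = 0.
  have [c cE] := pu.
  have := linfun_sum c (linfun_area open_rtri bounded_rtri cw) (fun ij => pf_continuous (pf_pmono ij)).
  rewrite [X in _ = X]big1 => [E|ij _].
    rewrite -[RHS]E; apply: eq_Rintegral => x _.
    have -> : \sum_i c i * pmono i x = u x by rewrite cE.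
    by rewrite wE; ring.
  rewrite (_ : Rintegral _ _ _ = 0) ?mulr0 //; rewrite /pmono; case: ifP => h.
    by rewrite -[RHS](wi _ _ h); apply: eq_Rintegral => x _; rewrite mulrC.
  by rewrite /Rintegral integral0_eq // => x _; rewrite mul0r.
move=> x rx; have /eqP : rbub x * u x ^+ 2 = 0.
  apply: (Rintegral_zero_plane open_rtri bounded_rtri _ _ Z) => //.
    by move=> y; apply: cvgM; [exact: cb|apply: cvgM; exact: cu].
  by move=> y ry; rewrite mulr_ge0 ?sqr_ge0 // ltW // rbub_gt0.
rewrite mulf_eq0 gt_eqF ?rbub_gt0 //= sqrf_eq0 => /eqP ux.
by rewrite wE ux mulr0.
Qed.

Lemma linfun_eval {R : realType} {T : topologicalType} (a : T) : linfun_on (fun f : T -> R => f a).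
Proof. by []. Qed.

Lemma linfun0 {R : realType} {T : topologicalType} : linfun_on (fun f : T -> R => 0).
Proof. by split=> [f g _ _|k f _]; rewrite ?addr0 ?mulr0. Qed.

Lemma linfun_edge {R : realType} (a b : R * R) (h : R -> R) : continuous h ->
  linfun_on (fun f : R * R -> R => \int[@lebesgue_measure R]_(t in unit_itv) (f (segpath a b t) * h t)).
Proof.
move=> ch; have [HD HZ] := linfun_unit ch.
have cs (f : R * R -> R) : continuous f -> continuous (fun t : R => f (segpath a b t)).
  by move=> cf t; apply: (@continuous_comp _ _ _ (segpath a b) f); [exact: continuous_segpath|exact: cf].
split=> [f g cf cg|k f cf].
  exact: (HD (fun t => f (segpath a b t)) (fun t => g (segpath a b t)) (cs _ cf) (cs _ cg)).
exact: (HZ k (fun t => f (segpath a b t)) (cs _ cf)).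
Qed.

Lemma continuous_shift_exp {R : realType} (c : R) l : continuous (fun t : R => (t - c) ^+ l).
Proof.
move=> t; apply: (@continuous_comp _ _ _ (fun t : R => t - c) (fun t => t ^+ l)); last exact: exprn_continuous.
by apply: cvgB; [exact: cvg_id|exact: cvg_cst].
Qed.

Lemma rtri_square {R : realType} (x : R * R) : 0 < x.1 < 2^-1 -> 0 < x.2 < 2^-1 -> rtri x.
Proof. by move=> x1 x2; split; lra. Qed.

(** The pair [(p, q)] need not be determined by the sum, since a multiple of the bubble can lie in
    [P_k]. So the sum itself is bounded: unisolvence is the kernel condition for each of its moments
    up to degree [k + 3], its total degree, and [pf_moment_bound] converts these moments into sup
    bounds. *)
Lemma macro_bound {R : realType} k (B : R) : exists2 C : R, 0 <= C & forall (p q : R * R -> R) M,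
  pf k p -> pf k q ->
  (forall a, `|p (refv a) + rbub (refv a) * q (refv a)| <= M) ->
  (forall a l, (l + 2 <= k)%N ->
    `|\int[@lebesgue_measure R]_(t in unit_itv)
      ((p (segpath (refv a) (refv (ordS a)) t) + rbub (segpath (refv a) (refv (ordS a)) t) *
        q (segpath (refv a) (refv (ordS a)) t)) * (t - 2^-1) ^+ l)| <= M) ->
  (forall i j, (i + j <= k)%N ->
    `|\int[area]_(x in (rtri : set (plane R))) ((p x + rbub x * q x) * mono i j x)| <= M) ->
  forall x, box B x -> [/\ `|p x + rbub x * q x| <= C * M,
    `|pd1 (fun x => p x + rbub x * q x) x| <= C * M & `|pd2 (fun x => p x + rbub x * q x) x| <= C * M].
Proof.
pose I0 := ('I_k.+1 * 'I_k.+1)%type.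
pose e (i : I0 + I0) : R * R -> R := match i with inl ij => pmono ij | inr ij => fun x => rbub x * pmono ij x end.
have ce i : continuous (e i).
  case: i => ij; first exact: pf_continuous (pf_pmono ij).
  exact: pf_continuous (pfM pf_rbub (pf_pmono ij)).
pose L (j : ('I_3 + 'I_3 * 'I_k.+1) + I0) (f : R * R -> R) : R := match j with
  | inl (inl a) => f (refv a)
  | inl (inr al) => if (al.2 + 2 <= k)%N then
     \int[@lebesgue_measure R]_(t in unit_itv) (f (segpath (refv al.1) (refv (ordS al.1)) t) * (t - 2^-1) ^+ al.2)
     else 0
  | inr ij => if (ij.1 + ij.2 <= k)%N then \int[area]_(x in (rtri : set (plane R))) (f x * mono ij.1 ij.2 x) else 0
  end.
have cm i j : continuous (@mono R i j) by apply: smooth_continuous; exact: smooth_mono.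
have lL j : linfun_on (L j).
  case: j => [[a|[a l]]|[i j]] /=; first exact: linfun_eval.
    have [h|/negPf h] := boolP (l + 2 <= k)%N; rewrite /L /= h; last exact: linfun0.
    by apply: linfun_edge; exact: continuous_shift_exp.
  have [h|/negPf h] := boolP (i + j <= k)%N; rewrite /L /= h; last exact: linfun0.
  by apply: linfun_area; [exact: open_rtri|exact: bounded_rtri|exact: cm].
have split_sum c : (fun x => \sum_i c i * e i x) =
    fun x => pfsum (fun ij => c (inl ij)) x + rbub x * pfsum (fun ij => c (inr ij)) x.
  apply/funext => x; rewrite big_sumType /= /pfsum mulr_sumr; congr (_ + _).
  by apply: eq_bigr => ij _; rewrite mulrCA.
have ps (c : I0 -> R) : pf k (pfsum c) by exists c.
have [[i j]|C C0 HC] := @finite_uniform R ('I_(k + 3).+1 * 'I_(k + 3).+1)%type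
   (fun ij C => forall c M, (forall j, `|L j (fun x => \sum_i c i * e i x)| <= M) ->
     `|\int[area]_(x in (rtri : set (plane R))) ((\sum_i c i * e i x) * mono ij.1 ij.2 x)| <= C * M).
  have [c Hc|C C0 HC] := span_bound ce lL (linfun_area open_rtri bounded_rtri (cm i j)).
    rewrite /Rintegral integral0_eq // => x rx.
    suff -> : \sum_i c i * e i x = 0 by rewrite mul0r.
    have := @ref_unisolvent R k _ _ (ps (fun ij => c (inl ij))) (ps (fun ij => c (inr ij))).
    have := congr1 (fun f => f x) (split_sum c) => /= ->; apply => //.
    - by move=> a; have := Hc (inl (inl a)); rewrite split_sum.
    - move=> a l lk; have lk' : (l < k.+1)%N by rewrite ltnS (leq_trans _ lk) // leq_addr.
      by have := Hc (inl (inr (a, Ordinal lk'))); rewrite split_sum /= lk.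
    - move=> i' j' ij; have ik : (i' < k.+1)%N by rewrite ltnS (leq_trans _ ij) // leq_addr.
      have jk : (j' < k.+1)%N by rewrite ltnS (leq_trans _ ij) // leq_addl.
      by have := Hc (inr (Ordinal ik, Ordinal jk)); rewrite split_sum /= ij.
  exists C => // C' CC' c M HM; apply: le_trans (HC _ _ HM) _; apply: ler_wpM2r => //.
  by apply: le_trans (HM (inl (inl ord0))).
have h2 : 0 < 2^-1 :> R by rewrite invr_gt0.
have c1 : continuous ((fun=> 1) : R * R -> R) by move=> ?; exact: cvg_cst.
have [D D0 HD] := @pf_moment_bound R rtri (fun=> 1) 2^-1 B (k + 3) open_rtri bounded_rtri h2 (@rtri_square R) c1 (fun _ _ => ltr01).
exists (D * C); first exact: mulr_ge0.
move=> p q M pp pq Hv He Hi x Bx.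
have pw : pf (k + 3) (fun x => p x + rbub x * q x).
  apply: pfD; first by apply: pfW pp; exact: leq_addr.
  by rewrite addnC; apply: pfM pq; exact: pf_rbub.
have := HD (fun x => p x + rbub x * q x) (C * M) pw; rewrite mulrA; apply => // i j ij.
have ik : (i < (k + 3).+1)%N by rewrite ltnS (leq_trans _ ij) // leq_addr.
have jk : (j < (k + 3).+1)%N by rewrite ltnS (leq_trans _ ij) // leq_addl.
have [c pE] := pp; have [d qE] := pq.
have E : (fun x => p x + rbub x * q x) = fun x => \sum_i (match i with inl ij => c ij | inr ij => d ij end) * e i x.
  by rewrite split_sum pE qE.
have := HC (Ordinal ik, Ordinal jk) (fun i => match i with inl ij => c ij | inr ij => d ij end) M.
rewrite -E /= => H; have {H} := H _.
rewrite (_ : \int[area]_(x in _) _ = \int[area]_(x in (rtri : set (plane R))) ((p x + rbub x * q x) * mono i j x)); last first.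
  by apply: eq_Rintegral => y _; have := congr1 (fun f => f y) E => /= <-.
rewrite (_ : \int[area]_(x in _) _ = \int[area]_(x in (rtri : set (plane R))) ((p x + rbub x * q x) * mono i j x)); last first.
  by apply: eq_Rintegral => y _; rewrite mul1r.
have M0 : 0 <= M by apply: le_trans (Hv ord0).
apply => -[[a|[a l]]|[i' j']] /=; first exact: Hv.
  by case: ifP => h; [exact: He|rewrite normr0].
by case: ifP => h; [exact: Hi|rewrite normr0].
Qed.

(** * Geometry of the triangulation *)

Lemma ord3S (a : 'I_3) : ordS (ordS (ordS a)) = a.
Proof. by apply/val_inj; case: a => -[|[|[|]]]. Qed.

Lemma ord3P (a b : 'I_3) : [\/ b = a, b = ordS a | b = ordS (ordS a)].
Proof.
case: a => -[|[|[|//]]] ia; case: b => -[|[|[|//]]] ib;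
  by [apply: Or31; apply/val_inj|apply: Or32; apply/val_inj|apply: Or33; apply/val_inj].
Qed.

Lemma sum_ord3 {V : nmodType} (F : 'I_3 -> V) (a : 'I_3) :
  \sum_i F i = F a + F (ordS a) + F (ordS (ordS a)).
Proof.
have E : \sum_i F i = F ord0 + F (ordS ord0) + F (ordS (ordS ord0)).
  rewrite !big_ord_recr /= big_ord0 add0r; congr (F _ + F _ + F _); exact/val_inj.
rewrite E; case: (ord3P ord0 a) => ->; rewrite ?ord3S //.
  by rewrite -addrA addrC.
by rewrite addrC addrA.
Qed.

Lemma ordS_neq (a : 'I_3) : (ordS a == a) = false.
Proof. by case: a => -[|[|[|]]]. Qed.

Lemma ordSS_neq (a : 'I_3) : (ordS (ordS a) == a) = false.
Proof. by case: a => -[|[|[|]]]. Qed.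

Section bary.
Context {R : realType} (t : 'I_3 -> R * R) (tn : noncollinear t).

Lemma cross_rot (a b c : R * R) : cross b c a = cross a b c.
Proof. by rewrite /cross; ring. Qed.

Lemma cross_any (a : 'I_3) : cross (t a) (t (ordS a)) (t (ordS (ordS a))) =
  cross (t ord0) (t (ordS ord0)) (t (ordS (ordS ord0))).
Proof.
case: (ord3P ord0 a) => ->; rewrite ?ord3S //; first exact: cross_rot.
by apply: esym; exact: cross_rot.
Qed.

Lemma cross_neq0 (a : 'I_3) : cross (t a) (t (ordS a)) (t (ordS (ordS a))) != 0.
Proof. by rewrite cross_any. Qed.

Lemma bary_lam (a : 'I_3) x :
  [/\ bary_coord t a x = lam1 (t a) (t (ordS a)) (t (ordS (ordS a))) x,
      bary_coord t (ordS a) x = lam2 (t a) (t (ordS a)) (t (ordS (ordS a))) x &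
      bary_coord t (ordS (ordS a)) x = lam3 (t a) (t (ordS a)) (t (ordS (ordS a))) x].
Proof.
have D := cross_neq0 a.
rewrite /lam1 /lam2 /lam3 /bary_coord !ord3S.
move: (t a) (t (ordS a)) (t (ordS (ordS a))) D => p q s D.
have E1 : cross q s p = cross p q s by exact: cross_rot.
have E2 : cross s p q = cross p q s by apply: esym; exact: cross_rot.
rewrite E1 E2; split; last first.
- by congr (_ / _); rewrite /cross; ring.
- by congr (_ / _); rewrite /cross; ring.
- have -> : cross x q s = cross p q s - cross p x s - cross p q x by rewrite /cross; ring.
  by rewrite (mulrBl (cross p q s)^-1) (mulrBl (cross p q s)^-1 (cross p q s)) divff.
Qed.

Lemma bary_sum x : \sum_i bary_coord t i x = 1.
Proof.
rewrite (sum_ord3 _ ord0); have [-> -> ->] := bary_lam ord0 x.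
by rewrite /lam1; ring.
Qed.

Lemma bary_comb x : x = \sum_i bary_coord t i x *: t i.
Proof.
rewrite (sum_ord3 _ ord0); have [-> -> ->] := bary_lam ord0 x.
have D := cross_neq0 ord0; move: D; rewrite /lam1 /lam2 /lam3.
move: (t ord0) (t (ordS ord0)) (t (ordS (ordS ord0))) => p q s D.
rewrite [RHS](_ : _ = ((1 - cross p x s / cross p q s - cross p q x / cross p q s) * p.1
  + cross p x s / cross p q s * q.1 + cross p q x / cross p q s * s.1,
  (1 - cross p x s / cross p q s - cross p q x / cross p q s) * p.2
  + cross p x s / cross p q s * q.2 + cross p q x / cross p q s * s.2)) //.
by rewrite [LHS]surjective_pairing; move: D; rewrite /cross => D; congr (_, _); field; exact: D.
Qed.

Lemma bary_vertex (a b : 'I_3) : bary_coord t a (t b) = (a == b)%:R.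
Proof.
have c0 (p q : R * R) : cross p p q = 0 /\ cross p q p = 0 by rewrite /cross; split; ring.
rewrite /bary_coord; case: (ord3P a b) => ->.
- by rewrite eqxx divff // cross_neq0.
- have -> : (a == ordS a) = false by case: a => -[|[|[|]]].
  by have [-> _] := c0 (t (ordS a)) (t (ordS (ordS a))); rewrite mul0r.
- have -> : (a == ordS (ordS a)) = false by case: a => -[|[|[|]]].
  by have [_ ->] := c0 (t (ordS (ordS a))) (t (ordS a)); rewrite mul0r.
Qed.

Lemma bary_segpath (a : 'I_3) x y s :
  bary_coord t a (segpath x y s) = (1 - s) * bary_coord t a x + s * bary_coord t a y.
Proof. by rewrite /bary_coord segpathE /cross /=; ring. Qed.

Lemma triangle_bary x : triangle t x <-> forall i, 0 <= bary_coord t i x.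
Proof.
split=> [[l [l0 l1 ->]] i|H]; last first.
  by exists (fun i => bary_coord t i x); split => //; [exact: bary_sum|exact: bary_comb].
suff -> : bary_coord t i (\sum_(i < 3) l i *: t i) = l i by [].
move: l1; rewrite !(sum_ord3 _ i) => l1.
have D := cross_neq0 i; rewrite /bary_coord.
rewrite (_ : l i *: t i + l (ordS i) *: t (ordS i) + l (ordS (ordS i)) *: t (ordS (ordS i)) =
  (l i * (t i).1 + l (ordS i) * (t (ordS i)).1 + l (ordS (ordS i)) * (t (ordS (ordS i))).1,
   l i * (t i).2 + l (ordS i) * (t (ordS i)).2 + l (ordS (ordS i)) * (t (ordS (ordS i))).2)) //.
have -> : l i = 1 - l (ordS i) - l (ordS (ordS i)) by rewrite -l1; ring.
by move: D; rewrite /cross => D /=; field; exact: D.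
Qed.

Lemma edge_bary (a : 'I_3) x : edge t a x <-> triangle t x /\ bary_coord t (ordS (ordS a)) x = 0.
Proof.
have n1 := ordSS_neq a; have n2 := ordS_neq (ordS a).
split=> [[s /=]|[Tx b0]].
  rewrite in_itv /= => /andP[s0 s1] <-; split.
    by apply/triangle_bary => i; rewrite bary_segpath !bary_vertex addr_ge0 // mulr_ge0 // subr_ge0.
  by rewrite bary_segpath !bary_vertex n1 n2 !mulr0 addr0.
have S := bary_sum x; rewrite (sum_ord3 _ a) b0 addr0 in S.
have /triangle_bary H := Tx.
exists (bary_coord t (ordS a) x).
  by rewrite /= in_itv /= H -S lerDr H.
rewrite [RHS](bary_comb x) (sum_ord3 _ a) b0 scale0r addr0 /segpath.
have -> : bary_coord t a x = 1 - bary_coord t (ordS a) x by rewrite -S addrK.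
by rewrite scalerBr scalerBl scale1r -!addrA; congr (_ + _); rewrite addrC.
Qed.

Lemma osegment_bary (a : 'I_3) x : osegment (t a) (t (ordS a)) x ->
  [/\ edge t a x, 0 < bary_coord t a x & 0 < bary_coord t (ordS a) x].
Proof.
have n1 := ordS_neq a.
move=> [s /=]; rewrite in_itv /= => /andP[s0 s1] xE; split.
- by exists s => //=; rewrite in_itv /= (ltW s0) ltW.
- by rewrite -xE bary_segpath !bary_vertex eqxx eq_sym n1 mulr1 mulr0 addr0 subr_gt0.
- by rewrite -xE bary_segpath !bary_vertex eqxx n1 mulr1 mulr0 add0r.
Qed.

Definition tri_int : set (R * R) := otri (t ord0) (t (ordS ord0)) (t (ordS (ordS ord0))).

Lemma tri_int_bary x : tri_int x <-> forall i, 0 < bary_coord t i x.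
Proof.
rewrite /tri_int otri_lam //; have [<- <- <-] := bary_lam ord0 x.
split=> [[b0 b1 b2] i|H]; last by split.
by case: (ord3P ord0 i) => ->.
Qed.

Lemma tri_int_any (a : 'I_3) : otri (t a) (t (ordS a)) (t (ordS (ordS a))) = tri_int.
Proof.
apply/seteqP; split => x; rewrite otri_lam ?cross_neq0 // => H.
  apply/tri_int_bary => i; move: H; have [<- <- <-] := bary_lam a x => -[b0 b1 b2].
  by case: (ord3P a i) => ->.
by move/tri_int_bary: H => H; have [<- <- <-] := bary_lam a x; split.
Qed.

End bary.

(** Let [a] and [b] have the parameters [s] and [u] on the segment from [c] to [d]. As [c] lies
    between [a] and [b], its parameter 0 is a convex combination of the non-negative [s] and [u], so
    both terms vanish and [c] is [a] or [b]. The parameter 1 of [d] settles the other end. *)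
Lemma segment_ends {R : realType} (a b c d : R * R) : a != b -> segment a b = segment c d ->
  (a = c /\ b = d) \/ (a = d /\ b = c).
Proof.
move=> ab E.
have inseg (p q : R * R) : segment p q p /\ segment p q q.
  split; [exists 0|exists 1]; rewrite /= ?in_itv /= ?lexx ?ler01 // /segpath ?scale0r ?addr0 //.
  by rewrite scale1r addrC subrK.
have cd : c != d.
  apply: contraNneq ab => cd; have [ha hb] := inseg a b.
  have cc x : segment c d x -> x = c by move=> [s _ <-]; rewrite /segpath -cd subrr scaler0 addr0.
  by move: ha hb; rewrite E => /cc -> /cc ->.
have [ha hb] := inseg a b; have [hc hd] := inseg c d.
move: ha hb; rewrite E => -[s /=] + sE [u /=] + uE; rewrite !in_itv /= => /andP[s0 s1] /andP[u0 u1].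
move: hc hd; rewrite -E => -[s' /=] + sE' [u' /=] + uE'; rewrite !in_itv /= => /andP[s0' s1'] /andP[u0' u1'].
have zero k : k *: (d - c) = 0 -> k = 0.
  by move=> /eqP; rewrite scaler_eq0 subr_eq0 (eq_sym d) (negPf cd) orbF => /eqP.
have ba : b - a = (u - s) *: (d - c).
  by rewrite -sE -uE /segpath opprD addrACA subrr add0r -scalerBl.
have e1 : c + s *: (d - c) = a by exact: sE.
have e2 : a + s' *: (b - a) = c by exact: sE'.
have e3 : a + u' *: (b - a) = d by exact: uE'.
have k1 : s + s' * (u - s) = 0.
  apply: zero; rewrite scalerDl -scalerA -ba.
  by apply: (addrI c); rewrite addr0 addrA e1 e2.
have k2 : s + u' * (u - s) = 1.
  apply/eqP; rewrite -subr_eq0; apply/eqP; apply: zero.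
  rewrite scalerBl scale1r scalerDl -scalerA -ba; apply/eqP; rewrite subr_eq0; apply/eqP.
  by apply: (addrI c); rewrite addrA [RHS]addrC subrK e1 e3.
have e4 : (1 - s') * s + s' * u = 0 by rewrite -k1; ring.
have m1 : 0 <= (1 - s') * s by rewrite mulr_ge0 // subr_ge0.
have m2 : 0 <= s' * u by rewrite mulr_ge0.
have z1 : (1 - s') * s = 0 by lra.
have z2 : s' * u = 0 by lra.
have seg0 : s = 0 -> a = c by move=> h; rewrite -sE h /segpath scale0r addr0.
have seg1 : s = 1 -> a = d by move=> h; rewrite -sE h /segpath scale1r addrC subrK.
have useg0 : u = 0 -> b = c by move=> h; rewrite -uE h /segpath scale0r addr0.
have useg1 : u = 1 -> b = d by move=> h; rewrite -uE h /segpath scale1r addrC subrK.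
move/eqP: z2; rewrite mulf_eq0 => /orP[] /eqP h.
  have s_0 : s = 0 by move: z1; rewrite h subr0 mul1r.
  left; split; first exact: seg0.
  apply: useg1; have : u' * u = 1 by move: k2; rewrite s_0 add0r subr0.
  nra.
have : s * (1 - u') = 1 by move: k2; rewrite h sub0r; lra.
right; split; last exact: useg0.
by apply: seg1; nra.
Qed.

Section triangulation_geometry.
Context {R : realType} (n : nat) (z : 'I_n -> R * R) (K : set (R * R)) (N : nat) (T : 'I_N -> 'I_3 -> R * R).
Context (pK : polygon z K) (tK : triangulation z K T).

Let Tn j : noncollinear (T j). Proof. by case: tK. Qed.

Lemma triangle_closure j x : triangle (T j) x -> closure K x.
Proof. by case: tK => _ <- _ _ Tx; exists j. Qed.

Lemma outside_edge x : closure K x -> ~ K x -> exists i j b, edge (T j) b = edge z i /\ edge z i x.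
Proof.
move=> cx nx; case: pK => _ _ _ [_ _ _ E].
have : polyline z x by rewrite -E.
move=> [i _ ix]; case: tK => _ _ _ /(_ i)[j [b jb]].
by exists i, j, b.
Qed.

Lemma edge_triangle j a x : edge (T j) a x -> triangle (T j) x.
Proof. by move=> /(edge_bary (Tn j))[]. Qed.

Lemma vertex_edge j a : edge (T j) a (T j a) /\ edge (T j) a (T j (ordS a)).
Proof.
split; [exists 0|exists 1]; rewrite /= ?in_itv /= ?lexx ?ler01 // /segpath ?scale0r ?addr0 //.
by rewrite scale1r addrC subrK.
Qed.

Lemma vertex_neq j a : T j a != T j (ordS a).
Proof.
apply/negP => /eqP E; have := bary_vertex (Tn j) a a.
by rewrite eqxx E bary_vertex // eq_sym ordS_neq => /eqP; rewrite eq_sym oner_eq0.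
Qed.

Lemma vertex_on_edge j a b : edge (T j) b (T j a) -> a = b \/ a = ordS b.
Proof.
move=> /(edge_bary (Tn j))[_]; rewrite bary_vertex //.
case: (ord3P b a) => ->; [by left|by right|].
by rewrite eqxx => /eqP; rewrite oner_eq0.
Qed.

(** A point of the closure outside [K] lies on an edge of some triangle. Conformity lets two
    triangles meet only in vertices or whole edges, and an interior point of a triangle is on
    neither. *)
Lemma tri_int_K j : tri_int (T j) `<=` K.
Proof.
move=> x /(tri_int_bary (Tn j)) b0.
have Tx : triangle (T j) x by apply/(triangle_bary (Tn j)) => i; exact: ltW.
have nedge a : ~ edge (T j) a x.
  by move=> /(edge_bary (Tn j))[_ h]; have := b0 (ordS (ordS a)); rewrite h ltxx.
apply: contrapT => nx; have [i [j' [b [E xe]]]] := outside_edge (triangle_closure Tx) nx.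
rewrite -E in xe; have [jj|jj] := eqVneq j j'; first by rewrite -jj in xe; exact: nedge xe.
have xj' := edge_triangle xe; case: tK => _ _ /(_ _ _ jj) C _.
have xI : (triangle (T j) `&` triangle (T j')) x by [].
case: C => [E0|[a [b' [_ E0]]]|[a [b' [_ E0]]]]; move: xI; rewrite E0 //.
  by move=> /= xa; case: (nedge a); rewrite xa; have [] := vertex_edge j a.
exact: nedge.
Qed.

Lemma tri_int_disjoint i j x : tri_int (T i) x -> tri_int (T j) x -> i = j.
Proof.
move=> xi xj; apply: contrapT => /eqP ij.
have b0 := (tri_int_bary (Tn i) x).1 xi.
have nedge a : ~ edge (T i) a x.
  by move=> /(edge_bary (Tn i))[_ h]; have := b0 (ordS (ordS a)); rewrite h ltxx.
have tri k : tri_int (T k) x -> triangle (T k) x.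
  by move=> /(tri_int_bary (Tn k)) h; apply/(triangle_bary (Tn k)) => l; exact: ltW.
have xI : (triangle (T i) `&` triangle (T j)) x by split; exact: tri.
case: tK => _ _ /(_ _ _ ij) [E0|[a [b' [_ E0]]]|[a [b' [_ E0]]]] _; move: xI; rewrite E0 //.
  by move=> /= xa; case: (nedge a); rewrite xa; have [] := vertex_edge i a.
exact: nedge.
Qed.

Lemma K_tri_int x : K x -> exists j, tri_int (T j) x \/ exists a, edge (T j) a x.
Proof.
move=> /subset_closure; case: tK => _ <- _ _ [j _ Tx]; exists j.
have b0 := (triangle_bary (Tn j) x).1 Tx.
have [H|] := pselect (forall i, bary_coord (T j) i x != 0).
  by left; apply/(tri_int_bary (Tn j)) => i; rewrite lt_neqAle eq_sym H b0.
move=> /existsNP[i /negP]; rewrite negbK => /eqP bi; right; exists (ordS i).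
by apply/(edge_bary (Tn j)); rewrite ord3S.
Qed.

Lemma edge_ends j b i : edge (T j) b = edge z i ->
  (T j b = z i /\ T j (ordS b) = z (ordS i)) \/ (T j b = z (ordS i) /\ T j (ordS b) = z i).
Proof. by move=> E; exact: segment_ends (vertex_neq j b) E. Qed.

(** A vertex outside [K] lies on a boundary edge of some triangle; by conformity it is a vertex of
    that triangle too, hence an end of that edge. Consequently the interpolation conditions
    prescribe the value at every vertex of the mesh. *)
Lemma vertex_cases j a : K (T j a) \/ exists i, T j a = z i.
Proof.
have [|nK] := pselect (K (T j a)); [by left|right].
have cl : closure K (T j a).
  by apply: (@triangle_closure j); apply: edge_triangle (vertex_edge j a).1.
have [i [j' [b [E xe]]]] := outside_edge cl nK.
suff [c ca cb] : exists2 c, T j a = T j' c & c = b \/ c = ordS b.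
  by rewrite ca; have := edge_ends E; case: cb => ->; case=> -[h1 h2]; rewrite ?h1 ?h2; eexists.
rewrite -E in xe; have [jj|jj] := eqVneq j j'.
  by rewrite -jj in xe *; exists a => //; exact: vertex_on_edge xe.
have xj := edge_triangle (vertex_edge j a).1; have xj' := edge_triangle xe.
case: tK => _ _ /(_ _ _ jj) C _.
have xI : (triangle (T j) `&` triangle (T j')) (T j a) by [].
case: C => [E0|[a' [b' [ab E0]]]|[a' [b' [ab E0]]]]; move: xI; rewrite E0 //.
  move=> /= xa; exists b'; first by rewrite xa.
  by apply: (@vertex_on_edge j'); rewrite -ab -xa.
move=> xa.
have [c xc] : exists c, T j a = T j' c.
  have := segment_ends (vertex_neq j a') ab.
  by case: (vertex_on_edge xa) => ->; case=> -[h1 h2]; eexists; [exact: h1|exact: h1|exact: h2|exact: h2].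
by exists c => //; apply: (@vertex_on_edge j'); rewrite -xc.
Qed.

(** A relative interior point [x] outside [K] lies on a triangle edge that is an edge of [K]. If
    that triangle is a different one, the two share a whole edge through [x]; an edge point that is
    no vertex is on a single edge of each triangle, so the edges coincide. Thus the moments on every
    mesh edge are prescribed. *)
Lemma edge_cases j a : osegment (T j a) (T j (ordS a)) `<=` K \/ exists i, edge (T j) a = edge z i.
Proof.
have [|nK] := pselect (osegment (T j a) (T j (ordS a)) `<=` K); [by left|right].
have [x [xo nx]] : exists x, osegment (T j a) (T j (ordS a)) x /\ ~ K x.
  by apply: contrapT => h; apply: nK => x xo; apply: contrapT => nx; apply: h; exists x.
have [xe x1 x2] := osegment_bary (Tn j) xo; have xj := edge_triangle xe.
have nv c : x <> T j c.
  move=> xc; rewrite xc in xe x1 x2; rewrite !bary_vertex // in x1 x2.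
  by move: x1 x2; have [<-|_] := eqVneq a c; rewrite ?ltxx // ordS_neq ltxx.
have one c : edge (T j) c x -> c = a.
  move=> /(edge_bary (Tn j))[_ h]; case: (ord3P a c) h => -> // h; move: x1 x2.
    by rewrite ord3S in h; rewrite h ltxx.
  by rewrite ord3S in h; rewrite h ltxx.
have [i [j' [b [E xb]]]] := outside_edge (triangle_closure xj) nx.
exists i; rewrite -E in xb *; have [jj|jj] := eqVneq j j'.
  by rewrite -jj in xb *; rewrite (one _ xb).
have xj' := edge_triangle xb.
case: tK => _ _ /(_ _ _ jj) C _.
have xI : (triangle (T j) `&` triangle (T j')) x by [].
case: C => [E0|[a' [b' [ab E0]]]|[a' [b' [ab E0]]]]; move: xI; rewrite E0 //.
  by move=> /= /nv.
move=> xa; have aa := one _ xa; rewrite aa in ab xa.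
rewrite ab; congr (edge (T j') _).
have xb' : edge (T j') b' x by rewrite -ab.
have nv' c : c = b' \/ c = ordS b' -> x <> T j' c.
  move=> cb xc; have := segment_ends (vertex_neq j a) ab.
  by case: cb xc => -> xc; case=> -[h1 h2]; apply: (@nv _); rewrite xc -?h1 -?h2.
have [_ z1] := (edge_bary (Tn j') _ _).1 xb'; have [_ z2] := (edge_bary (Tn j') _ _).1 xb.
have cb := bary_comb (Tn j') x; have sb := bary_sum (Tn j') x.
case: (ord3P b' b) => // bb; rewrite bb ?ord3S in z2.
- rewrite (sum_ord3 _ b') z1 z2 !scale0r addr0 add0r in cb.
  rewrite (sum_ord3 _ b') z1 z2 addr0 add0r in sb.
  by case: (nv' (ordS b')); [right|rewrite cb sb scale1r].
- rewrite (sum_ord3 _ b') z1 z2 !scale0r !addr0 in cb.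
  rewrite (sum_ord3 _ b') z1 z2 !addr0 in sb.
  by case: (nv' b'); [left|rewrite cb sb scale1r].
Qed.

End triangulation_geometry.

(** * Areas of triangles and additivity over the triangulation *)

Lemma area_preimage_amap {R : realType} (a b c : R * R) (A : set (R * R)) :
  cross a b c != 0 -> measurable (A : set (plane R)) ->
  area (A : set (plane R)) = (`|cross a b c|%:E * area (amap a b c @^-1` A : set (plane R)))%E.
Proof.
move=> D mA.
have mA' : measurable (amap a b c @^-1` A : set (plane R)).
  by rewrite -[X in measurable X]setTI; apply: (@measurable_amap R a b c) => //.
have mf : measurable_fun setT (fun x : plane R => (\1_A x)%:E : \bar R).
  by apply/measurable_EFinP; exact: measurable_indic.
have := ge0_integral_amap D mf (fun x => (_ : (0 <= (\1_A x)%:E)%E)).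
rewrite integral_indic // setIT => -> //.
congr (_ * _)%E.
have -> : (fun x : plane R => (\1_A (amap a b c x))%:E : \bar R) = (fun x => (\1_(amap a b c @^-1` A) x)%:E) by [].
by rewrite integral_indic // setIT.
Qed.

Lemma area_line0 {R : realType} (a b c : R * R) : cross a b c != 0 ->
  measurable ([set x | lam3 a b c x = 0] : set (plane R)) /\
  area ([set x | lam3 a b c x = 0] : set (plane R)) = 0%E.
Proof.
move=> D.
have mL : measurable ([set x | lam3 a b c x = 0] : set (plane R)).
  have -> : [set x | lam3 a b c x = 0] = lam3 a b c @^-1` [set 0] by [].
  rewrite -[X in measurable X]setTI.
  by apply: (continuous_measurable_plane (smooth_continuous (smooth_lam3 a b c))) => //; exact: measurable_set1.
split => //; rewrite (area_preimage_amap D mL).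
have -> : amap a b c @^-1` [set x | lam3 a b c x = 0] = setT `*` [set 0].
  apply/seteqP; split => x; first by rewrite /preimage /= lam3_amap // => h; split.
  by case=> _ h; rewrite /preimage /= lam3_amap.
have E : (@lebesgue_measure R \x @lebesgue_measure R)%E (setT `*` [set 0]) = 0%E.
  rewrite product_measure1E; [|exact: measurableT|exact: measurable_set1].
  have Z : @lebesgue_measure R [set 0] = 0%E by exact: lebesgue_measure_set1.
  by apply: etrans (mule0 (@lebesgue_measure R setT)); congr (_ * _)%E.
by apply: etrans (mule0 _); congr (_ * _)%E.
Qed.

(** The disc contains a square of side [r]. In the barycentric coordinates [lam2], [lam3] this
    square lies in the unit square, and the map back multiplies areas by [|cross a b c|]. *)
Lemma cross_area {R : realType} (a b c x0 : R * R) (r : R) : cross a b c != 0 -> 0 < r ->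
  (forall x, disc x0 r x -> 0 <= lam1 a b c x /\ 0 <= lam2 a b c x /\ 0 <= lam3 a b c x) ->
  r ^+ 2 <= `|cross a b c|.
Proof.
move=> D r0 H; have r2 : 0 < r / 2 by rewrite divr_gt0.
have := area_preimage_amap D (measurable_square x0 (r / 2)); rewrite area_square // => E.
pose U := square ((2^-1, 2^-1) : R * R) 2^-1.
have aU : area (U : set (plane R)) = 1%E.
  by rewrite area_square ?invr_gt0 //; congr EFin; field.
have sub : amap a b c @^-1` square x0 (r / 2) `<=` U.
  move=> x /= /(square_disc r0) /H; rewrite /lam1 lam2_amap // lam3_amap // => -[h1 [h2 h3]].
  by split; rewrite /= in_itv /=; apply/andP; split; lra.
have mS : measurable (amap a b c @^-1` square x0 (r / 2) : set (plane R)).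
  by rewrite -[X in measurable X]setTI; apply: (@measurable_amap R a b c) => //; exact: measurable_square.
rewrite -lee_fin (_ : r ^+ 2 = 4 * (r / 2) ^+ 2); last by field.
rewrite E -[leRHS]mule1 lee_wpmul2l ?lee_fin // -aU.
by apply: le_measure; rewrite ?inE //; exact: measurable_square.
Qed.

(** The square of side 1/4 centred at (1/4, 1/4) lies in the reference triangle. This crude value
    suffices for counting triangles. *)
Lemma area_rtri_ge {R : realType} : 16^-1 <= fine (area (@rtri R : set (plane R))).
Proof.
have fin : (area (@rtri R : set (plane R)) < +oo)%E by apply: bounded_area_fin; [exact: measurable_rtri|exact: bounded_rtri].
rewrite -lee_fin fineK ?ge0_fin_numE //.
have e0 : 0 < 8^-1 :> R by rewrite invr_gt0.
have -> : (16^-1 : R)%:E = (4 * ((8^-1) ^+ 2))%:E by congr EFin; field.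
rewrite -(@area_square R ((4^-1, 4^-1) : R * R) _ e0).
apply: le_measure; rewrite ?inE //; [exact: measurable_square|exact: measurable_rtri|].
by move=> x [/=]; rewrite !in_itv /= => x1 x2; split; lra.
Qed.

Lemma area_otri {R : realType} (a b c : R * R) : cross a b c != 0 ->
  16^-1 * `|cross a b c| <= fine (area (otri a b c : set (plane R))) <= `|cross a b c|.
Proof.
move=> D; rewrite (area_preimage_amap D (measurable_otri D)).
have -> : amap a b c @^-1` otri a b c = rtri by apply/seteqP; split => x /(otri_amap _ D).
have fin : (area (@rtri R : set (plane R)) < +oo)%E by apply: bounded_area_fin; [exact: measurable_rtri|exact: bounded_rtri].
have -> : fine (`|cross a b c|%:E * area (@rtri R : set (plane R))) = `|cross a b c| * fine (area (@rtri R : set (plane R))).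
  have aE : area (@rtri R : set (plane R)) = (fine (area (@rtri R : set (plane R))))%:E by rewrite fineK ?ge0_fin_numE.
  by rewrite [in LHS]aE -EFinM.
apply/andP; split; first by rewrite mulrC ler_wpM2l ?area_rtri_ge.
rewrite -[leRHS]mulr1 ler_wpM2l // -lee_fin fineK ?ge0_fin_numE //.
have e0 : 0 < 2^-1 :> R by rewrite invr_gt0.
have -> : (1 : R)%:E = (4 * ((2^-1) ^+ 2))%:E by congr EFin; field.
rewrite -(@area_square R ((2^-1, 2^-1) : R * R) _ e0).
apply: le_measure; rewrite ?inE //; [exact: measurable_rtri|exact: measurable_square|].
by move=> x [x1 x2 x3]; split; rewrite /= in_itv /=; apply/andP; split; lra.
Qed.

Lemma area_tri_lines {R : realType} (t : 'I_3 -> R * R) (a : 'I_3) : noncollinear t ->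
  measurable ([set x | bary_coord t a x = 0] : set (plane R)) /\
  area ([set x | bary_coord t a x = 0] : set (plane R)) = 0%E.
Proof.
move=> tn; have D := cross_neq0 tn (ordS a).
have -> : [set x | bary_coord t a x = 0] = [set x | lam3 (t (ordS a)) (t (ordS (ordS a))) (t (ordS (ordS (ordS a)))) x = 0].
  by congr mkset; apply/funext => x; have [_ _ E] := bary_lam tn (ordS a) x; rewrite -E ord3S.
exact: area_line0.
Qed.

Section triangulation_area.
Context {R : realType} (n : nat) (z : 'I_n -> R * R) (K : set (R * R)) (N : nat) (T : 'I_N -> 'I_3 -> R * R).
Context (pK : polygon z K) (tK : triangulation z K T).

Let Tn j : noncollinear (T j). Proof. by case: tK. Qed.
Let oK : open K. Proof. by case: pK => _ _ _ []. Qed.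
Let mK : measurable (K : set (plane R)) := open_measurable_plane oK.
Let mT j : measurable (tri_int (T j) : set (plane R)).
Proof. exact: (measurable_otri (Tn j)). Qed.

(** The lines that carry the edges of all triangles: a null set, off which the disjoint open
    triangles exhaust [K]. *)
Let L : set (plane R) := \big[setU/set0]_(ja : 'I_N * 'I_3) [set x | bary_coord (T ja.1) ja.2 x = 0].

Let mL : measurable L.
Proof. by apply: bigsetU_measurable => ja _; have [] := area_tri_lines ja.2 (Tn ja.1). Qed.

Let L0 : area L = 0%E.
Proof.
rewrite /L; elim: (index_enum _) => [|ja r IH]; first by rewrite big_nil measure0.
rewrite big_cons; have [m1 z1] := area_tri_lines ja.2 (Tn ja.1).
have mr : measurable (\big[setU/set0]_(j <- r) [set x | bary_coord (T j.1) j.2 x = 0] : set (plane R)).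
  by apply: bigsetU_measurable => j _; have [] := area_tri_lines j.2 (Tn j.1).
apply/eqP; rewrite eq_le measure_ge0 andbT; apply: le_trans (measureU2 _ m1 mr) _.
have h1 : (area ([set x | bary_coord (T ja.1) ja.2 x = 0%R] : set (plane R)) <= 0)%E by rewrite z1.
have h2 : (area (\big[setU/set0]_(j <- r) [set x | bary_coord (T j.1) j.2 x = 0%R] : set (plane R)) <= 0)%E by rewrite IH.
by have := leeD h1 h2; rewrite adde0.
Qed.

Lemma Rintegral_triangulation (F : R * R -> R) : area.-integrable (K : set (plane R)) (EFin \o F) ->
  \int[area]_(x in (K : set (plane R))) F x = \sum_j \int[area]_(x in (tri_int (T j) : set (plane R))) F x.
Proof.
move=> Fi.
pose U : set (plane R) := \big[setU/set0]_(j : 'I_N) tri_int (T j).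
have UE x : U x <-> exists j, tri_int (T j) x.
  by rewrite /U -bigcup_seq; split=> [[j _ Tx]|[j Tx]]; exists j => //; rewrite /= mem_index_enum.
have mU : measurable U by apply: bigsetU_measurable.
have UK : U `<=` K by move=> x /UE[j /(tri_int_K pK tK)].
have FiT j : area.-integrable (tri_int (T j) : set (plane R)) (EFin \o F).
  by apply: integrableS Fi => //; exact: tri_int_K tK _.
have FiU : area.-integrable U (EFin \o F) by exact: integrableS Fi.
apply: EFin_inj; rewrite -sumEFin /Rintegral fineK; last exact: integrable_fin_num.
under eq_bigr => j _ do rewrite fineK ?integrable_fin_num //.
rewrite -(@integral_bigsetU_EFin _ _ _ area _ (fun j => tri_int (T j)) F (index_enum 'I_N)) //; last 3 first.
- exact: index_enum_uniq.
- by move=> i j _ _ [x [xi xj]]; exact: tri_int_disjoint tK _ _ _ xi xj.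
- by case/integrableP: FiU.
rewrite (negligible_integral mL mK Fi L0) -/U (negligible_integral mL mU FiU L0).
congr (integral _ _ _); apply/seteqP; split => x [H nL]; split => //; last exact: UK.
apply/UE; have [j [Tx|[a xa]]] := K_tri_int tK H; first by exists j.
case: nL; rewrite /L -bigcup_seq; exists (j, ordS (ordS a)); first by rewrite /= mem_index_enum.
by move: xa => /(edge_bary (Tn j))[].
Qed.

End triangulation_area.

(** * Diameters and the constants of a regular mesh *)

Lemma diam_bound {R : realType} (S : set (R * R)) x y : bounded_set S -> S x -> S y ->
  eucl_dist x y <= diam S.
Proof.
move=> /bounded_in_box[B B0 SB] Sx Sy.
apply: ub_le_sup; last by exists x, y.
exists (4 * B) => _ [x' [y' [/SB[/= + +] /SB[/= + +] ->]]]; rewrite !in_itv /= => a1 a2 b1 b2.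
rewrite /eucl_dist /eucl_norm -[leRHS]ger0_norm ?mulr_ge0 ?(ltW B0) // -sqrtr_sqr ler_wsqrtr //=.
nra.
Qed.

Lemma closed_dist {R : realType} (y : R * R) (h : R) : 0 <= h -> closed [set x | eucl_dist x y <= h].
Proof.
move=> h0.
have -> : [set x | eucl_dist x y <= h] =
    (fun x : R * R => (x.1 - y.1) * (x.1 - y.1) + (x.2 - y.2) * (x.2 - y.2)) @^-1` [set s | s <= h ^+ 2].
  apply/funext => x; rewrite /preimage /mkset /=; apply/propext.
  rewrite /eucl_dist /eucl_norm -!expr2 -[X in _ <= X](ger0_norm h0) -sqrtr_sqr ler_sqrt ?sqr_ge0 //.
apply: closed_comp; last exact: closed_le.
have [s1 s2 _] := @pd_coord R.
have t1 := smoothB s1 (@smooth_cst R y.1); have t2 := smoothB s2 (@smooth_cst R y.2).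
move=> x _; exact: (smooth_continuous (smoothD (smoothM t1 t1) (smoothM t2 t2))).
Qed.

Lemma eucl_distC {R : realType} (x y : R * R) : eucl_dist x y = eucl_dist y x.
Proof. by rewrite /eucl_dist /eucl_norm /=; congr Num.sqrt; ring. Qed.

Lemma eucl_dist_gt0 {R : realType} (x y : R * R) : x != y -> 0 < eucl_dist x y.
Proof.
move=> xy; rewrite /eucl_dist /eucl_norm sqrtr_gt0 lt_neqAle addr_ge0 ?sqr_ge0 // andbT eq_sym.
apply: contraNneq xy => /eqP; rewrite paddr_eq0 ?sqr_ge0 // !sqrf_eq0 /= !subr_eq0 => /andP[/eqP a /eqP b].
by rewrite [x]surjective_pairing [y]surjective_pairing a b.
Qed.

Lemma closure_in {T : topologicalType} (S B : set T) : S `<=` B -> closed B -> closure S `<=` B.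
Proof. by move=> SB cB x cx; rewrite ((closure_id B).1 cB); exact: closureS SB _ cx. Qed.

Lemma closure_diam {R : realType} (S : set (R * R)) x y : bounded_set S -> closure S x -> closure S y ->
  eucl_dist x y <= diam S.
Proof.
move=> bS cx cy.
have [s Ss] : S !=set0 by have [s [Ss _]] := cx _ filterT; exists s.
have d0 : 0 <= diam S by apply: le_trans (diam_bound bS Ss Ss); exact: eucl_norm_ge0.
have H1 u : S u -> eucl_dist x u <= diam S.
  move=> Su; have SB : S `<=` [set x | eucl_dist x u <= diam S] by move=> w Sw; exact: diam_bound.
  have H := closure_in SB (@closed_dist R u _ d0).
  refine (H x cx).
have SB : S `<=` [set w | eucl_dist w x <= diam S] by move=> w Sw; rewrite /mkset eucl_distC; exact: H1.
have H := closure_in SB (@closed_dist R x _ d0).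
rewrite eucl_distC; exact (H y cy).
Qed.

(** [kap] bounds the shape of the triangles from below and [CL * h] bounds the perimeter of [K]. *)
Record good_mesh {R : realType} (rho kap CL h : R) (n : nat) (z : 'I_n -> R * R) (K : set (R * R))
    (N : nat) (T : 'I_N -> 'I_3 -> R * R) : Prop := GoodMesh {
  gm_poly : polygon z K;
  gm_tri : triangulation z K T;
  gm_open : open K;
  gm_bounded : bounded_set K;
  gm_h : 0 < h;
  gm_diam : forall x y, closure K x -> closure K y -> eucl_dist x y <= h;
  gm_disc : exists c r, [/\ rho * h <= r, 0 < r, disc c r `<=` K &
    forall x y, disc c r x -> K y -> segment x y `<=` K];
  gm_clos : forall x, closure K x -> K x \/ exists i, segment (z i) (z (ordS i)) x;
  gm_edge : forall i, rho * h <= eucl_dist (z i) (z (ordS i));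
  gm_cross : forall j a, kap * h ^+ 2 <= `|cross (T j a) (T j (ordS a)) (T j (ordS (ordS a)))|;
  gm_len : \sum_(i < n) eucl_dist (z i) (z (ordS i)) <= CL * h }.

(** Each edge of [K] is assigned a triangle edge equal to it. Two different edges of a simple
    polygon share at most one point, so the assignment is injective. *)
Lemma polygon_edges_le {R : realType} (n : nat) (z : 'I_n -> R * R) (K : set (R * R))
    (N : nat) (T : 'I_N -> 'I_3 -> R * R) :
  polygon z K -> triangulation z K T -> (n <= 3 * N)%N.
Proof.
move=> [n3 zi ze _] [_ _ _ H].
have /choice[f fE] : forall i : 'I_n, exists ja : 'I_N * 'I_3, edge (T ja.1) ja.2 = edge z i.
  by move=> i; have [j [a E]] := H i; exists (j, a).
have fi : injective f.
  move=> i i' E; apply/eqP; apply: contraT => ii.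
  have ei : edge z i = edge z i' by rewrite -!fE E.
  have := ze _ _ ii; rewrite -ei setIid => Ei.
  have [h1 h2] : edge z i (z i) /\ edge z i (z (ordS i)).
    split; [exists 0|exists 1]; rewrite /= ?in_itv /= ?lexx ?ler01 // /segpath ?scale0r ?addr0 //.
    by rewrite scale1r addrC subrK.
  have zz : z i <> z (ordS i).
    move=> /zi /(congr1 val) /=; case: i {E ii ei Ei h1 h2} => i /= ilt.
    have [E|ne] := eqVneq i.+1 n; first by rewrite E modnn => i0; move: n3; rewrite -E i0.
    by rewrite modn_small; [exact: n_Sn|rewrite ltn_neqAle ne].
  move: h1 h2; rewrite Ei; case: ifP => _; first by move=> e1 e2; case: zz; exact: (etrans e1 (esym e2)).
  by case: ifP => // _ e1 e2; case: zz; exact: (etrans e1 (esym e2)).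
have := leq_card f fi; rewrite card_prod !card_ord mulnC; exact.
Qed.

(** Every triangle contains a disc of radius at least [sigma * tau * h], which gives [kap] by
    [cross_area]. Its area is then at least [kap * h ^+ 2 / 16], while that of [K] is at most
    [4 * h ^+ 2], so there are at most [64 / kap] triangles. With at most three edges of [K] per
    triangle, each of length at most [h], the perimeter is at most [192 / kap * h]. *)
Lemma good_meshP {R : realType} (rho sigma tau : R) : 0 < rho -> 0 < sigma -> 0 < tau ->
  forall (n : nat) (z : 'I_n -> R * R) (K : set (R * R)) (N : nat) (T : 'I_N -> 'I_3 -> R * R),
  regular_polygon rho z K -> triangulation z K T -> regular_triangulation sigma tau K T ->
  good_mesh rho ((sigma * tau) ^+ 2) (192 / (sigma * tau) ^+ 2) (diam K) z K T.
Proof.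
move=> r0 s0 t0 n z K N T [pK [c [r [hr [dK star]]]] he] tK rT.
have [n3 zi ze [K0 oK bK bd]] := pK.
have i0 : 'I_n by case: n n3 {z zi ze bd pK he tK} => // n _; exact: ord0.
have Tn j : noncollinear (T j) by case: tK.
have clz i : closure K (z i).
  have [+ _] : (closure K `\` K) (z i).
    rewrite bd; exists i => //; exists 0; rewrite /= ?in_itv /= ?lexx ?ler01 // /segpath scale0r addr0 //.
  by [].
have d0 : 0 <= diam K.
  by apply: le_trans (closure_diam bK (clz i0) (clz i0)); exact: eucl_norm_ge0.
have h0 : 0 < diam K.
  have [x Kx] := K0; have : nbhs x K by exact: open_nbhs_nbhs.
  move=> /nbhs_ballP[e /= e0 He].
  have Ky : K (x.1 + e / 2, x.2).
    apply: He; split; rewrite /ball /= ?subrr ?normr0 // opprD addrA subrr sub0r normrN gtr0_norm ?divr_gt0 //.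
    lra.
  apply: lt_le_trans (diam_bound bK Kx Ky); apply: eucl_dist_gt0.
  by apply/negP => /eqP /(congr1 fst) /= h; move: e0; lra.
have rh0 : 0 < r by apply: lt_le_trans hr; rewrite mulr_gt0.
have dd x y : closure K x -> closure K y -> eucl_dist x y <= diam K by exact: closure_diam.
have k0 : 0 < (sigma * tau) ^+ 2 by rewrite exprn_gt0 // mulr_gt0.
have cr j a : (sigma * tau) ^+ 2 * diam K ^+ 2 <= `|cross (T j a) (T j (ordS a)) (T j (ordS (ordS a)))|.
  have [[x0 [q [hq dq]]] ht] := rT j.
  have q0 : 0 < sigma * tau * diam K by rewrite !mulr_gt0.
  have qq : sigma * tau * diam K <= q.
    by apply: le_trans hq; rewrite -mulrA ler_pM2l.
  rewrite -exprMn; apply: (@cross_area _ _ _ _ x0); [exact: cross_neq0|by []|].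
  move=> x dx; have /dq : disc x0 q x by exact: lt_le_trans dx qq.
  move=> /(triangle_bary (Tn j)) H; have [<- <- <-] := bary_lam (Tn j) a x.
  by split; [|split].
split => //.
- by exists c, r; split => // x y dx Ky; exact: star.
- move=> x cx; have [Kx|nK] := pselect (K x); [by left|right].
  have : (closure K `\` K) x by [].
  by rewrite bd => -[i _ ix]; exists i.
have mK := open_measurable_plane oK.
have area_ub : fine (area (K : set (plane R))) <= 4 * diam K ^+ 2.
  by have /andP[] := area_diam_bound oK bK rh0 dK (fun x y Kx Ky => dd x y (subset_closure Kx) (subset_closure Ky)).
have fK := bounded_area_fin mK bK.
have Nb : N%:R * ((sigma * tau) ^+ 2) <= 64.
  have c1 : continuous ((fun=> 1) : R * R -> R) by move=> ?; exact: cvg_cst.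
  have := Rintegral_triangulation pK tK (integrable_continuous mK bK c1).
  have E1 (S : set (R * R)) : measurable (S : set (plane R)) -> \int[area]_(x in (S : set (plane R))) (1 : R) = fine (area (S : set (plane R))).
    by move=> mS; rewrite Rintegral_cst // mul1r.
  rewrite (E1 K) // => E.
  have : \sum_(j < N) (16^-1 * ((sigma * tau) ^+ 2 * diam K ^+ 2)) <= 4 * diam K ^+ 2.
    apply: le_trans area_ub; rewrite E; apply: ler_sum => j _.
    have mT : measurable (tri_int (T j) : set (plane R)) by exact: (measurable_otri (Tn j)).
    rewrite (E1 (tri_int (T j))) //.
    have /andP[] := area_otri (Tn j); rewrite -/(tri_int (T j)) => + _; apply: le_trans.
    by rewrite ler_pM2l ?invr_gt0 //; exact: (cr j ord0).
  have -> : \sum_(j < N) (16^-1 * ((sigma * tau) ^+ 2 * diam K ^+ 2)) = N%:R * (16^-1 * ((sigma * tau) ^+ 2 * diam K ^+ 2)).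
    by rewrite sumr_const card_ord mulr_natl.
  have h2 : 0 < diam K ^+ 2 by rewrite exprn_gt0.
  move: (diam K ^+ 2) ((sigma * tau) ^+ 2) h2 => d2 k h2 H; rewrite -(ler_pM2r h2); lra.
have nN := polygon_edges_le pK tK.
apply: (@le_trans _ _ (\sum_(i < n) diam K)).
  by apply: ler_sum => i _; exact: dd.
have -> : \sum_(i < n) diam K = n%:R * diam K by rewrite sumr_const card_ord mulr_natl.
rewrite ler_pM2r // ler_pdivlMr //.
apply: (@le_trans _ _ ((3 * N)%:R * (sigma * tau) ^+ 2)); first by rewrite ler_pM2r // ler_nat.
rewrite natrM -mulrA; lra.
Qed.

(** * Scaling to the reference triangle *)

Lemma pd_amap {R : realType} (a b c : R * R) (F : R * R -> R) : smooth F ->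
  pd1 (fun x => F (amap a b c x)) =
    (fun x => (b.1 - a.1) * pd1 F (amap a b c x) + (b.2 - a.2) * pd2 F (amap a b c x)) /\
  pd2 (fun x => F (amap a b c x)) =
    (fun x => (c.1 - a.1) * pd1 F (amap a b c x) + (c.2 - a.2) * pd2 F (amap a b c x)).
Proof.
move=> sF; split; apply/funext => x.
  have /is_derive_lineP D := is_derive_smooth (amap a b c x) (b.1 - a.1, b.2 - a.2) sF.
  suff H : is_derive x ((1, 0) : R * R) (fun x => F (amap a b c x))
     ((b.1 - a.1) * pd1 F (amap a b c x) + (b.2 - a.2) * pd2 F (amap a b c x)) by have [_ E] := H.
  apply/is_derive_lineP; move: D; congr (is_derive _ _ _ _); apply/funext => h; congr F.
  rewrite [LHS](_ : _ = (h * (b.1 - a.1) + (amap a b c x).1, h * (b.2 - a.2) + (amap a b c x).2)) //.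
  rewrite [h *: _ + _](_ : _ = (h * 1 + x.1, h * 0 + x.2)) //.
  by rewrite /amap /=; congr (_, _); ring.
have /is_derive_lineP D := is_derive_smooth (amap a b c x) (c.1 - a.1, c.2 - a.2) sF.
suff H : is_derive x ((0, 1) : R * R) (fun x => F (amap a b c x))
   ((c.1 - a.1) * pd1 F (amap a b c x) + (c.2 - a.2) * pd2 F (amap a b c x)) by have [_ E] := H.
apply/is_derive_lineP; move: D; congr (is_derive _ _ _ _); apply/funext => h; congr F.
rewrite [LHS](_ : _ = (h * (c.1 - a.1) + (amap a b c x).1, h * (c.2 - a.2) + (amap a b c x).2)) //.
rewrite [h *: _ + _](_ : _ = (h * 0 + x.1, h * 1 + x.2)) //.
by rewrite /amap /=; congr (_, _); ring.
Qed.

Lemma pf_amap {R : realType} m (a b c : R * R) (f : R * R -> R) : pf m f -> pf m (fun x => f (amap a b c x)).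
Proof.
move=> pm.
have h1 := pf_affine (b.1 - a.1) (c.1 - a.1) a.1; have h2 := pf_affine (b.2 - a.2) (c.2 - a.2) a.2.
have := pf_comp h1 h2 pm; congr pf; apply/funext => x; congr f.
by rewrite /amap; congr (_, _); ring.
Qed.

Definition ref_map {R : realType} (a b c x : R * R) : R * R := (lam2 a b c x, lam3 a b c x).

(** The constant gradients of [lam2] and [lam3], which form the basis dual to [b - a] and
    [c - a]. *)
Definition gx2 {R : realType} (a b c : R * R) : R * R :=
  ((c.2 - a.2) / cross a b c, - (c.1 - a.1) / cross a b c).
Definition gx3 {R : realType} (a b c : R * R) : R * R :=
  (- (b.2 - a.2) / cross a b c, (b.1 - a.1) / cross a b c).

Lemma ref_map_amap {R : realType} (a b c : R * R) : exists p q s : R * R,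
  ref_map a b c = amap p q s /\
  [/\ q.1 - p.1 = (gx2 a b c).1, s.1 - p.1 = (gx2 a b c).2,
      q.2 - p.2 = (gx3 a b c).1 & s.2 - p.2 = (gx3 a b c).2].
Proof.
pose p : R * R := ((a.2 * (c.1 - a.1) - a.1 * (c.2 - a.2)) / cross a b c,
  (a.1 * (b.2 - a.2) - a.2 * (b.1 - a.1)) / cross a b c).
exists p, (p.1 + (gx2 a b c).1, p.2 + (gx3 a b c).1), (p.1 + (gx2 a b c).2, p.2 + (gx3 a b c).2).
split; last by split => /=; rewrite addrAC subrr add0r.
apply/funext => x; rewrite /ref_map lam2E lam3E /amap /=; congr (_, _).
  by move: (cross a b c)^-1 => k; ring.
by move: (cross a b c)^-1 => k; ring.
Qed.

Lemma pf_ref_map {R : realType} m (a b c : R * R) (f : R * R -> R) : pf m f ->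
  pf m (fun x => f (ref_map a b c x)).
Proof. by have [p [q [s [-> _]]]] := ref_map_amap a b c; exact: pf_amap. Qed.

Lemma pd_ref_map {R : realType} (a b c : R * R) (F : R * R -> R) : smooth F ->
  pd1 (fun x => F (ref_map a b c x)) =
    (fun x => (gx2 a b c).1 * pd1 F (ref_map a b c x) + (gx3 a b c).1 * pd2 F (ref_map a b c x)) /\
  pd2 (fun x => F (ref_map a b c x)) =
    (fun x => (gx2 a b c).2 * pd1 F (ref_map a b c x) + (gx3 a b c).2 * pd2 F (ref_map a b c x)).
Proof.
by move=> sF; have [p [q [s [-> [<- <- <- <-]]]]] := ref_map_amap a b c; exact: pd_amap.
Qed.

Lemma ref_map_of_amap {R : realType} (a b c x : R * R) : cross a b c != 0 ->
  ref_map a b c (amap a b c x) = x.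
Proof. by move=> D; rewrite /ref_map lam2_amap // lam3_amap // -surjective_pairing. Qed.

(** Here [h] will be the diameter of [K], not that of the triangle: all estimates are then
    homogeneous in one length. The definition singles out the vertex [a], so that the first two
    vertices can be taken along a given edge. *)
Record tri_shape {R : realType} (kap h : R) (a b c : R * R) : Prop := TriShape {
  sh_kap : 0 < kap;
  sh_h : 0 < h;
  sh_cross : kap * h ^+ 2 <= `|cross a b c|;
  sh_ab : eucl_dist b a <= h;
  sh_ac : eucl_dist c a <= h }.

Section shape_facts.
Context {R : realType} (kap h : R) (a b c : R * R) (sh : tri_shape kap h a b c).

Let h0 : 0 < h := sh_h sh.
Let k0 : 0 < kap := sh_kap sh.

Lemma shape_cross : cross a b c != 0.
Proof. by rewrite -normr_gt0; apply: lt_le_trans (sh_cross sh); rewrite mulr_gt0 // exprn_gt0. Qed.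

Lemma shape_coord : [/\ `|b.1 - a.1| <= h, `|b.2 - a.2| <= h, `|c.1 - a.1| <= h & `|c.2 - a.2| <= h].
Proof.
have [h1 h2] := coord_le_eucl a b; have [h3 h4] := coord_le_eucl a c.
have e1 := sh_ab sh; have e2 := sh_ac sh; rewrite eucl_distC in e1; rewrite eucl_distC in e2.
by split; [exact: le_trans h1 e1|exact: le_trans h2 e1|exact: le_trans h3 e2|exact: le_trans h4 e2].
Qed.

Lemma shape_cross_ub : `|cross a b c| <= 2 * h ^+ 2.
Proof.
have [h1 h2 h3 h4] := shape_coord; rewrite /cross; apply: le_trans (ler_normB _ _) _.
by rewrite !normrM mulr2n mulrDl mul1r expr2; apply: lerD; apply: ler_pM.
Qed.

Lemma shape_grad : [/\ `|(gx2 a b c).1| <= (kap * h)^-1, `|(gx2 a b c).2| <= (kap * h)^-1,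
   `|(gx3 a b c).1| <= (kap * h)^-1 & `|(gx3 a b c).2| <= (kap * h)^-1].
Proof.
have [h1 h2 h3 h4] := shape_coord.
have J0 : 0 < `|cross a b c| by rewrite normr_gt0 shape_cross.
have E x : `|x| <= h -> `|x / cross a b c| <= (kap * h)^-1.
  move=> xh; rewrite normrM normfV ler_pdivrMr //.
  apply: le_trans xh _; rewrite ler_pdivlMl ?mulr_gt0 //.
  by have := sh_cross sh; rewrite expr2 mulrA.
by rewrite /gx2 /gx3 /=; split; apply: E; rewrite ?normrN.
Qed.

Lemma shape_area : fine (area (otri a b c : set (plane R))) <= 2 * h ^+ 2.
Proof. by have /andP[_ H] := area_otri shape_cross; exact: le_trans H shape_cross_ub. Qed.

Lemma shape_sqrt_area : Num.sqrt (fine (area (otri a b c : set (plane R)))) <= 2 * h.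
Proof.
rewrite -[leRHS](ger0_norm (ltW _)) ?mulr_gt0 // -sqrtr_sqr ler_wsqrtr //.
apply: le_trans shape_area _; rewrite exprMn; have := sqr_ge0 h; nra.
Qed.

End shape_facts.

Definition C2bound {R : realType} (F : R * R -> R) (B : R) : Prop :=
  forall x, box 1 x ->
   [/\ `|F x| <= B, `|pd1 F x| <= B, `|pd2 F x| <= B &
     [/\ `|pd1 (pd1 F) x| <= B, `|pd2 (pd1 F) x| <= B, `|pd1 (pd2 F) x| <= B & `|pd2 (pd2 F) x| <= B]].

Lemma C2bound_ex {R : realType} (F : R * R -> R) : smooth F ->
  exists2 B : R, 0 <= B & forall B', B <= B' -> C2bound F B'.
Proof.
move=> sF; have s1 := smooth_pd1 sF; have s2 := smooth_pd2 sF.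
have [B0 b0 H0] := continuous_bounded_box 1 (smooth_continuous sF).
have [B1 b1 H1] := continuous_bounded_box 1 (smooth_continuous s1).
have [B2 b2 H2] := continuous_bounded_box 1 (smooth_continuous s2).
have [B3 b3 H3] := continuous_bounded_box 1 (smooth_continuous (smooth_pd1 s1)).
have [B4 b4 H4] := continuous_bounded_box 1 (smooth_continuous (smooth_pd2 s1)).
have [B5 b5 H5] := continuous_bounded_box 1 (smooth_continuous (smooth_pd1 s2)).
have [B6 b6 H6] := continuous_bounded_box 1 (smooth_continuous (smooth_pd2 s2)).
exists (B0 + B1 + B2 + B3 + B4 + B5 + B6); first by rewrite !addr_ge0.
move=> B' BB x Bx; split; [apply: le_trans (H0 _ Bx) _|apply: le_trans (H1 _ Bx) _|apply: le_trans (H2 _ Bx) _|].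
- lra.
- lra.
- lra.
split; [apply: le_trans (H3 _ Bx) _|apply: le_trans (H4 _ Bx) _|apply: le_trans (H5 _ Bx) _|apply: le_trans (H6 _ Bx) _]; lra.
Qed.

Lemma pd_lin {R : realType} (k l : R) (u w : R * R -> R) : smooth u -> smooth w ->
  pd1 (fun x => k * u x + l * w x) = (fun x => k * pd1 u x + l * pd1 w x) /\
  pd2 (fun x => k * u x + l * w x) = (fun x => k * pd2 u x + l * pd2 w x).
Proof.
move=> su sw; have sk := @smooth_cst R k; have sl := @smooth_cst R l.
have [k1 k2] := pd_cst k; have [l1 l2] := pd_cst l.
rewrite pd1D ?pd2D; try exact: smoothZ.
rewrite !pd1M // !pd2M // k1 k2 l1 l2.
by split; apply/funext => x; rewrite !mulr0 !addr0.
Qed.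

Section local_bound.
Context {R : realType} (kap h : R) (a b c : R * R) (sh : tri_shape kap h a b c).
Context (m : nat) (F : R * R -> R) (B : R) (pF : pf m F) (B0 : 0 <= B) (FB : C2bound F B).

Let phi x := F (ref_map a b c x).

Let box1 x : otri a b c x -> box 1 (ref_map a b c x).
Proof. by move=> /(otriE _ (shape_cross sh)) /rtri_box. Qed.

Let lin2 (p q u w e B' : R) : `|p| <= e -> `|q| <= e -> `|u| <= B' -> `|w| <= B' -> `|p * u + q * w| <= 2 * B' * e.
Proof.
move=> pe qe uB wB; apply: le_trans (ler_normD _ _) _; rewrite !normrM.
have := ler_pM (normr_ge0 _) (normr_ge0 _) pe uB; have := ler_pM (normr_ge0 _) (normr_ge0 _) qe wB.
lra.
Qed.

Let sF : smooth F := pf_smooth pF.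

Lemma local_pd x : otri a b c x ->
  [/\ `|phi x| <= B, `|pd1 phi x| <= 2 * B * (kap * h)^-1 & `|pd2 phi x| <= 2 * B * (kap * h)^-1].
Proof.
move=> /box1 /FB[f0 f1 f2 _]; have [g1 g2 g3 g4] := shape_grad sh.
have [-> ->] := pd_ref_map a b c sF.
by split => //; exact: lin2.
Qed.

Lemma local_pdd x : otri a b c x ->
  `|pd1 (pd1 phi) x + pd2 (pd2 phi) x| <= 8 * B * (kap * h)^-1 ^+ 2.
Proof.
move=> /box1 /FB[f0 f1 f2 [f11 f21 f12 f22]]; have [g1 g2 g3 g4] := shape_grad sh.
have [E1 E2] := pd_ref_map a b c sF; rewrite /phi E1 E2.
have s1 := smooth_pd1 sF; have s2 := smooth_pd2 sF.
have sl k l : smooth (fun y => k * pd1 F y + l * pd2 F y) by apply: smoothD; exact: smoothZ.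
have [-> _] := pd_ref_map a b c (sl (gx2 a b c).1 (gx3 a b c).1).
have [_ ->] := pd_ref_map a b c (sl (gx2 a b c).2 (gx3 a b c).2).
have [l1 l2] := pd_lin (gx2 a b c).1 (gx3 a b c).1 s1 s2.
have [l3 l4] := pd_lin (gx2 a b c).2 (gx3 a b c).2 s1 s2.
rewrite l1 l2 l3 l4.
set e := (kap * h)^-1 in g1 g2 g3 g4 *.
have := lin2 g1 g3 (lin2 g1 g3 f11 f12) (lin2 g1 g3 f21 f22).
have := lin2 g2 g4 (lin2 g2 g4 f11 f12) (lin2 g2 g4 f21 f22).
move=> H2 H1; apply: le_trans (ler_normD _ _) _; apply: le_trans (lerD H1 H2) _.
by rewrite le_eqVlt; apply/orP; left; apply/eqP; rewrite expr2; ring.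
Qed.

End local_bound.

(** * Boundary values of the virtual element function *)

(** The field is the gradient of [F] pulled back to the triangle, whose components along [b - a] and
    [c - a] are its products with the dual basis [gx2], [gx3]. It vanishes on two edges and has no
    flux there. The constant [c0] enters by subtracting the same formula for a constant function. *)
Lemma grad_green {R : realType} (K : set (R * R)) (v g : R * R -> R) G phi (a b c : R * R) m (F : R * R -> R) (c0 : R) :
  open K -> bounded_set K -> h1approx K v G phi -> approx_edge phi g a b ->
  cross a b c != 0 -> otri a b c `<=` K -> pf m F ->
  (forall t, pd1 F (0, t) = 0 /\ pd2 F (0, t) = 0) ->
  (forall t, pd1 F (1 - t, t) = 0 /\ pd2 F (1 - t, t) = 0) ->
  ip area (otri a b c : set (plane R)) (fun x => (G x).1) (pd1 (fun x => F (ref_map a b c x))) +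
  ip area (otri a b c : set (plane R)) (fun x => (G x).2) (pd2 (fun x => F (ref_map a b c x))) +
  ip area (otri a b c : set (plane R)) (fun x => v x - c0)
    (fun x => pd1 (pd1 (fun x => F (ref_map a b c x))) x + pd2 (pd2 (fun x => F (ref_map a b c x))) x) =
  - (`|cross a b c| * \int[@lebesgue_measure R]_(s in unit_itv)
     ((g (segpath a b s) - c0) *
      (((gx2 a b c).1 * (gx3 a b c).1 + (gx2 a b c).2 * (gx3 a b c).2) * pd1 F (s, 0) +
       ((gx3 a b c).1 ^+ 2 + (gx3 a b c).2 ^+ 2) * pd2 F (s, 0)))).
Proof.
move=> oK bK hA aE D TK pF H0 H1.
pose u x := F (ref_map a b c x); rewrite -/u.
have pu : pf m u by exact: pf_ref_map.
have su := pf_smooth pu; have sF := pf_smooth pF.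
have [E1 E2] := pd_ref_map a b c sF; rewrite -/u in E1 E2.
pose Xs x := (gx2 a b c).1 * pd1 u x + (gx2 a b c).2 * pd2 u x.
pose Xt x := (gx3 a b c).1 * pd1 u x + (gx3 a b c).2 * pd2 u x.
have s1 := smooth_pd1 su; have s2 := smooth_pd2 su.
have sXs : smooth Xs by apply: smoothD; exact: smoothZ.
have sXt : smooth Xt by apply: smoothD; exact: smoothZ.
have zero x : pd1 F x = 0 /\ pd2 F x = 0 -> pd1 u (amap a b c x) = 0 /\ pd2 u (amap a b c x) = 0.
  by move=> [z1 z2]; rewrite E1 E2 ref_map_of_amap // z1 z2 !mulr0 addr0.
have Xs0 t : Xs (amap a b c (0, t)) = 0.
  by have [z1 z2] := zero _ (H0 t); rewrite /Xs z1 z2 !mulr0 addr0.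
have X0 t : Xs (amap a b c (1 - t, t)) + Xt (amap a b c (1 - t, t)) = 0.
  by have [z1 z2] := zero _ (H1 t); rewrite /Xs /Xt z1 z2 !mulr0 !addr0.
have XE1 : (fun x => Xs x * (b.1 - a.1) + Xt x * (c.1 - a.1)) = pd1 u.
  by apply/funext => x; move: D; rewrite /Xs /Xt /gx2 /gx3 /cross /= => D; field; exact: D.
have XE2 : (fun x => Xs x * (b.2 - a.2) + Xt x * (c.2 - a.2)) = pd2 u.
  by apply/funext => x; move: D; rewrite /Xs /Xt /gx2 /gx3 /cross /= => D; field; exact: D.
have Eg := green_trace oK bK hA aE D TK sXs sXt Xs0 X0.
have Ec := green_triangle D sXs sXt (smooth_cst c0) Xs0 X0.
rewrite /= XE1 XE2 in Ec Eg.
have [wG sphi _ _ _] := hA.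
have mK := open_measurable_plane oK; have mT := measurable_otri D.
have [/L2fun_sqint vi _ _ _] := wG.
have viT : sqint area (otri a b c : set (plane R)) v by exact: (sqintS mK mT TK vi).
have sL : smooth (fun x => pd1 (pd1 u) x + pd2 (pd2 u) x).
  by apply: smoothD; [exact: smooth_pd1|exact: smooth_pd2].
have cL := smooth_continuous sL.
have bT := @bounded_otri R a b c.
have iL : sqint area (otri a b c : set (plane R)) (fun x => pd1 (pd1 u) x + pd2 (pd2 u) x) by exact: sqint_continuous.
have ic : sqint area (otri a b c : set (plane R)) (fun=> c0).
  by apply: sqint_continuous => // ?; exact: cvg_cst.
rewrite (ipBl mT viT ic iL) addrA Eg.
have -> : ip area (otri a b c : set (plane R)) (fun=> c0) (fun x => pd1 (pd1 u) x + pd2 (pd2 u) x) =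
   - (`|cross a b c| * \int[@lebesgue_measure R]_(s in unit_itv) (Xt (amap a b c (s, 0)) * c0)).
  rewrite -[RHS]Ec /ip; apply: eq_Rintegral => x _; have [d1 d2] := pd_cst c0.
  by rewrite d1 d2 !mulr0 !add0r.
have XtE s : Xt (segpath a b s) =
   (((gx2 a b c).1 * (gx3 a b c).1 + (gx2 a b c).2 * (gx3 a b c).2) * pd1 F (s, 0) +
       ((gx3 a b c).1 ^+ 2 + (gx3 a b c).2 ^+ 2) * pd2 F (s, 0)).
  by rewrite -(segpath_amap a b c) /Xt E1 E2 ref_map_of_amap //; ring.
have [gi _] := aE; have mU := @measurable_unit R.
have cXt : continuous (fun s => Xt (segpath a b s)).
  move=> t; apply: (@continuous_comp _ _ _ (segpath a b) Xt); first exact: continuous_segpath.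
  exact: smooth_continuous.
have iXt := sqint_unit_continuous cXt.
have iu : sqint (@lebesgue_measure R) unit_itv (fun=> c0) by apply: sqint_unit_continuous => ?; exact: cvg_cst.
rewrite -opprD -mulrBr; congr (- (_ * _)).
have -> : \int[@lebesgue_measure R]_(s in unit_itv) (Xt (amap a b c (s, 0)) * c0) =
  ip (@lebesgue_measure R) unit_itv (fun=> c0) (fun s => Xt (segpath a b s)).
  by apply: eq_Rintegral => s _; rewrite segpath_amap mulrC.
have := ipBl mU gi iu iXt => E; rewrite -[LHS]E.
by apply: eq_Rintegral => s _; rewrite XtE.
Qed.

(** Green's formula for the field [x - c], whose flux density is constant on [a b] and zero on the two other edges. *)
Lemma trace_mean_unique {R : realType} (K : set (R * R)) (v g g' : R * R -> R) G G' phi phi' (a b c : R * R) :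
  open K -> bounded_set K -> h1approx K v G phi -> approx_edge phi g a b ->
  h1approx K v G' phi' -> approx_edge phi' g' a b ->
  cross a b c != 0 -> otri a b c `<=` K ->
  \int[@lebesgue_measure R]_(s in unit_itv) g (segpath a b s) =
  \int[@lebesgue_measure R]_(s in unit_itv) g' (segpath a b s).
Proof.
move=> oK bK hA aE hA' aE' D TK.
(* In the frame [b - a], [c - a] the field [x - c] has the components [lam2] and [lam3 - 1]. *)
have sXs := smooth_lam2 a b c.
have sXt : smooth (fun x => lam3 a b c x - 1) by apply: smoothB; [exact: smooth_lam3|exact: smooth_cst].
have Xs0 t : lam2 a b c (amap a b c (0, t)) = 0 by rewrite lam2_amap.
have X0 t : lam2 a b c (amap a b c (1 - t, t)) + (lam3 a b c (amap a b c (1 - t, t)) - 1) = 0.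
  by rewrite lam2_amap // lam3_amap //=; ring.
have := green_trace oK bK hA aE D TK sXs sXt Xs0 X0.
have := green_trace oK bK hA' aE' D TK sXs sXt Xs0 X0.
rewrite /=.
have [wG _ _ _ _] := hA; have [wG' _ _ _ _] := hA'.
set X1 := (X in ip _ _ _ X + _ + _); set X2 := (X in _ + ip _ _ _ X + _).
have sm k l : smooth (fun x => lam2 a b c x * k + (lam3 a b c x - 1) * l).
  by apply: smoothD; (apply: smoothM; last exact: smooth_cst).
have [m1 _] := weak_grad_moment oK bK wG wG' D TK (sm (b.1 - a.1) (c.1 - a.1)).
have [_ m2] := weak_grad_moment oK bK wG wG' D TK (sm (b.2 - a.2) (c.2 - a.2)).
rewrite m1 m2 => -> /oppr_inj /mulfI; rewrite normr_eq0 => /(_ D) E.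
have F (k : R * R -> R) : sqint (@lebesgue_measure R) unit_itv (k \o segpath a b) ->
  \int[@lebesgue_measure R]_(s in unit_itv) (k (segpath a b s) * (lam3 a b c (segpath a b s) - 1)) =
  - \int[@lebesgue_measure R]_(s in unit_itv) k (segpath a b s).
  move=> ki; have mU := @measurable_unit R.
  have io : sqint (@lebesgue_measure R) unit_itv (fun=> 1) by apply: sqint_unit_continuous => ?; exact: cvg_cst.
  have := ipZl (-1) mU io ki.
  move=> H; transitivity (ip (@lebesgue_measure R) unit_itv (fun=> -1 * 1) (k \o segpath a b)).
    apply: eq_Rintegral => s _; have -> : lam3 a b c (segpath a b s) = 0 by rewrite -(segpath_amap a b c) lam3_amap.
    by rewrite sub0r mulr1 mulrC.
  rewrite H mulN1r; congr (- _); apply: eq_Rintegral => s _; by rewrite mul1r.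
have [gi _] := aE; have [gi' _] := aE'.
by have := E; rewrite (F _ gi) (F _ gi') => /oppr_inj.
Qed.

Lemma pd_sqM {R : realType} (A B : R * R -> R) : smooth A -> smooth B ->
  pd1 (fun x => A x * A x * B x) = (fun x => A x * A x * pd1 B x + 2 * A x * B x * pd1 A x) /\
  pd2 (fun x => A x * A x * B x) = (fun x => A x * A x * pd2 B x + 2 * A x * B x * pd2 A x).
Proof.
move=> sA sB; have sAA : smooth (fun x => A x * A x) by exact: smoothM.
rewrite (pd1M sAA sB) (pd2M sAA sB) (pd1M sA sA) (pd2M sA sA).
by split; apply/funext => x; ring.
Qed.

Lemma pd_sq_zero {R : realType} (A B : R * R -> R) x : smooth A -> smooth B -> A x = 0 ->
  pd1 (fun x => A x * A x * B x) x = 0 /\ pd2 (fun x => A x * A x * B x) x = 0.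
Proof.
move=> sA sB x0; have [-> ->] := pd_sqM sA sB.
by rewrite x0 !mulr0 !mul0r addr0.
Qed.

(** With barycentric coordinates [l1, l2, l3], this is [l1 ^+ 2 * l2 ^+ 2 * l3 * l2 ^+ i]. Its gradient vanishes on two edges,
    and on [l3 = 0] only its normal derivative is non-zero. *)
Definition edgeF {R : realType} (i : nat) (x : R * R) : R :=
  (1 - x.1 - x.2) * (1 - x.1 - x.2) * (x.1 * x.1 * (x.2 * mono i 0 x)).

Lemma pf_edgeF {R : realType} i : pf (5 + i) (@edgeF R i).
Proof.
have [h1 h2] := @pf_coord R; have h3 := @pf_lam1 R.
have hm : pf i (@mono R i 0) by apply: pf_mono; rewrite addn0.
have := pfM (pfM h3 h3) (pfM (pfM h1 h1) (pfM h2 hm)).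
by rewrite -[(1 + 1 + (1 + 1 + (1 + i)))%N]/(5 + i)%N.
Qed.

Lemma edgeF_zero {R : realType} i (t : R) :
  [/\ pd1 (@edgeF R i) (0, t) = 0 /\ pd2 (@edgeF R i) (0, t) = 0,
   pd1 (@edgeF R i) (1 - t, t) = 0 /\ pd2 (@edgeF R i) (1 - t, t) = 0 &
   pd1 (@edgeF R i) (t, 0) = 0 /\ pd2 (@edgeF R i) (t, 0) = (t * (1 - t)) ^+ 2 * t ^+ i].
Proof.
have [s1 s2 [_ _ e21 e22]] := @pd_coord R; have sm := @smooth_mono R i 0.
have sl := pf_smooth (@pf_lam1 R).
have s2m : smooth (fun x : R * R => x.2 * mono i 0 x) by exact: smoothM.
have s11 : smooth (fun x : R * R => x.1 * x.1) by exact: smoothM.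
have sll : smooth (fun x : R * R => (1 - x.1 - x.2) * (1 - x.1 - x.2)) by exact: smoothM.
split.
- have E : @edgeF R i = fun x => x.1 * x.1 * ((1 - x.1 - x.2) * (1 - x.1 - x.2) * (x.2 * mono i 0 x)).
    by apply/funext => x; rewrite /edgeF; ring.
  by rewrite E; exact: (@pd_sq_zero R _ _ (0, t) s1 (smoothM sll s2m) (erefl 0)).
- have z : 1 - (1 - t) - t = 0 by ring.
  exact: (@pd_sq_zero R _ _ (1 - t, t) sl (smoothM s11 s2m) z).
- have E : @edgeF R i = fun x => x.2 * ((1 - x.1 - x.2) * (1 - x.1 - x.2) * (x.1 * x.1 * mono i 0 x)).
    by apply/funext => x; rewrite /edgeF; ring.
  have sC := smoothM sll (smoothM s11 sm).
  rewrite E (pd1M s2 sC) (pd2M s2 sC) e21 e22; clear.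
  move: (pd1 _ _) (pd2 _ _) => d d'; rewrite /mono [(_, _).1]/= [(_, _).2]/= expr0; split; ring.
Qed.

(** The gradient vanishes on all three edges, so that no boundary values enter. *)
Definition intF {R : realType} (i j : nat) (x : R * R) : R := rbub x * rbub x * mono i j x.

Lemma pf_intF {R : realType} i j : pf (6 + (i + j)) (@intF R i j).
Proof. by apply: pfM; [apply: (pfM (@pf_rbub R) (@pf_rbub R))|exact: pf_mono]. Qed.

Lemma intF_zero {R : realType} i j (x : R * R) : rbub x = 0 ->
  pd1 (@intF R i j) x = 0 /\ pd2 (@intF R i j) x = 0.
Proof.
by move=> x0; exact: (pd_sq_zero (pf_smooth (@pf_rbub R)) (@smooth_mono R i j) x0).
Qed.

Section local_norms.
Context {R : realType} (kap h : R) (a b c : R * R) (sh : tri_shape kap h a b c).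
Context (m : nat) (F : R * R -> R) (B : R) (pF : pf m F) (B0 : 0 <= B) (FB : C2bound F B).

Let T : set (plane R) := otri a b c.
Let u x := F (ref_map a b c x).
Let mT : measurable T := measurable_otri (shape_cross sh).
Let fT : (area T < +oo)%E := bounded_area_fin mT (@bounded_otri R a b c).
Let su : smooth u := pf_smooth (pf_ref_map a b c pF).
Let h0 : 0 < h := sh_h sh.
Let k0 : 0 < kap := sh_kap sh.

Let mc (f : R * R -> R) : smooth f -> measurable_fun T f.
Proof.
move=> sf; apply: measurable_funTS; apply: continuous_measurable_plane; exact: smooth_continuous.
Qed.

Let nb (f : R * R -> R) e : smooth f -> 0 <= e -> (forall x, otri a b c x -> `|f x| <= e) -> nrm area T f <= e * (2 * h).
Proof.
move=> sf e0 fe; apply: le_trans (nrm_bounded mT fT (mc sf) e0 fe) _.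
by apply: ler_wpM2l => //; exact: shape_sqrt_area sh.
Qed.

Lemma local_nrm_pd : nrm area T (pd1 u) <= 4 * B / kap /\ nrm area T (pd2 u) <= 4 * B / kap.
Proof.
have e0 : 0 <= 2 * B * (kap * h)^-1 by rewrite mulr_ge0 ?mulr_ge0 // invr_ge0 ltW // mulr_gt0.
have E : 4 * B / kap = 2 * B * (kap * h)^-1 * (2 * h) by field; rewrite !gt_eqF.
rewrite E; split; apply: nb; [exact: (smooth_pd1 su)|exact: e0| |exact: (smooth_pd2 su)|exact: e0|].
  move=> x Tx; have [_ H _] := local_pd sh pF FB Tx; exact: H.
move=> x Tx; have [_ _ H] := local_pd sh pF FB Tx; exact: H.
Qed.

Lemma local_nrm_pdd : nrm area T (fun x => pd1 (pd1 u) x + pd2 (pd2 u) x) <= 16 * B / kap ^+ 2 / h.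
Proof.
have e0 : 0 <= 8 * B * (kap * h)^-1 ^+ 2 by rewrite mulr_ge0 ?sqr_ge0 // mulr_ge0.
have E : 16 * B / kap ^+ 2 / h = 8 * B * (kap * h)^-1 ^+ 2 * (2 * h) by field; rewrite !gt_eqF.
rewrite E; apply: nb => //; last by move=> x /(local_pdd sh pF FB).
by apply: smoothD; [apply: smooth_pd1; exact: smooth_pd1|apply: smooth_pd2; exact: smooth_pd2].
Qed.

End local_norms.

Lemma add_bound {R : realType} (A L J I M N : R) : A + L = - (`|J| * I) -> `|A| <= M -> `|L| <= N ->
  `|J| * `|I| <= M + N.
Proof.
move=> E AM LN; have -> : `|J| * `|I| = `|A + L| by rewrite E normrN normrM normr_id.
by apply: le_trans (ler_normD _ _) _; exact: lerD.
Qed.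

(** The test functions [edgeF i] turn the edge term into the moments of [g - c0] with weight
    $(t(1-t))^2$. Their Laplacian has norm of order [1 / h], which matches the bound [M * h] on
    [v - c0]. The factor in front of the moments is at least [rho ^+ 2 / 2], because the edge has
    length at least [rho * h] and the determinant is at most [2 * h ^+ 2]. *)
Lemma edge_bound {R : realType} k (kap rho : R) : 0 < kap -> 0 < rho ->
  exists2 C : R, 0 <= C & forall (K : set (R * R)) (v g : R * R -> R) G phi (a b c : R * R) (h c0 M : R) (P : {poly R}),
  open K -> bounded_set K -> h1approx K v G phi -> approx_edge phi g a b ->
  tri_shape kap h a b c -> otri a b c `<=` K -> rho * h <= eucl_dist a b -> (size P <= k.+1)%N ->
  (forall t, 0 <= t <= 1 -> g (segpath a b t) = P.[t]) -> 0 <= M ->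
  nrm area (otri a b c : set (plane R)) (fun x => v x - c0) <= M * h ->
  (forall i, (i <= k)%N ->
    `|ip area (otri a b c : set (plane R)) (fun x => (G x).1) (pd1 (fun x => edgeF i (ref_map a b c x))) +
      ip area (otri a b c : set (plane R)) (fun x => (G x).2) (pd2 (fun x => edgeF i (ref_map a b c x)))| <= M) ->
  forall t, 0 <= t <= 1 -> `|P.[t] - c0| <= C * M.
Proof.
move=> kap0 rho0.
pose om (t : R) : R := (t * (1 - t)) * (t * (1 - t)).
have com : continuous om.
  have c1 : continuous (fun t : R => t * (1 - t)).
    by move=> t; apply: cvgM; [exact: cvg_id|apply: cvgB; [exact: cvg_cst|exact: cvg_id]].
  by move=> t; apply: cvgM; exact: c1.
have [||D D0 HD] := @poly_moment_bound R k om com.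
- by move=> t t01; rewrite /om !mulr_gt0 //; lra.
- by move=> t t01; rewrite /om -expr2 sqr_ge0.
have [i|B B0 HB] := @finite_uniform R 'I_k.+1 (fun i B => C2bound (edgeF i) B).
  exact: C2bound_ex (pf_smooth (pf_edgeF i)).
exists (D * ((1 + 16 * B / kap ^+ 2) * (2 / rho ^+ 2))).
  by rewrite !mulr_ge0 ?addr_ge0 ?mulr_ge0 ?invr_ge0 ?sqr_ge0.
move=> K v g G phi a b c h c0 M P oK bK hA aE sh TK hd sP gP M0 Hv HG t t01.
have h0 := sh_h sh; have Dc := shape_cross sh.
have -> : P.[t] - c0 = (P - c0%:P).[t] by rewrite hornerD hornerN hornerC.
rewrite -mulrA; apply: HD => // [|i ik].
  by apply: leq_trans (size_polyD _ _) _; rewrite geq_max sP size_polyN (leq_trans (size_polyC_leq1 _)).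
have ik' : (i < k.+1)%N by rewrite ltnS.
have Bi := HB (Ordinal ik'); rewrite /= in Bi.
have z t' := @edgeF_zero R i t'.
have z0 t' : pd1 (@edgeF R i) (0, t') = 0 /\ pd2 (@edgeF R i) (0, t') = 0 by have [p _ _] := z t'; exact: p.
have z1 t' : pd1 (@edgeF R i) (1 - t', t') = 0 /\ pd2 (@edgeF R i) (1 - t', t') = 0.
  by have [_ p _] := z t'; exact: p.
have E := grad_green c0 oK bK hA aE Dc TK (pf_edgeF i) z0 z1.
have HGi := HG i ik.
have mK := open_measurable_plane oK; have mT := measurable_otri Dc.
have [[/L2fun_sqint vi _ _ _] _ _ _ _] := hA.
have viT : sqint area (otri a b c : set (plane R)) v by exact: (sqintS mK mT TK vi).
have bT := @bounded_otri R a b c.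
have ic : sqint area (otri a b c : set (plane R)) (fun=> c0).
  by apply: sqint_continuous => // ?; exact: cvg_cst.
have su := pf_smooth (pf_ref_map a b c (@pf_edgeF R i)).
pose u := fun x => edgeF i (ref_map a b c x); rewrite -/u in su E HGi.
have sL : smooth (fun x => pd1 (pd1 u) x + pd2 (pd2 u) x).
  by apply: smoothD; [apply: smooth_pd1; exact: smooth_pd1|apply: smooth_pd2; exact: smooth_pd2].
have iL : sqint area (otri a b c : set (plane R)) (fun x => pd1 (pd1 u) x + pd2 (pd2 u) x).
  by apply: sqint_continuous => //; exact: smooth_continuous.
have CS := cauchy_schwarz mT (sqintB mT viT ic) iL.
have NL := local_nrm_pdd sh (@pf_edgeF R i) B0 Bi.
set J := `|cross a b c| in E *; set I := Rintegral _ _ _ in E.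
have J0 : 0 < J by rewrite normr_gt0.
have CS' : M * h * (16 * B / kap ^+ 2 / h) = 16 * B / kap ^+ 2 * M by field; rewrite !gt_eqF.
have H1 : J * `|I| <= M * (1 + 16 * B / kap ^+ 2).
  rewrite mulrDr mulr1 [X in _ <= _ + X]mulrC -CS'.
  apply: (add_bound E HGi); apply: le_trans CS _.
  exact: ler_pM (nrm_ge0 _ _ _) (nrm_ge0 _ _ _) Hv NL.
(* [gx3] is the gradient of the coordinate that vanishes on [a b]; its length is the reciprocal of
   the height over that edge. *)
have E2 : (gx3 a b c).1 ^+ 2 + (gx3 a b c).2 ^+ 2 = eucl_dist a b ^+ 2 / J ^+ 2.
  rewrite /eucl_dist eucl_norm_sqr /gx3 /J /= real_normK ?num_real //.
  by field; rewrite Dc.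
have IE : I = eucl_dist a b ^+ 2 / J ^+ 2 *
   \int[@lebesgue_measure R]_(s in unit_itv) ((P - c0%:P).[s] * (om s * s ^+ i)).
  rewrite -RintegralZl; [|exact: measurable_unit|]; last first.
    apply: unit_integrable => s; apply: cvgM; first exact: continuous_horner.
    by apply: cvgM; [exact: com|exact: exprn_continuous].
  apply: eq_Rintegral => s; rewrite inE /unit_itv /= in_itv /= => s01.
  have [_ _ [-> ->]] := z s; rewrite mulr0 add0r E2 gP // hornerD hornerN hornerC /om; ring.
rewrite IE normrM in H1.
have q0 : 0 <= eucl_dist a b ^+ 2 / J ^+ 2 by rewrite divr_ge0 ?sqr_ge0.
rewrite (ger0_norm q0) in H1.
have Ju := shape_cross_ub sh; rewrite -/J in Ju.
have L : rho ^+ 2 / 2 <= J * (eucl_dist a b ^+ 2 / J ^+ 2).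
  have -> : J * (eucl_dist a b ^+ 2 / J ^+ 2) = eucl_dist a b ^+ 2 / J by field; rewrite gt_eqF.
  rewrite ler_pdivlMr //.
  have d2 : (rho * h) ^+ 2 <= eucl_dist a b ^+ 2.
    by rewrite ler_sqr ?nnegrE ?eucl_norm_ge0 // mulr_ge0 ?ltW.
  apply: le_trans d2; rewrite exprMn.
  have -> : rho ^+ 2 * h ^+ 2 = rho ^+ 2 / 2 * (2 * h ^+ 2) by field.
  by apply: ler_wpM2l Ju; rewrite divr_ge0 // sqr_ge0.
set I' := Rintegral _ _ _ in H1 *.
have H2 : rho ^+ 2 / 2 * `|I'| <= M * (1 + 16 * B / kap ^+ 2).
  by apply: le_trans H1; rewrite mulrA ler_wpM2r.
rewrite (mulrC M) -ler_pdivlMl ?divr_gt0 ?exprn_gt0 // in H2.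
apply: le_trans H2 _; rewrite le_eqVlt; apply/orP; left; apply/eqP.
by field; rewrite !gt_eqF.
Qed.

Section edge_terms.
Context {R : realType} (k : nat) (kap : R) (kap0 : 0 < kap).

Let bound_nrm (a b c : R * R) h (f : R * R -> R) e : tri_shape kap h a b c -> continuous f -> 0 <= e ->
  (forall x, otri a b c x -> `|f x| <= e) -> nrm area (otri a b c : set (plane R)) f <= e * (2 * h).
Proof.
move=> sh cf e0 fe; have mT := measurable_otri (shape_cross sh).
have mf : measurable_fun (otri a b c : set (plane R)) f.
  by apply: measurable_funTS; exact: continuous_measurable_plane.
apply: le_trans (nrm_bounded mT (bounded_area_fin mT (@bounded_otri R a b c)) mf e0 fe) _.
by apply: ler_wpM2l => //; exact: shape_sqrt_area sh.
Qed.

Lemma abs_add0 (A L M : R) : A + L = 0 -> `|L| <= M -> `|A| <= M.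
Proof. by move=> /eqP; rewrite addr_eq0 => /eqP ->; rewrite normrN. Qed.

(** For [u] equal to a squared bubble times a monomial, the same gradient term is evaluated twice:
    by [grad_green], without a boundary contribution, and by [bubble_laplacian]. This equates the
    moment of [f] against [u] with that of [v] against the Laplacian of [u]. The factor [1 / h ^+ 2]
    comes from the Jacobian, at least [kap * h ^+ 2]. *)
Lemma laplacian_bound : exists2 C : R, 0 <= C &
  forall (K : set (R * R)) (v f g : R * R -> R) G phi (a b c : R * R) (h M : R),
  open K -> bounded_set K -> h1approx K v G phi -> approx_edge phi g a b ->
  tri_shape kap h a b c -> otri a b c `<=` K -> pf k f -> weak_laplacian K v f -> 0 <= M ->
  nrm area (otri a b c : set (plane R)) v <= M * h ->
  forall x, otri a b c x -> `|f x| <= C * M / h ^+ 2.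
Proof.
pose om (x : R * R) : R := rbub x * rbub x.
have com : continuous om by apply: smooth_continuous; apply: (pf_smooth (pfM (@pf_rbub R) (@pf_rbub R))).
have [|||D D0 HD] := @pf_moment_bound R rtri om 2^-1 1 k (@open_rtri R) (@bounded_rtri R) _ _ com.
- by rewrite invr_gt0.
- exact: rtri_square.
- by move=> x /rbub_gt0 r0; rewrite mulr_gt0.
have [ij|B B0 HB] := @finite_uniform R ('I_k.+1 * 'I_k.+1)%type (fun ij B => C2bound (intF ij.1 ij.2) B).
  exact: C2bound_ex (pf_smooth (pf_intF ij.1 ij.2)).
exists (D * (16 * B / kap ^+ 2 / kap)).
  exact: (mulr_ge0 D0 (divr_ge0 (divr_ge0 (mulr_ge0 (ler0n _ _) B0) (sqr_ge0 _)) (ltW kap0))).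
move=> K v f g G phi a b c h M oK bK hA aE sh TK pk wl M0 Hv x Tx.
have h0 := sh_h sh; have Dc := shape_cross sh.
have mK := open_measurable_plane oK; have mT := measurable_otri Dc; have bT := @bounded_otri R a b c.
have [wG _ _ _ _] := hA; have [/L2fun_sqint vi _ _ _] := wG.
have viT : sqint area (otri a b c : set (plane R)) v by exact: (sqintS mK mT TK vi).
have -> : f x = f (amap a b c (ref_map a b c x)) by rewrite /ref_map amap_lam.
rewrite -mulrA -mulrA.
suff HM : forall i j, (i + j <= k)%N ->
    `|\int[area]_(y in (rtri : set (plane R))) (f (amap a b c y) * (om y * mono i j y))| <=
      16 * B / kap ^+ 2 / kap * (M / h ^+ 2).
  have [H _ _] := HD _ _ (pf_amap a b c pk) HM _ (rtri_box ((otriE x Dc).1 Tx)); exact: H.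
move=> i j ijk.
have ik : (i < k.+1)%N by rewrite ltnS (leq_trans _ ijk) // leq_addr.
have jk : (j < k.+1)%N by rewrite ltnS (leq_trans _ ijk) // leq_addl.
have Bij := HB (Ordinal ik, Ordinal jk); rewrite [(_, _).1]/= [(_, _).2]/= in Bij.
have z0 t : pd1 (@intF R i j) (0, t) = 0 /\ pd2 (@intF R i j) (0, t) = 0.
  by apply: intF_zero; rewrite /rbub /= !mul0r.
have z1 t : pd1 (@intF R i j) (1 - t, t) = 0 /\ pd2 (@intF R i j) (1 - t, t) = 0.
  by apply: intF_zero; rewrite /rbub /=; ring.
have z2 t : pd1 (@intF R i j) (t, 0) = 0 /\ pd2 (@intF R i j) (t, 0) = 0.
  by apply: intF_zero; rewrite /rbub /= mulr0 mul0r.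
have E := grad_green 0 oK bK hA aE Dc TK (pf_intF i j) z0 z1.
have E0 : \int[@lebesgue_measure R]_(s in unit_itv)
     ((g (segpath a b s) - 0) *
      (((gx2 a b c).1 * (gx3 a b c).1 + (gx2 a b c).2 * (gx3 a b c).2) * pd1 (@intF R i j) (s, 0) +
       ((gx3 a b c).1 ^+ 2 + (gx3 a b c).2 ^+ 2) * pd2 (@intF R i j) (s, 0))) = 0.
  rewrite -[RHS](Rintegral_unit_cst 0); apply: eq_Rintegral => s _.
  by have [-> ->] := z2 s; rewrite !mulr0 addr0 mulr0.
rewrite E0 mulr0 oppr0 in E; clear E0.
(* One factor of the squared bubble goes into [r]; the other is the one built into [bub]. *)
pose r x := rbub (ref_map a b c x) * mono i j (ref_map a b c x).
have pr : pf (3 + (i + j)) r.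
  by apply: pfM; [exact: (pf_ref_map a b c (@pf_rbub R))|apply: (pf_ref_map a b c); exact: pf_mono].
have ub : (fun x => intF i j (ref_map a b c x)) = bub a b c r.
  by apply/funext => y; rewrite /bub /r /intF /rbub /ref_map /= /lam1; ring.
have BL := bubble_laplacian Dc (pf_smooth pr) oK bK TK wG wl (pf_continuous pk).
rewrite -ub in BL; rewrite BL in E.
have pu := pf_ref_map a b c (@pf_intF R i j); have su := pf_smooth pu.
set u := fun x => intF i j (ref_map a b c x) in su E BL pu *.
have sL : smooth (fun x => pd1 (pd1 u) x + pd2 (pd2 u) x).
  by apply: smoothD; [exact: (smooth_pd1 (smooth_pd1 su))|exact: (smooth_pd2 (smooth_pd2 su))].
have iL : sqint area (otri a b c : set (plane R)) (fun x => pd1 (pd1 u) x + pd2 (pd2 u) x).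
  exact: (sqint_continuous mT bT (smooth_continuous sL)).
have NL := local_nrm_pdd sh (@pf_intF R i j) B0 Bij.
have v0 : (fun x => v x + 0) = v by apply/funext => y; rewrite addr0.
rewrite v0 in E.
have H1 : `|ip area (otri a b c : set (plane R)) f u| <= M * h * (16 * B / kap ^+ 2 / h).
  rewrite -normrN; apply: (abs_add0 E); apply: le_trans (cauchy_schwarz mT viT iL) _.
  exact: ler_pM (nrm_ge0 _ _ _) (nrm_ge0 _ _ _) Hv NL.
have cfu : continuous (fun x => f x * u x).
  by apply: pf_continuous; exact: (pfM pk pu).
rewrite /ip (Rintegral_otri Dc (integrable_continuous mT bT cfu)) normrM normr_id in H1.
have I1 : \int[area]_(x in (rtri : set (plane R))) (f (amap a b c x) * u (amap a b c x)) =
  \int[area]_(x in (rtri : set (plane R))) (f (amap a b c x) * (om x * mono i j x)).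
  by apply: eq_Rintegral => y _; rewrite /u ref_map_of_amap.
rewrite I1 in H1.
set I := Rintegral _ _ _ in H1 *; clearbody I.
apply: (@le_trans _ _ (M * h * (16 * B / kap ^+ 2 / h) / (kap * h ^+ 2))).
  rewrite ler_pdivlMr ?mulr_gt0 ?exprn_gt0 // mulrC.
  by apply: le_trans H1; apply: ler_wpM2r => //; exact: sh_cross sh.
by rewrite le_eqVlt; apply/orP; left; apply/eqP; field; rewrite !gt_eqF.
Qed.

(** [edgeF] still contains one full bubble, so the gradient term is minus the product of [f] with
    the test function. With [f] of order [M / h ^+ 2], a bounded test function and an area of order
    [h ^+ 2], the result is of order [M]. *)
Lemma edge_term_m0 : exists2 C : R, 0 <= C &
  forall (K : set (R * R)) (v f g : R * R -> R) G phi (a b c : R * R) (h M : R),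
  open K -> bounded_set K -> h1approx K v G phi -> approx_edge phi g a b ->
  tri_shape kap h a b c -> otri a b c `<=` K -> pf k f -> weak_laplacian K v f -> 0 <= M ->
  nrm area (otri a b c : set (plane R)) v <= M * h -> forall i, (i <= k)%N ->
  `|ip area (otri a b c : set (plane R)) (fun x => (G x).1) (pd1 (fun x => edgeF i (ref_map a b c x))) +
    ip area (otri a b c : set (plane R)) (fun x => (G x).2) (pd2 (fun x => edgeF i (ref_map a b c x)))| <= C * M.
Proof.
have [C1 C10 HC1] := laplacian_bound.
have [i|B B0 HB] := @finite_uniform R 'I_k.+1 (fun i B => C2bound (edgeF i) B).
  exact: C2bound_ex (pf_smooth (pf_edgeF i)).
exists (4 * C1 * B); first by rewrite !mulr_ge0.
move=> K v f g G phi a b c h M oK bK hA aE sh TK pk wl M0 Hv i ik.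
have f1 := HC1 K v f g G phi a b c h M oK bK hA aE sh TK pk wl M0 Hv.
have h0 := sh_h sh; have Dc := shape_cross sh.
have ik' : (i < k.+1)%N by rewrite ltnS.
have Bi := HB (Ordinal ik'); rewrite [nat_of_ord _]/= in Bi.
have mT := measurable_otri Dc; have bT := @bounded_otri R a b c.
have [wG _ _ _ _] := hA.
pose r x := (1 - lam2 a b c x - lam3 a b c x) * (lam2 a b c x * mono i 0 (ref_map a b c x)).
have pr : pf (1 + (1 + i)) r.
  apply: pfM; first exact: (pf_ref_map a b c (@pf_lam1 R)).
  apply: pfM; first exact: (pf_ref_map a b c (@pf_coord R).1).
  by apply: (pf_ref_map a b c); apply: pf_mono; rewrite addn0.
have ub : (fun x => edgeF i (ref_map a b c x)) = bub a b c r.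
  by apply/funext => y; rewrite /bub /r /edgeF /ref_map [(_, _).1]/= [(_, _).2]/= /lam1; ring.
have BL := bubble_laplacian Dc (pf_smooth pr) oK bK TK wG wl (pf_continuous pk).
rewrite -ub in BL; rewrite BL normrN.
have pu := pf_ref_map a b c (@pf_edgeF R i).
have cu := pf_continuous pu; have cf := pf_continuous pk.
apply: le_trans (cauchy_schwarz mT (sqint_continuous mT bT cf) (sqint_continuous mT bT cu)) _.
have N1 := bound_nrm sh cf (divr_ge0 (mulr_ge0 C10 M0) (sqr_ge0 h)) f1.
have N2 : nrm area (otri a b c : set (plane R)) (fun x => edgeF i (ref_map a b c x)) <= B * (2 * h).
  apply: (bound_nrm sh cu B0) => x Tx; have [H _ _] := local_pd sh (@pf_edgeF R i) Bi Tx; exact: H.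
apply: le_trans (ler_pM (nrm_ge0 _ _ _) (nrm_ge0 _ _ _) N1 N2) _.
by rewrite le_eqVlt; apply/orP; left; apply/eqP; field; rewrite gt_eqF.
Qed.

(** The test gradient is smooth, so [weak_grad_moment] replaces the weak gradient [G] of the trace
    by the given [G0]. The norm of the test gradient on the triangle does not scale with [h]. *)
Lemma edge_term_m1 : exists2 C : R, 0 <= C &
  forall (K : set (R * R)) (v : R * R -> R) G G0 (a b c : R * R) (h M : R),
  open K -> bounded_set K -> weak_grad K v G -> weak_grad K v G0 ->
  tri_shape kap h a b c -> otri a b c `<=` K -> 0 <= M ->
  nrm area (otri a b c : set (plane R)) (fun x => (G0 x).1) <= M ->
  nrm area (otri a b c : set (plane R)) (fun x => (G0 x).2) <= M -> forall i, (i <= k)%N ->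
  `|ip area (otri a b c : set (plane R)) (fun x => (G x).1) (pd1 (fun x => edgeF i (ref_map a b c x))) +
    ip area (otri a b c : set (plane R)) (fun x => (G x).2) (pd2 (fun x => edgeF i (ref_map a b c x)))| <= C * M.
Proof.
have [i|B B0 HB] := @finite_uniform R 'I_k.+1 (fun i B => C2bound (edgeF i) B).
  exact: C2bound_ex (pf_smooth (pf_edgeF i)).
exists (8 * B / kap); first by rewrite divr_ge0 ?mulr_ge0 // ltW.
move=> K v G G0 a b c h M oK bK wG wG0 sh TK M0 HG1 HG2 i ik.
have h0 := sh_h sh; have Dc := shape_cross sh.
have ik' : (i < k.+1)%N by rewrite ltnS.
have Bi := HB (Ordinal ik'); rewrite [nat_of_ord _]/= in Bi.
have mK := open_measurable_plane oK; have mT := measurable_otri Dc; have bT := @bounded_otri R a b c.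
have su := pf_smooth (pf_ref_map a b c (@pf_edgeF R i)).
have [N1 N2] := local_nrm_pd sh (@pf_edgeF R i) B0 Bi.
set u := fun x => edgeF i (ref_map a b c x) in su N1 N2 *.
have s1 := smooth_pd1 su; have s2 := smooth_pd2 su.
have [-> _] := weak_grad_moment oK bK wG wG0 Dc TK s1.
have [_ ->] := weak_grad_moment oK bK wG wG0 Dc TK s2.
have [_ /L2fun_sqint i1 /L2fun_sqint i2 _] := wG0.
have j1 := sqintS mK mT TK i1; have j2 := sqintS mK mT TK i2.
have l1 := sqint_continuous mT bT (smooth_continuous s1).
have l2 := sqint_continuous mT bT (smooth_continuous s2).
apply: le_trans (ler_normD _ _) _.
have P1 := le_trans (cauchy_schwarz mT j1 l1) (ler_pM (nrm_ge0 _ _ _) (nrm_ge0 _ _ _) HG1 N1).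
have P2 := le_trans (cauchy_schwarz mT j2 l2) (ler_pM (nrm_ge0 _ _ _) (nrm_ge0 _ _ _) HG2 N2).
apply: le_trans (lerD P1 P2) _.
by rewrite le_eqVlt; apply/orP; left; apply/eqP; field; rewrite gt_eqF.
Qed.

End edge_terms.

Lemma otri_flip {R : realType} (a b c : R * R) : cross a b c != 0 -> otri b a c = otri a b c.
Proof.
move=> D; have D' : cross b a c != 0.
  by rewrite (_ : cross b a c = - cross a b c) ?oppr_eq0 // /cross; ring.
have E x : [/\ lam1 b a c x = lam2 a b c x, lam2 b a c x = lam1 a b c x & lam3 b a c x = lam3 a b c x].
  move: D D'; rewrite /lam1 /lam2 /lam3 /cross => D D'.
  by split; field; rewrite D.
apply/seteqP; split => x.
  by move=> /(otri_lam _ D')[h1 h2 h3]; apply/(otri_lam _ D); have [e1 e2 e3] := E x; rewrite -e1 -e2 -e3.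
by move=> /(otri_lam _ D)[h1 h2 h3]; apply/(otri_lam _ D'); have [-> -> ->] := E x.
Qed.

Section mesh_facts.
Context {R : realType} (rho kap CL h : R) (n : nat) (z : 'I_n -> R * R) (K : set (R * R))
    (N : nat) (T : 'I_N -> 'I_3 -> R * R) (gm : good_mesh rho kap CL h z K T) (kap0 : 0 < kap).

Let S : set (plane R) := K.
Let mK : measurable S := open_measurable_plane (gm_open gm).

Lemma mesh_nonc j : noncollinear (T j).
Proof. by have [H _ _ _] := gm_tri gm; exact: H. Qed.

Lemma mesh_shape j a : tri_shape kap h (T j a) (T j (ordS a)) (T j (ordS (ordS a))).
Proof.
have cl b : closure K (T j b).
  apply: (triangle_closure (gm_tri gm)); exact: (edge_triangle (gm_tri gm) (vertex_edge T j b).1).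
by split; [exact: kap0|exact: gm_h gm|exact: (gm_cross gm)|exact: (gm_diam gm)|exact: (gm_diam gm)].
Qed.

Lemma mesh_otri j a : otri (T j a) (T j (ordS a)) (T j (ordS (ordS a))) = tri_int (T j).
Proof. exact: (tri_int_any (mesh_nonc j)). Qed.

(** The triangle may run through the common edge in the opposite direction. Then its first two
    vertices are exchanged, which changes neither the open triangle nor the modulus of the
    determinant. *)
Lemma boundary_tri i : exists j c, tri_shape kap h (z i) (z (ordS i)) c /\
  otri (z i) (z (ordS i)) c = tri_int (T j).
Proof.
have [_ _ _ H] := gm_tri gm; have [j [b E]] := H i.
exists j, (T j (ordS (ordS b))).
have sh := mesh_shape j b; have o := mesh_otri j b.
have [[e1 e2]|[e1 e2]] := edge_ends (gm_tri gm) E.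
  by rewrite -e1 -e2.
rewrite -e2 -e1; split; last by rewrite -o; apply: otri_flip; exact: shape_cross sh.
have cl d : closure K (T j d).
  apply: (triangle_closure (gm_tri gm)); exact: (edge_triangle (gm_tri gm) (vertex_edge T j d).1).
split; [exact: kap0|exact: gm_h gm| |exact: (gm_diam gm)|exact: (gm_diam gm)].
have := sh_cross sh; congr (_ <= _); rewrite -normrN; congr (`| _ |); rewrite /cross; ring.
Qed.

Lemma otri_K i j c : otri (z i) (z (ordS i)) c = tri_int (T j) -> otri (z i) (z (ordS i)) c `<=` K.
Proof. by move=> ->; exact: (tri_int_K (gm_poly gm) (gm_tri gm)). Qed.

Lemma mesh_tri_K j : tri_int (T j) `<=` K.
Proof. exact: (tri_int_K (gm_poly gm) (gm_tri gm)). Qed.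

(** The moment identities of the single triangles are summed; [psi] need not vanish near the
    boundary of [K]. *)
Lemma weak_grad_smooth v (G G' : R * R -> R * R) psi : weak_grad K v G -> weak_grad K v G' -> smooth psi ->
  ip area S (fun x => (G x).1) psi = ip area S (fun x => (G' x).1) psi /\
  ip area S (fun x => (G x).2) psi = ip area S (fun x => (G' x).2) psi.
Proof.
move=> wG wG' sp; have bK := gm_bounded gm.
have ip_sum f : L2fun K f -> ip area S f psi = \sum_j ip area (tri_int (T j) : set (plane R)) f psi.
  move=> /L2fun_sqint sf; have mp := sqint_continuous mK bK (smooth_continuous sp).
  by rewrite /ip (Rintegral_triangulation (gm_poly gm) (gm_tri gm)) //; exact: (sqint_integrableM mK sf mp).
have [_ g1 g2 _] := wG; have [_ g1' g2' _] := wG'.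
have M j := weak_grad_moment (gm_open gm) bK wG wG' (cross_neq0 (mesh_nonc j) ord0) (@mesh_tri_K j) sp.
split.
  by rewrite (ip_sum _ g1) (ip_sum _ g1'); apply: eq_bigr => j _; have [] := M j.
by rewrite (ip_sum _ g2) (ip_sum _ g2'); apply: eq_bigr => j _; have [] := M j.
Qed.

Lemma trace_line_int v g g' G G' phi phi' i :
  h1approx K v G phi -> (forall i, approx_edge phi g (z i) (z (ordS i))) ->
  h1approx K v G' phi' -> (forall i, approx_edge phi' g' (z i) (z (ordS i))) ->
  line_int (z i) (z (ordS i)) (fun t => g (segpath (z i) (z (ordS i)) t)) =
  line_int (z i) (z (ordS i)) (fun t => g' (segpath (z i) (z (ordS i)) t)).
Proof.
move=> hA aE hA' aE'; have [j [c [sh o]]] := boundary_tri i.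
by rewrite /line_int; congr (_ * _); exact: (trace_mean_unique (gm_open gm) (gm_bounded gm) hA (aE i) hA' (aE' i)
  (shape_cross sh) (otri_K o)).
Qed.

End mesh_facts.

Section boundary_values.
Context {R : realType} (k : nat) (rho kap CL : R) (rho0 : 0 < rho) (kap0 : 0 < kap).

Lemma boundary_bound_m0 : exists2 C : R, 0 <= C &
  forall (h : R) n (z : 'I_n -> R * R) K N (T : 'I_N -> 'I_3 -> R * R), good_mesh rho kap CL h z K T ->
  forall v f g G phi M, h1approx K v G phi -> (forall i, approx_edge phi g (z i) (z (ordS i))) ->
  bdry_space z k g -> pf k f -> weak_laplacian K v f ->
  nrm area (K : set (plane R)) v <= M * h ->
  forall i t, 0 <= t <= 1 -> `|g (segpath (z i) (z (ordS i)) t)| <= C * M.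
Proof.
have [C1 C10 HC1] := edge_term_m0 k kap0.
have [C2 C20 HC2] := edge_bound k kap0 rho0.
exists (C2 * (1 + C1)); first by rewrite mulr_ge0 // addr_ge0.
move=> h n z K N T gm v f g G phi M hA aE [_ bd] pk wl Hv i t t01.
have [P [sP gP]] := bd i; rewrite gP //.
have [j [c [sh o]]] := boundary_tri gm kap0 i; have TK := otri_K gm o.
have h0 := gm_h gm.
have M0 : 0 <= M by rewrite -(pmulr_lge0 _ h0); apply: le_trans Hv; exact: nrm_ge0.
have mK := open_measurable_plane (gm_open gm); have mT := measurable_otri (shape_cross sh).
have [[/L2fun_sqint vi _ _ _] _ _ _ _] := hA.
have HvT := le_trans (nrmS mK mT TK vi) Hv.
have ET := HC1 K v f g G phi _ _ c h M (gm_open gm) (gm_bounded gm) hA (aE i) sh TK pk wl M0 HvT.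
have M1 : 0 <= (1 + C1) * M by rewrite mulr_ge0 // addr_ge0.
have L1 : M <= (1 + C1) * M by rewrite mulrDl mul1r lerDl mulr_ge0.
have L2 : C1 * M <= (1 + C1) * M by rewrite mulrDl mul1r lerDr.
have v0 : (fun x => v x - 0) = v by apply/funext => y; rewrite subr0.
have HvT' : nrm area (otri (z i) (z (ordS i)) c : set (plane R)) (fun x => v x - 0) <= (1 + C1) * M * h.
  by rewrite v0; apply: le_trans HvT _; apply: ler_wpM2r => //; exact: ltW.
have := HC2 K v g G phi (z i) (z (ordS i)) c h 0 _ P (gm_open gm) (gm_bounded gm) hA (aE i) sh TK
  (gm_edge gm i) sP gP M1 HvT' (fun i ik => le_trans (ET i ik) L2) t t01.
by rewrite subr0 mulrA.
Qed.

Lemma boundary_bound_m1 : exists2 C : R, 0 <= C &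
  forall (h : R) n (z : 'I_n -> R * R) K N (T : 'I_N -> 'I_3 -> R * R), good_mesh rho kap CL h z K T ->
  forall v g G G0 phi c0 M, h1approx K v G phi -> (forall i, approx_edge phi g (z i) (z (ordS i))) ->
  bdry_space z k g -> weak_grad K v G0 ->
  nrm area (K : set (plane R)) (fun x => (G0 x).1) <= M ->
  nrm area (K : set (plane R)) (fun x => (G0 x).2) <= M ->
  nrm area (K : set (plane R)) (fun x => v x - c0) <= M * h ->
  forall i t, 0 <= t <= 1 -> `|g (segpath (z i) (z (ordS i)) t) - c0| <= C * M.
Proof.
have [C1 C10 HC1] := edge_term_m1 k kap0.
have [C2 C20 HC2] := edge_bound k kap0 rho0.
exists (C2 * (1 + C1)); first by rewrite mulr_ge0 // addr_ge0.
move=> h n z K N T gm v g G G0 phi c0 M hA aE [_ bd] wG0 HG1 HG2 Hv i t t01.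
have [P [sP gP]] := bd i; rewrite gP //.
have [j [c [sh o]]] := boundary_tri gm kap0 i; have TK := otri_K gm o.
have h0 := gm_h gm; have bK := gm_bounded gm.
have M0 : 0 <= M by apply: le_trans HG1; exact: nrm_ge0.
have mK := open_measurable_plane (gm_open gm); have mT := measurable_otri (shape_cross sh).
have [wG _ _ _ _] := hA.
have [/L2fun_sqint vi /L2fun_sqint i1 /L2fun_sqint i2 _] := wG0.
have ic : sqint area (K : set (plane R)) (fun=> c0) by apply: sqint_continuous => // ?; exact: cvg_cst.
have HvT := le_trans (nrmS mK mT TK (sqintB mK vi ic)) Hv.
have ET := HC1 K v G G0 _ _ c h M (gm_open gm) (gm_bounded gm) wG wG0 sh TK M0
  (le_trans (nrmS mK mT TK i1) HG1) (le_trans (nrmS mK mT TK i2) HG2).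
have M1 : 0 <= (1 + C1) * M by rewrite mulr_ge0 // addr_ge0.
have L1 : M <= (1 + C1) * M by rewrite mulrDl mul1r lerDl mulr_ge0.
have L2 : C1 * M <= (1 + C1) * M by rewrite mulrDl mul1r lerDr.
have HvT' : nrm area (otri (z i) (z (ordS i)) c : set (plane R)) (fun x => v x - c0) <= (1 + C1) * M * h.
  by apply: le_trans HvT _; apply: ler_wpM2r => //; exact: ltW.
have := HC2 K v g G phi (z i) (z (ordS i)) c h c0 _ P (gm_open gm) (gm_bounded gm) hA (aE i) sh TK
  (gm_edge gm i) sP gP M1 HvT' (fun i ik => le_trans (ET i ik) L2) t t01.
by rewrite mulrA.
Qed.

End boundary_values.

(** * Inverse estimates for polynomials on [K] *)

Lemma inverse_scale {R : realType} (D q s h e : R) : 0 <= D -> 0 <= q -> 0 < s -> 0 < h -> h / s = q -> 0 <= e ->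
  D * (e / s) <= (D * q + D * q ^+ 2) * (e / h) /\
  D * (e / s) / s <= (D * q + D * q ^+ 2) * (e / h / h).
Proof.
move=> D0 _ s0 h0 <- e0; split; rewrite mulrDl.
  have -> : D * (e / s) = D * (h / s) * (e / h) by field; rewrite !gt_eqF.
  by rewrite lerDl mulr_ge0 ?mulr_ge0 ?exprn_ge0 ?divr_ge0 ?invr_ge0 // ltW.
have -> : D * (e / s) / s = D * (h / s) ^+ 2 * (e / h / h) by field; rewrite !gt_eqF.
by rewrite lerDr mulr_ge0 ?mulr_ge0 ?exprn_ge0 ?divr_ge0 ?invr_ge0 // ltW.
Qed.

(** A right triangle with legs [s = rho * h / 2] at the centre fits into the disc. Pulled back to
    the reference triangle, [f] has moments at most its norm over [s], and [pf_moment_bound] extends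
    the control to the box of half-side [2 / rho = h / s], the preimage of a square around the
    centre large enough to contain [K] whenever its diameter is at most [h]. *)
Lemma inverse_bound {R : realType} k (rho : R) : 0 < rho -> exists2 C : R, 0 <= C &
  forall (K : set (R * R)) (c : R * R) (h : R) f, open K -> bounded_set K -> 0 < h ->
  disc c (rho * h) `<=` K -> pf k f ->
  forall x, `|x.1 - c.1| <= h -> `|x.2 - c.2| <= h ->
  let e := nrm area (K : set (plane R)) f / h in
  [/\ `|f x| <= C * e, `|pd1 f x| <= C * (e / h) & `|pd2 f x| <= C * (e / h)].
Proof.
move=> rho0.
have [|D D0 HD] := @pf_moment_bound R rtri (fun=> 1) 2^-1 (2 / rho) k (@open_rtri R) (@bounded_rtri R) _
  (@rtri_square R) (fun _ => cvg_cst _) (fun _ _ => ltr01).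
  by rewrite invr_gt0.
have q0 : 0 <= 2 / rho by rewrite divr_ge0 // ltW.
exists (D * (2 / rho) + D * (2 / rho) ^+ 2); first by rewrite addr_ge0 // mulr_ge0 // sqr_ge0.
move=> K c h f oK bK h0 dK pk x x1 x2.
pose s := rho * h / 2.
have s0 : 0 < s by rewrite /s !mulr_gt0 ?invr_gt0.
pose b : R * R := (c.1 + s, c.2); pose d : R * R := (c.1, c.2 + s).
have cr : cross c b d = s ^+ 2 by rewrite /cross /=; ring.
have Dc : cross c b d != 0 by rewrite cr expf_eq0 /= gt_eqF.
have am y : amap c b d y = (c.1 + s * y.1, c.2 + s * y.2) by rewrite /amap /=; congr (_, _); ring.
pose y : R * R := ((x.1 - c.1) / s, (x.2 - c.2) / s).
have xy : x = amap c b d y.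
  have E (u w : R) : u + s * ((w - u) / s) = w by rewrite mulrC divfK ?gt_eqF // subrKC.
  by rewrite am /y [(_, _).1]/= [(_, _).2]/= !E -surjective_pairing.
have hs : h / s = 2 / rho by rewrite /s; field; rewrite !gt_eqF.
have By : box (2 / rho) y.
  have E w : `|w| <= h -> `|w / s| <= 2 / rho.
    by move=> wh; rewrite normrM normfV (gtr0_norm s0) -hs; apply: ler_wpM2r => //; rewrite invr_ge0 ltW.
  by split => /=; rewrite in_itv /= -ler_norml; exact: E.
have oTK : otri c b d `<=` K.
  move=> _ [u [u1 u2 u12] <-]; apply: dK; rewrite /disc /= am.
  have -> : rho * h = 2 * s by rewrite /s; field.
  rewrite /eucl_dist /eucl_norm /=.
  have -> : c.1 + s * u.1 - c.1 = s * u.1 by ring.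
  have -> : c.2 + s * u.2 - c.2 = s * u.2 by ring.
  have s20 : 0 < 2 * s by rewrite mulr_gt0.
  rewrite -[ltRHS](gtr0_norm s20) -sqrtr_sqr ltr_sqrt; last exact: exprn_gt0.
  rewrite [ltLHS](_ : _ = (u.1 ^+ 2 + u.2 ^+ 2) * s ^+ 2); last ring.
  rewrite [ltRHS]exprMn (ltr_pM2r (exprn_gt0 2 s0)).
  move: u1 u2 u12; clear; move: u.1 u.2 => p q u1 u2 u12.
  by have := mulr_gt0 u1 u2; nra.
have mK := open_measurable_plane oK; have mT := measurable_otri Dc; have bT := @bounded_otri R c b d.
have cf := pf_continuous pk; have fi := sqint_continuous mK bK cf.
have fT := sqintS mK mT oTK fi.
set nf := nrm area (K : set (plane R)) f.
suff HM i j : (i + j <= k)%N ->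
    `|\int[area]_(y in (rtri : set (plane R))) (f (amap c b d y) * (1 * mono i j y))| <= nf / s.
  have [H1 H2 H3] := HD _ _ (pf_amap c b d pk) HM _ By.
  have [d1 d2] := pd_amap c b d (pf_smooth pk).
  rewrite d1 d2 -xy in H1 H2 H3.
  have bE : [/\ b.1 - c.1 = s, b.2 - c.2 = 0, d.1 - c.1 = 0 & d.2 - c.2 = s].
    by rewrite /b /d /= !subrr; split=> //; rewrite addrC addKr.
  have [b1 b2 b3 b4] := bE; rewrite b1 b2 mul0r addr0 in H2; rewrite b3 b4 mul0r add0r in H3.
  have nf0 : 0 <= nf := nrm_ge0 _ _ _.
  have := inverse_scale D0 q0 s0 h0 hs nf0.
  move=> [S1 S2]; split; first exact: le_trans H1 S1.
    apply: le_trans S2; rewrite ler_pdivlMr // mulrC -[X in X * _](gtr0_norm s0) -normrM; exact: H2.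
  apply: le_trans S2; rewrite ler_pdivlMr // mulrC -[X in X * _](gtr0_norm s0) -normrM; exact: H3.
move=> _; pose m x := @mono R i j (ref_map c b d x).
have pm : pf (i + j) m by apply: pf_ref_map; exact: pf_mono.
have cm := pf_continuous pm; have mi := sqint_continuous mT bT cm.
have H1 := cauchy_schwarz mT fT mi.
have mm : measurable_fun (otri c b d : set (plane R)) m.
  by apply: measurable_funTS; exact: continuous_measurable_plane.
have m1 u : otri c b d u -> `|m u| <= 1.
  move=> /(otriE _ Dc)[/= u1 u2 u12]; rewrite /m /mono /ref_map /= normrM !normrX !gtr0_norm //.
  by apply: mulr_ile1; [exact: exprn_ge0 (ltW u1)|exact: exprn_ge0 (ltW u2)|apply: exprn_ile1; lra|apply: exprn_ile1; lra].
have N2 := nrm_bounded mT (bounded_area_fin mT bT) mm ler01 m1.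
have /andP[_ A] := area_otri Dc.
have N3 : nrm area (otri c b d : set (plane R)) m <= s.
  apply: le_trans N2 _; rewrite mul1r -[leRHS](gtr0_norm s0) -sqrtr_sqr ler_wsqrtr //.
  by apply: le_trans A _; rewrite cr normrX gtr0_norm.
have H2 := le_trans H1 (ler_pM (nrm_ge0 _ _ _) (nrm_ge0 _ _ _) (nrmS mK mT oTK fi) N3).
have cfm : continuous (fun x => f x * m x) by apply: pf_continuous; exact: (pfM pk pm).
rewrite /ip (Rintegral_otri Dc (integrable_continuous mT bT cfm)) normrM normr_id cr normrX (gtr0_norm s0) in H2.
have I1 : \int[area]_(x in (rtri : set (plane R))) (f (amap c b d x) * m (amap c b d x)) =
  \int[area]_(x in (rtri : set (plane R))) (f (amap c b d x) * (1 * mono i j x)).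
  by apply: eq_Rintegral => u _; rewrite /m ref_map_of_amap // mul1r.
rewrite I1 -/nf in H2; set I := Rintegral _ _ _ in H2 *; clearbody I.
by rewrite ler_pdivlMr // -(ler_pM2r s0) -mulrA -expr2 mulrC.
Qed.

(** * The projections *)

Lemma sqr_sum_bound {R : realFieldType} (a b m : R) : 0 <= a -> 0 <= b -> 0 <= m ->
  a ^+ 2 + b ^+ 2 <= m * (a + b) -> a <= 2 * m /\ b <= 2 * m.
Proof.
have step (x y : R) : 0 <= x -> 0 <= m -> x ^+ 2 + y ^+ 2 <= m * (x + y) -> x <= 2 * m.
  move=> x0 m0 H; rewrite leNgt; apply/negP => H'; have x1 : 0 < x by nra.
  have P1 : 0 < (x - 2 * m) * x by rewrite mulr_gt0 // subr_gt0.
  have P2 : 0 <= m * (x - 2 * m) by rewrite mulr_ge0 // subr_ge0 ltW.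
  have P3 := sqr_ge0 (2 * y - m); have P4 := sqr_ge0 m; nra.
move=> a0 b0 m0 H; split; first exact: step H.
by apply: (step b a) => //; rewrite addrC [b + a]addrC.
Qed.

Lemma scale_mono {R : realFieldType} (C h e e' : R) : 0 <= C -> 0 < h -> e <= e' -> C * (e / h) <= C * (e' / h).
Proof. by move=> C0 h0 ee; apply: ler_wpM2l => //; apply: ler_wpM2r => //; rewrite invr_ge0 ltW. Qed.

Lemma grad_algebra {R : realFieldType} (C CL h N1 N2 M S A L : R) : 0 <= C -> 0 < h -> 0 <= N1 -> 0 <= N2 -> 0 <= M ->
  S <= CL * h -> N1 ^+ 2 + N2 ^+ 2 = A ->
  `|A + L| <= 4 * S * M * (C * ((N1 + N2) / h)) ->
  `|L| <= M * h * (C * (N1 / h / h) * (2 * h) + C * (N2 / h / h) * (2 * h)) ->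
  N1 ^+ 2 + N2 ^+ 2 <= (2 * C + 4 * CL * C) * M * (N1 + N2).
Proof.
move=> C0 h0 N10 N20 M0 SL -> HA HL.
have E1 : M * h * (C * (N1 / h / h) * (2 * h) + C * (N2 / h / h) * (2 * h)) = 2 * C * M * (N1 + N2).
  by field; rewrite gt_eqF.
have E2 : 4 * (CL * h) * M * (C * ((N1 + N2) / h)) = 4 * CL * C * M * (N1 + N2) by field; rewrite gt_eqF.
have HS : 4 * S * M * (C * ((N1 + N2) / h)) <= 4 * (CL * h) * M * (C * ((N1 + N2) / h)).
  apply: ler_wpM2r; first by rewrite mulr_ge0 // divr_ge0 ?addr_ge0 // ltW.
  by apply: ler_wpM2r => //; apply: ler_wpM2l.
rewrite E1 in HL; rewrite E2 in HS.
have := ler_norm (A + L); have := ler_norm (- L); rewrite normrN.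
move=> h1 h2; rewrite 2!mulrDl; lra.
Qed.

Lemma distl_trans {R : realFieldType} (px pc c0 e M : R) : `|px - pc| <= e -> pc - e <= c0 + M -> c0 - M <= pc + e ->
  `|px - c0| <= 2 * e + M.
Proof. by rewrite !ler_distl => /andP[e1 e2] S1 S2; apply/andP; split; lra. Qed.

Section projection_bounds.
Context {R : realType} (k : nat) (rho kap CL : R) (rho0 : 0 < rho) (kap0 : 0 < kap) (CL0 : 0 <= CL).

Lemma nrm_inverse : exists2 C : R, 0 <= C &
  forall (h : R) n (z : 'I_n -> R * R) K N (T : 'I_N -> 'I_3 -> R * R), good_mesh rho kap CL h z K T ->
  exists c : R * R, K c /\ forall f, pf k f -> forall x, `|x.1 - c.1| <= h -> `|x.2 - c.2| <= h ->
    let e := nrm area (K : set (plane R)) f / h in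
    [/\ `|f x| <= C * e, `|pd1 f x| <= C * (e / h) & `|pd2 f x| <= C * (e / h)].
Proof.
have [C C0 HC] := inverse_bound k rho0; exists C => // h n z K N T gm.
have [c [r [hr r0 dK _]]] := gm_disc gm; exists c; split.
  by apply: dK; rewrite /disc /= /eucl_dist subrr /eucl_norm /= !expr2 mulr0 addr0 sqrtr0.
move=> f pk; apply: HC => //; [exact: gm_open gm|exact: gm_bounded gm|exact: gm_h gm|].
by move=> x Bx; apply: dK; apply: lt_le_trans hr.
Qed.

Lemma closure_square (h : R) n (z : 'I_n -> R * R) K N (T : 'I_N -> 'I_3 -> R * R) c x :
  good_mesh rho kap CL h z K T -> K c -> closure K x -> `|x.1 - c.1| <= h /\ `|x.2 - c.2| <= h.
Proof.
move=> gm Kc cx; have D := gm_diam gm (subset_closure Kc) cx; have [h1 h2] := coord_le_eucl c x.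
by split; [exact: le_trans h1 D|exact: le_trans h2 D].
Qed.

Lemma boundary_closure (h : R) n (z : 'I_n -> R * R) K N (T : 'I_N -> 'I_3 -> R * R) i (t : R) :
  good_mesh rho kap CL h z K T -> 0 <= t <= 1 -> closure K (segpath (z i) (z (ordS i)) t).
Proof.
move=> gm t01; have [_ _ _ [_ _ _ B]] := gm_poly gm.
suff : (closure K `\` K) (segpath (z i) (z (ordS i)) t) by case.
by rewrite B; exists i => //; exists t => //=; rewrite in_itv.
Qed.

Lemma mesh_sqrt_area (h : R) n (z : 'I_n -> R * R) K N (T : 'I_N -> 'I_3 -> R * R) :
  good_mesh rho kap CL h z K T -> Num.sqrt (fine (area (K : set (plane R)))) <= 2 * h.
Proof.
move=> gm; have [c [r [_ r0 dK _]]] := gm_disc gm; have h0 := gm_h gm.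
have Kh x y : K x -> K y -> eucl_dist x y <= h.
  by move=> Kx Ky; apply: (gm_diam gm); exact: subset_closure.
have /andP[_ H] := area_diam_bound (gm_open gm) (gm_bounded gm) r0 dK Kh.
have h20 : 0 <= 2 * h by rewrite mulr_ge0 // ltW.
rewrite -[leRHS](ger0_norm h20) -sqrtr_sqr ler_wsqrtr //.
by apply: le_trans H _; rewrite exprMn; apply: ler_wpM2r; [exact: sqr_ge0|rewrite expr2; lra].
Qed.

Lemma pf_grad_self f (K : set (R * R)) : open K -> bounded_set K -> pf k f ->
  inner_vec K (grad f) (grad f) =
  nrm area (K : set (plane R)) (pd1 f) ^+ 2 + nrm area (K : set (plane R)) (pd2 f) ^+ 2.
Proof.
move=> oK bK pk; have mK := open_measurable_plane oK; have [p1 p2] := pf_pd pk.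
have i1 := sqint_continuous mK bK (pf_continuous p1); have i2 := sqint_continuous mK bK (pf_continuous p2).
transitivity (ip area (K : set (plane R)) (pd1 f) (pd1 f) + ip area (K : set (plane R)) (pd2 f) (pd2 f)); last first.
  by congr (_ + _); symmetry; exact: nrm_sqr.
have E := RintegralD mK (sqint_integrableM mK i1 i1) (sqint_integrableM mK i2 i2).
exact: E.
Qed.

Lemma pf_grad_ip f (K : set (R * R)) v G : open K -> bounded_set K -> pf k f -> weak_grad K v G ->
  inner_vec K G (grad f) = ip area (K : set (plane R)) (fun x => (G x).1) (pd1 f) +
    ip area (K : set (plane R)) (fun x => (G x).2) (pd2 f).
Proof.
move=> oK bK pk [_ /L2fun_sqint g1 /L2fun_sqint g2 _].
have mK := open_measurable_plane oK; have [p1 p2] := pf_pd pk.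
have i1 := sqint_continuous mK bK (pf_continuous p1); have i2 := sqint_continuous mK bK (pf_continuous p2).
have E := RintegralD mK (sqint_integrableM mK g1 i1) (sqint_integrableM mK g2 i2).
exact: E.
Qed.

(** In the projection identity tested with [p], the weak gradient may be replaced by [G0], since the
    gradient of [p] is smooth. Cauchy-Schwarz leaves $a^2 + b^2 \le M (a + b)$ for the norms of the
    two components. *)
Lemma proj_grad_m1 (h : R) n (z : 'I_n -> R * R) K N (T : 'I_N -> 'I_3 -> R * R) v p G G0 M :
  good_mesh rho kap CL h z K T -> weak_grad K v G -> weak_grad K v G0 -> pf k p ->
  inner_vec K (grad p) (grad p) = inner_vec K G (grad p) ->
  nrm area (K : set (plane R)) (fun x => (G0 x).1) <= M ->
  nrm area (K : set (plane R)) (fun x => (G0 x).2) <= M ->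
  nrm area (K : set (plane R)) (pd1 p) <= 2 * M /\ nrm area (K : set (plane R)) (pd2 p) <= 2 * M.
Proof.
move=> gm wG wG0 pk E H1 H2; have oK := gm_open gm; have bK := gm_bounded gm.
have mK := open_measurable_plane oK; have [p1 p2] := pf_pd pk.
have i1 := sqint_continuous mK bK (pf_continuous p1); have i2 := sqint_continuous mK bK (pf_continuous p2).
rewrite (pf_grad_self oK bK pk) (pf_grad_ip oK bK pk wG) in E.
rewrite (weak_grad_smooth gm wG wG0 (pf_smooth p1)).1 (weak_grad_smooth gm wG wG0 (pf_smooth p2)).2 in E.
have [_ /L2fun_sqint g1 /L2fun_sqint g2 _] := wG0.
apply: sqr_sum_bound; [exact: nrm_ge0|exact: nrm_ge0|exact: le_trans (nrm_ge0 _ _ _) H1|].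
rewrite E mulrDr; apply: le_trans (ler_norm _) _; apply: le_trans (ler_normD _ _) _.
by apply: lerD; [apply: le_trans (cauchy_schwarz mK g1 i1) _|apply: le_trans (cauchy_schwarz mK g2 i2) _];
  apply: ler_wpM2r => //; exact: nrm_ge0.
Qed.

(** [|grad p|^2 = (G, grad p)] is integrated by parts, so that only [v] and its boundary values [g] enter. *)
Lemma proj_grad_m0 : exists2 C : R, 0 <= C &
  forall (h : R) n (z : 'I_n -> R * R) K N (T : 'I_N -> 'I_3 -> R * R) v p g G G' phi M,
  good_mesh rho kap CL h z K T -> h1approx K v G phi -> (forall i, approx_edge phi g (z i) (z (ordS i))) ->
  weak_grad K v G' -> pf k p ->
  inner_vec K (grad p) (grad p) = inner_vec K G' (grad p) ->
  nrm area (K : set (plane R)) v <= M * h ->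
  (forall i t, 0 <= t <= 1 -> `|g (segpath (z i) (z (ordS i)) t)| <= M) ->
  nrm area (K : set (plane R)) (pd1 p) <= C * M /\ nrm area (K : set (plane R)) (pd2 p) <= C * M.
Proof.
have [C C0 HC] := nrm_inverse.
have CC0 : 0 <= 2 * C + 4 * CL * C by rewrite addr_ge0 // !mulr_ge0.
exists (2 * (2 * C + 4 * CL * C)); first by rewrite mulr_ge0.
move=> h n z K N T v p g G G' phi M gm hA aE wG' pk E Hv Hg.
have oK := gm_open gm; have bK := gm_bounded gm; have h0 := gm_h gm.
have [c [Kc Hc]] := HC h n z K N T gm.
have mK := open_measurable_plane oK; have [p1 p2] := pf_pd pk.
have [wG _ _ _ _] := hA; have [/L2fun_sqint vi _ _ _] := wG.
have M0 : 0 <= M by rewrite -(pmulr_lge0 _ h0); apply: le_trans Hv; exact: nrm_ge0.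
rewrite (pf_grad_self oK bK pk) (pf_grad_ip oK bK pk wG') in E.
rewrite (weak_grad_smooth gm wG' wG (pf_smooth p1)).1 (weak_grad_smooth gm wG' wG (pf_smooth p2)).2 in E.
set N1 := nrm area (K : set (plane R)) (pd1 p) in E *.
set N2 := nrm area (K : set (plane R)) (pd2 p) in E *.
have N10 : 0 <= N1 by exact: nrm_ge0.
have N20 : 0 <= N2 by exact: nrm_ge0.
have L1 : N1 <= N1 + N2 by rewrite lerDl; exact: N20.
have L2 : N2 <= N1 + N2 by rewrite lerDr; exact: N10.
have N0 : 0 <= N1 + N2 := addr_ge0 N10 N20.
have cl i t : 0 <= t <= 1 -> closure K (segpath (z i) (z (ordS i)) t) by exact: boundary_closure gm.
have B1 x : closure K x -> `|pd1 p x| <= C * ((N1 + N2) / h).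
  move=> cx; have [x1 x2] := closure_square gm Kc cx; have [H _ _] := Hc _ p1 _ x1 x2.
  exact: le_trans H (scale_mono C0 h0 L1).
have B2 x : closure K x -> `|pd2 p x| <= C * ((N1 + N2) / h).
  move=> cx; have [x1 x2] := closure_square gm Kc cx; have [H _ _] := Hc _ p2 _ x1 x2.
  exact: le_trans H (scale_mono C0 h0 L2).
have h0' := ltW h0; have Q0 : 0 <= C * ((N1 + N2) / h) := mulr_ge0 C0 (divr_ge0 N0 h0').
(* The boundary term costs the perimeter, at most [CL * h], times [M], times the supremum of the
   gradient of [p], which is of order [(N1 + N2) / h]. The powers of [h] cancel. *)
have BG := boundary_green_trace oK bK (gm_clos gm) hA aE (pf_smooth p1) (pf_smooth p2) M0 Hg Q0
  (fun i t t01 => B1 _ (cl i t t01)) (fun i t t01 => B2 _ (cl i t t01)).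
have [p11 _] := pf_pd p1; have [_ p22] := pf_pd p2.
have pn (f : R * R -> R) e : pf k f -> 0 <= e -> (forall x, K x -> `|f x| <= e) ->
    nrm area (K : set (plane R)) f <= e * (2 * h).
  move=> pf' e0 fe.
  have mf : measurable_fun (K : set (plane R)) f.
    by apply: measurable_funTS; apply: continuous_measurable_plane; exact: pf_continuous pf'.
  apply: le_trans (nrm_bounded mK (bounded_area_fin mK bK) mf e0 fe) _.
  by apply: ler_wpM2l e0 _ _ _; exact: mesh_sqrt_area gm.
have n1 : nrm area (K : set (plane R)) (pd1 (pd1 p)) <= C * (N1 / h / h) * (2 * h).
  apply: (pn _ _ p11); first exact: (mulr_ge0 C0 (divr_ge0 (divr_ge0 N10 h0') h0')).
  move=> x Kx; have [x1 x2] := closure_square gm Kc (subset_closure Kx).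
  by have [_ H _] := Hc _ p1 _ x1 x2; exact: H.
have n2 : nrm area (K : set (plane R)) (pd2 (pd2 p)) <= C * (N2 / h / h) * (2 * h).
  apply: (pn _ _ p22); first exact: (mulr_ge0 C0 (divr_ge0 (divr_ge0 N20 h0') h0')).
  move=> x Kx; have [x1 x2] := closure_square gm Kc (subset_closure Kx).
  by have [_ _ H] := Hc _ p2 _ x1 x2; exact: H.
have i1 := sqint_continuous mK bK (pf_continuous p11).
have i2 := sqint_continuous mK bK (pf_continuous p22).
have CS := cauchy_schwarz mK vi (sqintD mK i1 i2).
have CS' := le_trans CS (ler_pM (nrm_ge0 _ _ _) (nrm_ge0 _ _ _) Hv (le_trans (nrmD mK i1 i2) (lerD n1 n2))).
rewrite -mulrA; apply: (sqr_sum_bound N10 N20 (mulr_ge0 CC0 M0)); exact: (grad_algebra C0 h0 N10 N20 M0 (gm_len gm) E BG CS').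
Qed.

(** The mean value theorem on the segment from the centre [c] to [x]. The inverse estimate holds on
    the whole square of half-side [h] around [c], which contains this segment. *)
Lemma pf_near_centre : exists2 C : R, 0 <= C &
  forall (h : R) n (z : 'I_n -> R * R) K N (T : 'I_N -> 'I_3 -> R * R), good_mesh rho kap CL h z K T ->
  exists c : R * R, K c /\ forall p M, pf k p ->
    nrm area (K : set (plane R)) (pd1 p) <= M -> nrm area (K : set (plane R)) (pd2 p) <= M ->
    forall x, closure K x -> `|p x - p c| <= C * M.
Proof.
have [C C0 HC] := nrm_inverse.
exists (2 * C); first by rewrite mulr_ge0.
move=> h n z K N T gm; have [c [Kc Hc]] := HC h n z K N T gm.
exists c; split => // p M pk H1 H2 x cx.
have [x1 x2] := closure_square gm Kc cx; have [p1 p2] := pf_pd pk; have h0 := gm_h gm.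
have D (s : R) := is_derive_amap1 c x c s 0 (pf_smooth pk).
have [y] := @MVT_near R _ _ 0 1 D.
rewrite subr0 normr1 add0r mul1r => y1.
have -> : amap c x c (1, 0) = x by rewrite /amap /= [RHS]surjective_pairing; congr (_, _); ring.
have -> : amap c x c (0, 0) = c by rewrite /amap /= [RHS]surjective_pairing; congr (_, _); ring.
move=> ->; set u := amap c x c (y, 0).
have u1 : `|u.1 - c.1| <= h.
  have -> : u.1 - c.1 = y * (x.1 - c.1) by rewrite /u /amap /=; ring.
  by rewrite normrM -[h]mul1r; apply: ler_pM.
have u2 : `|u.2 - c.2| <= h.
  have -> : u.2 - c.2 = y * (x.2 - c.2) by rewrite /u /amap /=; ring.
  by rewrite normrM -[h]mul1r; apply: ler_pM.
have [B1 _ _] := Hc _ p1 _ u1 u2; have [B2 _ _] := Hc _ p2 _ u1 u2.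
have B1' := le_trans B1 (scale_mono C0 h0 H1); have B2' := le_trans B2 (scale_mono C0 h0 H2).
apply: le_trans (ler_normD _ _) _; rewrite !normrM.
apply: le_trans (lerD (ler_pM (normr_ge0 _) (normr_ge0 _) x1 B1') (ler_pM (normr_ge0 _) (normr_ge0 _) x2 B2')) _.
by rewrite le_eqVlt; apply/orP; left; apply/eqP; field; rewrite gt_eqF.
Qed.

(** [p] and [g] have the same boundary integral: the projection uses another trace [g'], whose edge
    integrals agree with those of [g] by [trace_line_int]. As [p] stays within [C * M] of its value
    at the centre and [g] within [M] of [c0], these two constants differ by at most [C * M + M]. *)
Lemma proj_bound : exists2 C : R, 0 <= C &
  forall (h : R) n (z : 'I_n -> R * R) K N (T : 'I_N -> 'I_3 -> R * R) v p g g' G G' phi phi' c0 M,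
  good_mesh rho kap CL h z K T ->
  h1approx K v G phi -> (forall i, approx_edge phi g (z i) (z (ordS i))) ->
  h1approx K v G' phi' -> (forall i, approx_edge phi' g' (z i) (z (ordS i))) ->
  pf k p -> polyline_int z p = polyline_int z g' ->
  nrm area (K : set (plane R)) (pd1 p) <= M -> nrm area (K : set (plane R)) (pd2 p) <= M ->
  (forall i t, 0 <= t <= 1 -> `|g (segpath (z i) (z (ordS i)) t) - c0| <= M) ->
  forall x, closure K x -> `|p x - c0| <= C * M.
Proof.
have [C C0 HC] := pf_near_centre.
exists (2 * C + 1); first by rewrite addr_ge0 // mulr_ge0.
move=> h n z K N T v p g g' G G' phi phi' c0 M gm hA aE hA' aE' pk E H1 H2 Hg x cx.
have [c [Kc Hc]] := HC h n z K N T gm.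
have Hp := Hc p M pk H1 H2.
have E2 : \sum_(i < n) eucl_dist (z i) (z (ordS i)) *
    \int[@lebesgue_measure R]_(t in unit_itv) p (segpath (z i) (z (ordS i)) t) =
  \sum_(i < n) eucl_dist (z i) (z (ordS i)) *
    \int[@lebesgue_measure R]_(t in unit_itv) g (segpath (z i) (z (ordS i)) t).
  transitivity (polyline_int z p); first by [].
  rewrite E; apply: eq_bigr => i _; exact: (trace_line_int gm kap0 i hA' aE' hA aE).
have cl i t : 0 <= t <= 1 -> closure K (segpath (z i) (z (ordS i)) t) by exact: boundary_closure gm.
have mU := @measurable_unit R; have fU := @unit_fin R.
have dev (f : R -> R) (k0 e : R) : (@lebesgue_measure R).-integrable unit_itv (EFin \o f) ->
    (forall t, 0 <= t <= 1 -> `|f t - k0| <= e) ->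
    k0 - e <= \int[@lebesgue_measure R]_(t in unit_itv) f t <= k0 + e.
  move=> fi fe; have ci (w : R) : (@lebesgue_measure R).-integrable unit_itv (EFin \o (fun=> w)).
    by apply: unit_integrable => ?; exact: cvg_cst.
  have fb t : unit_itv t -> k0 - e <= f t <= k0 + e.
    by rewrite /unit_itv /= in_itv /= => t01; rewrite -ler_distl; exact: fe.
  rewrite -[X in X <= _ <= _]Rintegral_unit_cst -[X in _ <= _ <= X]Rintegral_unit_cst.
  by apply/andP; split; apply: le_Rintegral => // t /fb /andP[].
have pi i : (@lebesgue_measure R).-integrable unit_itv (EFin \o (fun t => p (segpath (z i) (z (ordS i)) t))).
  apply: unit_integrable => t; apply: (@continuous_comp _ _ _ (segpath (z i) (z (ordS i))) p); first exact: continuous_segpath.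
  exact: pf_continuous pk _.
have gi i : (@lebesgue_measure R).-integrable unit_itv (EFin \o (fun t => g (segpath (z i) (z (ordS i)) t))).
  have [si _] := aE i; have s1 : sqint (@lebesgue_measure R) unit_itv (fun=> 1).
    by apply: sqint_unit_continuous => ?; exact: cvg_cst.
  have := sqint_integrableM mU si s1; apply: eq_integrable => // t _ /=; by rewrite mulr1.
have Dp i := dev _ (p c) (C * M) (pi i) (fun t t01 => Hp _ (cl i t t01)).
have Dg i := dev _ c0 M (gi i) (Hg i).
have [m3 _ _ _] := gm_poly gm; have n0 : (0 < n)%N by apply: leq_trans m3.
have d0 i : 0 < eucl_dist (z i) (z (ordS i)).
  have [c1 [r [hr r0 _ _]]] := gm_disc gm; apply: lt_le_trans (gm_edge gm i); exact: mulr_gt0 rho0 (gm_h gm).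
set L := \sum_(i < n) eucl_dist (z i) (z (ordS i)).
have L0 : 0 < L.
  rewrite /L (bigD1 (Ordinal n0)) //=; apply: ltr_wpDr (d0 _); apply: sumr_ge0 => i _; exact: ltW (d0 i).
have S1 : L * (p c - C * M) <= L * (c0 + M).
  have le1 : L * (p c - C * M) <= \sum_(i < n) eucl_dist (z i) (z (ordS i)) *
    \int[@lebesgue_measure R]_(t in unit_itv) p (segpath (z i) (z (ordS i)) t).
    rewrite /L mulr_suml; apply: ler_sum => i _; apply: ler_wpM2l (ltW (d0 i)) _ _ _.
    by have /andP[] := Dp i.
  apply: le_trans le1 _; rewrite E2 /L mulr_suml; apply: ler_sum => i _; apply: ler_wpM2l (ltW (d0 i)) _ _ _.
  by have /andP[] := Dg i.
have S2 : L * (c0 - M) <= L * (p c + C * M).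
  have le1 : L * (c0 - M) <= \sum_(i < n) eucl_dist (z i) (z (ordS i)) *
    \int[@lebesgue_measure R]_(t in unit_itv) g (segpath (z i) (z (ordS i)) t).
    rewrite /L mulr_suml; apply: ler_sum => i _; apply: ler_wpM2l (ltW (d0 i)) _ _ _.
    by have /andP[] := Dg i.
  apply: le_trans le1 _; rewrite -E2 /L mulr_suml; apply: ler_sum => i _; apply: ler_wpM2l (ltW (d0 i)) _ _ _.
  by have /andP[] := Dp i.
rewrite (ler_pM2l L0) in S1; rewrite (ler_pM2l L0) in S2.
have -> : (2 * C + 1) * M = 2 * (C * M) + M by rewrite mulrDl mul1r mulrA.
exact: (distl_trans (Hp _ cx) S1 S2).
Qed.

End projection_bounds.

(** * Bounds on one triangle *)

Lemma hpolyfun_pf {R : realType} (c : R * R) (m : int) k (f : R * R -> R) : m <= k%:Z -> hpolyfun c m f -> pf k f.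
Proof.
move=> mk [p [Hp Ef]].
have pk : pf k (fun x : R * R => p.[x.1, x.2]).
  by apply/polyfun_pf; exists p; split=> // i j /Hp ->.
have := pf_amap ((- c.1, - c.2) : R * R) ((1 - c.1, - c.2) : R * R) ((- c.1, 1 - c.2) : R * R) pk.
congr pf; apply/funext => x; rewrite Ef /amap /=.
by congr (_.[_, _]); ring.
Qed.

Section triangle_facts.
Context {R : realType} (t : 'I_3 -> R * R) (tn : noncollinear t).

Lemma smooth_bary a : smooth (bary_coord t a).
Proof.
have -> : bary_coord t a = lam1 (t a) (t (ordS a)) (t (ordS (ordS a))).
  by apply/funext => x; have [] := bary_lam tn a x.
by apply: affine_smooth; exact: affine_lam1.
Qed.

Lemma bubble_amap x : bubble t (amap (t ord0) (t (ordS ord0)) (t (ordS (ordS ord0))) x) = rbub x.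
Proof.
have D := cross_neq0 tn ord0.
have [e1 e2 e3] := bary_lam tn ord0 (amap (t ord0) (t (ordS ord0)) (t (ordS (ordS ord0))) x).
have i1 : lift ord0 ord0 = ordS ord0 :> 'I_3 by exact: val_inj.
have i2 : lift ord0 (lift ord0 ord0) = ordS (ordS ord0) :> 'I_3 by exact: val_inj.
rewrite /bubble !big_ord_recl big_ord0 i2 i1 e1 e2 e3 /lam1 lam2_amap // lam3_amap // /rbub; ring.
Qed.

Lemma amap_refv a : amap (t ord0) (t (ordS ord0)) (t (ordS (ordS ord0))) (refv a) = t a.
Proof.
rewrite [RHS]surjective_pairing /amap /refv.
have [->|->|->] := ord3P ord0 a => /=.
- by congr (_, _); ring.
- by congr (_, _); ring.
- by congr (_, _); ring.
Qed.

Lemma amap_segpath (a b c x y : R * R) s : amap a b c (segpath x y s) = segpath (amap a b c x) (amap a b c y) s.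
Proof.
have E (u v : R * R) : segpath u v s = (u.1 + s * (v.1 - u.1), u.2 + s * (v.2 - u.2)) by [].
by rewrite !E /amap /=; congr (_, _); ring.
Qed.

Lemma measurable_triangle : measurable (triangle t : set (plane R)).
Proof.
have -> : triangle t = \big[setI/setT]_(a : 'I_3) [set x | 0 <= bary_coord t a x].
  apply/seteqP; split => x; first by move=> /(triangle_bary tn) H; rewrite -bigcap_seq => a _; exact: H.
  by rewrite -bigcap_seq => H; apply/(triangle_bary tn) => a; apply: H; rewrite /= mem_index_enum.
apply: bigsetI_measurable => a _; rewrite -[X in measurable X]setTI.
rewrite [X in _ `&` X](_ : _ = bary_coord t a @^-1` `[0, +oo[); last first.
  by apply/seteqP; split => x /=; rewrite in_itv /= andbT.
by apply: (continuous_measurable_plane (smooth_continuous (smooth_bary a))) => //; exact: measurable_itv.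
Qed.

Lemma bounded_triangle : bounded_set (triangle t).
Proof.
apply: (@bounded_subset _ _ (box (\sum_a (`|(t a).1| + `|(t a).2|)))); last exact: box_bounded.
move=> x [l [l0 l1 ->]].
have ll a : l a <= 1 by rewrite -l1 (bigD1 a) //= lerDl sumr_ge0.
have c1 : (\sum_i l i *: t i).1 = \sum_i l i * (t i).1 by rewrite !(sum_ord3 _ ord0).
have c2 : (\sum_i l i *: t i).2 = \sum_i l i * (t i).2 by rewrite !(sum_ord3 _ ord0).
split; rewrite /= in_itv /= -ler_norml ?c1 ?c2; apply: le_trans (ler_norm_sum _ _ _) _; apply: ler_sum => i _;
  rewrite normrM (ger0_norm (l0 i)).
  apply: le_trans (ler_wpM2r (normr_ge0 _) (ll i)) _; rewrite mul1r lerDl; exact: normr_ge0.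
apply: le_trans (ler_wpM2r (normr_ge0 _) (ll i)) _; rewrite mul1r lerDr; exact: normr_ge0.
Qed.

Lemma Rintegral_triangle (f : R * R -> R) : continuous f ->
  \int[area]_(x in (triangle t : set (plane R))) f x = \int[area]_(x in (tri_int t : set (plane R))) f x.
Proof.
move=> cf; have mT := measurable_triangle; have bT := bounded_triangle.
have mI : measurable (tri_int t : set (plane R)) := measurable_otri (cross_neq0 tn ord0).
have fi := integrable_continuous mT bT cf.
have fo := integrable_continuous mI (@bounded_otri R _ _ _) cf.
pose Z : set (plane R) := \big[setU/set0]_(a : 'I_3) [set x | bary_coord t a x = 0].
have mZ : measurable Z by apply: bigsetU_measurable => a _; have [] := area_tri_lines a tn.
have Z0 : area Z = 0%E.
  rewrite /Z; elim: (index_enum _) => [|a r IH]; first by rewrite big_nil measure0.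
  rewrite big_cons; have [m1 z1] := area_tri_lines a tn.
  have mr : measurable (\big[setU/set0]_(j <- r) [set x | bary_coord t j x = 0] : set (plane R)).
    by apply: bigsetU_measurable => j _; have [] := area_tri_lines j tn.
  apply/eqP; rewrite eq_le measure_ge0 andbT; apply: le_trans (measureU2 _ m1 mr) _.
  have h1 : (area ([set x | bary_coord t a x = 0%R] : set (plane R)) <= 0)%E by rewrite z1.
  have h2 : (area (\big[setU/set0]_(j <- r) [set x | bary_coord t j x = 0%R] : set (plane R)) <= 0)%E by rewrite IH.
  by have := leeD h1 h2; rewrite adde0.
rewrite /Rintegral (negligible_integral mZ mT fi Z0) (negligible_integral mZ mI fo Z0).
congr (fine (integral _ _ _)); apply/seteqP; split => x [H nL]; split => //.
  apply/(tri_int_bary tn) => a; have /(triangle_bary tn)/(_ a) := H; rewrite le_eqVlt => /orP[/eqP E|//].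
  by case: nL; rewrite /Z -bigcup_seq; exists a => //; rewrite /= mem_index_enum.
by apply/(triangle_bary tn) => a; have /(tri_int_bary tn)/(_ a) := H; exact: ltW.
Qed.

Lemma triangle_vertex a : triangle t (t a).
Proof. by apply/(triangle_bary tn) => b; rewrite (bary_vertex tn); case: eqP. Qed.

Lemma triangle_segpath a s : 0 <= s <= 1 -> triangle t (segpath (t a) (t (ordS a)) s).
Proof.
move=> /andP[s0 s1]; apply/(triangle_bary tn) => b.
rewrite (bary_segpath t) !(bary_vertex tn) addr_ge0 // mulr_ge0 // ?subr_ge0 //; by case: eqP.
Qed.

Lemma diam_triangle_gt0 : 0 < diam (triangle t).
Proof.
have H : t ord0 != t (ordS ord0).
  apply/eqP => E; have := bary_vertex tn ord0 ord0; rewrite eqxx E (bary_vertex tn) eq_sym ordS_neq => /eqP.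
  by rewrite eq_sym oner_eq0.
exact: lt_le_trans (eucl_dist_gt0 H) (diam_bound bounded_triangle (triangle_vertex ord0) (triangle_vertex (ordS ord0))).
Qed.

(** The scaled monomials span the polynomials of degree at most [k]. *)
Lemma moments_span k (u : R * R -> R) : continuous u ->
  (forall l m, (l + m <= k)%N -> inner (triangle t) u (scaled_monomial (triangle t) l m) = 0) ->
  forall f, pf k f -> ip area (tri_int t : set (plane R)) u f = 0.
Proof.
move=> cu H f pk; have d0 := diam_triangle_gt0; set d := diam (triangle t) in d0 H.
set b := barycenter (triangle t) in H.
(* [inv] is the centring and scaling inside the scaled monomials and [aff] undoes it. Since [f]
   composed with [aff] is a polynomial of degree at most [k], [f] itself is a combination of scaled
   monomials. *)
pose aff := amap b (b.1 + d, b.2) (b.1, b.2 + d).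
have affE x : aff x = (b.1 + d * x.1, b.2 + d * x.2) by rewrite /aff /amap /=; congr (_, _); ring.
pose inv (x : R * R) : R * R := ((x.1 - b.1) / d, (x.2 - b.2) / d).
have invK x : aff (inv x) = x.
  have E (v w : R) : v + d * ((w - v) / d) = w by rewrite mulrC divfK ?gt_eqF // subrKC.
  by rewrite affE /inv [(_, _).1]/= [(_, _).2]/= !E -surjective_pairing.
have cinv : continuous inv.
  by apply: continuous_pair => x; apply: cvgM; [apply: cvgB; [exact: continuous_fst_plane|exact: cvg_cst]|exact: cvg_cst
   |apply: cvgB; [exact: continuous_snd_plane|exact: cvg_cst]|exact: cvg_cst].
have mI : measurable (tri_int t : set (plane R)) := measurable_otri (cross_neq0 tn ord0).
have bI := @bounded_otri R (t ord0) (t (ordS ord0)) (t (ordS (ordS ord0))).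
have ui := sqint_continuous mI bI cu.
pose Q (f' : R * R -> R) := continuous f' /\ ip area (tri_int t : set (plane R)) u (fun x => f' (inv x)) = 0.
suff [_ E] : Q (fun x => f (aff x)).
  by rewrite -[RHS]E; congr ip; apply/funext => x; rewrite invK.
have ci (f' : R * R -> R) : continuous f' -> continuous (fun x => f' (inv x)).
  by move=> cf' x; apply: (@continuous_comp _ _ _ inv f'); [exact: cinv|exact: cf'].
have si (f' : R * R -> R) : continuous f' -> sqint area (tri_int t : set (plane R)) (fun x => f' (inv x)).
  by move=> cf'; exact: (sqint_continuous mI bI (ci _ cf')).
apply: (@pf_ind _ k Q _ _ _ _ _ (pf_amap b (b.1 + d, b.2) (b.1, b.2 + d) pk)).
- split; first by move=> ?; exact: cvg_cst.
  by rewrite /ip /Rintegral; under eq_integral do rewrite mulr0; rewrite integral0.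
- move=> f1 f2 [c1 e1] [c2 e2]; split; first by move=> x; apply: cvgD; [exact: c1|exact: c2].
  by rewrite (ipDr mI (si _ c1) (si _ c2) ui) e1 e2 addr0.
- move=> a f1 [c1 e1]; split; first by move=> x; apply: cvgM; [exact: cvg_cst|exact: c1].
  by rewrite ipC (ipZl a mI (si _ c1) ui) ipC e1 mulr0.
- move=> i j ij; have cm := smooth_continuous (@smooth_mono R i j); split => //.
  have cp : continuous (fun x => u x * mono i j (inv x)) by move=> x; apply: cvgM; [exact: cu|exact: ci].
  by rewrite /ip -(Rintegral_triangle cp); exact: (H i j ij).
Qed.

End triangle_facts.

(** [W] is [w - c0] on the reference triangle; constants belong to [P_k], so the subtraction only
    changes the polynomial part. Of the two factors [A], one comes from the interior moments and the
    other absorbs the factor [2 / kap] of the chain rule in the gradient bounds. *)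
Lemma local_bound {R : realType} k (kap : R) : 0 < kap -> exists2 C : R, 0 <= C &
  forall (t : 'I_3 -> R * R) (h c0 M : R) (w q : R * R -> R),
  noncollinear t -> tri_shape kap h (t ord0) (t (ordS ord0)) (t (ordS (ordS ord0))) ->
  local_space t k w -> pf k q -> 0 <= M ->
  (forall a, `|w (t a) - c0| <= M) ->
  (forall a l, (l + 2 <= k)%N ->
    `|\int[@lebesgue_measure R]_(s in unit_itv)
      ((w (segpath (t a) (t (ordS a)) s) - c0) * (s - 2^-1) ^+ l)| <= M) ->
  (forall l m, (l + m <= k)%N ->
    inner (triangle t) (fun x => w x - q x) (scaled_monomial (triangle t) l m) = 0) ->
  nrm area (tri_int t : set (plane R)) (fun x => q x - c0) <= M * h ->
  exists F, [/\ smooth F, forall x, triangle t x -> w x = F x &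
    forall x, triangle t x -> [/\ `|F x - c0| <= C * M, `|pd1 F x| <= C * (M / h) & `|pd2 F x| <= C * (M / h)]].
Proof.
move=> kap0; have [D D0 HD] := @macro_bound R k 1.
pose A := 1 + 2 / kap.
have A0 : 0 <= A by rewrite addr_ge0 // divr_ge0 // ltW.
exists (D * A * A); first by rewrite !mulr_ge0.
move=> t h c0 M w q tn sh [p [q0 [q1 [q2 [pp hq0 hq1 hq2 wE]]]]] pq M0 HV HE HM Hq.
have Dc := shape_cross sh; have h0 := sh_h sh.
have pp' : pf k p by apply/polyfun_pf.
have pq0 : pf k q0 by apply: hpolyfun_pf hq0; rewrite gerBl.
have pq1 : pf k q1 by apply: hpolyfun_pf hq1; rewrite gerBl.
have pq2 : pf k q2 by exact: hpolyfun_pf hq2.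
have pQ := pfD (pfD pq0 pq1) pq2.
set a0 := t ord0 in Dc sh *; set b0 := t (ordS ord0) in Dc sh *; set e0 := t (ordS (ordS ord0)) in Dc sh *.
pose ph x := p (amap a0 b0 e0 x) - c0.
pose qh x := q0 (amap a0 b0 e0 x) + q1 (amap a0 b0 e0 x) + q2 (amap a0 b0 e0 x).
have pph : pf k ph by apply: (pfD (pf_amap a0 b0 e0 pp')); exact: pf_cst.
have pqh : pf k qh by exact: (pf_amap a0 b0 e0 pQ).
pose W x := ph x + rbub x * qh x.
have pW : pf (3 + k) W by apply: pfD; [exact: (pfW (leq_addl _ _) pph)|exact: (pfM (@pf_rbub R) pqh)].
pose F x := W (ref_map a0 b0 e0 x) + c0.
have pF : pf (3 + k) F by apply: (pfD (pf_ref_map a0 b0 e0 pW)); exact: pf_cst.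
have wF x : triangle t x -> w x = F x.
  move=> Tx; rewrite wE // /F /W /ph /qh /ref_map amap_lam // -{2 4 6}(amap_lam x Dc) (bubble_amap tn); ring.
have FA x : F (amap a0 b0 e0 x) - c0 = W x by rewrite /F ref_map_of_amap // addrK.
exists F; split; [exact: pf_smooth pF|exact: wF|].
have BM x : box 1 x -> [/\ `|W x| <= D * (A * M), `|pd1 W x| <= D * (A * M) & `|pd2 W x| <= D * (A * M)].
  have MA : M <= A * M by rewrite mulrDl mul1r lerDl mulr_ge0 // divr_ge0 // ltW.
  apply: HD => //.
  - move=> a; rewrite -/(W (refv a)) -FA amap_refv -wF; last exact: triangle_vertex.
    exact: le_trans (HV a) MA.
  - move=> a l lk; apply: le_trans MA; apply: le_trans (HE a l lk).
    rewrite le_eqVlt; apply/orP; left; apply/eqP; congr (`| _ |); apply: eq_Rintegral => s.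
    rewrite inE /unit_itv /= in_itv /= => s01.
    rewrite wF; last exact: triangle_segpath.
    by rewrite -(amap_refv t a) -(amap_refv t (ordS a)) -amap_segpath FA.
  - move=> i j ij; pose m x := @mono R i j (ref_map a0 b0 e0 x).
    have pm : pf (i + j) m by apply: pf_ref_map; exact: pf_mono.
    have mI := measurable_otri Dc; have bI := @bounded_otri R a0 b0 e0.
    have mi := sqint_continuous mI bI (pf_continuous pm).
    have cFq : continuous (fun x => F x - q x).
      by move=> y; apply: cvgB; [exact: (pf_continuous pF)|exact: (pf_continuous pq)].
    have cqc : continuous (fun x => q x - c0).
      by move=> y; apply: cvgB; [exact: (pf_continuous pq)|exact: cvg_cst].
    (* Against polynomials of degree at most [k], [F] may be replaced by [q]. The moment is then at
       most [M * h], times the norm [2 * h] of the monomial, over the Jacobian [kap * h ^+ 2]: this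
       is the term [2 / kap] of [A]. *)
    have O : ip area (otri a0 b0 e0 : set (plane R)) (fun x => F x - q x) m = 0.
      apply: (moments_span tn cFq _ (pfW ij pm)) => l n ln; rewrite -[RHS](HM l n ln).
      by apply: eq_Rintegral => y; rewrite inE => Tx; rewrite wF.
    have E1 := ipDl mI (sqint_continuous mI bI cFq) (sqint_continuous mI bI cqc) mi.
    rewrite O add0r in E1.
    have CS := cauchy_schwarz mI (sqint_continuous mI bI cqc) mi.
    rewrite -E1 in CS.
    have m1 u : otri a0 b0 e0 u -> `|m u| <= 1.
      move=> /(otriE _ Dc)[/= u1 u2 u12]; rewrite /m /mono /ref_map /= normrM !normrX !gtr0_norm //.
      by apply: mulr_ile1; [exact: exprn_ge0 (ltW u1)|exact: exprn_ge0 (ltW u2)|apply: exprn_ile1; lra|apply: exprn_ile1; lra].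
    have mm : measurable_fun (otri a0 b0 e0 : set (plane R)) m.
      by apply: measurable_funTS; apply: continuous_measurable_plane; exact: pf_continuous pm.
    have N2 := nrm_bounded mI (bounded_area_fin mI bI) mm ler01 m1.
    have N3 := le_trans N2 (ler_wpM2l ler01 (shape_sqrt_area sh)).
    have CS' := le_trans CS (ler_pM (nrm_ge0 _ _ _) (nrm_ge0 _ _ _) Hq N3).
    have cW : continuous (fun x => (F x - q x + (q x - c0)) * m x).
      move=> y; apply: cvgM; last exact: (pf_continuous pm).
      by apply: cvgD; [exact: cFq|exact: cqc].
    rewrite /ip (Rintegral_otri Dc (integrable_continuous mI bI cW)) normrM normr_id in CS'.
    have I1 : \int[area]_(x in (rtri : set (plane R))) ((F (amap a0 b0 e0 x) - q (amap a0 b0 e0 x) +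
        (q (amap a0 b0 e0 x) - c0)) * m (amap a0 b0 e0 x)) =
      \int[area]_(x in (rtri : set (plane R))) ((ph x + rbub x * qh x) * mono i j x).
      by apply: eq_Rintegral => y _; rewrite addrA subrK FA /m ref_map_of_amap.
    rewrite I1 in CS'; set I := Rintegral _ _ _ in CS' *; clearbody I.
    apply: (@le_trans _ _ (2 / kap * M)); last by rewrite [A * M]mulrDl mul1r lerDr.
    have H1 := le_trans (ler_wpM2r (normr_ge0 I) (sh_cross sh)) CS'.
    rewrite mulrC in H1; rewrite -ler_pdivlMr in H1; last by rewrite mulr_gt0 // exprn_gt0.
    apply: le_trans H1 _; rewrite le_eqVlt; apply/orP; left; apply/eqP; field; rewrite !gt_eqF //.
move=> x /(triangle_bary tn) Tx.
have Bx : box 1 (ref_map a0 b0 e0 x).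
  have := Tx ord0; have := Tx (ordS ord0); have := Tx (ordS (ordS ord0)).
  have [-> -> ->] := bary_lam tn ord0 x; rewrite /lam1 -/a0 -/b0 -/e0 => x3 x2 x1.
  by split; rewrite /ref_map /= in_itv /=; apply/andP; split; lra.
have [W0 W1 W2] := BM _ Bx; have [g1 g2 g3 g4] := shape_grad sh.
have AA : A <= A * A by rewrite -{1}[A]mulr1; apply: ler_wpM2l => //; rewrite lerDl divr_ge0 // ltW.
have sW := pf_smooth pW; have sWr := pf_smooth (pf_ref_map a0 b0 e0 pW).
have [d1 d2] := pd_ref_map a0 b0 e0 sW; have [z1 z2] := pd_cst c0.
have PE1 : pd1 F = (fun x => (gx2 a0 b0 e0).1 * pd1 W (ref_map a0 b0 e0 x) + (gx3 a0 b0 e0).1 * pd2 W (ref_map a0 b0 e0 x)).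
  by rewrite /F (pd1D sWr (@smooth_cst R c0)) d1 z1; apply/funext => y; rewrite addr0.
have PE2 : pd2 F = (fun x => (gx2 a0 b0 e0).2 * pd1 W (ref_map a0 b0 e0 x) + (gx3 a0 b0 e0).2 * pd2 W (ref_map a0 b0 e0 x)).
  by rewrite /F (pd2D sWr (@smooth_cst R c0)) d2 z2; apply/funext => y; rewrite addr0.
have gb (u v a b : R) : `|u| <= (kap * h)^-1 -> `|v| <= (kap * h)^-1 -> `|a| <= D * (A * M) -> `|b| <= D * (A * M) ->
    `|u * a + v * b| <= D * A * A * (M / h).
  move=> u1 v1 a1 b1; apply: le_trans (ler_normD _ _) _; rewrite !normrM.
  apply: le_trans (lerD (ler_pM (normr_ge0 _) (normr_ge0 _) u1 a1) (ler_pM (normr_ge0 _) (normr_ge0 _) v1 b1)) _.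
  have -> : (kap * h)^-1 * (D * (A * M)) + (kap * h)^-1 * (D * (A * M)) = D * A * (2 / kap) * (M / h).
    by field; rewrite !gt_eqF.
  apply: ler_wpM2r; first by rewrite divr_ge0 // ltW.
  by apply: ler_wpM2l; [exact: mulr_ge0|rewrite lerDr].
split.
- rewrite /F addrK; apply: le_trans W0 _; rewrite mulrA; apply: ler_wpM2r => //.
  by rewrite -mulrA; exact: ler_wpM2l.
- by rewrite PE1; exact: gb.
- by rewrite PE2; exact: gb.
Qed.

(** * Weak gradients of piecewise smooth functions *)

Section slice_zero.
Context {R : realType} (I J : finType) (a b : I -> R * R) (U : J -> set (R * R))
  (f F : J -> R * R -> R) (H : R * R -> R) (B : R).
Context (B0 : 0 < B) (mU : forall j, measurable (U j : set (plane R))) (UB : forall j, U j `<=` box B)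
  (cf : forall j, continuous (f j))
  (FD : forall j (s t : R), is_derive s 1 (fun s : R => F j (s, t)) (f j (s, t)))
  (oU : forall j (y : R), open [set x | U j (x, y)])
  (clU : forall j (x y : R), closure [set s | U j (s, y)] x ->
     U j (x, y) \/ exists i, segment (a i) (b i) (x, y))
  (HU : forall j (x y : R), closure [set s | U j (s, y)] x -> H (x, y) = F j (x, y))
  (H0 : forall x y : R, closure [set s | (forall j, ~ U j (s, y)) /\ (forall i, ~ segment (a i) (b i) (s, y))] x ->
     H (x, y) = 0)
  (HB : forall x, ~ box B x -> H x = 0)
  (dU : forall i j x, U i x -> U j x -> i = j).
Local Notation mu := (@lebesgue_measure R).

Let dy i : R := (b i).2 - (a i).2.
Let tt i (y : R) : R := (y - (a i).2) / dy i.
Let bad : seq R := [seq (a i).2 | i <- enum I].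
Let pts (y : R) : seq R := [seq (segpath (a i) (b i) (tt i y)).1 | i <- enum I].

Let on_pts i x y : y \notin bad -> segment (a i) (b i) (x, y) -> x \in pts y.
Proof.
move=> yb [t _ xyE].
have y2 : y = (a i).2 + t * dy i by have := congr1 snd xyE.
have x2 : x = (segpath (a i) (b i) t).1 by have := congr1 fst xyE.
have d0 : dy i != 0.
  apply: contraNneq yb => d0; apply/mapP; exists i; first by rewrite mem_enum.
  by rewrite y2 d0 mulr0 addr0.
have tE : tt i y = t by rewrite /tt y2; field.
by apply/mapP; exists i; [rewrite mem_enum|rewrite tE].
Qed.

Let slice (y : R) (x : R) : R := \sum_j (f j \_ (U j)) (x, y).

Let slice_in j x y : U j (x, y) -> slice y x = f j (x, y).
Proof.
move=> Ux; rewrite /slice (bigD1 j) //= patchE mem_set // big1 ?addr0 // => i ij.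
by rewrite patchE memNset // => Ui; move: ij; rewrite (dU Ui Ux) eqxx.
Qed.

Let slice_out x y : (forall j, ~ U j (x, y)) -> slice y x = 0.
Proof. by move=> nU; apply: big1 => j _; rewrite patchE memNset. Qed.

Let slice_c j y : continuous (fun x : R => f j (x, y)).
Proof.
move=> x; apply: (@continuous_comp _ _ _ (fun s : R => (s, y)) (f j)); last exact: cf.
by apply: continuous_pair => ?; [exact: cvg_id|exact: cvg_cst].
Qed.

(** Along a line that avoids the exceptional heights, the slice is between breakpoints either some
    [f j], with antiderivative [F j], or zero. [H] agrees with these antiderivatives at the
    breakpoints, so the integral telescopes to values of [H] beyond the box, which are 0. *)
Let slice_zero1 y : y \notin bad -> (\int[mu]_x (slice y x)%:E = 0)%E.
Proof.
move=> yb.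
have [M M0 HM] : exists2 M : R, 0 <= M & forall j x, box B x -> `|f j x| <= M.
  have [j|M M0 HM] := @finite_uniform R J (fun j M => forall x, box B x -> `|f j x| <= M).
    have [M M0 HM] := continuous_bounded_box B (@cf j); exists M => // M' MM x Bx.
    exact: le_trans (HM _ Bx) MM.
  by exists M.
have mh : measurable_fun (setT : set (measurableTypeR R)) (slice y).
  apply: measurable_sum => j.
  have -> : (fun x => (f j \_ (U j)) (x, y)) = (fun x => f j (x, y) * \1_[set x | U j (x, y)] x).
    apply/funext => x; rewrite patchE indicE; case: (pselect (U j (x, y))) => Ux.
      by rewrite !mem_set // mulr1.
    by rewrite !memNset // mulr0.
  apply: measurable_funM; first by apply: continuous_measurable_fun; exact: slice_c.
  by apply: measurable_indic; apply: open_measurable; exact: oU.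
have bh x : `|slice y x| <= M.
  case: (pselect (exists j, U j (x, y))) => [[j Ux]|nU].
    by rewrite (slice_in Ux); apply: HM; exact: UB Ux.
  by rewrite slice_out ?normr0 // => j Ux; apply: nU; exists j.
have E0 : \int[mu]_(x in `](- B - 1), (B + 1)]) slice y x = 0.
  rewrite (@piecewise_FTC R (fun x => H (x, y)) _ (pts y) M) //.
  - rewrite !HB ?subrr // => -[/=]; rewrite in_itv /= => /andP[]; lra.
  - have B0' := B0; lra.
  move=> u v uv nP.
  have cuv x : u <= x <= v -> closure `]u, v[%classic x by exact: closure_itv.
  have cu : closure `]u, v[%classic u by apply: cuv; rewrite lexx ltW.
  have cv : closure `]u, v[%classic v by apply: cuv; rewrite lexx ltW.
  have nS x i : u < x < v -> ~ segment (a i) (b i) (x, y).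
    by move=> uxv /(on_pts yb) /nP; rewrite uxv.
  (* A gap contains no point of an edge. Once it meets some [U j] it is therefore contained in it;
     otherwise it misses all of them, and [H] vanishes at its ends by [H0]. *)
  case: (pselect (exists j x, u < x < v /\ U j (x, y))) => [[j [x [uxv Ux]]]|nU].
    have gp s : u < s < v -> closure [set s | U j (s, y)] s -> U j (s, y).
      by move=> usv /clU[//|[i /nS]]; case.
    have [sub|dis] := interval_sub_or_disjoint (@oU j y) gp; last by case: (dis x uxv).
    exists (fun x => F j (x, y)), (fun x => f j (x, y)); split.
    + by move=> s; exact: FD.
    + exact: slice_c.
    + by apply: HU; apply: closure_subset sub _ _; exact: cu.
    + by apply: HU; apply: closure_subset sub _ _; exact: cv.
    + by move=> s usv; apply: slice_in; apply: sub; rewrite /= in_itv.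
  have sub : `]u, v[%classic `<=` [set s | (forall j, ~ U j (s, y)) /\ (forall i, ~ segment (a i) (b i) (s, y))].
    move=> s; rewrite /= in_itv /= => usv; split; last by move=> i; exact: nS.
    by move=> j Us; apply: nU; exists j, s.
  exists (fun=> 0), (fun=> 0); split.
  + by move=> s; exact: is_derive_cst.
  + by move=> s; exact: cvg_cst.
  + by apply: H0; apply: closure_subset sub _ _; exact: cu.
  + by apply: H0; apply: closure_subset sub _ _; exact: cv.
  + by move=> s usv; apply: slice_out => j Us; apply: nU; exists j, s.
have bhi := @integrable_bounded_itv R _ _ (- B - 1) (B + 1) mh bh.
have E1 : (\int[mu]_(x in `](- B - 1)%R, (B + 1)%R]) (slice y x)%:E = 0)%E.
  rewrite -[LHS]fineK; last by apply: integrable_fin_num => //; exact: measurable_itv.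
  by congr EFin; exact: E0.
rewrite -E1 [RHS]integral_mkcond; apply: eq_integral => x _; rewrite patchE.
case: ifPn => // xi; rewrite slice_out // => j Ux.
have [+ _] := UB Ux; rewrite /= in_itv /= => /andP[x1 x2].
by move: xi; rewrite notin_setE /= in_itv /=; apply; apply/andP; split; lra.
Qed.

Lemma slice_zero : \sum_j \int[area]_(x in (U j : set (plane R))) f j x = 0.
Proof.
have bU j : bounded_set (U j) by exact: bounded_subset (UB (j := j)) (box_bounded B).
have fi j : area.-integrable (setT : set (plane R)) (EFin \o (f j \_ (U j))).
  rewrite -restrict_EFin; apply/(integrable_mkcond _ _).1; first exact: mU.
  exact: (integrable_continuous (mU j) (bU j) (@cf j)).
have si : area.-integrable (setT : set (plane R)) (EFin \o (fun x => \sum_j (f j \_ (U j)) x)).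
  have -> : EFin \o (fun x => \sum_j (f j \_ (U j)) x) = (fun x : plane R => (\sum_j (EFin \o (f j \_ (U j))) x)%E).
    by apply/funext => x /=; rewrite sumEFin.
  by apply: integrable_sum => //; exact: fi.
apply: EFin_inj; rewrite -sumEFin.
transitivity (\int[area]_x (\sum_j (f j \_ (U j)) x)%:E)%E.
  under [RHS]eq_integral do rewrite -sumEFin.
  apply: etrans (esym (integral_sum measurableT fi _ _)).
  apply: eq_bigr => j _; rewrite Rintegral_mkcond /Rintegral fineK //.
  by apply: integrable_fin_num => //; exact: fi.
rewrite -(integral21_prod_meas1 si).
rewrite (ae_eq_integral (cst 0%E)); first by rewrite integral0.
- exact: measurableT.
- exact: (measurable_fubini_G si).
- exact: measurable_cst.
- exists [set` bad]; split.
  + apply: countable_measurable; first exact: measurable_set1.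
    exact/finite_set_countable/finite_seq.
  + exact/countable_lebesgue_measure0/finite_set_countable/finite_seq.
  move=> y /=; apply: contra_notP => /negP yb _.
  exact: slice_zero1.
Qed.

End slice_zero.

Lemma continuous_inr {R : realType} (y : R) : continuous (fun s : R => (s, y)).
Proof. by apply: continuous_pair => ?; [exact: cvg_id|exact: cvg_cst]. Qed.

Lemma closure_slice {R : realType} (S : set (R * R)) (x y : R) : closure [set s | S (s, y)] x -> closure S (x, y).
Proof.
move=> H B nB; have : nbhs x [set s | B (s, y)] by apply: (continuous_inr (y := y)); exact: nB.
by move=> /H[s [/= Ks Bs]]; exists (s, y).
Qed.

Lemma closure_swap {R : realType} (S : set (R * R)) (x : R * R) : closure (swap @^-1` S) x -> closure S (swap x).
Proof.
move=> H B nB; have : nbhs x (swap @^-1` B) by apply: continuous_swap; exact: nB.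
by move=> /H[s [/= Ks Bs]]; exists (swap s).
Qed.

Section piecewise_zero.
Context {R : realType} (I J : finType) (a b : I -> R * R) (U : J -> set (R * R)) (F : J -> R * R -> R) (H : R * R -> R) (B : R).
Context (B0 : 0 < B) (UB : forall j, U j `<=` box B) (sF : forall j, smooth (F j)) (oU : forall j, open (U j))
  (clU : forall j x, closure (U j) x -> U j x \/ exists i, segment (a i) (b i) x)
  (HU : forall j x, closure (U j) x -> H x = F j x)
  (H0 : forall x, closure [set x | (forall j, ~ U j x) /\ (forall i, ~ segment (a i) (b i) x)] x -> H x = 0)
  (HB : forall x, ~ box B x -> H x = 0)
  (dU : forall i j x, U i x -> U j x -> i = j).

(** The pieces are tied together only by [HU]: on a common edge the neighbouring [F j] take the
    values of one function [H], so no jump remains. The second identity follows by exchanging the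
    coordinates. *)
Lemma piecewise_zero :
  \sum_j \int[area]_(x in (U j : set (plane R))) pd1 (F j) x = 0 /\
  \sum_j \int[area]_(x in (U j : set (plane R))) pd2 (F j) x = 0.
Proof.
have mU j : measurable (U j : set (plane R)) by exact: open_measurable_plane.
split.
  apply: (@slice_zero R I J a b U (fun j => pd1 (F j)) F H B) => //.
  - by move=> j; exact: smooth_continuous (smooth_pd1 (sF j)).
  - by move=> j s t; exact: is_derive_slice1.
  - move=> j y; apply: (@open_comp _ _ (fun x : R => (x, y)) (U j)) => // x _; exact: continuous_inr.
  - by move=> j x y /closure_slice; exact: clU.
  - by move=> j x y /closure_slice; exact: HU.
  - move=> x y h; apply: H0; exact: (@closure_slice R [set x | (forall j, ~ U j x) /\ (forall i, ~ segment (a i) (b i) x)]).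
have sws : forall x : R * R, swap (swap x) = x by case.
transitivity (\sum_j \int[area]_(x in (swap @^-1` (U j) : set (plane R))) pd2 (F j) (swap x)).
  apply: eq_bigr => j _; apply: Rintegral_swap => //; first exact: bounded_subset (UB (j := j)) (box_bounded B).
  exact: smooth_continuous (smooth_pd2 (sF j)).
have segE i x : segment (swap (a i)) (swap (b i)) x -> segment (a i) (b i) (swap x).
  by move=> [t t01 <-]; exists t.
have segE' i x : segment (a i) (b i) (swap x) -> segment (swap (a i)) (swap (b i)) x.
  by move=> [t t01 E]; exists t => //; rewrite -[RHS]sws -E.
have oS j : open (swap @^-1` (U j)) by apply: open_comp => // x _; exact: continuous_swap.
have bs x : box B (swap x) <-> box B x by split => -[? ?]; split.
apply: (@slice_zero R I J (fun i => swap (a i)) (fun i => swap (b i)) (fun j => swap @^-1` (U j))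
  (fun j => pd2 (F j) \o swap) (fun j => F j \o swap) (H \o swap) B) => //.
- by move=> j; exact: open_measurable_plane.
- by move=> j x /UB /bs.
- by move=> j x; apply: continuous_comp; [exact: continuous_swap|exact: (smooth_continuous (smooth_pd2 (sF j)))].
- by move=> j s t; exact: is_derive_slice2.
- move=> j y; apply: (@open_comp _ _ (fun x : R => (x, y)) (swap @^-1` U j)) => // x _; exact: continuous_inr.
- move=> j x y /closure_slice /closure_swap /clU[?|[i /segE' ?]]; [by left|by right; exists i].
- by move=> j x y /closure_slice /closure_swap; exact: HU.
- move=> x y h; apply: H0.
  have := @closure_slice R [set x | (forall j, ~ (swap @^-1` U j) x) /\ (forall i, ~ segment (swap (a i)) (swap (b i)) x)] x y h.
  have -> : [set x | (forall j, ~ (swap @^-1` U j) x) /\ (forall i, ~ segment (swap (a i)) (swap (b i)) x)] =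
    swap @^-1` [set x | (forall j, ~ U j x) /\ (forall i, ~ segment (a i) (b i) x)].
    apply/seteqP; split => s [h1 h2]; split => // i; first by move=> /segE'; exact: h2.
    by move=> /segE; exact: h2.
  exact: closure_swap.
- by move=> x nb; apply: HB => /bs.
- by move=> i j x; exact: dU.
Qed.

End piecewise_zero.

Lemma tri_closure {R : realType} (t : 'I_3 -> R * R) x : noncollinear t -> closure (tri_int t) x -> triangle t x.
Proof.
move=> tn cx; apply/(triangle_bary tn) => a.
have cb : closed [set y | 0 <= bary_coord t a y] by apply: closed_ge_smooth; exact: smooth_bary.
suff sub : tri_int t `<=` [set y | 0 <= bary_coord t a y] by exact: (closure_in sub cb cx).
by move=> y /(tri_int_bary tn)/(_ a); exact: ltW.
Qed.

Lemma triangle_cases {R : realType} (t : 'I_3 -> R * R) x : noncollinear t -> triangle t x ->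
  tri_int t x \/ exists a, edge t a x.
Proof.
move=> tn Tx; have /(triangle_bary tn) b0 := Tx.
case: (pselect (exists a, bary_coord t a x = 0)) => [[a xa]|nx].
  by right; exists (ordS a); apply/(edge_bary tn); rewrite ord3S.
left; apply/(tri_int_bary tn) => a; rewrite lt_neqAle b0 andbT eq_sym; apply/eqP => xa.
by apply: nx; exists a.
Qed.

Lemma test_fun_out {R : realType} (K : set (R * R)) phi x : test_fun K phi -> ~ K x -> phi x = 0.
Proof. by move=> [_ [A [_ AK A0]]] nK; apply: A0 => /AK. Qed.

Lemma closed_zero_smooth {R : realType} (f : R * R -> R) : smooth f -> closed [set x | f x = 0].
Proof.
move=> sf; have -> : [set x | f x = 0] = [set x | 0 <= f x] `&` [set x | 0 <= - f x].
  apply/seteqP; split => x /=; first by move=> ->; rewrite oppr0.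
  by rewrite oppr_ge0 => -[h1 h2]; apply/eqP; rewrite eq_le h1 h2.
have sN := smoothN sf.
by apply: closedI; exact: closed_ge_smooth.
Qed.

Lemma sqint_L2fun {R : realType} (K : set (R * R)) (f : R * R -> R) : measurable (K : set (plane R)) ->
  sqint area (K : set (plane R)) f -> L2fun K f.
Proof. by move=> mK fi; split; [have [] := fi|rewrite (L2norm_nrm mK fi) ltry]. Qed.

Section macro_gradient.
Context {R : realType} (rho kap CL h : R) (n : nat) (z : 'I_n -> R * R) (K : set (R * R))
    (N : nat) (T : 'I_N -> 'I_3 -> R * R) (gm : good_mesh rho kap CL h z K T).
Context (w : R * R -> R) (F : 'I_N -> R * R -> R) (sF : forall j, smooth (F j))
  (wF : forall j x, triangle (T j) x -> w x = F j x).

Let S : set (plane R) := K.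
Let oK := gm_open gm.
Let bK := gm_bounded gm.
Let mK : measurable S := open_measurable_plane oK.
Let tK := gm_tri gm.
Let Tn j : noncollinear (T j) := mesh_nonc gm j.
Let mT j : measurable (tri_int (T j) : set (plane R)) := measurable_otri (cross_neq0 (Tn j) ord0).
Let oT j : open (tri_int (T j)) := open_otri (cross_neq0 (Tn j) ord0).
Let TK j : tri_int (T j) `<=` K := mesh_tri_K gm (j := j).
Let bT j : bounded_set (tri_int (T j)) := @bounded_otri R _ _ _.
Let dT := tri_int_disjoint tK.

Let tri_sub j x : tri_int (T j) x -> triangle (T j) x.
Proof. by move=> /subset_closure; exact: tri_closure. Qed.

Let wFi j x : tri_int (T j) x -> w x = F j x.
Proof. by move=> /tri_sub; exact: wF. Qed.

(** [w] is known only through the smooth [F j] on the closed triangles, so the preimage is put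
    together from finitely many closed pieces intersected with preimages under [F j]. *)
Lemma macro_measurable : measurable_fun S w.
Proof.
move=> _ Y mY.
have -> : S `&` w @^-1` Y = \big[setU/set0]_(j : 'I_N) (S `&` (triangle (T j) `&` (F j @^-1` Y))).
  apply/seteqP; split => x.
    move=> [Kx Yx]; have : closure K x by exact: subset_closure.
    have [_ <- _ _] := tK; move=> [j _ Tx]; rewrite -bigcup_seq; exists j; first by rewrite /= mem_index_enum.
    by split => //; split => //; rewrite /= -(wF Tx).
  rewrite -bigcup_seq => -[j _ [Kx [Tx Yx]]]; split => //; by rewrite /= (wF Tx).
apply: bigsetU_measurable => j _; apply: measurableI => //; apply: measurableI; first exact: measurable_triangle.
rewrite -[X in measurable X]setTI; apply: (continuous_measurable_plane (smooth_continuous (@sF j))) => //.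
Qed.

Let cover x : K x -> exists j, triangle (T j) x.
Proof.
by move=> Kx; have : closure K x by [exact: subset_closure]; have [_ <- _ _] := tK; move=> [j _ Tx]; exists j.
Qed.

Lemma macro_sqint : sqint area S w.
Proof.
have [M M0 HM] : exists2 M : R, 0 <= M & forall j x, K x -> `|F j x| <= M.
  have [j|M M0 HM] := @finite_uniform R 'I_N (fun j M => forall x, K x -> `|F j x| <= M).
    have [M M0 HM] := continuous_bounded_on bK (smooth_continuous (@sF j)); exists M => // M' MM x Bx.
    exact: le_trans (HM _ Bx) MM.
  by exists M.
apply: (sqint_bounded mK (bounded_area_fin mK bK) macro_measurable) => x Kx.
have [j Tx] := cover Kx; rewrite (wF Tx); exact: HM.
Qed.

(** The piecewise derivative for [d] either partial derivative, with the value 0 on the edges, which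
    form a null set. *)
Let pw (d : (R * R -> R) -> R * R -> R) (x : R * R) : R := \sum_j d (F j) x * \1_(tri_int (T j)) x.

Let pw_in d j x : tri_int (T j) x -> pw d x = d (F j) x.
Proof.
move=> Tx; rewrite /pw (bigD1 j) //= indicE mem_set // mulr1 big1 ?addr0 // => i ij.
rewrite indicE memNset ?mulr0 // => Ti; move: ij; by rewrite (dT Ti Tx) eqxx.
Qed.

Let pw_bound d e : 0 <= e -> (forall j x, tri_int (T j) x -> `|d (F j) x| <= e) -> forall x, `|pw d x| <= e.
Proof.
move=> e0 he x; case: (pselect (exists j, tri_int (T j) x)) => [[j Tx]|nT].
  by rewrite (pw_in _ Tx); exact: he.
rewrite /pw big1 ?normr0 // => j _; rewrite indicE memNset ?mulr0 // => Tx; by apply: nT; exists j.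
Qed.

Let pw_measurable d : (forall j, continuous (d (F j))) -> measurable_fun S (pw d).
Proof.
move=> cd; apply: measurable_funTS; apply: measurable_sum => j; apply: measurable_funM.
  exact: (continuous_measurable_plane (@cd j)).
by apply: measurable_indic; exact: mT.
Qed.

Let pw_ip d psi : (forall j, continuous (d (F j))) -> sqint area S (pw d) -> sqint area S psi ->
  ip area S (pw d) psi = \sum_j \int[area]_(x in (tri_int (T j) : set (plane R))) (d (F j) x * psi x).
Proof.
move=> cd pi si; rewrite /ip (Rintegral_triangulation (gm_poly gm) tK); last exact: (sqint_integrableM mK pi si).
by apply: eq_bigr => j _; apply: eq_Rintegral => x; rewrite inE => Tx; rewrite (pw_in _ Tx).
Qed.

Let w_ip psi : sqint area S psi ->
  ip area S w psi = \sum_j \int[area]_(x in (tri_int (T j) : set (plane R))) (F j x * psi x).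
Proof.
move=> si; rewrite /ip (Rintegral_triangulation (gm_poly gm) tK); last exact: (sqint_integrableM mK macro_sqint si).
by apply: eq_bigr => j _; apply: eq_Rintegral => x; rewrite inE => Tx; rewrite (wFi Tx).
Qed.

(** The products [F j * phi] are the pieces of [w * phi]. A point off all open triangles and edges
    is outside [K], where [phi] vanishes; this also holds in the limit, the zero set of [phi] being
    closed. *)
Lemma macro_zero phi : test_fun K phi ->
  \sum_j \int[area]_(x in (tri_int (T j) : set (plane R))) pd1 (fun x => F j x * phi x) x = 0 /\
  \sum_j \int[area]_(x in (tri_int (T j) : set (plane R))) pd2 (fun x => F j x * phi x) x = 0.
Proof.
move=> tp; have [sp _] := tp; have [B B0 KB] := bounded_in_box bK.
apply: (@piecewise_zero R ('I_N * 'I_3)%type 'I_N (fun ja => T ja.1 ja.2) (fun ja => T ja.1 (ordS ja.2))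
  (fun j => tri_int (T j)) (fun j x => F j x * phi x) (fun x => w x * phi x) B B0).
- by move=> j x /TK /KB.
- by move=> j; exact: (smoothM (@sF j) sp).
- exact: oT.
- move=> j x /(tri_closure (Tn j)) /(triangle_cases (Tn j))[?|[a ea]]; first by left.
  by right; exists (j, a).
- by move=> j x /(tri_closure (Tn j)) Tx; rewrite (wF Tx).
- move=> x cx; suff -> : phi x = 0 by rewrite mulr0.
  apply: (closure_in _ (closed_zero_smooth sp) cx) => y [nT nE].
  apply: (test_fun_out tp) => /(K_tri_int tK)[j [Tx|[a ea]]]; first exact: nT Tx.
  exact: (nE (j, a)).
- by move=> x nB; rewrite (test_fun_out tp) ?mulr0 // => /KB.
- by move=> i j x; exact: dT.
Qed.

Lemma macro_weak_grad e : 0 <= e -> 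
  (forall j x, tri_int (T j) x -> `|pd1 (F j) x| <= e) -> (forall j x, tri_int (T j) x -> `|pd2 (F j) x| <= e) ->
  exists G, weak_grad K w G /\ forall x, `|(G x).1| <= e /\ `|(G x).2| <= e.
Proof.
move=> e0 H1 H2; exists (fun x => (pw pd1 x, pw pd2 x)); split; last first.
  by move=> x; split; exact: pw_bound.
have c1 j : continuous (pd1 (F j)) := smooth_continuous (smooth_pd1 (@sF j)).
have c2 j : continuous (pd2 (F j)) := smooth_continuous (smooth_pd2 (@sF j)).
have fK := bounded_area_fin mK bK.
have g1 : sqint area S (pw pd1).
  by apply: (sqint_bounded mK fK (pw_measurable c1)) => x _; exact: pw_bound e0 H1 x.
have g2 : sqint area S (pw pd2).
  by apply: (sqint_bounded mK fK (pw_measurable c2)) => x _; exact: pw_bound e0 H2 x.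
split; [exact: (sqint_L2fun mK macro_sqint)|exact: (sqint_L2fun mK g1)|exact: (sqint_L2fun mK g2)|].
move=> phi tp; have [sp _] := tp; have [z1 z2] := macro_zero tp.
have cp := smooth_continuous sp.
have cp1 := smooth_continuous (smooth_pd1 sp); have cp2 := smooth_continuous (smooth_pd2 sp).
have i0 := sqint_continuous mK bK cp.
have i1 := sqint_continuous mK bK cp1; have i2 := sqint_continuous mK bK cp2.
have cM (f g : R * R -> R) : continuous f -> continuous g -> continuous (fun x => f x * g x).
  by move=> cf cg x; apply: cvgM; [exact: cf|exact: cg].
have cF j := smooth_continuous (@sF j).
split; apply/eqP; rewrite -addr_eq0; apply/eqP.
  transitivity (ip area S w (pd1 phi) + ip area S (pw pd1) phi); first by [].
  rewrite (w_ip i1) (pw_ip c1 g1 i0) -big_split -[RHS]z1; apply: eq_bigr => j _.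
  rewrite (pd1M (@sF j) sp).
  rewrite (RintegralD (mT j) (integrable_continuous (mT j) (@bT j) (cM _ _ (@cF j) cp1))
    (integrable_continuous (mT j) (@bT j) (cM _ _ cp (@c1 j)))).
  by congr (_ + _); apply: eq_Rintegral => x _; rewrite mulrC.
transitivity (ip area S w (pd2 phi) + ip area S (pw pd2) phi); first by [].
rewrite (w_ip i2) (pw_ip c2 g2 i0) -big_split -[RHS]z2; apply: eq_bigr => j _.
rewrite (pd2M (@sF j) sp).
rewrite (RintegralD (mT j) (integrable_continuous (mT j) (@bT j) (cM _ _ (@cF j) cp2))
  (integrable_continuous (mT j) (@bT j) (cM _ _ cp (@c2 j)))).
by congr (_ + _); apply: eq_Rintegral => x _; rewrite mulrC.
Qed.

Lemma macro_L2 e : 0 <= e -> (forall j x, triangle (T j) x -> `|F j x| <= e) ->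
  (L2norm K w <= (e * Num.sqrt (fine (area S)))%:E)%E.
Proof.
move=> e0 He; rewrite (L2norm_nrm mK macro_sqint) lee_fin.
apply: (nrm_bounded mK (bounded_area_fin mK bK) macro_measurable e0) => x Kx.
have [j Tx] := cover Kx; rewrite (wF Tx); exact: He.
Qed.

End macro_gradient.

(** * Stability of the interpolation *)

(** The affine substitution is available for non-negative integrands, so [f] is first raised by a
    bound [M] for its modulus on the unit interval. *)
Lemma Rintegral_reflect {R : realType} (f : R -> R) : continuous f ->
  \int[@lebesgue_measure R]_(s in unit_itv) f s = \int[@lebesgue_measure R]_(s in unit_itv) f (1 - s).
Proof.
move=> cf; have cf2 : continuous (fun x : R * R => f x.1).
  by move=> x; apply: (@continuous_comp _ _ _ fst f); [exact: continuous_fst_plane|exact: cf].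
have [M M0 HM] := continuous_bounded_box 1 cf2.
have fM s : 0 <= s <= 1 -> 0 <= f s + M.
  move=> /andP[s0 s1]; have := HM (s, 0); rewrite ler_norml => H.
  have /H/andP[h1 _] : box 1 (s, 0) by split; rewrite /= in_itv /=; apply/andP; split; lra.
  by rewrite /= in h1; rewrite -lerBlDr sub0r.
have cr : continuous (fun s : R => f (1 - s)).
  by move=> s; apply: (@continuous_comp _ _ _ (fun s : R => 1 - s) f); [apply: cvgB; [exact: cvg_cst|exact: cvg_id]|exact: cf].
have mU := @measurable_unit R.
have ic : (@lebesgue_measure R).-integrable unit_itv (EFin \o (fun=> M)) by apply: unit_integrable => ?; exact: cvg_cst.
suff : \int[@lebesgue_measure R]_(s in unit_itv) (f s + M) = \int[@lebesgue_measure R]_(s in unit_itv) (f (1 - s) + M).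
  by rewrite (RintegralD mU (unit_integrable cf) ic) (RintegralD mU (unit_integrable cr) ic) => /addIr.
pose q (s : R) := (f s + M) * \1_unit_itv s.
have mq : measurable_fun (setT : set (measurableTypeR R)) (EFin \o q).
  apply/measurable_EFinP; apply: measurable_funM; last by apply: measurable_indic; exact: measurable_unit.
  by apply: continuous_measurable_fun => s; apply: cvgD; [exact: cf|exact: cvg_cst].
have q0 s : (0 <= (q s)%:E)%E.
  rewrite lee_fin /q indicE; case: (pselect (unit_itv s)) => Us; last by rewrite memNset // mulr0.
  by rewrite mem_set // mulr1; apply: fM; move: Us; rewrite /unit_itv /= in_itv.
have m1 : (-1 : R) != 0 by rewrite oppr_eq0 oner_eq0.
have := ge0_integral_affine 1 m1 mq q0.
rewrite normrN1 mul1e => E; rewrite /Rintegral; congr fine.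
rewrite integral_mkcond [RHS]integral_mkcond.
transitivity (\int[@lebesgue_measure R]_x (q x)%:E)%E.
  by apply: eq_integral => s _; rewrite patchE /q indicE; case: ifP => _; rewrite ?mulr1 ?mulr0.
apply: etrans E _; apply: eq_integral => s _; rewrite patchE /= /q indicE mulN1r.
have -> : (1 - s \in unit_itv) = (s \in unit_itv).
  by apply/idP/idP; rewrite !inE /unit_itv /= !in_itv /= => /andP[h1 h2]; apply/andP; split; lra.
by case: ifP => _; rewrite ?mulr1 ?mulr0.
Qed.

(** The edge monomials are centred at the midpoint, so reversing the edge only multiplies them by a
    sign. *)
Lemma edge_reflect {R : realType} (e : R -> R) l : continuous e ->
  \int[@lebesgue_measure R]_(s in unit_itv) (e s * (s - 2^-1) ^+ l) = 0 ->
  \int[@lebesgue_measure R]_(s in unit_itv) (e (1 - s) * (s - 2^-1) ^+ l) = 0.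
Proof.
move=> ce; have cm := @continuous_shift_exp R 2^-1 l.
have cr : continuous (fun s : R => e (1 - s)).
  by move=> s; apply: (@continuous_comp _ _ _ (fun s : R => 1 - s) e); [apply: cvgB; [exact: cvg_cst|exact: cvg_id]|exact: ce].
rewrite Rintegral_reflect; last by move=> s; apply: cvgM; [exact: ce|exact: cm].
have -> : \int[@lebesgue_measure R]_(s in unit_itv) (e (1 - s) * (1 - s - 2^-1) ^+ l) =
   \int[@lebesgue_measure R]_(s in unit_itv) ((-1) ^+ l * (e (1 - s) * (s - 2^-1) ^+ l)).
  apply: eq_Rintegral => s _; have -> : 1 - s - 2^-1 = -1 * (s - 2^-1) by field.
  by rewrite exprMn; ring.
have mU := @measurable_unit R.
rewrite RintegralZl //; last by apply: unit_integrable => s; apply: cvgM; [exact: cr|exact: cm].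
by move/eqP; rewrite mulf_eq0 expf_eq0 oppr_eq0 oner_eq0 andbF => /eqP.
Qed.

Lemma edge_moment_bound {R : realType} (wt e : R -> R) l (c0 M : R) : continuous wt -> continuous e ->
  \int[@lebesgue_measure R]_(s in unit_itv) ((wt s - e s) * (s - 2^-1) ^+ l) = 0 ->
  (forall s, 0 <= s <= 1 -> `|e s - c0| <= M) ->
  `|\int[@lebesgue_measure R]_(s in unit_itv) ((wt s - c0) * (s - 2^-1) ^+ l)| <= M.
Proof.
move=> cw ce E He; have cm := @continuous_shift_exp R 2^-1 l; have mU := @measurable_unit R.
have i1 : (@lebesgue_measure R).-integrable unit_itv (EFin \o (fun s => (wt s - e s) * (s - 2^-1) ^+ l)).
  by apply: unit_integrable => s; apply: cvgM; [apply: cvgB; [exact: cw|exact: ce]|exact: cm].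
have i2 : (@lebesgue_measure R).-integrable unit_itv (EFin \o (fun s => (e s - c0) * (s - 2^-1) ^+ l)).
  by apply: unit_integrable => s; apply: cvgM; [apply: cvgB; [exact: ce|exact: cvg_cst]|exact: cm].
have -> : \int[@lebesgue_measure R]_(s in unit_itv) ((wt s - c0) * (s - 2^-1) ^+ l) =
  \int[@lebesgue_measure R]_(s in unit_itv) ((e s - c0) * (s - 2^-1) ^+ l).
  have := RintegralD mU i1 i2; rewrite E add0r => <-.
  by apply: eq_Rintegral => s _; rewrite -mulrDl addrA subrK.
have fb s : unit_itv s -> `|(e s - c0) * (s - 2^-1) ^+ l| <= M.
  rewrite /unit_itv /= in_itv /= => s01; rewrite normrM normrX -[M]mulr1; apply: ler_pM => //.
    exact: He.
  apply: exprn_ile1 => //; rewrite ler_norml; move: s01 => /andP[? ?]; apply/andP; split; lra.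
apply: le_trans (le_normr_Rintegral mU i2) _.
rewrite -[leRHS]Rintegral_unit_cst; apply: le_Rintegral => //.
- by apply: unit_integrable => s; apply: cvg_norm; apply: cvgM; [apply: cvgB; [exact: ce|exact: cvg_cst]|exact: cm].
- by apply: unit_integrable => ?; exact: cvg_cst.
Qed.

Lemma smooth_bubble {R : realType} (t : 'I_3 -> R * R) : noncollinear t -> smooth (bubble t).
Proof.
move=> tn; have sb a : smooth (bary_coord t a) by exact: smooth_bary.
have -> : bubble t = fun x => bary_coord t ord0 x * (bary_coord t (lift ord0 ord0) x *
    (bary_coord t (lift ord0 (lift ord0 ord0)) x * 1)).
  by apply/funext => x; rewrite /bubble !big_ord_recl big_ord0.
by apply: smoothM => //; apply: smoothM => //; apply: smoothM => //; exact: smooth_cst.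
Qed.

Lemma local_space_smooth {R : realType} (t : 'I_3 -> R * R) k w : noncollinear t -> local_space t k w ->
  exists2 F, smooth F & forall x, triangle t x -> w x = F x.
Proof.
move=> tn [p [q0 [q1 [q2 [/polyfun_pf pp hq0 hq1 hq2 wE]]]]].
have pq0 : pf k q0 by apply: hpolyfun_pf hq0; rewrite gerBl.
have pq1 : pf k q1 by apply: hpolyfun_pf hq1; rewrite gerBl.
have pq2 : pf k q2 by exact: hpolyfun_pf hq2.
have sb := smooth_bubble tn.
exists (fun x => p x + bubble t x * q0 x + bubble t x * q1 x + bubble t x * q2 x) => //.
apply: smoothD (smoothM sb (pf_smooth pq2)); apply: smoothD (smoothM sb (pf_smooth pq1)).
exact: smoothD (pf_smooth pp) (smoothM sb (pf_smooth pq0)).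
Qed.

Lemma edge_moment0 {R : realType} (a b : R * R) l (u : R * R -> R) : a != b -> edge_moment a b l u = 0 ->
  \int[@lebesgue_measure R]_(s in unit_itv) (u (segpath a b s) * (s - 2^-1) ^+ l) = 0.
Proof.
move=> /eucl_dist_gt0 d0 /eqP; rewrite /edge_moment /line_int mulf_eq0 gt_eqF //= => /eqP E.
exact: E.
Qed.

Lemma segpath_flip {R : realType} (a b : R * R) s : segpath b a s = segpath a b (1 - s).
Proof.
have E (u v : R * R) w : segpath u v w = (u.1 + w * (v.1 - u.1), u.2 + w * (v.2 - u.2)) by [].
by rewrite !E; congr (_, _); ring.
Qed.

Section interpolation.
Context {R : realType} (k : nat) (rho kap CL : R) (rho0 : 0 < rho) (kap0 : 0 < kap).

(** By [vertex_cases] and [edge_cases] every vertex value and every edge moment of a triangle is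
    taken from [g] or from [p], both within [M] of [c0]. The interior moments come from [q]. *)
Lemma interpolant_bound : exists2 C : R, 0 <= C &
  forall (h : R) n (z : 'I_n -> R * R) K N (T : 'I_N -> 'I_3 -> R * R), good_mesh rho kap CL h z K T ->
  forall w g p q c0 M, 0 <= M -> (forall j, local_space (T j) k w) -> bdry_space z k g -> pf k p -> pf k q ->
  (forall i, w (z i) = g (z i)) -> (forall j a, K (T j a) -> w (T j a) = p (T j a)) ->
  (forall i l, (l + 2 <= k)%N -> edge_moment (z i) (z (ordS i)) l (fun x => w x - g x) = 0) ->
  (forall j a l, osegment (T j a) (T j (ordS a)) `<=` K -> (l + 2 <= k)%N ->
     edge_moment (T j a) (T j (ordS a)) l (fun x => w x - p x) = 0) ->
  (forall j l m, (l + m <= k)%N ->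
     inner (triangle (T j)) (fun x => w x - q x) (scaled_monomial (triangle (T j)) l m) = 0) ->
  (forall i t, 0 <= t <= 1 -> `|g (segpath (z i) (z (ordS i)) t) - c0| <= M) ->
  (forall x, closure K x -> `|p x - c0| <= M) ->
  nrm area (K : set (plane R)) (fun x => q x - c0) <= M * h ->
  exists F, [/\ forall j, smooth (F j), forall j x, triangle (T j) x -> w x = F j x &
    forall j x, triangle (T j) x ->
      [/\ `|F j x - c0| <= C * M, `|pd1 (F j) x| <= C * (M / h) & `|pd2 (F j) x| <= C * (M / h)]].
Proof.
have [C C0 HC] := @local_bound R k kap kap0; exists C => //.
move=> h n z K N T gm w g p q c0 M M0 lw [_ bg] pk qk wz wp eg ep iq Hg Hp Hq.
have pK := gm_poly gm; have tK := gm_tri gm.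
have mK := open_measurable_plane (gm_open gm); have bK := gm_bounded gm.
have cpq : continuous (fun x => q x - c0).
  by move=> x; apply: cvgB; [exact: (pf_continuous qk)|exact: cvg_cst].
suff H j : exists F, [/\ smooth F, forall x, triangle (T j) x -> w x = F x &
    forall x, triangle (T j) x -> [/\ `|F x - c0| <= C * M, `|pd1 F x| <= C * (M / h) & `|pd2 F x| <= C * (M / h)]].
  have [F HF] := choice H; exists F; split => j; first by have [] := HF j.
    by move=> x; have [_ Hj _] := HF j; exact: Hj.
  by move=> x; have [_ _ Hj] := HF j; exact: Hj.
have tn := mesh_nonc gm j.
(* Nothing is known of [w] off the triangles. [F0] agrees with it on this one and is smooth
   everywhere, so that the edge integrals are those of continuous functions. *)
have [F0 sF0 wF0] := local_space_smooth tn (lw j).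
have cseg (f : R * R -> R) a b : continuous f -> continuous (fun s => f (segpath a b s)).
  by move=> cf s; apply: (@continuous_comp _ _ _ (segpath a b) f); [exact: continuous_segpath|exact: cf].
have cF0 := smooth_continuous sF0.
apply: (HC _ h c0 M w q tn (mesh_shape gm kap0 j ord0) (lw j) qk M0 _ _ (iq j)).
- move=> a; have [Ka|[i Ta]] := vertex_cases pK tK j a.
    by rewrite wp //; apply: Hp; exact: subset_closure.
  rewrite Ta wz; have := Hg i 0; rewrite lexx ler01 => /(_ isT); congr (`|g _ - _| <= _).
  by rewrite /segpath scale0r addr0.
- move=> a l lk; set A := T j a; set B := T j (ordS a).
  have AB : A != B := vertex_neq tK j a.
  have wE u : continuous u -> \int[@lebesgue_measure R]_(s in unit_itv) ((w (segpath A B s) - u s) * (s - 2^-1) ^+ l) =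
      \int[@lebesgue_measure R]_(s in unit_itv) ((F0 (segpath A B s) - u s) * (s - 2^-1) ^+ l).
    move=> cu; apply: eq_Rintegral => s; rewrite inE /unit_itv /= in_itv /= => s01; rewrite wF0 //.
    exact: triangle_segpath tn a s s01.
  rewrite (wE (fun=> c0)); last by move=> ?; exact: cvg_cst.
  have [sub|[i E]] := edge_cases pK tK j a.
    apply: (@edge_moment_bound R _ (fun s => p (segpath A B s))); [exact: cseg|exact: (cseg _ _ _ (pf_continuous pk))| |].
      rewrite -(wE (fun s => p (segpath A B s))); last exact: (cseg _ _ _ (pf_continuous pk)).
      exact: edge_moment0 AB (ep j a l sub lk).
    move=> s s01; apply: Hp; apply: (triangle_closure tK (j := j)); exact: triangle_segpath.
  have [P [sP gP]] := bg i.
  have cP : continuous (fun s => P.[s]) by exact: continuous_horner.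
  have zz : z i != z (ordS i).
    by apply/eqP => zE; have [[e1 e2]|[e1 e2]] := edge_ends tK E; move/eqP: AB; rewrite /A /B e1 e2 zE.
  have Z := edge_moment0 zz (eg i l lk).
  have [[e1 e2]|[e1 e2]] := edge_ends tK E.
    have AE : A = z i by []. have BE : B = z (ordS i) by [].
    apply: (@edge_moment_bound R _ (fun s => P.[s]) l c0 M (cseg _ _ _ cF0) cP).
      rewrite -(wE _ cP) AE BE -[RHS]Z; apply: eq_Rintegral => s.
      by rewrite inE /unit_itv /= in_itv /= => s01; rewrite gP.
    by move=> s s01; rewrite -gP //; exact: Hg.
  (* The triangle runs through this edge of [K] backwards, so the prescribed moments are carried
     over by [edge_reflect]. *)
  have AE : A = z (ordS i) by []. have BE : B = z i by [].
  have cPr : continuous (fun s : R => P.[1 - s]).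
    move=> s; apply: (@continuous_comp _ _ _ (fun s : R => 1 - s) (fun s => P.[s])); last exact: cP.
    by apply: cvgB; [exact: cvg_cst|exact: cvg_id].
  have s01' (s : R) : 0 <= s <= 1 -> 0 <= 1 - s <= 1.
    by move=> /andP[? ?]; apply/andP; split; lra.
  have Ts s : 0 <= s <= 1 -> w (segpath (z i) (z (ordS i)) s) = F0 (segpath (z i) (z (ordS i)) s).
    move=> s01; apply: wF0; rewrite -AE -BE segpath_flip; apply: triangle_segpath => //; exact: s01'.
  apply: (@edge_moment_bound R _ (fun s => P.[1 - s]) l c0 M (cseg _ _ _ cF0) cPr).
    pose e s := F0 (segpath (z i) (z (ordS i)) s) - P.[s].
    have ce : continuous e by move=> s; apply: cvgB; [exact: cseg|exact: cP].
    have Z' : \int[@lebesgue_measure R]_(s in unit_itv) (e s * (s - 2^-1) ^+ l) = 0.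
      rewrite -[RHS]Z; apply: eq_Rintegral => s.
      by rewrite inE /unit_itv /= in_itv /= => s01; rewrite gP // Ts.
    rewrite -[RHS](edge_reflect ce Z'); apply: eq_Rintegral => s _.
    by rewrite AE BE segpath_flip.
  by move=> s s01; rewrite -gP; [exact: Hg (s01' _ s01)|exact: s01'].
- apply: le_trans Hq; apply: (nrmS mK (measurable_otri (cross_neq0 tn ord0)) (mesh_tri_K gm (j := j))).
  exact: sqint_continuous mK bK cpq.
Qed.

End interpolation.

Lemma le_of_sqr_le_mul {R : realFieldType} (a b : R) : 0 <= a -> 0 <= b -> a ^+ 2 <= b * a -> a <= b.
Proof.
rewrite le_eqVlt => /orP[/eqP <- //|a0] b0.
by rewrite expr2 (ler_pM2r a0).
Qed.

(** Constants are in [P_k], so [q - c0] is the projection of [v - c0]. Testing with [q - c0] itself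
    and Cauchy-Schwarz give the contraction. *)
Lemma L2proj_bound {R : realType} (K : set (R * R)) k (v q : R * R -> R) c0 : open K -> bounded_set K ->
  sqint area (K : set (plane R)) v -> L2proj K k v q ->
  nrm area (K : set (plane R)) (fun x => q x - c0) <= nrm area (K : set (plane R)) (fun x => v x - c0).
Proof.
move=> oK bK vi [/polyfun_pf pq Hq]; have mK := open_measurable_plane oK.
have pr : pf k (fun x => q x - c0) by apply: (pfD pq); exact: pf_cst.
have qi := sqint_continuous mK bK (pf_continuous pq).
have ri := sqint_continuous mK bK (pf_continuous pr).
have ci : sqint area (K : set (plane R)) (fun=> c0) by apply: sqint_continuous => // ?; exact: cvg_cst.
apply: (le_of_sqr_le_mul (nrm_ge0 _ _ _) (nrm_ge0 _ _ _)).
have E : ip area (K : set (plane R)) q (fun x => q x - c0) = ip area (K : set (plane R)) v (fun x => q x - c0).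
  by apply: Hq; apply/polyfun_pf.
have E2 := ipBl mK qi ci ri; rewrite E -(ipBl mK vi ci ri) in E2.
apply: le_trans (cauchy_schwarz mK (sqintB mK vi ci) ri).
apply: le_trans (ler_norm _); rewrite -E2 le_eqVlt; apply/orP; left; apply/eqP; exact: nrm_sqr.
Qed.

(** From [rho * h <= r] follows $4h^2 + r^2 \le q r^2$ with $q = 4/\rho^2 + 1$, and the radius
    cancels. The remaining $x^2 \le 8q (ha)^2$ is weakened to $x \le 8q\,ha$, using $8q \ge 1$, to
    avoid a square root. *)
Lemma poincare_algebra {R : realFieldType} (rho h r a x y : R) : 0 < rho -> 0 < h -> rho * h <= r -> 0 < r -> 0 <= a -> 0 <= x ->
  r ^+ 2 * x ^+ 2 <= 4 * h ^+ 2 * (4 * h ^+ 2 + r ^+ 2) * y -> y <= 2 * a ^+ 2 ->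
  x <= 8 * (4 / rho ^+ 2 + 1) * a * h.
Proof.
move=> rho0 h0 hr r0 a0 x0 H1 H2; set q := 4 / rho ^+ 2 + 1.
have r20 : 0 < r ^+ 2 by rewrite exprn_gt0.
have q1 : 1 <= q by rewrite lerDr divr_ge0 // sqr_ge0.
have E : 4 * h ^+ 2 + r ^+ 2 <= q * r ^+ 2.
  rewrite [q * _]mulrDl mul1r lerD2r.
  have hr2 : (rho * h) ^+ 2 <= r ^+ 2 by rewrite ler_sqr ?nnegrE ?mulr_ge0 // ltW.
  have -> : 4 * h ^+ 2 = 4 / rho ^+ 2 * (rho * h) ^+ 2 by field; rewrite gt_eqF.
  by apply: ler_wpM2l hr2; rewrite divr_ge0 // sqr_ge0.
have h20 := sqr_ge0 h; have a20 := sqr_ge0 a.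
have H3 : r ^+ 2 * x ^+ 2 <= r ^+ 2 * (8 * q * (h ^+ 2 * a ^+ 2)).
  apply: le_trans H1 _.
  apply: (@le_trans _ _ (4 * h ^+ 2 * (4 * h ^+ 2 + r ^+ 2) * (2 * a ^+ 2))).
    by apply: ler_wpM2l H2; exact: (mulr_ge0 (mulr_ge0 (ler0n _ _) h20) (addr_ge0 (mulr_ge0 (ler0n _ _) h20) (ltW r20))).
  have -> : r ^+ 2 * (8 * q * (h ^+ 2 * a ^+ 2)) = 4 * h ^+ 2 * (q * r ^+ 2) * (2 * a ^+ 2) by ring.
  by apply: ler_wpM2r; [rewrite mulr_ge0|apply: ler_wpM2l => //; rewrite mulr_ge0].
rewrite (ler_pM2l r20) in H3.
have Q0 : 0 <= 8 * q * a * h by rewrite !mulr_ge0 ?(le_trans _ q1) // ltW.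
rewrite -ler_sqr ?nnegrE //; apply: le_trans H3 _.
have -> : (8 * q * a * h) ^+ 2 = 8 * q * (8 * q) * (h ^+ 2 * a ^+ 2) by ring.
apply: ler_wpM2r; first exact: mulr_ge0.
have q80 : 0 <= 8 * q by rewrite mulr_ge0 // (le_trans _ q1).
rewrite -{1}[8 * q]mulr1; apply: ler_wpM2l => //; lra.
Qed.

Section mesh_poincare.
Context {R : realType} (rho kap CL h : R) (rho0 : 0 < rho) (n : nat) (z : 'I_n -> R * R) (K : set (R * R))
    (N : nat) (T : 'I_N -> 'I_3 -> R * R) (gm : good_mesh rho kap CL h z K T).

Let S : set (plane R) := K.
Let oK := gm_open gm.
Let bK := gm_bounded gm.
Let mK : measurable S := open_measurable_plane oK.

(** [|G|^2 = lim (G, grad phi_i) = lim (G0, grad phi_i) = (G0, G)]. *)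
Lemma approx_grad_le v G phi G0 : h1approx K v G phi -> weak_grad K v G0 ->
  nrm area S (fun x => (G x).1) <= nrm area S (fun x => (G0 x).1) /\
  nrm area S (fun x => (G x).2) <= nrm area S (fun x => (G0 x).2).
Proof.
move=> [wG sp _ l1 l2] wG0.
have [_ /L2fun_sqint g1 /L2fun_sqint g2 _] := wG; have [_ /L2fun_sqint k1 /L2fun_sqint k2 _] := wG0.
have i1 i := sqint_continuous mK bK (smooth_continuous (smooth_pd1 (sp i))).
have i2 i := sqint_continuous mK bK (smooth_continuous (smooth_pd2 (sp i))).
have gen (d : (R * R -> R) -> R * R -> R) (f f0 : R * R -> R) : (forall i, sqint area S (d (phi i))) ->
    sqint area S f -> sqint area S f0 ->
    nrm area S (fun x => d (phi i) x - f x) @[i --> \oo] --> (0 : R) ->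
    (forall i, ip area S f (d (phi i)) = ip area S f0 (d (phi i))) -> nrm area S f <= nrm area S f0.
  move=> di fi fi0 l E; apply: (le_of_sqr_le_mul (nrm_ge0 _ _ _) (nrm_ge0 _ _ _)).
  have L1 := ip_cvgl mK di fi fi l; have L2 := ip_cvgl mK di fi fi0 l.
  have EE : ip area S f f = ip area S f f0.
    apply: (cvg_unique _ L1); first exact: norm_hausdorff.
    apply: cvg_trans L2; apply: near_eq_cvg; near=> i.
    by transitivity (ip area S f0 (d (phi i))); [exact: ipC|rewrite -E; exact: ipC].
  rewrite mulrC; apply: le_trans (cauchy_schwarz mK fi fi0); apply: le_trans (ler_norm _).
  by rewrite -EE le_eqVlt; apply/orP; left; apply/eqP; exact: nrm_sqr.
split.
  apply: (gen pd1 _ _ i1 g1 k1 l1) => i.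
  by have [] := weak_grad_smooth gm wG wG0 (smooth_pd1 (sp i)).
apply: (gen pd2 _ _ i2 g2 k2 l2) => i.
by have [] := weak_grad_smooth gm wG wG0 (smooth_pd2 (sp i)).
Unshelve. all: by end_near.
Qed.

(** The inequality is known for the gradient [G] that comes with the trace; by [approx_grad_le] its
    norm is at most that of any weak gradient [G0]. *)
Lemma mesh_poincare v G phi G0 a : h1approx K v G phi -> weak_grad K v G0 ->
  nrm area S (fun x => (G0 x).1) <= a -> nrm area S (fun x => (G0 x).2) <= a ->
  nrm area S (fun x => v x - mean area S v) <= (8 * (4 / rho ^+ 2 + 1)) * a * h.
Proof.
move=> hA wG0 H1 H2; have [c [r [hr r0 dK star]]] := gm_disc gm; have h0 := gm_h gm.
have Kh x y : K x -> K y -> eucl_dist x y <= h.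
  by move=> Kx Ky; apply: (gm_diam gm); exact: subset_closure.
have P := poincare oK bK r0 dK star Kh hA.
have [e1 e2] := approx_grad_le hA wG0.
have [wG _ _ _ _] := hA; have [_ /L2fun_sqint g1 /L2fun_sqint g2 _] := wG.
have [_ Eu] := sqint_eucl mK g1 g2.
have a0 : 0 <= a := le_trans (nrm_ge0 _ _ _) H1.
have N2 : nrm area S (fun x => eucl_norm (G x)) ^+ 2 <= 2 * a ^+ 2.
  have -> : nrm area S (fun x => eucl_norm (G x)) ^+ 2 =
    nrm area S (fun x => (G x).1) ^+ 2 + nrm area S (fun x => (G x).2) ^+ 2.
    transitivity (ip area S (fun x => (G x).1) (fun x => (G x).1) + ip area S (fun x => (G x).2) (fun x => (G x).2)); last first.
      by congr (_ + _); symmetry; exact: nrm_sqr.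
    rewrite -[RHS]Eu; apply: etrans (nrm_sqr _ _ _) _; apply: eq_ip => x _; by case: (G x).
  have sq (u : R) : 0 <= u -> u <= a -> u ^+ 2 <= a ^+ 2.
    by move=> u0 ua; rewrite !expr2; apply: ler_pM.
  have := lerD (sq _ (nrm_ge0 _ _ _) (le_trans e1 H1)) (sq _ (nrm_ge0 _ _ _) (le_trans e2 H2)).
  by move/le_trans; apply; rewrite mulr2n mulrDl mul1r.
exact: (poincare_algebra rho0 h0 hr r0 a0 (nrm_ge0 _ _ _) P N2).
Qed.

End mesh_poincare.

Lemma eucl_norm_le {R : realType} (x : R * R) e : `|x.1| <= e -> `|x.2| <= e -> eucl_norm x <= 2 * e.
Proof.
move=> h1 h2; have e0 : 0 <= e := le_trans (normr_ge0 _) h1.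
have e20 : 0 <= 2 * e by rewrite mulr_ge0.
rewrite /eucl_norm -[leRHS](ger0_norm e20) -sqrtr_sqr ler_wsqrtr //.
have sq (u : R) : `|u| <= e -> u ^+ 2 <= e ^+ 2 by move=> ue; rewrite -[u ^+ 2]real_normK ?num_real // !expr2 ler_pM.
have := sq _ h1; have := sq _ h2; have := sqr_ge0 e; rewrite exprMn; move: (x.1 ^+ 2) (x.2 ^+ 2) => u v; lra.
Qed.

Lemma absorb {R : realFieldType} (A C m : R) : 0 <= A -> 0 <= m -> C * (A * m) <= A * (1 + C) * m.
Proof. by move=> A0 m0; rewrite mulrA (mulrC C); apply: ler_wpM2r => //; apply: ler_wpM2l => //; rewrite lerDr. Qed.

Section stability.
Context {R : realType} (k : nat) (rho kap CL : R) (rho0 : 0 < rho) (kap0 : 0 < kap) (CL0 : 0 <= CL).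

(** The constants [A1 <= A2 <= A3] dominate in turn the bounds for the boundary values, for the
    gradient of [p] and for [p] itself, so that each step is entered with a single multiple of
    [mu]. *)
Lemma stability_m0 : exists2 C : R, 0 <= C &
  forall (h : R) n (z : 'I_n -> R * R) K N (T : 'I_N -> 'I_3 -> R * R), good_mesh rho kap CL h z K T ->
  forall v w, vem_space z K k v -> interpolant z K T k v w -> (L2norm K w <= C%:E * L2norm K v)%E.
Proof.
have [C1 C10 HC1] := @boundary_bound_m0 R k rho kap CL rho0 kap0.
have [C2 C20 HC2] := @proj_grad_m0 R k rho kap CL rho0 CL0.
have [C3 C30 HC3] := @proj_bound R k rho kap CL rho0 kap0.
have [C4 C40 HC4] := @interpolant_bound R k rho kap CL kap0.
pose A1 := 1 + C1; pose A2 := A1 * (1 + C2); pose A3 := A2 * (1 + C3).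
have A11 : 1 <= A1 by rewrite lerDl.
have A10 : 0 <= A1 := le_trans ler01 A11.
have A12 : A1 <= A2 by rewrite /A2 mulrDr mulr1 lerDl mulr_ge0.
have A20 : 0 <= A2 := le_trans A10 A12.
have A23 : A2 <= A3 by rewrite /A3 mulrDr mulr1 lerDl mulr_ge0.
have A30 : 0 <= A3 := le_trans A20 A23.
exists (2 * C4 * A3); first exact: (mulr_ge0 (mulr_ge0 (ler0n _ _) C40) A30).
move=> h n z K N T gm v w [_ [f [pf' wl]] _ _] [[_ lw] [g [p [q [[tg bg] [/polyfun_pf pk [G' [g' [wG' tg' Epr Eint]]]] pq [c1 c2 c3 c4 c5]]]]]].
have oK := gm_open gm; have bK := gm_bounded gm; have h0 := gm_h gm; have mK := open_measurable_plane oK.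
have d0 i : 0 < eucl_dist (z i) (z (ordS i)) := lt_le_trans (mulr_gt0 rho0 h0) (gm_edge gm i).
have [G [phi [hA aE]]] := trace_approx oK bK d0 tg.
have [Gp [phip [hAp aEp]]] := trace_approx oK bK d0 tg'.
have [[/L2fun_sqint vi _ _ _] _ _ _ _] := hA.
have fk : pf k f by apply/polyfun_pf.
(* The unit for sup norms. At the end the square root of the area of [K], at most [2 * h], converts
   [mu] back into the norm of [v]. *)
pose mu := nrm area (K : set (plane R)) v / h.
have mu0 : 0 <= mu by rewrite /mu; apply: divr_ge0; [exact: nrm_ge0|exact: ltW].
have muh : mu * h = nrm area (K : set (plane R)) v by rewrite /mu divfK // gt_eqF.
have up B B' : B <= B' -> B * mu <= B' * mu by move=> BB; apply: ler_wpM2r.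
have Hv B : 1 <= B -> nrm area (K : set (plane R)) v <= B * mu * h.
  by move=> B1; rewrite -mulrA muh -[leLHS]mul1r; apply: ler_wpM2r B1; exact: nrm_ge0.
have Hg1 := HC1 h n z K N T gm v f g G phi mu hA aE bg fk wl.
rewrite muh in Hg1; have {}Hg1 := Hg1 (lexx _).
have C1A : C1 <= A1 by rewrite lerDr.
have Hg2 i t : 0 <= t <= 1 -> `|g (segpath (z i) (z (ordS i)) t)| <= A1 * mu.
  by move=> t01; exact: le_trans (Hg1 i t t01) (up _ _ C1A).
have Ep : inner_vec K (grad p) (grad p) = inner_vec K G' (grad p) by apply: Epr; apply/polyfun_pf.
have [N1 N2] := HC2 h n z K N T v p g G G' phi (A1 * mu) gm hA aE wG' pk Ep (Hv _ A11) Hg2.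
have C2A : C2 * (A1 * mu) <= A2 * mu.
  exact: absorb A10 mu0.
have Hg3 i t : 0 <= t <= 1 -> `|g (segpath (z i) (z (ordS i)) t) - 0| <= A2 * mu.
  by move=> t01; rewrite subr0; exact: le_trans (Hg2 i t t01) (up _ _ A12).
have Hp := HC3 h n z K N T v p g g' G Gp phi phip 0 (A2 * mu) gm hA aE hAp aEp pk Eint (le_trans N1 C2A) (le_trans N2 C2A) Hg3.
have C3A : C3 * (A2 * mu) <= A3 * mu.
  exact: absorb A20 mu0.
have v0 : (fun x => v x - 0) = v by apply/funext => y; rewrite subr0.
have Hq := L2proj_bound 0 oK bK vi pq; rewrite v0 in Hq.
have A31 : 1 <= A3 := le_trans A11 (le_trans A12 A23).
have [pqk _] := pq; have qk : pf k q by apply/polyfun_pf.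
have [F [sF wF bF]] := HC4 h n z K N T gm w g p q 0 (A3 * mu) (mulr_ge0 A30 mu0) lw bg pk qk c1 c2 c3 c4 c5
  (fun i t t01 => le_trans (Hg3 i t t01) (up _ _ A23)) (fun x cx => le_trans (Hp x cx) C3A)
  (le_trans Hq (Hv _ A31)).
have e0 : 0 <= C4 * (A3 * mu) := mulr_ge0 C40 (mulr_ge0 A30 mu0).
have bF' j x : triangle (T j) x -> `|F j x| <= C4 * (A3 * mu).
  by move=> Tx; have [H _ _] := bF j x Tx; rewrite subr0 in H.
apply: le_trans (macro_L2 gm sF wF e0 bF') _.
rewrite (L2norm_nrm mK vi) -EFinM lee_fin -muh.
have := mesh_sqrt_area gm => sa.
apply: le_trans (ler_wpM2l e0 sa) _.
by rewrite le_eqVlt; apply/orP; left; apply/eqP; ring.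
Qed.

Lemma stability_m1 : exists2 C : R, 0 < C &
  forall (h : R) n (z : 'I_n -> R * R) K N (T : 'I_N -> 'I_3 -> R * R), good_mesh rho kap CL h z K T ->
  forall v w, vem_space z K k v -> interpolant z K T k v w -> (H1semi K w <= C%:E * H1semi K v)%E.
Proof.
have [C1 C10 HC1] := @boundary_bound_m1 R k rho kap CL rho0 kap0.
have [C3 C30 HC3] := @proj_bound R k rho kap CL rho0 kap0.
have [C4 C40 HC4] := @interpolant_bound R k rho kap CL kap0.
pose P := 8 * (4 / rho ^+ 2 + 1).
have P2 : 2 <= P by rewrite /P; have : 0 <= 4 / rho ^+ 2; [rewrite divr_ge0 // sqr_ge0|lra].
have P1 : 1 <= P by apply: le_trans P2; rewrite ler1n.
have P0 : 0 <= P := le_trans ler01 P1.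
pose A2 := P * (1 + C1); pose A3 := A2 * (1 + C3).
have PA : P <= A2 by rewrite /A2 mulrDr mulr1 lerDl mulr_ge0.
have A20 : 0 <= A2 := le_trans P0 PA.
have A23 : A2 <= A3 by rewrite /A3 mulrDr mulr1 lerDl mulr_ge0.
have A30 : 0 <= A3 := le_trans A20 A23.
have C0 : 0 < 4 * C4 * A3 + 1 by apply: ltr_wpDl => //; exact: (mulr_ge0 (mulr_ge0 (ler0n _ _) C40) A30).
exists (4 * C4 * A3 + 1) => //.
move=> h n z K N T gm v w [_ _ _ _] [[_ lw] [g [p [q [[tg bg] [/polyfun_pf pk [G' [g' [wG' tg' Epr Eint]]]] pq [c1 c2 c3 c4 c5]]]]]].
have oK := gm_open gm; have bK := gm_bounded gm; have h0 := gm_h gm; have mK := open_measurable_plane oK.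
have d0 i : 0 < eucl_dist (z i) (z (ordS i)) := lt_le_trans (mulr_gt0 rho0 h0) (gm_edge gm i).
have [G [phi [hA aE]]] := trace_approx oK bK d0 tg.
have [Gp [phip [hAp aEp]]] := trace_approx oK bK d0 tg'.
have [[/L2fun_sqint vi _ _ _] _ _ _ _] := hA.
(* The constant is moved to the left so that the claim can be checked for each weak gradient [G0] in
   the infimum. This division requires a positive constant, hence the summand 1 in it. *)
rewrite -lee_pdivrMl //; apply: le_ereal_inf_tmp => _ [G0 /= wG0 <-].
rewrite lee_pdivrMl //.
have [_ /L2fun_sqint g1 /L2fun_sqint g2 _] := wG0.
have [eu _] := sqint_eucl mK g1 g2; have [n1 n2] := nrm_eucl_le mK g1 g2.
have euE : (fun x => eucl_norm ((G0 x).1, (G0 x).2)) = (fun x => eucl_norm (G0 x)).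
  by apply/funext => x; case: (G0 x).
rewrite euE in eu n1 n2; rewrite (L2norm_nrm mK eu).
set a := nrm area (K : set (plane R)) (fun x => eucl_norm (G0 x)) in n1 n2 *.
have a0 : 0 <= a := nrm_ge0 _ _ _.
have up B B' : B <= B' -> B * a <= B' * a by move=> BB; apply: ler_wpM2r.
set c0 := mean area (K : set (plane R)) v.
have Hv := mesh_poincare rho0 gm hA wG0 n1 n2; rewrite -/P -/c0 in Hv.
have aP : a <= P * a by rewrite -{1}[a]mul1r; exact: up.
have Hg1 := HC1 h n z K N T gm v g G G0 phi c0 (P * a) hA aE bg wG0 (le_trans n1 aP) (le_trans n2 aP) Hv.
have C1A : C1 * (P * a) <= A2 * a.
  exact: absorb P0 a0.
have Hg2 i t t01 := le_trans (Hg1 i t t01) C1A.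
have Ep : inner_vec K (grad p) (grad p) = inner_vec K G' (grad p) by apply: Epr; apply/polyfun_pf.
have [N1 N2] := proj_grad_m1 gm wG' wG0 pk Ep n1 n2.
have A2a : 2 * a <= A2 * a by apply: up; exact: le_trans P2 PA.
have Hp := HC3 h n z K N T v p g g' G Gp phi phip c0 (A2 * a) gm hA aE hAp aEp pk Eint (le_trans N1 A2a) (le_trans N2 A2a) Hg2.
have C3A : C3 * (A2 * a) <= A3 * a.
  exact: absorb A20 a0.
have Hq := L2proj_bound c0 oK bK vi pq.
have [pqk _] := pq; have qk : pf k q by apply/polyfun_pf.
have PA3 : P * a * h <= A3 * a * h.
  by apply: ler_wpM2r; [exact: ltW|apply: up; exact: le_trans PA A23].
have [F [sF wF bF]] := HC4 h n z K N T gm w g p q c0 (A3 * a) (mulr_ge0 A30 a0) lw bg pk qk c1 c2 c3 c4 c5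
  (fun i t t01 => le_trans (Hg2 i t t01) (up _ _ A23)) (fun x cx => le_trans (Hp x cx) C3A)
  (le_trans Hq (le_trans Hv PA3)).
(* [e] bounds each component of the piecewise gradient. The Euclidean norm is then at most [2 * e]
   and the square root of the area at most [2 * h], which explains the 4 in the final constant. *)
pose e := C4 * (A3 * a / h).
have e0 : 0 <= e by rewrite /e; apply: mulr_ge0 => //; apply: divr_ge0; [exact: mulr_ge0|exact: ltW].
have sub j x : tri_int (T j) x -> triangle (T j) x.
  by move=> /subset_closure; apply: tri_closure; exact: mesh_nonc gm j.
have [Gw [wGw bGw]] := macro_weak_grad gm sF wF e0
  (fun j x Tx => (let: And3 _ H _ := bF j x (sub j x Tx) in H)) (fun j x Tx => (let: And3 _ _ H := bF j x (sub j x Tx) in H)).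
apply: (@le_trans _ _ (L2norm K (fun x => eucl_norm (Gw x)))); first by apply: ereal_inf_lbound; exists Gw.
have [_ /L2fun_sqint w1 /L2fun_sqint w2 _] := wGw.
have [ew _] := sqint_eucl mK w1 w2.
have ewE : (fun x => eucl_norm ((Gw x).1, (Gw x).2)) = (fun x => eucl_norm (Gw x)).
  by apply/funext => x; case: (Gw x).
rewrite ewE in ew; rewrite (L2norm_nrm mK ew) -EFinM lee_fin.
have nb x : K x -> `|eucl_norm (Gw x)| <= 2 * e.
  move=> _; rewrite ger0_norm ?eucl_norm_ge0 //; have [b1 b2] := bGw x.
  exact: eucl_norm_le b1 b2.
have e20 : 0 <= 2 * e by rewrite mulr_ge0.
have [mw _] := ew.
apply: le_trans (nrm_bounded mK (bounded_area_fin mK bK) mw e20 nb) _.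
apply: le_trans (ler_wpM2l e20 (mesh_sqrt_area gm)) _.
have -> : 2 * e * (2 * h) = 4 * C4 * A3 * a by rewrite /e; field; rewrite gt_eqF.
by apply: up; rewrite lerDl.
Qed.

End stability.

Theorem lemma3p1 (R : realType) (k : nat) (rho sigma tau : R) :
  (1 <= k)%N -> 0 < rho -> 0 < sigma -> 0 < tau ->
  exists2 C : R, 0 < C &
    forall (n : nat) (z : 'I_n -> R * R) (K : set (R * R))
           (N : nat) (T : 'I_N -> 'I_3 -> R * R),
      regular_polygon rho z K ->
      triangulation z K T ->
      regular_triangulation sigma tau K T ->
      forall v w : R * R -> R,
        vem_space z K k v ->
        interpolant z K T k v w ->
        (L2norm K w <= C%:E * L2norm K v)%E /\
        (H1semi K w <= C%:E * H1semi K v)%E.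
Proof.
move=> _ rho0 sigma0 tau0.
have kap0 : 0 < (sigma * tau) ^+ 2 by rewrite exprn_gt0 // mulr_gt0.
have CL0 : 0 <= 192 / (sigma * tau) ^+ 2 by rewrite divr_ge0 // ltW.
have [C0 C00 HC0] := stability_m0 k rho0 kap0 CL0.
have [C1 C10 HC1] := stability_m1 k (192 / (sigma * tau) ^+ 2) rho0 kap0.
exists (C0 + C1); first by rewrite ltr_wpDl.
move=> n z K N T rK tK rT v w vv iw.
have gm := good_meshP rho0 sigma0 tau0 rK tK rT.
have [H0 H1] := (HC0 _ _ _ _ _ _ gm v w vv iw, HC1 _ _ _ _ _ _ gm v w vv iw).
split; [apply: le_trans H0 _|apply: le_trans H1 _].
  by apply: lee_wpmul2r; [exact: sqrte_ge0|rewrite lee_fin lerDl ltW].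
apply: lee_wpmul2r; last by rewrite lee_fin lerDr.
by apply: le_ereal_inf_tmp => _ [G _ <-]; exact: sqrte_ge0.
Qed.
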